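(* Let $X$ be a finite-dimensional unbounded CAT(0) cube complex such that $\mathrm{Aut}(X)$ acts essentially without a fixed point at infinity. Then $X$ is irreducible if and only if there is a pair of strongly separated hyperplanes.
   Context: A CAT(0) cube complex is a simply connected cell complex all of whose cells are Euclidean cubes with edge length one and such that the link of each vertex is a flag complex; it is endowed with the induced length metric, which is CAT(0). It is finite-dimensional if the supremum of the dimensions of its cubes is finite. It is irreducible if it does not split as a product of two cube complexes neither of which is reduced to a single vertex. $\mathrm{Aut}(X)$ is the group of automorphisms of the cube complex $X$. A fixed point at infinity is a fixed point in the visual boundary $\partial_\infty X$. The midpoint of each edge of $X$ belongs to a unique hyperplane; a hyperplane is a closed convex subspace (a union of midcubes) whose complement has exactly two connected components, both convex. The closures of these two components are called half-spaces. A group $\Gamma \leq \mathrm{Aut}(X)$ acts essentially on $X$ if no $\Gamma$-orbit remains in a bounded neighbourhood of a half-space of $X$. Two hyperplanes are strongly separated if no hyperplane has a non-empty intersection with both of them; in particular they are disjoint. *)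

(* Defs.v *)
From HB Require Import structures.
From Stdlib Require Import Relation_Operators.
From mathcomp Require Import all_boot all_order all_algebra.
From mathcomp Require Import all_classical all_reals all_analysis.
Import Order.TTheory GRing.Theory Num.Theory.
Import numFieldNormedType.Exports.

Set Implicit Arguments.
Unset Strict Implicit.
Unset Printing Implicit Defensive.

Local Open Scope classical_set_scope.
Local Open Scope ring_scope.

Section EuclideanCubes.
Variable R : realType.

(* The library norm on 'rV[R]_n is the sup norm, hence this definition. *)
Definition edist n (u v : 'rV[R]_n) : R :=
  Num.sqrt (\sum_(i < n) (u ord0 i - v ord0 i) ^+ 2).

Definition unit_cube n : set 'rV[R]_n :=
  [set u | forall i, 0 <= u ord0 i <= 1].

(* The nonempty faces of [0,1]^n, the cube itself included: [s i = Some b]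
   fixes the i-th coordinate to b, [s i = None] leaves it free. *)
Definition face n (s : 'I_n -> option bool) : set 'rV[R]_n :=
  [set u | unit_cube u /\ forall i b, s i = Some b -> u ord0 i = b%:R].

Definition isometric_on m n (A : set 'rV[R]_m) (h : 'rV[R]_m -> 'rV[R]_n) :=
  forall u v, A u -> A v -> edist (h u) (h v) = edist u v.

End EuclideanCubes.
Arguments unit_cube {R n}.
Arguments face {R n}.

(* Cubical complexes in the sense of Bridson and Haefliger (Metric spaces of
   non-positive curvature, I.7.32), with the family of cubes closed under
   passing to faces.  Only the values of [chart c] on the unit cube matter.
   Different indices may describe the same cell. *)
Record cubeComplex (R : realType) := CubeComplex {
  pt :> Type;
  cube : Type;
  dim : cube -> nat;
  chart : forall c : cube, 'rV[R]_(dim c) -> pt;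
  chart_inj : forall c u v, unit_cube u -> unit_cube v ->
    @chart c u = @chart c v -> u = v;
  chart_cover : forall x, exists c, (@chart c @` unit_cube) x;
  chart_face : forall c (s : 'I_(dim c) -> option bool),
    exists c', @chart c' @` unit_cube = @chart c @` face s;
  chart_glue : forall c c',
    (@chart c @` unit_cube) `&` (@chart c' @` unit_cube) !=set0 ->
    exists (s : 'I_(dim c) -> option bool) (s' : 'I_(dim c') -> option bool)
           (h : 'rV[R]_(dim c) -> 'rV[R]_(dim c')),
      [/\ h @` face s = face s',
          isometric_on (face s) h &
          forall u u', unit_cube u -> unit_cube u' ->
            (@chart c u = @chart c' u' <-> face s u /\ u' = h u)]
}.
Arguments cube {R} X : rename.
Arguments dim {R X} c : rename.
Arguments chart {R X} c u : rename.

Section Cells.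
Variables (R : realType) (X : cubeComplex R).

Definition cell (c : cube X) : set X := chart c @` unit_cube.

Definition is_vertex (v : X) := exists c : cube X, dim c = 0%N /\ cell c v.

Definition is_edge (e : set X) := exists c : cube X, dim c = 1%N /\ e = cell c.

Definition finite_dimensional :=
  exists N : nat, forall c : cube X, (dim c <= N)%N.

(* The cubes are glued along faces and embedded, so a vertex of the link of v
   is an edge of X containing v, and the simplices of the link are the sets of
   edges at v contained in a given cube at v. *)
Definition link_vertex (v : X) : set (set X) := [set e | is_edge e /\ e v].

Definition link_simplex (v : X) : set (set (set X)) :=
  [set S | S !=set0 /\
     exists c : cube X, cell c v /\ S = link_vertex v `&` [set e | e `<=` cell c]].

End Cells.

Definition flag_complex T (V : set T) (simplex : set (set T)) :=
  forall S : set T, S !=set0 -> finite_set S -> S `<=` V ->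
    (forall e f, S e -> S f -> e <> f -> simplex [set e; f]) -> simplex S.

Section CellTopology.
Variables (R : realType) (X : cubeComplex R).

HB.instance Definition _ := gen_eqMixin (pt X).
HB.instance Definition _ := gen_choiceMixin (pt X).

(* The topology of the cell complex: a set is open when its trace on each
   closed cell is relatively open. *)
Definition cell_open : set_system (pt X) :=
  [set U | forall c : cube X,
     open (chart c @^-1` U : set (subspace (@unit_cube R (dim c))))].

Let cell_openT : cell_open setT.
Proof. by move=> c; rewrite preimage_setT; exact: openT. Qed.

Let cell_openI : setI_closed cell_open.
Proof. by move=> A B oA oB c; rewrite preimage_setI; exact: openI. Qed.

Let cell_open_bigU (I : Type) (f : I -> set (pt X)) :
  (forall i, cell_open (f i)) -> cell_open (\bigcup_i f i).
Proof.
by move=> of_ c; rewrite preimage_bigcup; apply: bigcup_open => i _; exact: of_.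
Qed.

HB.instance Definition _ :=
  isOpenTopological.Build (pt X) cell_openT cell_openI cell_open_bigU.

End CellTopology.

Definition simply_connected (R : realType) (T : topologicalType) :=
  [/\ exists x : T, True,
      forall x y : T, exists p : R -> T,
        [/\ {within `[0, 1], continuous p}, p 0 = x & p 1 = y] &
      forall p : R -> T, {within `[0, 1], continuous p} -> p 0 = p 1 ->
        exists H : R * R -> T,
          [/\ {within `[0, 1] `*` `[0, 1], continuous H},
              forall t, 0 <= t <= 1 -> H (t, 0) = p t,
              forall t, 0 <= t <= 1 -> H (t, 1) = p 0 &
              forall s, 0 <= s <= 1 -> H (0, s) = p 0 /\ H (1, s) = p 0]].

(* The CAT(0) inequality for the length metric is a consequence of this
   definition and is not part of it. *)
Definition cat0_cube_complex (R : realType) (X : cubeComplex R) :=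
  simply_connected R (pt X) /\
  forall v : X, is_vertex v -> flag_complex (link_vertex v) (link_simplex v).

Section LengthMetric.
Variables (R : realType) (X : cubeComplex R).

(* [string_length x y l]: some finite sequence of points from x to y, any two
   consecutive ones lying in a common cube, has total length l, each step
   being measured in the Euclidean metric of that cube. *)
Inductive string_length : X -> X -> R -> Prop :=
| string_nil x : string_length x x 0
| string_cons (c : cube X) u v y l : unit_cube u -> unit_cube v ->
    string_length (chart c v) y l ->
    string_length (chart c u) y (edist u v + l).

Definition cdist (x y : X) : R := inf [set l | string_length x y l].

Definition unbounded := ~ exists M : R, forall x y : X, cdist x y <= M.

(* Geodesic rays are parametrized by [0, +oo[; their values at negative
   arguments are irrelevant. *)
Definition geodesic_ray (r : R -> X) :=
  forall s t, 0 <= s -> 0 <= t -> cdist (r s) (r t) = `|s - t|.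

Definition asymptotic (r r' : R -> X) :=
  exists K : R, forall t, 0 <= t -> cdist (r t) (r' t) <= K.

Definition visual_boundary : set (set (R -> X)) :=
  [set xi | exists2 r, geodesic_ray r &
     xi = [set r' | geodesic_ray r' /\ asymptotic r r']].

Definition fixed_point_at_infinity (G : set (X -> X)) (xi : set (R -> X)) :=
  visual_boundary xi /\ forall g, G g -> [set g \o r | r in xi] = xi.

End LengthMetric.

Section Isomorphisms.
Variable R : realType.

Definition maps_cube (X Y : cubeComplex R) (f : X -> Y)
    (c : cube X) (c' : cube Y) :=
  exists h : 'rV[R]_(dim c) -> 'rV[R]_(dim c'),
    [/\ h @` unit_cube = unit_cube,
        isometric_on unit_cube h &
        forall u, unit_cube u -> f (chart c u) = chart c' (h u)].

Definition cube_iso (X Y : cubeComplex R) (f : X -> Y) :=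
  [/\ bijective f,
      forall c, exists c', maps_cube f c c' &
      forall c', exists c, maps_cube f c c'].

Definition Aut (X : cubeComplex R) : set (X -> X) := [set f | cube_iso f].

End Isomorphisms.
Arguments Aut {R} X : rename.

Section Hyperplanes.
Variables (R : realType) (X : cubeComplex R).

(* [dual_edge c i e]: e is an edge of the cube c in the direction i. *)
Definition dual_edge (c : cube X) (i : 'I_(dim c)) (e : set X) :=
  exists s : 'I_(dim c) -> option bool,
    (forall j, s j = None <-> j = i) /\ e = chart c @` face s.

Definition opposite_edges (e f : set X) :=
  exists (c : cube X) (i : 'I_(dim c)),
    [/\ dim c = 2%N, dual_edge i e & dual_edge i f].

Definition parallel : set X -> set X -> Prop :=
  clos_refl_sym_trans (set X) opposite_edges.

Definition midcube (c : cube X) (i : 'I_(dim c)) : set X :=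
  chart c @` [set u | unit_cube u /\ u ord0 i = 2^-1].

(* The union of the midcubes that cross an edge parallel to e. *)
Definition hyperplane_of (e : set X) : set X :=
  [set x | exists (c : cube X) (i : 'I_(dim c)) (f : set X),
     [/\ dual_edge i f, parallel e f & midcube i x]].

Definition hyperplane (H : set X) :=
  exists2 e, is_edge e & H = hyperplane_of e.

Definition half_space (Z : set X) :=
  exists (H : set X) (x : X),
    [/\ hyperplane H, ~ H x & Z = closure (connected_component (~` H) x)].

Definition strongly_separated (H H' : set X) :=
  [/\ hyperplane H, hyperplane H' &
      ~ exists K, [/\ hyperplane K, K `&` H !=set0 & K `&` H' !=set0]].

Definition acts_essentially (G : set (X -> X)) :=
  forall (x : X) (Z : set X), half_space Z ->
    ~ exists r : R, forall g, G g -> exists2 z, Z z & cdist (g x) z <= r.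

End Hyperplanes.

Section Product.
Variables (R : realType) (X Y : cubeComplex R).

Lemma unit_cube_row m n (u : 'rV[R]_(m + n)) :
  unit_cube u <-> unit_cube (lsubmx u) /\ unit_cube (rsubmx u).
Proof.
split=> [hu|[hl hr] i]; first by split=> i; rewrite mxE; exact: hu.
case: (split_ordP i) => j ->.
- by have := hl j; rewrite mxE.
- by have := hr j; rewrite mxE.
Qed.

Lemma face_row m n (s : 'I_(m + n) -> option bool) (u : 'rV[R]_(m + n)) :
  face s u <-> face (s \o @lshift m n) (lsubmx u) /\
               face (s \o @rshift m n) (rsubmx u).
Proof.
split=> [[/unit_cube_row[hl hr] hs]|[[hl sl] [hr sr]]].
  by split; split=> // i b /= /hs <-; rewrite mxE.
split; first exact/unit_cube_row.
move=> i b; case: (split_ordP i) => j -> hj.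
- by rewrite -(sl j b hj) mxE.
- by rewrite -(sr j b hj) mxE.
Qed.

Lemma edist_row m n (u v : 'rV[R]_(m + n)) :
  edist u v = Num.sqrt (edist (lsubmx u) (lsubmx v) ^+ 2 +
                        edist (rsubmx u) (rsubmx v) ^+ 2).
Proof.
rewrite /edist !sqr_sqrtr ?sumr_ge0// => [|i _|i _]; try exact: sqr_ge0.
by rewrite big_split_ord /=; congr (Num.sqrt (_ + _));
  apply: eq_bigr => i _; rewrite !mxE.
Qed.

Definition prod_chart (c : cube X * cube Y) (u : 'rV[R]_(dim c.1 + dim c.2)) :
  X * Y := (chart c.1 (lsubmx u), chart c.2 (rsubmx u)).

Definition glue_face m n (s : 'I_m -> option bool) (t : 'I_n -> option bool)
  (i : 'I_(m + n)) := match fintype.split i with inl j => s j | inr j => t j end.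

Lemma glue_facel m n (s : 'I_m -> option bool) (t : 'I_n -> option bool) :
  glue_face s t \o @lshift m n = s.
Proof. by apply/funext => i; rewrite /glue_face /= (unsplitK (inl i)). Qed.

Lemma glue_facer m n (s : 'I_m -> option bool) (t : 'I_n -> option bool) :
  glue_face s t \o @rshift m n = t.
Proof. by apply/funext => i; rewrite /glue_face /= (unsplitK (inr i)). Qed.

Lemma prod_cellE m n (f : 'rV[R]_m -> X) (g : 'rV[R]_n -> Y)
    (A : set 'rV[R]_m) (B : set 'rV[R]_n) (C : set 'rV[R]_(m + n)) :
  (forall u, C u <-> A (lsubmx u) /\ B (rsubmx u)) ->
  (fun u => (f (lsubmx u), g (rsubmx u))) @` C = (f @` A) `*` (g @` B).
Proof.
move=> hC; apply/seteqP; split=> [_ [u /hC[Au Bu] <-]|[x y] [/= [a Aa <-] [b Bb <-]]].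
  by split=> /=; [exists (lsubmx u)|exists (rsubmx u)].
by exists (row_mx a b); rewrite ?row_mxKl ?row_mxKr//; apply/hC;
  rewrite row_mxKl row_mxKr.
Qed.

Lemma prod_cell c : @prod_chart c @` unit_cube =
  (chart c.1 @` unit_cube) `*` (chart c.2 @` unit_cube).
Proof. by apply: prod_cellE; exact: unit_cube_row. Qed.

Lemma prod_chart_inj c u v : unit_cube u -> unit_cube v ->
  @prod_chart c u = prod_chart v -> u = v.
Proof.
move=> /unit_cube_row[ul ur] /unit_cube_row[vl vr] [el er].
by rewrite -(hsubmxK u) -(hsubmxK v) (chart_inj ul vl el) (chart_inj ur vr er).
Qed.

Lemma prod_chart_cover z : exists c, (@prod_chart c @` unit_cube) z.
Proof.
case: z => x y; have [a ha] := chart_cover x; have [b hb] := chart_cover y.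
by exists (a, b); rewrite prod_cell.
Qed.

Lemma prod_chart_face c (s : 'I_(dim c.1 + dim c.2) -> option bool) :
  exists c', @prod_chart c' @` unit_cube = @prod_chart c @` face s.
Proof.
have [a ha] := chart_face (s \o @lshift _ _).
have [b hb] := chart_face (s \o @rshift _ _).
by exists (a, b); rewrite prod_cell (prod_cellE _ _ (face_row s)) /= ha hb.
Qed.

Lemma prod_chart_glue c c' :
  (@prod_chart c @` unit_cube) `&` (@prod_chart c' @` unit_cube) !=set0 ->
  exists (s : 'I_(dim c.1 + dim c.2) -> option bool)
         (s' : 'I_(dim c'.1 + dim c'.2) -> option bool)
         (h : 'rV[R]_(dim c.1 + dim c.2) -> 'rV[R]_(dim c'.1 + dim c'.2)),
    [/\ h @` face s = face s',
        isometric_on (face s) h &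
        forall u u', unit_cube u -> unit_cube u' ->
          (prod_chart u = prod_chart u' <-> face s u /\ u' = h u)].
Proof.
rewrite !prod_cell => -[[x y] [[/= x1 y1] [/= x2 y2]]].
have [|s [s' [h [hF hI hG]]]] := @chart_glue _ X c.1 c'.1; first by exists x.
have [|t [t' [k [kF kI kG]]]] := @chart_glue _ Y c.2 c'.2; first by exists y.
have faceE m n (a : 'I_m -> option bool) (b : 'I_n -> option bool)
      (u : 'rV[R]_(m + n)) :
    face (glue_face a b) u <-> face a (lsubmx u) /\ face b (rsubmx u).
  by have := face_row (glue_face a b) u; rewrite glue_facel glue_facer.
exists (glue_face s t), (glue_face s' t'),
  (fun u => row_mx (h (lsubmx u)) (k (rsubmx u))); split.
- apply/seteqP; split=> [_ [u /faceE[ul ur] <-]|u /faceE[]].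
    apply/faceE; rewrite row_mxKl row_mxKr -hF -kF.
    by split; [exists (lsubmx u)|exists (rsubmx u)].
  rewrite -hF -kF => -[a sa ea] [b tb eb]; exists (row_mx a b).
    by apply/faceE; rewrite row_mxKl row_mxKr.
  by rewrite row_mxKl row_mxKr ea eb hsubmxK.
- move=> u v /faceE[ul ur] /faceE[vl vr].
  by rewrite edist_row [RHS]edist_row !row_mxKl !row_mxKr hI// kI.
- move=> u u' /unit_cube_row[ul ur] /unit_cube_row[vl vr]; split.
    case=> /(hG _ _ ul vl)[su e1] /(kG _ _ ur vr)[tu e2].
    by split; [exact/faceE|rewrite -e1 -e2 hsubmxK].
  case=> /faceE[su tu] e; rewrite /prod_chart; congr pair.
    by apply/(hG _ _ ul vl); rewrite e row_mxKl.
  by apply/(kG _ _ ur vr); rewrite e row_mxKr.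
Qed.

Definition prod_complex : cubeComplex R :=
  CubeComplex prod_chart_inj prod_chart_cover prod_chart_face prod_chart_glue.

End Product.

Definition single_vertex (R : realType) (X : cubeComplex R) :=
  exists v : X, forall x : X, x = v.

Definition irreducible (R : realType) (X : cubeComplex R) :=
  ~ exists (Y Z : cubeComplex R) (f : X -> prod_complex Y Z),
      [/\ cube_iso f, ~ single_vertex Y & ~ single_vertex Z].

(* Main.v *)
(* The vertices of X form a graph in which, by simple connectivity, edge paths with the same ends differ by
   moves across squares; together with the flag condition this makes it a median graph with its halfspaces. The
   points of X are then determined by coordinates in [0, 1], one for each wall, and X is the cube complex of a
   set of 0-1 vectors closed under medians. Its length metric is complete and CAT(0), by gluing along walls.

   Suppose X irreducible. Every halfspace h is flipped by an automorphism (g maps the complement of h into h):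
   otherwise the translates of the complement of h generate a filter of convex subcomplexes with empty
   intersection, and steepest descent along this filter gives a point at infinity fixed by Aut(X). If the walls
   split into two nonempty classes, each wall of one crossing each wall of the other, then X is a product; hence
   the graph of non-crossing walls is connected. Combining flips of nested halfspaces then yields two disjoint
   walls crossed by no third one. Conversely, in a product every wall of one factor crosses every wall of the
   other, so any two walls are both met by a third. *)
Require Import Defs.
From HB Require Import structures.
From Stdlib Require Import Relation_Operators.
From mathcomp Require Import all_boot all_order all_algebra.
From mathcomp Require Import all_classical all_reals all_analysis.
From mathcomp Require Import ring lra zify.
Require Import Defs.

Set Implicit Arguments.
Unset Strict Implicit.
Unset Printing Implicit Defensive.
Local Open Scope classical_set_scope.

(** * Crossing halfspaces *)

(** The complex need not be locally finite, so limits of segments cannot come from compactness: rays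
    are limits of Cauchy sequences, and the Cauchy property comes from uniform convexity of squared
    distances. A filter of convex subcomplexes [C] with empty intersection has a Busemann-like
    function, the upper limit of [d(x, C) - d(o, C)]; it is convex and 1-Lipschitz. Finite dimension
    makes it decrease linearly: crossing together the at most [N] walls at a vertex that separate it
    from small members costs at most [N] and gains 1. Points far out along nearly maximal descent
    lie in nearly the same direction, which gives both the existence of the ray and its invariance.
    Strong separation comes from minimality: take a disjoint pair crossed by the smallest families
    of pairwise crossing walls, enlarge it to three nested walls by composing two flips, and compare
    the sectors that contain halfspaces. Medians replace geodesic arguments on vertices: they give
    gates onto convex sets, the Helly property and the cube shared by pairwise crossing walls. *)

Definition meets T (A B : set T) := exists x, A x /\ B x.

Definition crossing T (h k : set T) :=
  [/\ meets h k, meets h (~` k), meets (~` h) k & meets (~` h) (~` k)].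

Definition orient T (b : bool) (h : set T) := if b then h else ~` h.

Section Crossing.
Variable T : Type.
Implicit Types h k u v : set T.

Lemma crossingC h k : crossing h k -> crossing k h.
Proof.
move=> [[x [hx kx]] [y [hy ky]] [z [hz kz]] [t [ht kt]]].
by split; [exists x|exists z|exists y|exists t].
Qed.

Lemma crossing_setCr h k : crossing h k -> crossing h (~` k).
Proof. by move=> [? ? ? ?]; split; rewrite ?setCK. Qed.

Lemma crossing_setCl h k : crossing h k -> crossing (~` h) k.
Proof. by move=> [? ? ? ?]; split; rewrite ?setCK. Qed.

Lemma crossing_orient b c h k : crossing h k -> crossing (orient b h) (orient c k).
Proof.
by case: b; case: c => //=; move=> H; do ?[apply: crossing_setCl | apply: crossing_setCr].
Qed.

Lemma crossing_irr h : ~ crossing h h.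
Proof. by move=> [_ [x []]]. Qed.

Lemma crossing_between u h k l : h `<=` k -> k `<=` l ->
  crossing u h -> crossing u l -> crossing u k.
Proof.
move=> hk kl [[x [ux hx]] _ [y [uy hy]] _] [_ [z [uz lz]] _ [t [ut lt]]].
split; [by exists x; split=> //; exact: hk|exists z; split=> // /kl//|
        by exists y; split=> //; exact: hk|exists t; split=> // /kl//].
Qed.

Lemma ncrossing_sub h k : ~ crossing h k ->
  exists b c, orient b h `<=` orient c k.
Proof.
move=> nc; apply: contrapT => no; apply: nc.
have M b c : meets (orient b h) (orient c k).
  apply: contrapT => nm; apply: no; exists b, (~~ c) => x bx.
  case: c nm => /= nm; first by move=> kx; apply: nm; exists x.
  by apply: contrapT => kx; apply: nm; exists x.
by split; [exact: M true true|exact: M true false|exact: M false true|exact: M false false].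
Qed.

Lemma sub_ncrossing b c h k : orient b h `<=` orient c k -> ~ crossing h k.
Proof.
move=> s /(crossing_orient b c)[_ [x [bx cx]] _ _].
by apply: cx; apply: s.
Qed.

Lemma orientN b h : orient (~~ b) h = ~` orient b h.
Proof. by case: b => //=; rewrite setCK. Qed.

(** If the two inclusions used opposite sides of [t], the quadrant opposite to [orient b u] and
    [orient c v] would be empty. *)
Lemma ncrossing_sector u v t : crossing u v -> ~ crossing t u -> ~ crossing t v ->
  exists e b c, orient e t `<=` orient b u `&` orient c v.
Proof.
move=> uv /ncrossing_sub[e [b s]] /ncrossing_sub[f [c s']].
have [ef|ef] := eqVneq e f.
  by exists e, b, c => x ex; split; [exact: s|apply: s'; rewrite -ef].
have fe : f = ~~ e by move: ef; case: (e) (f) => -[].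
case: (crossing_orient b c uv) => _ _ _ [x [nbx ncx]]; exfalso.
rewrite fe orientN in s'.
by apply: nbx; apply: s; apply: contrapT => nex; apply: ncx; apply: s'.
Qed.

End Crossing.

(** * Strong separation from flips and connectedness of the non-crossing graph *)

Section StronglySeparated.
Variables (T : Type) (Hs : set (set T)) (G : set (T -> T)).
Hypothesis HsC : forall h, Hs h -> Hs (~` h).
Hypothesis Gcomp : forall f g, G f -> G g -> G (f \o g).
Hypothesis Ginv : forall g, G g -> exists g', [/\ G g', cancel g g' & cancel g' g].
Hypothesis GHs : forall g h, G g -> Hs h -> Hs (g @` h).
Hypothesis flip : forall h, Hs h -> exists2 g, G g & g @` (~` h) `<=` h.
Variable N : nat.
Hypothesis fdim : forall f : nat -> set T, (forall i, i <= N -> Hs (f i)) ->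
  ~ forall i j, i < j -> j <= N -> crossing (f i) (f j).
(** Irreducibility enters here, as connectedness of the graph of non-crossing halfspaces. *)
Hypothesis irr : forall P : set (set T),
  (forall h k, Hs h -> Hs k -> P h -> ~ P k -> crossing h k) ->
  forall h k, Hs h -> Hs k -> P h -> P k.

Implicit Types h k u v : set T.

Lemma Hs_orient b h : Hs h -> Hs (orient b h).
Proof. by case: b => //=; exact: HsC. Qed.

Lemma image_setC_bij g h : G g -> g @` (~` h) = ~` (g @` h).
Proof.
move=> /Ginv[g' [Gg' gK g'K]]; apply/seteqP; split=> [_ [x hx <-] [y hy e]|x nx].
  by apply: hx; rewrite -(gK x) -e gK.
by exists (g' x) => // hx; apply: nx; exists (g' x).
Qed.

Lemma meets_image g A B : G g -> (meets (g @` A) (g @` B) <-> meets A B).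
Proof.
move=> /Ginv[g' [Gg' gK g'K]]; split=> [[_ [[x Ax <-] [y By e]]]|[x [Ax Bx]]].
  by exists x; split=> //; rewrite -(gK x) -e gK.
by exists (g x); split; exists x.
Qed.

Lemma crossing_image g h k : G g -> crossing (g @` h) (g @` k) <-> crossing h k.
Proof.
move=> Gg; rewrite /crossing -!(image_setC_bij _ Gg).
have M A B := propext (meets_image A B Gg).
by rewrite !M.
Qed.

(** Composition of two flips: [b] sends [k] into its complement, which lies outside [h], and [a]
    sends the outside of [h] into [h]. *)
Lemma double_skewer h k : Hs h -> Hs k -> h `<=` k -> exists2 g, G g & g @` k `<=` h.
Proof.
move=> Hh Hk hk; have [a Ga ah] := flip Hh; have [b Gb bk] := flip (HsC Hk).
exists (a \o b); first exact: Gcomp.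
rewrite -image_comp => _ [z [y yb <-] <-]; apply: ah; exists (b y) => // hy.
by rewrite setCK in bk; apply: (bk (b y)); [exists y|exact: hk].
Qed.

(* Among the first translates of [c] by the powers of [g] two do not cross, so some positive power moves [c] to a non-crossing wall; it lands in the absorbing set [a]. *)
Lemma skewer_power g a k c : G g -> g @` k `<=` a -> a `<=` k -> Hs c -> c `<=` k ->
  exists d, [/\ Hs d, d `<=` a & ~ crossing c d].
Proof.
move=> Gg gka ak Hc ck.
pose f n := iter n (fun s => g @` s) c.
have Hf n : Hs (f n) by elim: n => //= n IH; exact: GHs.
have fa n : f n.+1 `<=` a.
  elim: n => [|n IH]; first by move=> _ [x cx <-]; apply: gka; exists x => //; exact: ck.
  by move=> _ [x fx <-]; apply: gka; exists x => //; apply: ak; exact: IH.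
have fsh i m : crossing (f i) (f (i + m)) <-> crossing (f 0) (f m).
  elim: i => // i IH; rewrite addSn /= -IH; exact: crossing_image.
apply: contrapT => no; apply: (@fdim f) => // i j ij _.
have -> : j = i + (j - i) by lia.
apply/fsh; apply: contrapT => nc; apply: no; exists (f (j - i)); split=> //.
by have -> : j - i = (j - i).-1.+1 by lia.
Qed.

(** In the non-crossing graph any two walls are at distance at most 2: by [irr] it suffices to
    shorten a path [u], [t1], [t2], [t3]. In the case that is not immediate, a double skewer maps a
    side of [t2] into a side of [t1] that lies on one side of [u]; some power of it moves [t3] to a
    wall there that does not cross [t3]. *)
Lemma common_noncrossing u v : Hs u -> Hs v ->
  exists t, [/\ Hs t, ~ crossing t u & ~ crossing t v].
Proof.
move=> Hu Hv.
apply: (irr (P := [set v | exists t, [/\ Hs t, ~ crossing t u & ~ crossing t v]]) _ Hu Hv);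
  last by exists u; split=> //; exact: crossing_irr.
move=> {v Hv} t2 t3 H2 H3 [t1 [H1 n10 n12]] no; apply: contrapT => n23; apply: no.
have [n13|] := pselect (~ crossing t1 t3); first by exists t1.
move=> /contrapT c13.
have [n20|/contrapT c20] := pselect (~ crossing t2 u); first by exists t2.
have [n03|/contrapT c03] := pselect (~ crossing u t3).
  by exists u; split=> //; exact: crossing_irr.
have [e [b [c s]]] := ncrossing_sector (crossingC c20) n10 n12.
have [f [d s']] := ncrossing_sub n23.
have fc : f = ~~ c.
  apply: contrapT => /eqP; rewrite -(inj_eq negb_inj) negbK => fc.
  have {}fc : f = c by move: fc; case: (f) (c) => -[].
  have [_ [x [ex dx]] _ _] := crossing_orient e d c13.
  by apply: dx; apply: s'; rewrite fc; case: (s x ex).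
subst f; rewrite orientN in s'.
have cs : orient (~~ d) t3 `<=` orient c t2.
  by rewrite orientN => x dx; apply: contrapT => cx; apply: dx; apply: s'.
have s2 : orient e t1 `<=` orient c t2 by move=> x /s[].
have [g Gg gs] := double_skewer (Hs_orient e H1) (Hs_orient c H2) s2.
have [t [Ht ta nt]] := skewer_power Gg gs s2 (Hs_orient (~~ d) H3) cs.
exists t; split=> //.
  apply: (@sub_ncrossing _ true b) => /= x tx.
  by case: (s x (ta x tx)).
move=> ct; apply: nt; apply: (crossing_orient (~~ d) true).
exact: crossingC.
Qed.

Definition full (S : set T) := exists2 a, Hs a & a `<=` S.

(** A double skewer taking the complement of [a] into that of [u] moves [v] to some [d] inside the
    complement of [u] that does not cross [v]. One side of [v] then contains [d]; it cannot contain
    the complement of [d], since that contains [u], which meets both sides of [v]. *)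
Lemma full_opposite_side u v : Hs u -> Hs v -> crossing u v -> full (u `&` v) ->
  exists c, full (~` u `&` orient c v).
Proof.
move=> Hu Hv uv [a Ha auv].
have s1 : ~` u `<=` ~` a by move=> x ux /auv[].
have [g Gg gs] := double_skewer (HsC Hu) (HsC Ha) s1.
have s2 : ~` v `<=` ~` a by move=> x ux /auv[].
have [d [Hd du nd]] := skewer_power Gg gs s1 (HsC Hv) s2.
have ndv : ~ crossing d v by move=> /crossingC/crossing_setCl.
have [b [c s]] := ncrossing_sub ndv.
case: b s => /= s; first by exists c, d => // x dx; split; [exact: du|exact: s].
exfalso.
have := crossing_orient true (~~ c) uv; rewrite orientN => -[[x [ux ncx]] _ _ _].
exact: (ncx (s x (fun dx => du x dx ux))).
Qed.

(** A wall crossing neither [u] nor [v] makes one sector full. Applying [full_opposite_side] across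
    [u] and across [v] fills either the opposite sector or both adjacent ones, which are opposite to
    each other. *)
Lemma full_opposite_sectors u v : Hs u -> Hs v -> crossing u v ->
  (full (u `&` v) /\ full (~` u `&` ~` v)) \/ (full (u `&` ~` v) /\ full (~` u `&` v)).
Proof.
move=> Hu Hv uv.
have [t [Ht tu tv]] := common_noncrossing Hu Hv.
have [e [b [c s]]] := ncrossing_sector uv tu tv.
have F : full (orient b u `&` orient c v) by exists (orient e t) => //; exact: Hs_orient.
suff [[F1 F2]|[F1 F2]] :
  (full (orient b u `&` orient c v) /\ full (~` orient b u `&` ~` orient c v)) \/
  (full (orient b u `&` ~` orient c v) /\ full (~` orient b u `&` orient c v)).
- by case: b c F1 F2 {s F} => -[] /=; rewrite ?setCK; auto.
- by case: b c F1 F2 {s F} => -[] /=; rewrite ?setCK; auto.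
have Hb := Hs_orient b Hu; have Hc := Hs_orient c Hv.
have bc := crossing_orient b c uv.
have [[] F1] := full_opposite_side Hb Hc bc F; last by left.
have [|[] F2] := full_opposite_side Hc Hb (crossingC bc); first by rewrite setIC.
  by right; split => //; rewrite setIC.
by left; split=> //; rewrite setIC.
Qed.

Definition disjoint_walls h k := [/\ Hs h, Hs k, h `<=` ~` k & h <> ~` k].

Definition clique n h k := exists f : nat -> set T,
  (forall i, i < n -> [/\ Hs (f i), crossing (f i) h & crossing (f i) k]) /\
  (forall i j, i < j -> j < n -> crossing (f i) (f j)).

Lemma clique_sub n h k h' k' : h' `<=` h -> k' `<=` k -> h `<=` ~` k ->
  clique n h' k' -> clique n h k.
Proof.
move=> sh sk hk [f [f1 f2]]; exists f; split=> // i /f1[Hi ch ck]; split=> //.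
  apply: (crossing_between sh _ ch (crossing_setCr ck)).
  by move=> x /hk nk /sk.
apply: (crossing_between sk _ ck (crossing_setCr ch)).
by move=> x kx /sh/hk.
Qed.

Lemma clique_image n g h k : G g -> clique n (g @` h) (g @` k) -> clique n h k.
Proof.
move=> Gg [f [f1 f2]]; have [g' [Gg' gK g'K]] := Ginv Gg.
have E A : g' @` (g @` A) = A.
  apply/seteqP; split=> [_ [_ [x Ax <-] <-]|x Ax]; first by rewrite gK.
  by exists (g x); [exists x|rewrite gK].
exists (fun i => g' @` f i); split=> [i /f1[Hi ch ck]|i j ij jn].
  by split; [exact: GHs|rewrite -(E h); exact/crossing_image|
             rewrite -(E k); exact/crossing_image].
by apply/crossing_image => //; exact: f2.
Qed.

Lemma clique_bound n h k : clique n h k -> n <= N.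
Proof.
move=> [f [f1 f2]]; rewrite leqNgt; apply/negP => Nn.
apply: (@fdim f) => [i iN|i j ij jN]; first by case: (f1 i (leq_ltn_trans iN Nn)).
by apply: f2 => //; lia.
Qed.

(** A wall crossing both [A], on one side of [u], and [B], on the other side, also crosses [u]. *)
Lemma clique_extend n u h k A B : Hs u -> crossing u h -> crossing u k ->
  A `<=` h `&` u -> B `<=` k `&` ~` u -> h `<=` ~` k ->
  clique n A B -> clique n.+1 h k.
Proof.
move=> Hu uh uk sA sB hk [f [f1 f2]].
have C x : crossing x A -> crossing x B -> crossing x u.
  move=> [[p [p1 p2]] _ [q [q1 q2]] _] [[r [r1 r2]] _ [t [t1 t2]] _].
  split; [exists p|exists r|exists q|exists t]; split=> //;
    by [case: (sA _ p2)|case: (sB _ r2)|case: (sA _ q2)|case: (sB _ t2)].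
have sA' : A `<=` h by move=> x /sA[].
have sB' : B `<=` k by move=> x /sB[].
exists (fun i => if i < n then f i else u); split=> [i|i j ij].
  case: ifP => [lt _|_ _]; last by split.
  have [Hi cA cB] := f1 i lt; split=> //.
    apply: (crossing_between sA' _ cA (crossing_setCr cB)).
    by move=> x /hk nk /sB'.
  apply: (crossing_between sB' _ cB (crossing_setCr cA)).
  by move=> x kx /sA'/hk.
rewrite ltnS leq_eqVlt => /orP[/eqP jn|jn]; last first.
  by rewrite jn (ltn_trans ij jn); exact: f2.
rewrite jn ltnn -jn ij; have [_ cA cB] := f1 i (leq_trans ij (eq_leq jn)).
exact: C.
Qed.

Lemma exists_strongly_separated : (exists h k, disjoint_walls h k) ->
  exists h k, disjoint_walls h k /\ ~ exists t, [/\ Hs t, crossing t h & crossing t k].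
Proof.
move=> exd; apply: contrapT => noss.
have ss h k : disjoint_walls h k -> exists t, [/\ Hs t, crossing t h & crossing t k].
  by move=> hk; apply: contrapT => no; apply: noss; exists h, k.
(* Take the least [n] for which some disjoint pair is crossed by no family of n+1 pairwise crossing
   walls. By minimality every disjoint pair is crossed by such a family of [n] walls. *)
pose P n := `[< exists h k, (disjoint_walls h k) /\ (~ clique n.+1 h k) >].
have exP : exists n, P n.
  have [h [k hk]] := exd; exists N; apply/asboolP; exists h, k; split=> //.
  by move/clique_bound; rewrite ltnn.
case: (ex_minnP exP) => n /asboolP[h [k [hk tight]]] nmin.
have allclq A B : disjoint_walls A B -> clique n A B.
  move=> AB; case: (n) nmin => [|m] nmin.
    by exists (fun=> A).
  apply: contrapT => nc.
  have : P m by apply/asboolP; exists A, B.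
  by move/nmin; rewrite ltnn.
have [Hh Hk hsk hnk] := hk.
have khs : k `<=` ~` h by move=> x kx /hsk.
(* The walls of [h], [H2], [H3] are nested and distinct. Each of their three pairs inherits from
   [h], [k] the absence of an (n+1)-clique, while some [u] crosses all three. *)
have [g Gg gs] := double_skewer Hk (HsC Hh) khs.
pose H2 := g @` (~` h); pose H3 := g @` k.
have HH2 : Hs H2 by apply: GHs => //; exact: HsC.
have HH3 : Hs H3 by exact: GHs.
have H32 : H3 `<=` H2 by exact: image_subset.
have H20 : H2 `<=` ~` h by move=> x /gs/khs.
have strict2 : h <> ~` H2.
  move=> e; apply: hnk; rewrite e; congr (~` _); apply/seteqP; split=> // x kx.
  by apply: contrapT => nx; apply: (khs x kx); rewrite e.
have strict3 : H3 <> H2.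
  have [g' [_ gK _]] := Ginv Gg.
  move=> e; apply: hnk; rewrite -[h]setCK; congr (~` _).
  apply/seteqP; split=> // x hx.
  have : H2 (g x) by exists x.
  by rewrite -e => -[y ky /(can_inj gK) <-].
have d02 : disjoint_walls h H2.
  by split=> // x hx /H20.
have d03 : disjoint_walls h H3.
  split=> //; first by move=> x hx /H32/H20.
  move=> e; apply: strict3; apply/seteqP; split=> // x /H20; rewrite e.
  by move/contrapT.
have d23 : disjoint_walls (~` H2) H3.
  split=> //; first exact: HsC.
    by move=> x nx /H32.
  by move=> e; apply: strict3; rewrite -[LHS]setCK -e setCK.
have t02 : ~ clique n.+1 h H2 by move/(clique_sub (fun x => id) gs hsk).
have t03 : ~ clique n.+1 h H3.
  by apply: contra_not t02; apply: clique_sub => // x hx /H20.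
have t23 : ~ clique n.+1 (~` H2) H3.
  rewrite /H2 (image_setC_bij _ Gg) setCK => /(clique_image Gg).
  exact: tight.
have [u [Hu uh u3]] := ss h H3 d03.
have u2 : crossing u H2.
  by apply: (crossing_between H32 H20) => //; exact: crossing_setCr.
(* A halfspace [a] in [v] and [B] and a halfspace [b] in [A] outside [v] have an n-clique crossing
   both; adding [v] would give an (n+1)-clique for [A], [B]. *)
have key v A B : Hs v -> disjoint_walls A B -> ~ clique n.+1 A B -> crossing v A ->
    crossing v B -> full (v `&` B) -> full (~` v `&` A) -> False.
  move=> Hv [HA HB sAB nAB] tAB vA vB [a Ha sa] [b Hb sb]; apply: tAB.
  have dba : disjoint_walls b a.
    split=> //.
      by move=> x /sb[_ Ax] /sa[_ Bx]; exact: (sAB x).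
    move=> e; have [_ [x [vx nBx]] _ _] := vB.
    have nax : (~` a) x by move=> /sa[].
    by move: nax; rewrite -e => /sb[].
  apply: (@clique_extend n (~` v) A B b a) => //.
  - exact: HsC.
  - exact: crossing_setCl.
  - exact: crossing_setCl.
  - by rewrite setIC.
  - by rewrite setCK setIC.
  - exact: allclq.
have pairs A B : Hs A -> disjoint_walls (~` A) B -> ~ clique n.+1 (~` A) B -> crossing u A ->
    crossing u B ->
    ~ (full (u `&` B) /\ full (~` u `&` ~` A)) /\ ~ (full (~` u `&` B) /\ full (u `&` ~` A)).
  move=> HA dAB tAB cA cB; split=> -[F1 F2].
    exact: (key u (~` A) B) (crossing_setCr cA) cB F1 F2.
  apply: (key (~` u) (~` A) B) _ _ _ _ _ F1 _ => //; first exact: HsC.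
  - by apply: crossing_setCl; exact: crossing_setCr.
  - exact: crossing_setCl.
  - by rewrite setCK.
have [p02 q02] : ~ (full (u `&` H2) /\ full (~` u `&` ~` (~` h))) /\ ~ (full (~` u `&` H2) /\ full (u `&` ~` (~` h))).
  by apply: pairs; rewrite ?setCK //; [exact: HsC|exact: crossing_setCr].
have [p03 q03] : ~ (full (u `&` H3) /\ full (~` u `&` ~` (~` h))) /\ ~ (full (~` u `&` H3) /\ full (u `&` ~` (~` h))).
  by apply: pairs; rewrite ?setCK //; [exact: HsC|exact: crossing_setCr].
have [p23 q23] := pairs H2 H3 HH2 d23 t23 u2 u3.
(* Pigeonhole: with [u], each of the three walls has one of two diagonals full, so two of them share
   the type of diagonal, which [pairs] excludes. *)
have := full_opposite_sectors Hu (HsC Hh) (crossing_setCr uh).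
have := full_opposite_sectors Hu HH2 u2.
have := full_opposite_sectors Hu HH3 u3.
tauto.
Qed.

End StronglySeparated.

(** * Edge paths up to squares *)

Section SquareGraph.
Variables (V : Type) (adj : V -> V -> Prop) (sq : V -> V -> V -> V -> Prop).

Fixpoint walk (l : seq V) : Prop :=
  match l with
  | a :: t => match t with b :: _ => adj a b /\ walk t | [::] => True end
  | [::] => True
  end.

Inductive hstep : seq V -> seq V -> Prop :=
| hstep_back a b p : adj a b -> hstep [:: a, b, a & p] (a :: p)
| hstep_sq a b c d p : sq a b c d -> hstep [:: a, b, c & p] [:: a, d, c & p]
| hstep_cons a p q : hstep p q -> hstep (a :: p) (a :: q).

Definition homotopic := clos_refl_sym_trans (seq V) hstep.

Inductive swap_step : seq V -> seq V -> Prop :=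
| sw_here a b c d p : sq a b c d -> swap_step [:: a, b, c & p] [:: a, d, c & p]
| sw_cons a p q : swap_step p q -> swap_step (a :: p) (a :: q).

Inductive swap_equiv (p : seq V) : seq V -> Prop :=
| swap_equiv_refl : swap_equiv p p
| swap_equiv_step q r : swap_equiv p q -> swap_step q r -> swap_equiv p r.

Hypothesis adjC : forall a b, adj a b -> adj b a.
Hypothesis sq_rot : forall a b c d, sq a b c d -> sq b c d a.
Hypothesis sq_rev : forall a b c d, sq a b c d -> sq a d c b.
Hypothesis sq_adj : forall a b c d, sq a b c d -> adj a b.
Hypothesis sq_diag : forall a b c d, sq a b c d -> a <> c.
Hypothesis sq_uniq : forall a b c c' d, sq a b c d -> sq a b c' d -> c = c'.
Hypothesis sq_cube : forall w x y z p q r,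
  sq w x p y -> sq w y q z -> sq w z r x ->
  exists s, [/\ sq x p s r, sq y p s q & sq z q s r].

Lemma swap_equiv_trans p q r : swap_equiv p q -> swap_equiv q r -> swap_equiv p r.
Proof. by move=> pq; elim=> // s t _ ps st; exact: swap_equiv_step st. Qed.

Lemma sweq1 p q : swap_step p q -> swap_equiv p q.
Proof. by move=> s; apply: swap_equiv_step s; exact: swap_equiv_refl. Qed.

Lemma sw_sym p q : swap_step p q -> swap_step q p.
Proof. by elim=> *; [apply: sw_here; exact: sq_rev|exact: sw_cons]. Qed.

Lemma swap_equiv_sym p q : swap_equiv p q -> swap_equiv q p.
Proof.
elim=> [|s t _ sp st]; first exact: swap_equiv_refl.
by apply: swap_equiv_trans sp; apply: sweq1; exact: sw_sym.
Qed.

Lemma swap_equiv_cons a p q : swap_equiv p q -> swap_equiv (a :: p) (a :: q).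
Proof.
elim=> [|s t _ sp st]; first exact: swap_equiv_refl.
by apply: swap_equiv_step sp _; exact: sw_cons.
Qed.

Lemma swap_equiv_sq a b c d p : sq a b c d -> swap_equiv [:: a, b, c & p] [:: a, d, c & p].
Proof. by move=> s; apply: sweq1; exact: sw_here. Qed.

Lemma swap_equiv_size p q : swap_equiv p q -> size p = size q.
Proof.
elim=> // s t _ -> {p}; elim=> //= a u v _ e; by rewrite e.
Qed.

Lemma swap_equiv_head z p l : swap_equiv (z :: p) l -> exists q, l = z :: q.
Proof.
elim=> [|s t _ [q ->] st]; first by exists p.
by inversion st; eexists.
Qed.

Lemma swap_equiv_heads a p b q : swap_equiv (a :: p) (b :: q) -> a = b.
Proof. by move=> /swap_equiv_head[r [->]]. Qed.

(** Normal form of a swap equivalence between paths with the same first vertex [z]: at most one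
    square is used at [z]. *)
Definition exchange z p q := swap_equiv p q \/
  exists v x w r, [/\ sq z v x w, swap_equiv p [:: v, x & r] & swap_equiv q [:: w, x & r]].

(** Two squares used in succession at [z] are replaced by one. The induction hypothesis compares the
    middle paths starting at [w]; if it uses another square there, the three squares at [w] span a
    cube, whose face at [z] is the required square. *)
Lemma exchange_trans n z p q s :
  (forall z' p' q', size p' < n -> swap_equiv (z' :: p') (z' :: q') -> exchange z' p' q') ->
  size p = n -> exchange z p q -> exchange z q s -> exchange z p s.
Proof.
move=> IH pn [pq|[v [x [w [r [zv pv qw]]]]]] [qs|[w' [y [t' [t [zw qw' st]]]]]].
- by left; exact: swap_equiv_trans qs.
- by right; exists w', y, t', t; split=> //; exact: swap_equiv_trans qw'.
- by right; exists v, x, w, r; split=> //; apply: swap_equiv_trans qw; exact: swap_equiv_sym.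
have ww := swap_equiv_trans (swap_equiv_sym qw) qw'.
have ew := swap_equiv_heads ww; subst w'.
have sz : size (x :: r) < n by rewrite -pn (swap_equiv_size pv).
case: (IH _ _ _ sz ww) => [e|[x' [y0 [y' [r0 [wx e1 e2]]]]]].
  have exy := swap_equiv_heads e; subst y.
  have cell_vertex : v = t'.
    by apply: (@sq_uniq w z _ _ x);
      [exact: (sq_rot (sq_rot (sq_rot zv)))|exact: (sq_rot (sq_rot (sq_rot (sq_rev zw))))].
  left; subst t'; apply: swap_equiv_trans pv _; apply: swap_equiv_trans (swap_equiv_sym st).
  exact: swap_equiv_cons.
have ex := swap_equiv_heads e1; have ey := swap_equiv_heads e2; subst x' y'.
have [u [s1 s2 s3]] := sq_cube (sq_rot (sq_rot (sq_rot zv))) wx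
  (sq_rev (sq_rot (sq_rot (sq_rot (sq_rev zw))))).
right; exists v, u, t', (y0 :: r0); split=> //.
  apply: swap_equiv_trans pv _; apply: swap_equiv_trans (swap_equiv_cons v e1) _.
  by apply: swap_equiv_sq; exact: (sq_rot (sq_rot (sq_rot (sq_rev s2)))).
apply: swap_equiv_trans st _; apply: swap_equiv_trans (swap_equiv_cons t' e2) _.
by apply: swap_equiv_sq; exact: (sq_rot (sq_rot (sq_rot s3))).
Qed.

Lemma swap_equiv_exchange z p q : swap_equiv (z :: p) (z :: q) -> exchange z p q.
Proof.
have [n pn] : exists n, size p = n by exists (size p).
elim/ltn_ind: n => n IHn in z p q pn *.
have IH z' p' q' : size p' < n -> swap_equiv (z' :: p') (z' :: q') -> exchange z' p' q'.
  by move=> sn; exact: IHn sn _ _ _ erefl.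
suff H l : swap_equiv (z :: p) l -> forall q, l = z :: q -> exchange z p q by move/H; exact.
elim=> {q} [q [<-]|l' l2 zl IH2 ll q el]; first by left; exact: swap_equiv_refl.
have [q' eq'] := swap_equiv_head zl; subst l' l2.
apply: (exchange_trans IH pn (IH2 _ erefl)).
move: ll; move E1 : (z :: q') => l1; move E2 : (z :: q) => l2 ll.
case: ll E1 E2 => [a b c d r sqr [-> ->] [->]|a u v uv [_ ->] [_ ->]].
  by right; exists b, c, d, r; split=> //; exact: swap_equiv_refl.
by left; exact: sweq1.
Qed.

(** A square used at [z] would have [f] at two opposite corners. *)
Lemma swap_equiv_cancel z f q q' : swap_equiv [:: z, f & q] [:: z, f & q'] -> swap_equiv (f :: q) (f :: q').
Proof.
move=> /swap_equiv_exchange[//|[v [x [w [r [s e1 e2]]]]]].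
have ev := swap_equiv_heads e1; have ew := swap_equiv_heads e2; subst v w.
by case: (sq_diag (sq_rot s)).
Qed.

Fixpoint backtracks (l : seq V) : Prop :=
  match l with
  | a :: t => match t with b :: c :: _ => a = c \/ backtracks t | _ => False end
  | [::] => False
  end.

Definition reduced l := forall l', swap_equiv l l' -> ~ backtracks l'.

Lemma backtracks_cons a p : backtracks p -> backtracks (a :: p).
Proof. by case: p => [|b [|c p]] //=; right. Qed.

Lemma reduced_sweq p q : swap_equiv p q -> reduced p -> reduced q.
Proof. by move=> pq Rp l ql; apply: Rp; exact: swap_equiv_trans ql. Qed.

Lemma reduced_tail a p : reduced (a :: p) -> reduced p.
Proof. by move=> R l pl /(backtracks_cons a); apply: R; exact: swap_equiv_cons. Qed.

(* [descends q f]: up to swaps, the path [q] (listed from its end) arrives through [f]. *)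
Definition descends q f := exists z q', swap_equiv q [:: z, f & q'].

Lemma descends_sweq p q f : swap_equiv p q -> descends p f -> descends q f.
Proof.
move=> pq [z [q' e]]; exists z, q'; apply: swap_equiv_trans e; exact: swap_equiv_sym.
Qed.

(** A backtrack appearing after swaps either lies behind the first vertex or returns to [f]. Read
    through [exchange], it makes [q] backtrack or descend through [f], or it contradicts the
    statement for a shorter path. *)
Lemma reduced_cons f q : reduced q -> ~ descends q f -> reduced (f :: q).
Proof.
have [n qn] : exists n, size q = n by exists (size q).
elim/ltn_ind: n => n IH in f q qn *.
move=> Rq nd l fl btl.
have [s el] := swap_equiv_head fl; subst l.
case: s fl btl => [|w s] // fl btl.
case: q qn Rq nd fl => [|z q0] qn Rq nd fl.
  by have := swap_equiv_size fl.
have btl' : backtracks (w :: s) \/ exists s', s = f :: s'.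
  by case: s btl {fl} => [//|c s] /= [->|]; [right; exists s|left].
case: (swap_equiv_exchange fl) => [qs|[z' [y [w' [r [sqf e1 e2]]]]]].
  have ez := swap_equiv_heads qs; subst w.
  case: btl' => [|[s' es]]; first exact: Rq.
  by apply: nd; exists z, s'; rewrite -es.
have ez := swap_equiv_heads e1; have ew := swap_equiv_heads e2; subst z' w'.
case: btl' => [btw|[s' es]].
  have Ry : reduced (y :: r) by apply: (@reduced_tail z); exact: reduced_sweq Rq.
  have [[y' [q' e3]]|ny] := pselect (descends (y :: r) w).
    have ey := swap_equiv_heads e3; subst y'.
    apply: nd; exists z, (w :: q'); apply: swap_equiv_trans e1 _.
    apply: swap_equiv_trans (swap_equiv_cons z e3) _.
    by apply: swap_equiv_sq; exact: sq_rot.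
  have sz : size (y :: r) < n by rewrite -qn (swap_equiv_size e1).
  by apply: (IH _ sz w _ erefl Ry ny _ (swap_equiv_sym e2)).
subst s; case: (swap_equiv_exchange e2) => [e|[v [x [w2 [r' [s1 e3 e4]]]]]].
  by have := swap_equiv_heads e; exact: sq_diag sqf.
have ev := swap_equiv_heads e3; have ew := swap_equiv_heads e4; subst v w2.
have xz : z = x.
  apply: (@sq_uniq w f _ _ y) s1; exact: sq_rot (sq_rot (sq_rot sqf)).
subst x; apply: (Rq [:: z, y, z & r']); last by left.
by apply: swap_equiv_trans e1 _; exact: swap_equiv_cons.
Qed.

(** Prolongs a reduced path by one vertex, cancelling the last edge when the path arrives through
    [f]. The remainder is chosen, so the result is meaningful only up to swaps. *)
Definition push f q : seq V :=
  if pselect (exists q', exists z, swap_equiv q [:: z, f & q']) is left H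
  then f :: projT1 (cid H) else f :: q.

Lemma push_desc f q z q' : swap_equiv q [:: z, f & q'] -> swap_equiv (push f q) (f :: q').
Proof.
move=> e; rewrite /push; case: pselect => [H|]; last by case; exists q', z.
case: cid => q'' [z' e'] /=; have ee := swap_equiv_trans (swap_equiv_sym e') e.
have ez := swap_equiv_heads ee; subst z'.
exact: swap_equiv_cancel ee.
Qed.

Lemma push_new f q : ~ descends q f -> push f q = f :: q.
Proof.
move=> nd; rewrite /push; case: pselect => // -[q' [z e]].
by case: nd; exists z, q'.
Qed.

Lemma push_head f q : exists t, push f q = f :: t.
Proof. by rewrite /push; case: pselect => H; eexists. Qed.

Lemma push_sweq f p q : swap_equiv p q -> swap_equiv (push f p) (push f q).
Proof.
move=> pq; have [[z [q' e]]|nd] := pselect (descends q f).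
  apply: swap_equiv_trans (push_desc (swap_equiv_trans pq e)) _; apply: swap_equiv_sym; exact: push_desc e.
rewrite !push_new //; first exact: swap_equiv_cons.
by move=> /(descends_sweq pq).
Qed.

Lemma push_reduced f q : reduced q -> reduced (push f q).
Proof.
move=> Rq; have [[z [q' e]]|nd] := pselect (descends q f); last first.
  by rewrite push_new //; exact: reduced_cons.
apply: (reduced_sweq (swap_equiv_sym (push_desc e))).
by apply: (@reduced_tail z); exact: reduced_sweq Rq.
Qed.

Lemma push_push f z q : reduced (z :: q) -> swap_equiv (push z (push f (z :: q))) (z :: q).
Proof.
move=> R; have [[z' [q' e]]|nd] := pselect (descends (z :: q) f).
  have ez := swap_equiv_heads e; subst z'.
  apply: swap_equiv_trans (push_sweq z (push_desc e)) _.
  rewrite push_new; first exact: swap_equiv_sym.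
  move=> [f' [q'' e2]]; have ef := swap_equiv_heads e2; subst f'.
  apply: (R [:: z, f, z & q'']); last by left.
  by apply: swap_equiv_trans e _; exact: swap_equiv_cons.
by rewrite (push_new nd); apply: push_desc; exact: swap_equiv_refl.
Qed.

Lemma push_sq_desc a b c d q : sq a b c d -> descends (a :: q) b ->
  ~ descends (a :: q) d ->
  swap_equiv (push c (push b (a :: q))) (push c (push d (a :: q))).
Proof.
move=> s [a' [q1 e]] nd; have ea := swap_equiv_heads e; subst a'.
apply: swap_equiv_trans (push_sweq c (push_desc e)) _; apply: swap_equiv_sym.
rewrite (push_new nd) [X in swap_equiv _ X]push_new; last first.
  move=> [b' [q2 e2]]; have eb := swap_equiv_heads e2; subst b'.
  apply: nd; exists a, (c :: q2); apply: swap_equiv_trans e _.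
  by apply: swap_equiv_trans (swap_equiv_cons a e2) _; exact: swap_equiv_sq.
apply: (@push_desc c _ d).
apply: swap_equiv_trans (swap_equiv_cons d e) _; apply: swap_equiv_sq.
by apply: sq_rot; apply: sq_rot; exact: sq_rot.
Qed.

Lemma push_new_new a b c d q : sq a b c d -> ~ descends (a :: q) b ->
  ~ descends (a :: q) d -> push c (push b (a :: q)) = [:: c, b, a & q].
Proof.
move=> s nb nd; rewrite (push_new nb) push_new // => -[b' [q2 e]].
have eb := swap_equiv_heads e; subst b'.
case: (swap_equiv_exchange e) => [e2|[v [x [w [r [s1 e1 e2]]]]]].
  by have := swap_equiv_heads e2; exact: sq_diag s.
have ev := swap_equiv_heads e1; have ew := swap_equiv_heads e2; subst v w.
apply: nd; exists a, r.
have -> // : d = x.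
apply: (@sq_uniq b a _ _ c) s1.
exact: sq_rot (sq_rot (sq_rot (sq_rev s))).
Qed.

(** With [push_push], this says that [push] respects both elementary homotopies. When the path
    descends through both [b] and [d], it descends through the fourth corner [c], by [sq_uniq], and
    both sides cancel two edges. *)
Lemma push_sq a b c d q : sq a b c d -> reduced (a :: q) ->
  swap_equiv (push c (push b (a :: q))) (push c (push d (a :: q))).
Proof.
move=> s R.
have [db|nb] := pselect (descends (a :: q) b); have [dd|nd] := pselect (descends (a :: q) d).
- have [a' [q1 e1]] := db; have [a2 [q2 e2]] := dd.
  have ea := swap_equiv_heads e1; have ea2 := swap_equiv_heads e2; subst a' a2.
  case: (swap_equiv_exchange (swap_equiv_trans (swap_equiv_sym e1) e2)) => [e|[v [x [w [r [s1 e3 e4]]]]]].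
    have := swap_equiv_heads e => ebd; subst d.
    by case: (sq_diag (sq_rot s)).
  have ev := swap_equiv_heads e3; have ew := swap_equiv_heads e4; subst v w.
  have ex : x = c by exact: sq_uniq s1 s.
  subst x; apply: (@swap_equiv_trans _ (c :: r)).
    by apply: swap_equiv_trans (push_sweq c (push_desc e1)) _; exact: push_desc e3.
  apply: swap_equiv_sym.
  by apply: swap_equiv_trans (push_sweq c (push_desc e2)) _; exact: push_desc e4.
- exact: push_sq_desc.
- by apply: swap_equiv_sym; apply: push_sq_desc => //; exact: sq_rev.
- rewrite (push_new_new s) // (push_new_new (sq_rev s)) //.
  by apply: swap_equiv_sq; exact: sq_rev (sq_rot (sq_rot s)).
Qed.

Fixpoint reduction l : seq V :=
  match l with
  | [::] => [::]
  | f :: t => if t is [::] then [:: f] else push f (reduction t)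
  end.

Lemma reduction_head f t : exists q, reduction (f :: t) = f :: q.
Proof. by case: t => [|z t] /=; [exists [::]|exact: push_head]. Qed.

Lemma reduction_reduced l : reduced (reduction l).
Proof.
elim: l => [|f [|z t] IH] /=.
- by move=> l' /swap_equiv_size; case: l' => [_ []|].
- by move=> l' /swap_equiv_size; case: l' => [//|a [_ []|]].
- exact: push_reduced.
Qed.

Lemma reduction_id l : reduced l -> swap_equiv (reduction l) l.
Proof.
elim: l => [|f [|z t] IH] R; try exact: swap_equiv_refl.
have e := IH (reduced_tail R); rewrite [reduction _]/=.
apply: swap_equiv_trans (push_sweq f e) _; rewrite push_new; first exact: swap_equiv_refl.
move=> [z' [q' e']]; have ez := swap_equiv_heads e'; subst z'.
by apply: (R [:: f, z, f & q']); [exact: swap_equiv_cons|left].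
Qed.

Lemma reduction_hstep p q : hstep p q -> swap_equiv (reduction p) (reduction q).
Proof.
elim=> {p q} [a b p _|a b c d p s|a p q h IH].
- have [q eq] := reduction_head a p; have R : reduced (reduction (a :: p)) by exact: reduction_reduced.
  have -> : reduction [:: a, b, a & p] = push a (push b (reduction (a :: p))) by [].
  by rewrite eq; apply: push_push; rewrite -eq.
- have [q eq] := reduction_head c p; have R : reduced (reduction (c :: p)) by exact: reduction_reduced.
  have -> : reduction [:: a, b, c & p] = push a (push b (reduction (c :: p))) by [].
  have -> : reduction [:: a, d, c & p] = push a (push d (reduction (c :: p))) by [].
  by rewrite eq; apply: push_sq; [exact: sq_rev (sq_rot (sq_rot s))|rewrite -eq].
- have np : exists x p', p = x :: p' by case: h => *; eexists; eexists.
  have nq : exists x q', q = x :: q' by case: h => *; eexists; eexists.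
  have [x [p' ep]] := np; have [y [q' eq]] := nq.
  rewrite ep eq [reduction (a :: _)]/= [X in swap_equiv _ X]/=.
  by move: IH; rewrite ep eq; exact: push_sweq.
Qed.

(** [reduction] is invariant under elementary homotopies and fixes reduced paths, up to swaps;
    compare Tits' solution of the word problem in Coxeter groups. *)
Lemma homotopic_reduced l l' : homotopic l l' -> reduced l -> reduced l' -> swap_equiv l l'.
Proof.
move=> h R R'; apply: swap_equiv_trans (swap_equiv_sym (reduction_id R)) _; apply: swap_equiv_trans (reduction_id R').
elim: h => {R R' l l'} [p q|p|p q _|p q r _ pq _]; first exact: reduction_hstep.
- exact: swap_equiv_refl.
- exact: swap_equiv_sym.
- exact: swap_equiv_trans.
Qed.

End SquareGraph.

(** * Walls of a simply connected square graph *)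

Section Walls.
Variables (V : Type) (adj : V -> V -> Prop) (sq : V -> V -> V -> V -> Prop).
Hypothesis adjC : forall a b, adj a b -> adj b a.
Hypothesis sq_rot : forall a b c d, sq a b c d -> sq b c d a.
Hypothesis sq_rev : forall a b c d, sq a b c d -> sq a d c b.
Hypothesis sq_adj : forall a b c d, sq a b c d -> adj a b.
Hypothesis sq_diag : forall a b c d, sq a b c d -> a <> c.
Hypothesis sq_uniq : forall a b c c' d, sq a b c d -> sq a b c' d -> c = c'.
Hypothesis sq_cube : forall w x y z p q r,
  sq w x p y -> sq w y q z -> sq w z r x ->
  exists s, [/\ sq x p s r, sq y p s q & sq z q s r].

(* Walks are listed from their end: [joins l u v] means that [l] goes from [u] to [v]. *)
Definition joins l u v := walk adj l /\ exists t, l = v :: t /\ last v t = u.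

Hypothesis connected_graph : forall u v, exists l, joins l u v.
Hypothesis simply_connected_graph : forall u v l l',
  joins l u v -> joins l' u v -> homotopic adj sq l l'.

Lemma joins_nil u : joins [:: u] u u.
Proof. by split=> //; exists [::]. Qed.

Lemma joins_cons l u v w : joins l u v -> adj w v -> joins (w :: l) u w.
Proof. by move=> [wl [t [e lt]]] wv; subst l; split=> //; exists (v :: t). Qed.

Lemma joins_tail l u v w : joins [:: v, w & l] u v -> joins (w :: l) u w.
Proof. by move=> [[_ wl] [t [[<-] lt]]]; split=> //; exists l. Qed.

Lemma joins_cat l l' u v w : joins l u v -> joins l' v w ->
  exists2 l2, joins l2 u w & size l2 + 1 = size l + size l'.
Proof.
move=> jl; elim: l' w => [|a [|b t] IH] w [wl' [t' [e lt]]] //.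
  case: e lt => aw <- /= lt; exists l; [by rewrite lt|rewrite /=; lia].
case: e lt => <- <- /= lt; have [ab wt] := wl'.
have [|l2 j2 s2] := IH b; first by split=> //; exists t.
exists (a :: l2); first exact: joins_cons j2 _.
by rewrite /= in s2 *; lia.
Qed.

Lemma joins_rev l u v : joins l u v -> exists2 l', joins l' v u & size l' = size l.
Proof.
elim: l v => [|a [|b t] IH] v [wl [t' [e lt]]] //.
  case: e lt => av <- /= lt; exists [:: v] => //; rewrite lt; exact: joins_nil.
case: e lt => <- <- /= lt; have [ab wt] := wl.
have [|l' j' s'] := IH b; first by split=> //; exists t.
have jab : joins [:: b; a] a b by split; [split=> //; exact: adjC|exists [:: a]].
have [l2 j2 s2] := joins_cat jab j'.
by exists l2 => //; move: s2 s' => /=; lia.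
Qed.

Definition joins_len u v n := exists2 l, joins l u v & size l = n.+1.

Lemma exists_len u v : exists n, `[< joins_len u v n >].
Proof.
have [l jl] := connected_graph u v; exists (size l).-1; apply/asboolP; exists l => //.
by case: jl => _ [t [-> _]].
Qed.

Definition gdist u v := ex_minn (exists_len u v).

Lemma gdistP u v : joins_len u v (gdist u v).
Proof. by rewrite /gdist; case: ex_minnP => n /asboolP. Qed.

Lemma gdist_le u v n : joins_len u v n -> gdist u v <= n.
Proof. by move=> h; rewrite /gdist; case: ex_minnP => m _; apply; exact/asboolP. Qed.

Lemma gdist_sym_le u v : gdist u v <= gdist v u.
Proof.
apply: gdist_le; have [l jl sl] := gdistP v u.
by have [l' jl' sl'] := joins_rev jl; exists l' => //; rewrite sl'.
Qed.

Lemma gdistC u v : gdist u v = gdist v u.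
Proof. by apply/eqP; rewrite eqn_leq !gdist_sym_le. Qed.

Lemma gdist_triangle u v w : gdist u w <= gdist u v + gdist v w.
Proof.
have [l jl sl] := gdistP u v; have [l' jl' sl'] := gdistP v w.
have [l2 j2 s2] := joins_cat jl jl'.
by apply: gdist_le; exists l2 => //; lia.
Qed.

Lemma gdist0 u : gdist u u = 0.
Proof.
apply/eqP; rewrite -leqn0; apply: gdist_le; exists [:: u] => //; exact: joins_nil.
Qed.

Lemma gdist_eq0 u v : gdist u v = 0 -> u = v.
Proof.
by move=> e; have [l [_ [t [-> lt]]]] := gdistP u v; rewrite e; case: t lt.
Qed.

Lemma gdist_adj u v : adj u v -> gdist u v <= 1.
Proof.
move=> uv; apply: gdist_le; exists [:: v; u] => //.
by split; [split=> //; exact: adjC|exists [:: u]].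
Qed.

(** Elementary homotopies change the length by 0 or 2; this makes the graph bipartite. *)
Lemma homotopic_odd l l' : homotopic adj sq l l' -> odd (size l) = odd (size l').
Proof.
elim=> {l l'} [p q|//|p q _ ->|p q r _ -> _ ->] //.
by elim=> {p q} [a b p _|//|a p q _ IH] /=; [rewrite negbK|rewrite IH].
Qed.

Lemma gdist_adj_neq u v w : adj v w -> gdist u v <> gdist u w.
Proof.
move=> vw e; have [l jl sl] := gdistP u v; have [l' jl' sl'] := gdistP u w.
have := homotopic_odd (simply_connected_graph (joins_cons jl (adjC vw)) jl').
by rewrite /= sl sl' e /=; case: (odd _).
Qed.

Lemma gdist_adjP u v w : adj v w ->
  gdist u v = (gdist u w).+1 \/ gdist u w = (gdist u v).+1.
Proof.
move=> vw; have := gdist_adj_neq (u := u) vw.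
have := gdist_triangle u v w; have := gdist_triangle u w v.
have := gdist_adj vw; have := gdist_adj (adjC vw); lia.
Qed.

Lemma step_towards u v : u <> v -> exists w, adj v w /\ gdist u v = (gdist u w).+1.
Proof.
move=> uv; have [l jl sl] := gdistP u v.
have [wl [t [e lt]]] := jl; case: t e lt => [|w t] e lt; first by move: lt => /= ?; case: uv.
subst l; exists w; have [vw _] := wl; split=> //.
have le : gdist u w <= size t.
  by apply: gdist_le; exists (w :: t) => //; exact: joins_tail jl.
by have := gdist_adjP u vw; move: sl => /=; lia.
Qed.

(** Swaps keep the ends and the length, so removing a backtrack would give a shorter path with the
    same ends. *)
Lemma geodesic_reduced l u v : joins l u v -> size l = (gdist u v).+1 -> reduced sq l.
Proof.
move=> jl sl l' ll' btl.
have walk_sw p q : swap_step sq p q -> joins p u v -> joins q u v.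
  move=> s; suff W : (walk adj p -> walk adj q) /\ (forall x, last x p = last x q) /\
      ohead p = ohead q.
    case: W => W [W1 W2] [wp [t [ep lt]]]; split; first exact: W.
    move: W2; rewrite ep; case: (q) W1 => [//|y q'] W1 [ey]; exists q'; rewrite -ey; split=> //.
    by have := W1 v; rewrite ep /= lt => ->; rewrite ey.
  elim: s => {p q} [a b c d p s|a p q s [IH [IH1 IH2]]].
    split=> [[_ [_ wc]]|//]; split; first exact: sq_adj (sq_rev s).
    by split=> //; exact: sq_adj (sq_rot (sq_rev s)).
  split; last by split=> // x /=; exact: IH1.
  by case: s IH IH2 {IH1} => {p q} [a' b' c' d' p' s' IH _ [ab wp]|a' p' q' s' IH _ [ab wp]];
    split=> //; exact: IH.
have jl' : joins l' u v.
  by elim: ll' {btl} => // q r _ jq /walk_sw; apply.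
have shorter : forall l2 x, joins l2 u x -> backtracks l2 -> exists2 l3, joins l3 u x & size l3 + 2 = size l2.
  elim=> [//|a [|b [|c t]] IH] x [wl [t' [e lt]]] //.
  case: e lt => <- <- /= lt btc; have [ab wb] := wl.
  case: btc => [ac|btc].
    exists (a :: t); last by rewrite /=; lia.
    have [_ wc] := wb; subst c.
    by split=> //; exists t.
  have [|l3 j3 s3] := IH b _ btc; first by split=> //; exists (c :: t).
  by exists (a :: l3); [exact: joins_cons j3 _|rewrite /= in s3 *; lia].
have [l3 j3 s3] := shorter _ _ jl' btl.
have := swap_equiv_size ll'; rewrite sl => s'.
have : gdist u v <= (size l3).-1.
  apply: gdist_le; exists l3 => //.
  by case: j3 => _ [t [-> _]].
by case: j3 s3 => _ [t [-> _]] /=; lia.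
Qed.

(** Geodesics from [u] to [z] through [v] and through [w] are homotopic and reduced, hence differ by
    swaps alone; [exchange] then yields the square at [z]. *)
Lemma quadrangle u z v w : adj z v -> adj z w -> v <> w ->
  gdist u z = (gdist u v).+1 -> gdist u z = (gdist u w).+1 ->
  exists x, sq z v x w /\ gdist u v = (gdist u x).+1.
Proof.
move=> zv zw vw dv dw.
have [l jl sl] := gdistP u v; have [l' jl' sl'] := gdistP u w.
have j1 := joins_cons jl zv; have j2 := joins_cons jl' zw.
have R1 : reduced sq (z :: l) by apply: geodesic_reduced j1 _; rewrite /= sl dv.
have R2 : reduced sq (z :: l') by apply: geodesic_reduced j2 _; rewrite /= sl' dw.
have e := homotopic_reduced sq_rot sq_rev sq_diag sq_uniq sq_cube
  (simply_connected_graph j1 j2) R1 R2.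
case: (swap_equiv_exchange sq_rot sq_rev sq_uniq sq_cube e) => [ll'|[v' [x [w' [r [s e1 e2]]]]]].
  have [_ [t [el _]]] := jl; have [_ [t' [el' _]]] := jl'; subst l l'.
  by case: vw; exact: swap_equiv_heads ll'.
have ev : v' = v by have [_ [t [el _]]] := jl; subst l; rewrite (swap_equiv_heads e1).
have ew : w' = w by have [_ [t [el _]]] := jl'; subst l'; rewrite (swap_equiv_heads e2).
subst v' w'; exists x; split=> //.
have dx := gdist_adjP u (sq_adj (sq_rot s)).
have lx : last x r = u /\ walk adj (x :: r).
  have W p q : swap_equiv sq p q -> walk adj p -> walk adj q.
    elim=> {q} // q q' _ IH s' /IH; elim: s' => {IH q q'} [a b c d p' s'|a p1 q1 s' IH].
      move=> [_ [_ wc]]; split; first exact: sq_adj (sq_rev s').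
      by split=> //; exact: sq_adj (sq_rot (sq_rev s')).
    by case: s' IH => {p1 q1} [a' b' c' d' p2 s2 IH [ab wp]|a' p2 q2 s2 IH [ab wp]];
      split=> //; exact: IH.
  have La p q : swap_equiv sq p q -> forall y, last y p = last y q.
    elim=> {q} // q q' _ IH s' y; rewrite IH; elim: s' y => {IH q q'} // a p1 q1 _ IH y /=.
    exact: IH.
  have [_ ?] := W _ _ e1 jl.1; split=> //.
  have := La _ _ e1 u; case: jl => _ [t [-> lt]] /=; rewrite lt => ->.
  by [].
have : gdist u x <= size r.
  by apply: gdist_le; exists (x :: r) => //; split; [exact: lx.2|exists r; split=> //; exact: lx.1].
by have := swap_equiv_size e1; rewrite sl /=; lia.
Qed.

Definition nearer a b : set V := [set v | gdist v a < gdist v b].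

Lemma half_compl a b : adj a b -> ~` nearer a b = nearer b a.
Proof.
move=> ab; apply/seteqP; split=> v; rewrite /nearer /=.
  by have := gdist_adjP v ab; lia.
by lia.
Qed.

(** Otherwise [a] and [c] are both nearer to [v] than [b] is. The quadrangle condition at [b] then
    makes the fourth corner [d] nearer to [v] than [a], whereas it is farther. *)
Lemma half_sq_sub a b c d : sq a b c d -> nearer a b `<=` nearer d c.
Proof.
move=> s v; rewrite /nearer /= => ab; rewrite ltnNge; apply/negP => cd.
have dab := gdist_adjP v (sq_adj s); have dbc := gdist_adjP v (sq_adj (sq_rot s)).
have dcd := gdist_adjP v (sq_adj (sq_rot (sq_rot s))).
have dda := gdist_adjP v (sq_adj (sq_rot (sq_rot (sq_rot s)))).
have ac := sq_diag s.
have [x [s1 e]] : exists x, sq b a x c /\ gdist v a = (gdist v x).+1.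
  apply: quadrangle => //; [exact: adjC (sq_adj s)|exact: sq_adj (sq_rot s)|lia|lia].
have ex : x = d.
  apply: (@sq_uniq b a _ _ c) => //; exact: sq_rot (sq_rot (sq_rot (sq_rev s))).
by subst x; lia.
Qed.

Lemma half_sq a b c d : sq a b c d -> nearer a b = nearer d c.
Proof.
move=> s; apply/seteqP; split; first exact: half_sq_sub.
apply: half_sq_sub; exact: sq_rev (sq_rot (sq_rot (sq_rot s))).
Qed.

Definition opp_step (e f : V * V) := sq e.1 e.2 f.2 f.1.

Definition edge_parallel := clos_refl_trans (V * V) opp_step.

Lemma edge_parallel_half e f : edge_parallel e f -> nearer e.1 e.2 = nearer f.1 f.2.
Proof. by elim=> {e f} [e f /half_sq|//|e f g _ -> _ ->]. Qed.

(** Induction on the distance from [p] to [a]: [q] and a neighbour [p'] of [p] on the way to [a] are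
    both nearer to [b] than [p], so the edge slides across a square to an edge starting at [p']. *)
Lemma crossing_edge_parallel a b p q : adj a b -> adj p q -> nearer a b p -> ~ nearer a b q ->
  edge_parallel (a, b) (p, q).
Proof.
move=> ab; have [k ek] : exists k, gdist p a = k by exists (gdist p a).
elim: k p q ek => [|k IH] p q ek pq hp hq.
  have := gdist_eq0 ek => epa; subst p.
  have := gdist_adjP q ab; have := gdist_adjP b pq; have := gdist_adjP a pq.
  move: hq; rewrite /nearer /= !(gdistC q) gdist0 => hq h1 h2 h3.
  have := gdist_adj ab; rewrite gdistC => h4.
  have eqb : gdist b q = 0 by lia.
  by have := gdist_eq0 eqb => ->; exact: rt_refl.
move: hp hq; rewrite /nearer /= => hp hq.
have dp := gdist_adjP p ab; have dq := gdist_adjP q ab.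
have da := gdist_adjP a pq; have db := gdist_adjP b pq.
move: da db; rewrite !(gdistC _ p) !(gdistC _ q) => da db.
have [|p' [pp' dp']] := @step_towards a p; first by move=> e; move: ek; rewrite e gdist0.
have db' := gdist_adjP b pp'; have dap' := gdist_adjP p' ab.
move: db' dp'; rewrite !(gdistC _ p) !(gdistC _ p') => db' dp'.
have [q' [s dq']] : exists x, sq p q x p' /\ gdist b q = (gdist b x).+1.
  apply: quadrangle => //; rewrite ?(gdistC b); [|lia|lia].
  by move=> e; subst q; lia.
have aq' := gdist_adjP q' ab.
have aq2 := gdist_adjP a (sq_adj (sq_rot s)).
move: dq' aq2; rewrite !(gdistC _ q) !(gdistC _ q') => dq' aq2.
have pq' : adj p' q' by exact: sq_adj (sq_rev (sq_rot (sq_rot (sq_rot s)))).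
apply: (@rt_trans _ _ _ (p', q')).
  apply: IH => //; rewrite /nearer /=; lia.
apply: rt_step; exact: sq_rev (sq_rot (sq_rot (sq_rot s))).
Qed.

Definition halfspace (h : set V) := exists a b, adj a b /\ h = nearer a b.

Lemma halfspaceC h : halfspace h -> halfspace (~` h).
Proof. by move=> [a [b [ab ->]]]; exists b, a; rewrite half_compl //; split=> //; exact: adjC. Qed.

Lemma half_edge a b : adj a b -> nearer a b a /\ ~ nearer a b b.
Proof. by move=> ab; rewrite /nearer /= !gdist0; have := gdist_adjP a ab; rewrite gdist0; lia. Qed.

Lemma halfspace_edge h p q : halfspace h -> adj p q -> h p -> ~ h q -> h = nearer p q.
Proof.
move=> [a [b [ab ->]]] pq hp hq.
exact: (edge_parallel_half (crossing_edge_parallel ab pq hp hq)).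
Qed.

(** The wall of the first edge of a shortest path from [m] to [h] separates them. Were some point of
    [h] on the wrong side, the quadrangle condition would produce an edge one step closer to [h]
    with the same defect. *)
Lemma sub_half_towards h m : halfspace h -> ~ h m -> (exists a, h a) ->
  exists m', adj m' m /\ h `<=` nearer m' m.
Proof.
move=> Hh hm [a0 ha0].
have exn x : exists n, `[< exists a, h a /\ gdist x a = n >].
  by exists (gdist x a0); apply/asboolP; exists a0.
pose dh x := ex_minn (exn x).
have dhP x : exists a, h a /\ gdist x a = dh x.
  by rewrite /dh; case: ex_minnP => n /asboolP.
have dh_le x a : h a -> dh x <= gdist x a.
  by move=> ha; rewrite /dh; case: ex_minnP => n _; apply; apply/asboolP; exists a.
have dh0 x : dh x = 0 -> h x.
  by have [a [ha <-]] := dhP x => /gdist_eq0 ->.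
have dh_adj x y : adj x y -> dh x <= (dh y).+1.
  move=> xy; have [a [ha <-]] := dhP y; have := dh_le x a ha.
  by have := gdist_triangle x y a; have := gdist_adj xy; lia.
have desc x : ~ h x -> exists x', adj x' x /\ dh x = (dh x').+1.
  move=> hx; have [a [ha da]] := dhP x.
  have [|x' [xx' dx']] := @step_towards a x; first by move=> e; apply: hx; rewrite -e.
  exists x'; split; first exact: adjC.
  have := dh_le x' a ha; have := dh_adj _ _ xx'.
  by move: dx'; rewrite (gdistC a x) (gdistC a x'); lia.
have G n : forall x x', dh x' = n -> adj x' x -> dh x = n.+1 -> h `<=` nearer x' x.
  elim: n => [|n IH] x x' e' x'x e a ha.
    have hx' : h x' by exact: dh0.
    have hx : ~ h x by move=> hx; have := dh_le x x hx; rewrite gdist0 e.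
    by rewrite -(halfspace_edge Hh x'x hx' hx).
  rewrite /nearer /=; rewrite ltnNge; apply/negP => dxx'.
  have hx' : ~ h x' by move=> hx; have := dh_le x' x' hx; rewrite gdist0 e'.
  have [x2 [x2x' e2]] := desc _ hx'.
  have e2n : dh x2 = n by lia.
  have := IH x' x2 e2n x2x' e' a ha; rewrite /nearer /= => lt2.
  have d1 := gdist_adjP a x'x; have d2 := gdist_adjP a x2x'.
  have [y [s dy]] : exists y, sq x' x y x2 /\ gdist a x = (gdist a y).+1.
    apply: quadrangle => //; [exact: adjC|by move=> ex; subst x2; lia|lia|lia].
  have h1 := dh_adj _ _ (sq_adj (sq_rot s)).
  have h2 := dh_adj _ _ (adjC (sq_adj (sq_rot (sq_rot s)))).
  have h3 := dh_adj _ _ (sq_adj (sq_rot (sq_rot s))).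
  have ey : dh y = n.+1 by lia.
  have := IH y x2 e2n (adjC (sq_adj (sq_rot (sq_rot s)))) ey a ha.
  by rewrite /nearer /=; lia.
have [m' [m'm e]] := desc _ hm.
by exists m'; split=> //; apply: (G (dh m')).
Qed.

(** Minimize the sum of the distances to the three vertices. If [m] is outside a halfspace
    containing two of them, a step towards it shortens two distances and lengthens the third by at
    most 1. *)
Lemma exists_median u v w : exists m, forall h, halfspace h ->
  (h u /\ h v) \/ (h u /\ h w) \/ (h v /\ h w) -> h m.
Proof.
pose S m := gdist u m + gdist v m + gdist w m.
have exn : exists n, `[< exists m, S m = n >] by exists (S u); apply/asboolP; exists u.
case: (ex_minnP exn) => n /asboolP[m Sm] nmin; exists m => h Hh majority.
apply: contrapT => hm.
have [|m' [m'm hsub]] := sub_half_towards Hh hm.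
  by case: majority => [[]|[[]|[]]] *; [exists u|exists u|exists v].
have : n <= S m' by apply: nmin; apply/asboolP; exists m'.
rewrite -Sm /S.
have d1 := gdist_adjP u m'm; have d2 := gdist_adjP v m'm; have d3 := gdist_adjP w m'm.
by case: majority => [[/hsub + /hsub]|[[/hsub + /hsub]|[/hsub + /hsub]]]; rewrite /nearer /=; lia.
Qed.

Lemma halfspaces_separating_finite u v :
  exists s : seq (set V), forall h, halfspace h -> h u -> ~ h v -> List.In h s.
Proof.
have [l jl] := connected_graph u v.
elim: l v jl => [|a [|b t] IH] v [wl [t' [e lt]]] //.
  by case: e lt => <- <- /= ->; exists [::] => h _ ? [].
case: e lt => <- <- /= lt; have [ab wt] := wl.
have [|s Hs] := IH b; first by split=> //; exists t.
exists (nearer b a :: s) => h Hh hu ha /=.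
have [hb|hb] := pselect (h b); last by right; exact: Hs.
by left; rewrite (halfspace_edge Hh (adjC ab)).
Qed.

End Walls.

Import Order.TTheory GRing.Theory Num.Theory.
Local Open Scope ring_scope.

(** * CAT(0) inequality and gluing *)

Section RealInequalities.
Variable R : realFieldType.
Implicit Types a b c x y z r s t : R.

Lemma le_of_small_multiples a b e0 : 0 < e0 ->
  (forall e, 0 < e -> e <= e0 -> 0 <= a + e * b) -> 0 <= a.
Proof.
move=> e00 H; rewrite leNgt; apply/negP => a0.
pose e := Num.min e0 (- a / (2 * (`|b| + 1))).
have b1 : 0 < 2 * (`|b| + 1) :> R by have := normr_ge0 b; lra.
have pe : 0 < e by rewrite lt_min e00 /= divr_gt0 // oppr_gt0.
have ee : e <= e0 by rewrite ge_min lexx.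
have := H e pe ee.
have : e * (2 * (`|b| + 1)) <= - a.
  by rewrite -ler_pdivlMr // ge_min lexx orbT.
have := ler_norm b; have := normr_ge0 b; nra.
Qed.

Lemma sqrD_le_div x y t : 0 < t -> t < 1 -> (x + y) ^+ 2 <= x ^+ 2 / t + y ^+ 2 / (1 - t).
Proof.
move=> t0 t1; have t1' : 0 < 1 - t by lra.
rewrite -subr_ge0.
have -> : x ^+ 2 / t + y ^+ 2 / (1 - t) - (x + y) ^+ 2 =
    ((1 - t) * x - t * y) ^+ 2 / (t * (1 - t)).
  by field; rewrite !gt_eqF.
by rewrite divr_ge0 ?sqr_ge0 // ltW // mulr_gt0.
Qed.

(** Tangent to the square root at [t ^+ 2]: converts bounds on squared distances into bounds on
    distances that are exact when [x = t]. *)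
Lemma le_tangent x t : 0 < t -> x <= (x ^+ 2 / t + t) / 2.
Proof.
move=> t0; rewrite -subr_ge0.
have -> : (x ^+ 2 / t + t) / 2 - x = (x - t) ^+ 2 / (2 * t).
  by field; rewrite gt_eqF.
by rewrite divr_ge0 ?sqr_ge0 //; lra.
Qed.

(* Two comparison triangles glued along [xe]; with this choice of the division ratios the length [xe] drops out. *)
Lemma glued_triangles (zx xy ze ey xe zp yp px pw zw r s : R) :
  0 < ze -> 0 < ey -> 0 < r -> r < 1 -> 0 <= zp -> 0 <= pw -> 0 <= zw -> 0 <= px ->
  s = r * (ze + ey) / (r * ey + ze) ->
  zp ^+ 2 <= (1 - s) * zx ^+ 2 + s * ze ^+ 2 - s * (1 - s) * xe ^+ 2 ->
  yp ^+ 2 <= (1 - s) * xy ^+ 2 + s * ey ^+ 2 - s * (1 - s) * xe ^+ 2 ->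
  px ^+ 2 <= s ^+ 2 * xe ^+ 2 ->
  pw ^+ 2 <= (1 - r) * px ^+ 2 + r * yp ^+ 2 - r * (1 - r) * xy ^+ 2 ->
  zw <= zp + pw ->
  zw ^+ 2 <= (1 - r) * zx ^+ 2 + r * (ze + ey) ^+ 2 - r * (1 - r) * xy ^+ 2.
Proof.
move=> ze0 ey0 r0 r1 zp0 pw0 zw0 px0 es Hzp Hyp Hpx Hpw Hzw.
pose D := r * ey + ze; pose t := ze / D.
have D0 : 0 < D by rewrite /D; nra.
have t0 : 0 < t by rewrite divr_gt0.
have t1 : t < 1 by rewrite ltr_pdivrMr // /D; nra.
have zwle : zw ^+ 2 <= (zp + pw) ^+ 2 by rewrite ler_sqr ?nnegrE ?addr_ge0.
apply: (le_trans zwle); apply: (le_trans (sqrD_le_div zp pw t0 t1)).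
set F := (1 - s) * zx ^+ 2 + s * ze ^+ 2 - s * (1 - s) * xe ^+ 2 in Hzp.
set Y := (1 - s) * xy ^+ 2 + s * ey ^+ 2 - s * (1 - s) * xe ^+ 2 in Hyp.
have HG : pw ^+ 2 <= (1 - r) * (s ^+ 2 * xe ^+ 2) + r * Y - r * (1 - r) * xy ^+ 2.
  by nra.
apply: (@le_trans _ _ (F / t + ((1 - r) * (s ^+ 2 * xe ^+ 2) + r * Y - r * (1 - r) * xy ^+ 2) / (1 - t))).
  by apply: lerD; apply: ler_wpM2r => //; rewrite invr_ge0; lra.
rewrite le_eqVlt; apply/orP; left; apply/eqP.
rewrite /F /Y /t es /D.
field.
by rewrite !gt_eqF //; nra.
Qed.

End RealInequalities.

Section Gluing.
Variables (R : realFieldType) (T : Type) (d : T -> T -> R).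
Hypothesis d_ge0 : forall x y, 0 <= d x y.
Hypothesis dxx : forall x, d x x = 0.
Hypothesis dC : forall x y, d x y = d y x.
Hypothesis d_triangle : forall x y z, d x z <= d x y + d y z.

(* The CAT(0) inequality of Bruhat and Tits for the point [m] dividing [x, y] in the ratio [r : 1 - r]. *)
Definition stewart z x y r m :=
  d z m ^+ 2 <= (1 - r) * d z x ^+ 2 + r * d z y ^+ 2 - r * (1 - r) * d x y ^+ 2.

Definition cat0_on (A : set T) := forall x y, A x -> A y -> forall r, 0 <= r <= 1 ->
  exists2 m, A m & forall z, A z -> stewart z x y r m.

Lemma d0_eq p q z : d p q = 0 -> d z p = d z q.
Proof.
move=> e; have := d_triangle z p q; have := d_triangle z q p.
by rewrite (dC q p) e => ? ?; apply/eqP; rewrite eq_le; apply/andP; split; lra.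
Qed.

Lemma d_sqr0 p q : d p q ^+ 2 <= 0 -> d p q = 0.
Proof. by move=> h; apply/eqP; rewrite -sqrf_eq0 eq_le h sqr_ge0. Qed.

Lemma stewart_sym z x y r m : stewart z x y r m -> stewart z y x (1 - r) m.
Proof. by rewrite /stewart (dC y x) => h; lra. Qed.

Lemma stewart_left x y r m : 0 <= r <= 1 -> stewart x x y r m -> d x m <= r * d x y.
Proof.
rewrite /stewart dxx => /andP[r0 r1] h.
rewrite -(@ler_sqr R) ?nnegrE ?mulr_ge0 //; apply: (le_trans h); nra.
Qed.

Lemma stewart_right x y r m : 0 <= r <= 1 -> stewart y x y r m -> d y m <= (1 - r) * d x y.
Proof.
move=> /andP[r0 r1] /stewart_sym; rewrite (dC x y); apply: stewart_left.
by apply/andP; split; lra.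
Qed.

Lemma stewart_unique x y r m m' : 0 <= r <= 1 -> stewart m' x y r m ->
  d x m' <= r * d x y -> d y m' <= (1 - r) * d x y -> d m m' = 0.
Proof.
move=> /andP[r0 r1] h h1 h2; rewrite dC; apply: d_sqr0; apply: (le_trans h).
rewrite (dC m' x) (dC m' y).
have := d_ge0 x m'; have := d_ge0 y m'; have D0 := d_ge0 x y => a1 a2.
have e1 : d x m' ^+ 2 <= r ^+ 2 * d x y ^+ 2.
  by rewrite -exprMn ler_sqr ?nnegrE // mulr_ge0.
have e2 : d y m' ^+ 2 <= (1 - r) ^+ 2 * d x y ^+ 2.
  by rewrite -exprMn ler_sqr ?nnegrE // mulr_ge0 //; lra.
nra.
Qed.

Lemma stewart_d0 z z' x y r m : d z z' = 0 -> stewart z x y r m -> stewart z' x y r m.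
Proof.
by move=> e; rewrite /stewart !(dC z) !(dC z') -!(d0_eq _ e).
Qed.

Lemma stewart_d0m z x y r m m' : d m m' = 0 -> stewart z x y r m -> stewart z x y r m'.
Proof. by move=> e; rewrite /stewart (d0_eq z e). Qed.

(** Any point realizing equality in the triangle inequality is at distance 0 from the dividing
    point, by [stewart_unique]. Denominators are cleared so that degenerate segments fit the same
    formula. *)
Lemma between_stewart A x y c z : cat0_on A -> A x -> A y -> A c -> A z ->
  d x c + d c y = d x y ->
  (d x c + d c y) * d z c ^+ 2 <=
  d c y * d z x ^+ 2 + d x c * d z y ^+ 2 - d x c * d c y * (d x c + d c y).
Proof.
move=> gA Ax Ay Ac Az e; have a0 := d_ge0 x c; have b0 := d_ge0 c y.
have [ab0|abn] := eqVneq (d x c + d c y) 0.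
  have a00 : d x c = 0 by lra.
  have b00 : d c y = 0 by lra.
  by rewrite a00 b00; lra.
have ab0 : 0 < d x c + d c y by rewrite lt_def abn addr_ge0.
pose r := d x c / (d x c + d c y).
have r01 : 0 <= r <= 1.
  by rewrite divr_ge0 ?addr_ge0 //= ler_pdivrMr // mul1r lerDl.
have rE : r * (d x c + d c y) = d x c by rewrite /r divfK.
have [m Am Hm] := gA x y Ax Ay r r01.
have mc : d m c = 0.
  apply: (stewart_unique r01 (Hm c Ac)); rewrite -e ?rE //.
  by rewrite dC mulrBl mul1r rE; lra.
have := stewart_d0m mc (Hm z Az); rewrite /stewart -e => H.
have := ler_wpM2l (ltW ab0) H.
set zc := d z c; set zx := d z x; set zy := d z y.
move: rE; set a := d x c; set b := d c y; move: r {r01 Hm H mc} => r rE H.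
have e1 : (a + b) * ((1 - r) * zx ^+ 2 + r * zy ^+ 2 - r * (1 - r) * (a + b) ^+ 2) =
  (a + b - r * (a + b)) * zx ^+ 2 + (r * (a + b)) * zy ^+ 2 -
  (r * (a + b)) * (a + b - r * (a + b)) * (a + b) by ring.
by move: H; rewrite e1 rE; lra.
Qed.

Variables (A B C : set T).
Hypothesis CA : C `<=` A.
Hypothesis CB : C `<=` B.
Hypothesis gA : cat0_on A.
Hypothesis gB : cat0_on B.
Hypothesis gC : cat0_on C.
Hypothesis cross : forall a b, A a -> B b -> exists2 c, C c & d a c + d c b = d a b.

Lemma cat0_on_common x y r : C x -> C y -> 0 <= r <= 1 ->
  exists2 m, C m & forall z, (A `|` B) z -> stewart z x y r m.
Proof.
move=> Cx Cy r01; have [m Cm Hm] := gC Cx Cy r01; exists m => //.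
have lm := stewart_left r01 (Hm x Cx); have rm := stewart_right r01 (Hm y Cy).
have [mA AmA HA] := gA (CA Cx) (CA Cy) r01; have [mB BmB HB] := gB (CB Cx) (CB Cy) r01.
have eA := stewart_unique r01 (HA m (CA Cm)) lm rm.
have eB := stewart_unique r01 (HB m (CB Cm)) lm rm.
by move=> z [/HA/(stewart_d0m eA)|/HB/(stewart_d0m eB)].
Qed.

(** The triangle [z], [x], [y] is cut along the segment from [x] to [e], with [e] in [C] on the way
    from [z] to [y]; the inequalities for [z] and for [y] on that segment combine by
    [glued_triangles]. *)
Lemma stewart_across_aux z x y e r m : A z -> B x -> B y -> C e ->
  d z e + d e y = d z y ->
  (forall s, 0 <= s <= 1 -> exists p, [/\ B p, forall z', B z' -> stewart z' x e s p &
     stewart z x e s p]) ->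
  0 <= r <= 1 -> B m -> (forall z', B z' -> stewart z' x y r m) -> stewart z x y r m.
Proof.
move=> Az Bx By Ce ze Hx r01 Bm Hm.
have Be := CB Ce; have /andP[r0 r1] := r01.
have xm := stewart_left r01 (Hm x Bx); have ym := stewart_right r01 (Hm y By).
have [z0|zn] := eqVneq (d z e) 0.
  by apply: (stewart_d0 _ (Hm e Be)); rewrite dC.
have [y0|yn] := eqVneq (d e y) 0.
  have [p [Bp Hp Hzp]] := Hx r r01.
  have xe : d x e = d x y by exact: d0_eq.
  have pm : d p m = 0.
    apply: (stewart_unique r01 (Hp m Bm)); first by rewrite xe.
    by rewrite xe (dC e m) (d0_eq m y0) dC.
  apply: (stewart_d0m pm); move: Hzp.
  by rewrite /stewart xe (d0_eq z y0).
have [re0|rn0] := eqVneq r 0.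
  move: xm; rewrite re0 mul0r => xm.
  have x0 : d x m = 0 by apply/eqP; rewrite eq_le xm d_ge0.
  by rewrite /stewart -(d0_eq z x0); lra.
have [re1|rn1] := eqVneq r 1.
  move: ym; rewrite re1 subrr mul0r => ym.
  have y0 : d y m = 0 by apply/eqP; rewrite eq_le ym d_ge0.
  by rewrite /stewart -(d0_eq z y0); lra.
have ze0 : 0 < d z e by rewrite lt_def zn d_ge0.
have ey0 : 0 < d e y by rewrite lt_def yn d_ge0.
have r0' : 0 < r by rewrite lt_def rn0.
have r1' : r < 1 by rewrite lt_def eq_sym rn1.
pose s := r * (d z e + d e y) / (r * d e y + d z e).
have D0 : 0 < r * d e y + d z e by nra.
have s01 : 0 <= s <= 1.
  apply/andP; split; first by apply: divr_ge0; [apply: mulr_ge0 => //; exact: addr_ge0|exact: ltW].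
  by rewrite /s ler_pdivrMr // mul1r; nra.
have [p [Bp Hp Hzp]] := Hx s s01; have s0 : 0 <= s by case/andP: s01.
have px := stewart_left s01 (Hp x Bx).
rewrite /stewart -ze.
apply: (@glued_triangles R (d z x) (d x y) (d z e) (d e y) (d x e) (d z p) (d y p)
  (d p x) (d p m) (d z m) r s) => //.
- by move: (Hp y By); rewrite /stewart (dC y x) (dC y e).
- by rewrite -exprMn ler_sqr ?nnegrE //; [rewrite dC|exact: mulr_ge0].
- by move: (Hm p Bp); rewrite /stewart (dC p y).
Qed.

(** Two cuts: along the segment from [x] to [e], then along the one from [e] to [e']. The latter has
    both ends in [C], where [cat0_on_common] applies. *)
Lemma stewart_across z x y r m : A z -> B x -> B y -> 0 <= r <= 1 -> B m ->
  (forall z', B z' -> stewart z' x y r m) -> stewart z x y r m.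
Proof.
move=> Az Bx By r01 Bm Hm.
have [e Ce ze] := cross Az By; have [e' Ce' ze'] := cross Az Bx.
apply: (stewart_across_aux Az Bx By Ce ze) => // s s01.
have s01' : 0 <= 1 - s <= 1 by case/andP: s01 => ? ?; apply/andP; split; lra.
have [p Bp Hp] := gB Bx (CB Ce) s01; exists p; split=> //.
have E (z' : T) : stewart z' e x (1 - s) p -> stewart z' x e s p.
  by move/stewart_sym; rewrite opprB addrC subrK.
apply: E; apply: (stewart_across_aux Az (CB Ce) Bx Ce' ze') => //; last first.
  by move=> z' Bz'; apply: stewart_sym; exact: Hp.
move=> t t01; have [q Cq Hq] := cat0_on_common Ce Ce' t01.
exists q; split; [exact: CB|by move=> z' Bz'; apply: Hq; right|by apply: Hq; left].
Qed.

(** A first variation argument: moving the crossing point [c] slightly within [C], or leaving it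
    towards [z], cannot shorten the path from [x] to [y]. *)
Lemma between_across x y c z : A x -> B y -> C c -> A z ->
  d x c + d c y = d x y ->
  (d x c + d c y) * d z c ^+ 2 <=
  d c y * d z x ^+ 2 + d x c * d z y ^+ 2 - d x c * d c y * (d x c + d c y).
Proof.
move=> Ax By Cc Az e; have Ac := CA Cc; have a0 := d_ge0 x c; have b0 := d_ge0 c y.
have [ae|an] := eqVneq (d x c) 0.
  by rewrite ae (d0_eq z ae); lra.
have [be|bn] := eqVneq (d c y) 0.
  by rewrite be (d0_eq z be); lra.
have [f Cf zf] := cross Az By.
have [ye|yn] := eqVneq (d f y) 0.
  have := @between_stewart A x f c z gA Ax (CA Cf) Ac Az.
  by rewrite !(d0_eq _ ye) => /(_ e).
have ap : 0 < d x c by rewrite lt_def an.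
have bp : 0 < d c y by rewrite lt_def bn.
have bep : 0 < d f y by rewrite lt_def yn d_ge0.
(* By the law of cosines this says that the comparison angles at [c], from [z] to [x] and from [z]
   to [y], add up to at least pi. *)
suff key : 0 <= (d z x ^+ 2 - d x c ^+ 2 - d z c ^+ 2) / d x c +
                (d z y ^+ 2 - d c y ^+ 2 - d z c ^+ 2) / d c y.
  have := mulr_ge0 (ltW (mulr_gt0 ap bp)) key.
  have -> : d x c * d c y * ((d z x ^+ 2 - d x c ^+ 2 - d z c ^+ 2) / d x c +
                (d z y ^+ 2 - d c y ^+ 2 - d z c ^+ 2) / d c y) =
     d c y * (d z x ^+ 2 - d x c ^+ 2 - d z c ^+ 2) +
     d x c * (d z y ^+ 2 - d c y ^+ 2 - d z c ^+ 2).
    by field; rewrite !gt_eqF.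
  by lra.
have iap : 0 < (d x c)^-1 by rewrite invr_gt0.
have ibp : 0 < (d c y)^-1 by rewrite invr_gt0.
have short (q p : T) : d x c + d c y <= d x q + d q p + d p y.
  by rewrite e; have := d_triangle x q y; have := d_triangle q p y; lra.
have [ze|zn] := eqVneq (d z f) 0.
  have zd w : d z w = d f w by rewrite !(dC _ w); exact: d0_eq.
  rewrite !zd.
  apply: (@le_of_small_multiples _ _ (d f c ^+ 2 / d x c + d f c ^+ 2 / d c y) 1) => // s s0 s1.
  have s01 : 0 <= s <= 1 by rewrite (ltW s0).
  have [p Cp Hp] := cat0_on_common Cc Cf s01.
  have Hx : stewart x c f s p by apply: Hp; left.
  have Hy : stewart y c f s p by apply: Hp; right.
  have := short p p; rewrite dxx addr0.
  have := le_tangent (d x p) ap; have := le_tangent (d p y) bp.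
  move: Hx Hy; rewrite /stewart (dC y p) (dC y c) (dC y f) (dC f x) (dC c f) => Hx Hy.
  have Hx' := ler_wpM2r (ltW iap) Hx; have Hy' := ler_wpM2r (ltW ibp) Hy.
  move=> t1 t2 t3; rewrite -(pmulr_rge0 _ s0).
  have e1 : ((1 - s) * d x c ^+ 2 + s * d x f ^+ 2 - s * (1 - s) * d f c ^+ 2) / d x c =
     d x c + s * ((d x f ^+ 2 - d x c ^+ 2 - d f c ^+ 2) / d x c + s * (d f c ^+ 2 / d x c)).
    by field; rewrite gt_eqF.
  have e2 : ((1 - s) * d c y ^+ 2 + s * d f y ^+ 2 - s * (1 - s) * d f c ^+ 2) / d c y =
     d c y + s * ((d f y ^+ 2 - d c y ^+ 2 - d f c ^+ 2) / d c y + s * (d f c ^+ 2 / d c y)).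
    by field; rewrite gt_eqF.
  by move: Hx' Hy'; rewrite e1 e2; lra.
have zp : 0 < d z f by rewrite lt_def zn d_ge0.
(* In the flat picture with [f] between [z] and [y], let [q] divide [[c, z]] in ratio [ep] and [p]
   divide [[c, f]] in ratio [ep * sg]. This [sg] makes [[q, p]] parallel to [[c, y]], and its length
   is then [ep * ka]. *)
pose sg := (d z f + d f y) / d f y; pose ka := d z f * d c y / d f y.
have sg0 : 0 < sg by rewrite divr_gt0 ?addr_gt0.
have ka0 : 0 < ka by rewrite divr_gt0 ?mulr_gt0.
pose Q := (sg ^+ 2 - sg) * d c f ^+ 2 + (1 - sg) * d z c ^+ 2 + sg * d z f ^+ 2.
have -> : (d z x ^+ 2 - d x c ^+ 2 - d z c ^+ 2) / d x c +
          (d z y ^+ 2 - d c y ^+ 2 - d z c ^+ 2) / d c y =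
   ka + (d z x ^+ 2 - d x c ^+ 2 - d z c ^+ 2) / d x c +
    sg * ((d f y ^+ 2 - d c y ^+ 2 - d c f ^+ 2) / d c y) + Q / ka.
  by rewrite -zf /Q /ka /sg; field; rewrite !gt_eqF.
apply: (@le_of_small_multiples _ _ (d z c ^+ 2 / d x c + sg ^+ 2 * (d c f ^+ 2 / d c y))
  (d f y / (d z f + d f y))); first by rewrite divr_gt0 ?addr_gt0.
move=> ep ep0 epe.
have s1 : ep * sg <= 1.
  move: epe; rewrite ler_pdivlMr ?addr_gt0 // /sg mulrA => h.
  by rewrite ler_pdivrMr // mul1r.
have s01 : 0 <= ep * sg <= 1 by rewrite (mulr_ge0 (ltW ep0) (ltW sg0)) s1.
have e1 : ep <= 1.
  by apply: (le_trans _ s1); rewrite ler_peMr ?(ltW ep0) // /sg ler_pdivlMr // mul1r lerDr ltW.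
have e01 : 0 <= ep <= 1 by rewrite (ltW ep0) e1.
have [p Cp Hp] := cat0_on_common Cc Cf s01.
have [q Aq Hq] := gA Ac Az e01.
have Hxq := Hq x Ax; have Hpq := Hq p (CA Cp).
have Hyp : stewart y c f (ep * sg) p by apply: Hp; right.
have Hzp : stewart z c f (ep * sg) p by apply: Hp; left.
have Hcp : stewart c c f (ep * sg) p by apply: Hp; left.
move: Hxq Hpq Hyp Hzp Hcp; rewrite /stewart dxx (dC y p) (dC y c) (dC y f) (dC x z) (dC c z) (dC p z) (dC p c).
set s := ep * sg in s1 s01 *; move=> Hxq Hpq Hyp Hzp Hcp.
have Hpq' : d p q ^+ 2 <= (s ^+ 2 - ep * s) * d c f ^+ 2 + (ep ^+ 2 - ep * s) * d z c ^+ 2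
     + ep * s * d z f ^+ 2.
  apply: (le_trans Hpq).
  have e1' : 0 <= 1 - ep by lra.
  have := ler_wpM2l e1' Hcp; have := ler_wpM2l (ltW ep0) Hzp; lra.
have EQ : (s ^+ 2 - ep * s) * d c f ^+ 2 + (ep ^+ 2 - ep * s) * d z c ^+ 2
     + ep * s * d z f ^+ 2 = ep ^+ 2 * Q by rewrite /s /Q; ring.
rewrite EQ in Hpq'.
have eka : 0 < ep * ka by rewrite mulr_gt0.
have := short q p; have := le_tangent (d x q) ap; have := le_tangent (d p y) bp.
have := le_tangent (d q p) eka.
have Hx' := ler_wpM2r (ltW iap) Hxq; have Hy' := ler_wpM2r (ltW ibp) Hyp.
have iek : 0 < (ep * ka)^-1 by rewrite invr_gt0.
have Hk' := ler_wpM2r (ltW iek) Hpq'.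
rewrite (dC q p) => t0 t1 t2 t3; rewrite -(pmulr_rge0 _ ep0).
have e3 : ((1 - ep) * d x c ^+ 2 + ep * d z x ^+ 2 - ep * (1 - ep) * d z c ^+ 2) / d x c =
   d x c + ep * ((d z x ^+ 2 - d x c ^+ 2 - d z c ^+ 2) / d x c + ep * (d z c ^+ 2 / d x c)).
  by field; rewrite gt_eqF.
have e4 : ((1 - s) * d c y ^+ 2 + s * d f y ^+ 2 - s * (1 - s) * d c f ^+ 2) / d c y =
   d c y + ep * (sg * ((d f y ^+ 2 - d c y ^+ 2 - d c f ^+ 2) / d c y) + ep * (sg ^+ 2 * (d c f ^+ 2 / d c y))).
  by rewrite /s; field; rewrite gt_eqF.
have e5 : ep ^+ 2 * Q / (ep * ka) = ep * (Q / ka).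
  by field; rewrite !gt_eqF.
by move: Hx' Hy' Hk'; rewrite e3 e4 e5; lra.
Qed.

End Gluing.

Section GluingTheorem.
Variables (R : realFieldType) (T : Type) (d : T -> T -> R).
Hypothesis d_ge0 : forall x y, 0 <= d x y.
Hypothesis dxx : forall x, d x x = 0.
Hypothesis dC : forall x y, d x y = d y x.
Hypothesis d_triangle : forall x y z, d x z <= d x y + d y z.

Definition crosses_at (A B C : set T) :=
  forall a b, A a -> B b -> exists2 c, C c & d a c + d c b = d a b.

Lemma crosses_atC A B C : crosses_at A B C -> crosses_at B A C.
Proof.
move=> cr b a Bb Aa; have [c Cc e] := cr a b Aa Bb.
by exists c => //; rewrite (dC b c) (dC c a) (dC b a) -e addrC.
Qed.

(** The dividing point lies on the part from [x] to [c]. Its inequality on that part, at the ratio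
    [s], is combined with the inequality at [c] given by [between_across]. *)
Lemma glued_midpoint A B C x y c r : C `<=` A -> C `<=` B ->
  cat0_on d A -> cat0_on d B -> cat0_on d C -> crosses_at A B C ->
  A x -> B y -> C c -> d x c + d c y = d x y -> 0 <= r <= 1 -> r * d x y <= d x c ->
  exists2 m, A m & forall z, (A `|` B) z -> stewart d z x y r m.
Proof.
move=> CA CB gA gB gC cr Ax By Cc e r01 rle.
have /andP[r0 r1] := r01.
have [l0|ln] := eqVneq (d x y) 0.
  exists x => // z _; rewrite /stewart l0 -(d0_eq dC d_triangle z l0); lra.
have lp : 0 < d x y by rewrite lt_def ln d_ge0.
have [a0|an] := eqVneq (d x c) 0.
  have r00 : r = 0.
    by move: rle; rewrite a0 pmulr_lle0 // => r00; apply/eqP; rewrite eq_le r00 r0.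
  by exists x => // z _; rewrite /stewart r00; lra.
have ap : 0 < d x c by rewrite lt_def an d_ge0.
pose s := r * d x y / d x c.
have s01 : 0 <= s <= 1.
  apply/andP; split; first by apply: divr_ge0 => //; exact: mulr_ge0.
  by rewrite ler_pdivrMr // mul1r.
have sE : s * d x c = r * d x y by rewrite /s divfK.
have [m Am Hm] := gA x c Ax (CA _ Cc) s s01.
exists m => // z ABz.
have St : stewart d z x c s m.
  case: ABz => [/Hm//|Bz].
  apply: (stewart_across d_ge0 dxx dC d_triangle CB CA gB gA gC (crosses_atC cr)) => //.
  exact: CA.
have V : (d x c + d c y) * d z c ^+ 2 <=
  d c y * d z x ^+ 2 + d x c * d z y ^+ 2 - d x c * d c y * (d x c + d c y).
  case: ABz => [Az|Bz].
    exact: (between_across d_ge0 dxx dC d_triangle CA CB gA gB gC cr).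
  have := between_across d_ge0 dxx dC d_triangle CB CA gB gA gC (crosses_atC cr) By Ax Cc Bz.
  rewrite (dC y c) (dC c x) (dC y x) addrC => /(_ e); lra.
move: St; rewrite /stewart => St; apply: (le_trans St).
rewrite -subr_ge0; rewrite -(pmulr_rge0 _ lp).
move: V; rewrite e => V.
have := ler_wpM2l (proj1 (andP s01)) V.
have rE : r * d x y = s * d x c by [].
have b1 : d c y = d x y - d x c by lra.
rewrite b1.
have -> : d x y * ((1 - r) * d z x ^+ 2 + r * d z y ^+ 2 - r * (1 - r) * d x y ^+ 2 -
   ((1 - s) * d z x ^+ 2 + s * d z c ^+ 2 - s * (1 - s) * d x c ^+ 2)) =
   (d x y - r * d x y) * d z x ^+ 2 + (r * d x y) * d z y ^+ 2
    - (r * d x y) * (d x y - r * d x y) * d x y - d x y * (1 - s) * d z x ^+ 2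
    - s * (d x y * d z c ^+ 2) + d x y * (s * d x c) * (d x c - s * d x c) by ring.
rewrite rE; lra.
Qed.

(** A form of Reshetnyak's gluing theorem; the ends lie in the same piece ([same]) or in different
    pieces ([mixed]). *)
Lemma cat0_on_glue A B C : C `<=` A -> C `<=` B ->
  cat0_on d A -> cat0_on d B -> cat0_on d C -> crosses_at A B C ->
  cat0_on d (A `|` B).
Proof.
move=> CA CB gA gB gC cr.
have same A' B' : C `<=` A' -> C `<=` B' -> cat0_on d A' -> cat0_on d B' ->
    crosses_at A' B' C -> forall x y, A' x -> A' y -> forall r, 0 <= r <= 1 ->
    exists2 m, (A' `|` B') m & forall z, (A' `|` B') z -> stewart d z x y r m.
  move=> CA' CB' gA' gB' cr' x y Ax Ay r r01.
  have [m Am Hm] := gA' x y Ax Ay r r01; exists m; first by left.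
  move=> z [/Hm//|Bz].
  exact: (stewart_across d_ge0 dxx dC d_triangle CB' CA' gB' gA' gC (crosses_atC cr')).
have mixed A' B' : C `<=` A' -> C `<=` B' -> cat0_on d A' -> cat0_on d B' ->
    crosses_at A' B' C -> forall x y, A' x -> B' y -> forall r, 0 <= r <= 1 ->
    exists2 m, (A' `|` B') m & forall z, (A' `|` B') z -> stewart d z x y r m.
  move=> CA' CB' gA' gB' cr' x y Ax By r r01.
  have [c Cc e] := cr' x y Ax By.
  have [le|lt] := leP (r * d x y) (d x c).
    have [m Am Hm] := glued_midpoint CA' CB' gA' gB' gC cr' Ax By Cc e r01 le.
    by exists m => //; left.
  have e' : d y c + d c x = d y x by rewrite (dC y c) (dC c x) (dC y x) -e addrC.
  have r01' : 0 <= 1 - r <= 1 by case/andP: r01 => ? ?; apply/andP; split; lra.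
  have le' : (1 - r) * d y x <= d y c by rewrite (dC y x) (dC y c); lra.
  have [m Bm Hm] := glued_midpoint CB' CA' gB' gA' gC (crosses_atC cr') By Ax Cc e' r01' le'.
  exists m; first by right.
  move=> z ABz; have := stewart_sym dC (Hm z (proj1 (or_comm _ _) ABz)).
  by rewrite opprB addrC subrK.
move=> x y [Ax|Bx] [Ay|By] r r01.
- exact: same.
- exact: mixed.
- by rewrite setUC; apply: (mixed B A) => //; exact: crosses_atC.
- by rewrite setUC; apply: (same B A) => //; exact: crosses_atC.
Qed.

End GluingTheorem.

(** * Completeness and exact crossing points *)

Section CauchyReal.
Variable R : realType.

(** The limit is the supremum of the eventual lower bounds; any Cauchy estimate at [n] passes to it
    with the same constant. *)
Lemma cauchy_limit (v : nat -> R) :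
  (forall e, 0 < e -> exists n, forall m, (n <= m)%N -> `|v m - v n| <= e) ->
  exists l, forall e n, (forall m, (n <= m)%N -> `|v m - v n| <= e) -> `|v n - l| <= e.
Proof.
move=> cv; pose S := [set t | exists n, forall m, (n <= m)%N -> t <= v m].
have ubS n e : (forall m, (n <= m)%N -> `|v m - v n| <= e) -> ubound S (v n + e).
  move=> H t [k Hk]; have := Hk _ (leq_maxr n k); have := H _ (leq_maxl n k).
  by rewrite ler_norml => /andP[_]; lra.
have inS n e : (forall m, (n <= m)%N -> `|v m - v n| <= e) -> S (v n - e).
  by move=> H; exists n => m /H; rewrite ler_norml => /andP[]; lra.
have [n0 H0] := cv 1 ltr01.
have hS : has_sup S by split; [exists (v n0 - 1); exact: inS|exists (v n0 + 1); exact: ubS].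
exists (sup S) => e n H.
have h1 : v n - e <= sup S by apply: (sup_upper_bound hS); exact: inS.
have h2 : sup S <= v n + e by apply: ge_sup; [case: hS|exact: ubS].
by rewrite ler_norml; lra.
Qed.

End CauchyReal.

Section ExactCrossing.
Variables (R : realType) (T : Type) (d : T -> T -> R).
Hypothesis d_ge0 : forall x y, 0 <= d x y.
Hypothesis dC : forall x y, d x y = d y x.
Hypothesis d_triangle : forall x y z, d x z <= d x y + d y z.

Definition cauchy_seq (u : nat -> T) :=
  forall e, 0 < e -> exists n, forall m k, (n <= m)%N -> (n <= k)%N -> d (u m) (u k) <= e.

Definition complete_on (C : set T) := forall u, (forall n, C (u n)) -> cauchy_seq u ->
  exists2 x, C x & forall e, 0 < e -> exists n, forall m, (n <= m)%N -> d (u m) x <= e.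

(* A minimizing sequence along which d(a, c_n) also converges is Cauchy, by uniform convexity. *)
Lemma exact_crossing (C : set T) a b : complete_on C ->
  (forall x y, C x -> C y -> exists2 m, C m &
     stewart d a x y 2^-1 m /\ stewart d b x y 2^-1 m) ->
  (forall e, 0 < e -> exists2 c, C c & d a c + d c b <= d a b + e) ->
  exists2 c, C c & d a c + d c b = d a b.
Proof.
move=> cC mid near; pose L := d a b.
(* [sup S] is the lower limit of [d a c] over almost minimizing [c]. Fixing this value matters: when
   [C] contains a segment of the geodesic from [a] to [b], minimizers are not unique. *)
pose S := [set t | exists2 e, 0 < e & forall c, C c -> d a c + d c b <= L + e -> t <= d a c].
have S0 : S 0 by exists 1.
have hS : has_sup S.
  split; first by exists 0.
  exists (L + 1) => t [e e0 He]; have m0 : 0 < Num.min e 1 by rewrite lt_min e0 /=.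
  have [c Cc Hc] := near _ m0.
  have h1 : Num.min e 1 <= e by rewrite ge_min lexx.
  have h2 : Num.min e 1 <= 1 by rewrite ge_min lexx orbT.
  have := He c Cc; have := d_ge0 c b; rewrite -/L in Hc *; lra.
pose al := sup S.
have al0 : 0 <= al by exact: (sup_upper_bound hS).
have low e : 0 < e -> exists2 e0, 0 < e0 & forall c, C c -> d a c + d c b <= L + e0 ->
    al - e <= d a c.
  move=> e0; have [t [e1 e10 H] lt] := sup_adherent e0 hS.
  by exists e1 => // c Cc /(H c Cc); rewrite /al; lra.
have up e f : 0 < e -> 0 < f -> exists2 c, C c & d a c + d c b <= L + e /\ d a c <= al + f.
  move=> e0 f0; apply: contrapT => no.
  have : S (al + f).
    exists e => // c Cc Hc; rewrite leNgt; apply/negP => lt; apply: no.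
    by exists c => //; split=> //; exact: ltW.
  by move/(sup_upper_bound hS); rewrite -/al; lra.
have sq n : exists c, [/\ C c, d a c + d c b <= L + n.+1%:R^-1 & `|d a c - al| <= n.+1%:R^-1].
  have n0 : 0 < n.+1%:R^-1 :> R by rewrite invr_gt0.
  have [e0 e00 He0] := low _ n0.
  have m0 : 0 < Num.min e0 n.+1%:R^-1 by rewrite lt_min e00 n0.
  have [c Cc [Hc1 Hc2]] := up _ _ m0 n0; exists c; split=> //.
    by apply: (le_trans Hc1); rewrite lerD2l ge_min lexx orbT.
  rewrite ler_norml; have := He0 c Cc.
  have -> : d a c + d c b <= L + e0 by apply: (le_trans Hc1); rewrite lerD2l ge_min lexx.
  move=> /(_ isT); move: (n.+1%:R^-1) Hc2 => t; lra.
have {sq}[u Hu] := choice sq.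
have [n|e|c Cc Hc] := cC u; first by case: (Hu n).
  move=> e0; pose K := 4 * (2 * e + (al + 1) * 2 + 4) : R.
  have K0 : 0 < K by rewrite /K; nra.
  pose eta := Num.min (e ^+ 2 / K) 1.
  have eta0 : 0 < eta by rewrite lt_min divr_gt0 ?exprn_gt0 //=.
  have eta1 : eta <= 1 by rewrite ge_min lexx orbT.
  have etaK : eta * K <= e ^+ 2 by rewrite -ler_pdivlMr // ge_min lexx.
  have [n Hn] : exists n, n.+1%:R^-1 <= eta.
    exists (Num.truncn eta^-1).
    rewrite invf_ple ?posrE //; apply: ltW; exact: truncnS_gt.
  have Hu' m : (n <= m)%N -> [/\ C (u m), d a (u m) + d (u m) b <= L + eta &
      `|d a (u m) - al| <= eta].
    move=> nm; have [H1 H2 H3] := Hu m.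
    have lem : m.+1%:R^-1 <= eta :> R.
      apply: le_trans Hn; rewrite lef_pV2 ?posrE // ler_nat; lia.
    by split=> //; [apply: (le_trans H2); rewrite lerD2l|exact: le_trans lem].
  exists n => m k /Hu'[Cm m1 m2] /Hu'[Ck k1 k2].
  have [c Cc [Sa Sb]] := mid _ _ Cm Ck.
  have := d_triangle a c b; have := d_triangle a (u m) b; have := d_triangle a (u k) b.
  move: m1 k1 m2 k2 Sa Sb; rewrite /stewart -/L !(dC b) !ler_norml.
  set p := d a (u m); set p' := d a (u k); set q := d (u m) b; set q' := d (u k) b.
  set x := d a c; set y := d c b; set D := d (u m) (u k).
  have : 0 <= p by exact: d_ge0.
  have : 0 <= p' by exact: d_ge0.
  have : 0 <= q by exact: d_ge0.
  have : 0 <= q' by exact: d_ge0.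
  have : 0 <= x by exact: d_ge0.
  have : 0 <= y by exact: d_ge0.
  have D0 : 0 <= D by exact: d_ge0.
  move=> y0 x0 q'0 q0 p'0 p0 m1 k1 /andP[m2 m3] /andP[k2 k3] Sa Sb t1 t2 t3.
  rewrite -ler_sqr ?nnegrE // ?(ltW e0) //.
  pose P := (p + p') / 2; pose Q := (q + q') / 2.
  have ex : x ^+ 2 <= P ^+ 2 + eta ^+ 2 - D ^+ 2 / 4.
    have : (p - p') ^+ 2 <= (2 * eta) ^+ 2.
      by rewrite -[leLHS]real_normK ?num_real // ler_sqr ?nnegrE ?mulr_ge0 ?(ltW eta0) // ler_norml; lra.
    by rewrite /P; lra.
  have ey : y ^+ 2 <= Q ^+ 2 + (2 * eta) ^+ 2 - D ^+ 2 / 4.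
    have : (q - q') ^+ 2 <= (4 * eta) ^+ 2.
      rewrite -[leLHS]real_normK ?num_real // ler_sqr ?nnegrE ?mulr_ge0 ?(ltW eta0) // ler_norml; lra.
    by rewrite /Q; lra.
  have [small|big] := leP (D ^+ 2) (4 * (2 * eta) ^+ 2).
    apply: (le_trans small); apply: le_trans etaK; rewrite /K; nra.
  have yQ : y <= Q.
    rewrite -ler_sqr ?nnegrE // ?divr_ge0 ?addr_ge0 //; lra.
  have xP : P - eta <= x by rewrite /P /Q in yQ *; lra.
  have xP2 : P ^+ 2 - 2 * P * eta <= x ^+ 2.
    have [h|h] := leP eta P; first by nra.
    by have : 0 <= P by [rewrite divr_ge0 ?addr_ge0]; nra.
  have Pal : P <= al + 1 by rewrite /P; lra.
  apply: le_trans etaK; rewrite /K; nra.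
exists c => //; apply/eqP; rewrite eq_le d_triangle andbT.
apply/ler_addgt0Pr => e e0.
have e3 : 0 < e / 3 by rewrite divr_gt0.
have [n Hn] := Hc _ e3.
pose m := maxn n (Num.truncn (e / 3)^-1).
have [Cm m1 _] := Hu m; have m2 := Hn m (leq_maxl _ _).
have m3 : m.+1%:R^-1 <= e / 3.
  rewrite invf_ple ?posrE //; apply: (@le_trans _ _ (Num.truncn (e / 3)^-1).+1%:R).
    exact: ltW (truncnS_gt _).
  by rewrite ler_nat ltnS leq_maxr.
have := d_triangle a (u m) c; have := d_triangle c (u m) b; rewrite (dC c (u m)).
rewrite -/L in m1 *; move: (m.+1%:R^-1) m1 m3 => t m1 m3; lra.
Qed.

End ExactCrossing.

(** * Cube complexes of median-closed families *)

Definition majority (x y z : bool) := [|| x && y, x && z | y && z].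

Section Points.
Variables (R : realType) (W : choiceType).
Implicit Types (f g : W -> R) (a b : W -> bool) (C : set (W -> bool)).

Definition flip_at w a : W -> bool := fun w' => if w' == w then ~~ a w' else a w'.

Lemma flip_atK w a : flip_at w (flip_at w a) = a.
Proof. by apply/funext => w'; rewrite /flip_at; case: eqP => // _; rewrite negbK. Qed.

Lemma flip_at_neq w w' a : w' != w -> flip_at w a w' = a w'.
Proof. by rewrite /flip_at => /negbTE ->. Qed.

Lemma flip_at_eq w a : flip_at w a w = ~~ a w.
Proof. by rewrite /flip_at eqxx. Qed.

(* A point of the cube complex with vertex set [C] is given by its coordinates; it belongs to the complex when every vertex of the cube it spans does. *)
Definition rounding f h := forall w, (f w = 0 -> h w = false) /\ (f w = 1 -> h w = true).

Definition in_cube f := forall w, 0 <= f w <= 1.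

Definition pts C f := in_cube f /\ forall h, rounding f h -> C h.

(** The vertices of the smallest face of the cube over [W] that contains both [f] and [g]. *)
Definition joint f g h := forall w, (f w = 0 -> g w = 0 -> h w = false) /\
  (f w = 1 -> g w = 1 -> h w = true).

Definition cocube C f g := [/\ in_cube f, in_cube g & forall h, joint f g h -> C h].

Definition vtx a : W -> R := fun w => (a w)%:R.

Definition floor01 f : W -> bool := fun w => f w == 1.
Definition ceil01 f : W -> bool := fun w => f w != 0.

Lemma floor01_rounding f : rounding f (floor01 f).
Proof. by move=> w; rewrite /floor01; split=> ->; rewrite ?eqxx // eq_sym oner_eq0. Qed.

Lemma ceil01_rounding f : rounding f (ceil01 f).
Proof. by move=> w; rewrite /ceil01; split=> ->; rewrite ?eqxx // oner_eq0. Qed.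

Lemma rounding_vtx a h : rounding (vtx a) h -> h = a.
Proof. by move=> H; apply/funext => w; case: (H w); rewrite /vtx; case: (a w) => [_ ->|->]. Qed.

Lemma vtx_rounding a : rounding (vtx a) a.
Proof.
by move=> w; rewrite /vtx; case: (a w); split=> // /eqP; rewrite ?oner_eq0 // eq_sym oner_eq0.
Qed.

Lemma vtx_in_cube a : in_cube (vtx a).
Proof. by move=> w; rewrite /vtx; case: (a w); rewrite ?lexx ?ler01. Qed.

Lemma pts_vtx C a : pts C (vtx a) <-> C a.
Proof.
split=> [[_]|Ca]; first by apply; exact: vtx_rounding.
by split=> [|h /rounding_vtx -> //]; exact: vtx_in_cube.
Qed.

Lemma joint_rounding_l f g h : rounding f h -> joint f g h.
Proof. by move=> H w; case: (H w) => h0 h1; split=> [/h0|/h1]. Qed.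

Lemma joint_rounding_r f g h : rounding g h -> joint f g h.
Proof. by move=> H w; case: (H w) => h0 h1; split=> _ => [/h0|/h1]. Qed.

Lemma cocube_l C f g : cocube C f g -> pts C f.
Proof. by move=> [f01 g01 H]; split=> // h J; apply: H; exact: joint_rounding_l. Qed.

Lemma cocube_r C f g : cocube C f g -> pts C g.
Proof. by move=> [f01 g01 H]; split=> // h J; apply: H; exact: joint_rounding_r. Qed.

Lemma cocubeC C f g : cocube C f g -> cocube C g f.
Proof.
by move=> [f01 g01 H]; split=> // h J; apply: H => w; case: (J w) => j0 j1; split=> *; auto.
Qed.

Lemma pts_sub C C' f : C `<=` C' -> pts C f -> pts C' f.
Proof. by move=> s [f01 H]; split=> // h /H/s. Qed.

Lemma cocube_sub C C' f g : C `<=` C' -> cocube C f g -> cocube C' f g.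
Proof. by move=> s [f01 g01 H]; split=> // h /H/s. Qed.

Definition seqlen (s : seq W) f g := Num.sqrt (\sum_(w <- s) (f w - g w) ^+ 2).

Definition supported (s : seq W) f g := forall w, w \notin s -> f w = g w.

(** Counterpart of [string_length]. The list [s] only has to contain the coordinates that change;
    the length of a step does not depend on it. *)
Inductive chain C : (W -> R) -> (W -> R) -> R -> Prop :=
| chain_nil f : pts C f -> chain C f f 0
| chain_cons f g h s l : cocube C f g -> uniq s -> supported s f g -> chain C g h l ->
    chain C f h (seqlen s f g + l).

Lemma seqlen_ge0 s f g : 0 <= seqlen s f g.
Proof. exact: sqrtr_ge0. Qed.

Lemma sumsq_ge0 (s : seq W) (F : W -> R) : 0 <= \sum_(w <- s) F w ^+ 2.
Proof. by apply: sumr_ge0 => w _; exact: sqr_ge0. Qed.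

Lemma seqlenC s f g : seqlen s f g = seqlen s g f.
Proof. by congr Num.sqrt; apply: eq_bigr => w _; rewrite -sqrrN opprB. Qed.

Lemma seqlen_le s f g f' g' : (forall w, `|f w - g w| <= `|f' w - g' w|) ->
  seqlen s f g <= seqlen s f' g'.
Proof.
move=> H; apply: ler_wsqrtr; apply: ler_sum => w _.
by rewrite -[leLHS]real_normK ?num_real // -[leRHS]real_normK ?num_real // ler_sqr ?nnegrE.
Qed.

Lemma coord_le_seqlen s f g w : supported s f g -> `|f w - g w| <= seqlen s f g.
Proof.
move=> sp; have [ws|/sp ->] := boolP (w \in s); last by rewrite subrr normr0 seqlen_ge0.
rewrite -sqrtr_sqr; apply: ler_wsqrtr; rewrite (big_rem w) //= lerDl; exact: sumsq_ge0.
Qed.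

Lemma seqlen_bound s f g e : 0 <= e -> (forall w, `|f w - g w| <= e) ->
  seqlen s f g <= (size s)%:R * e.
Proof.
move=> e0 H; rewrite -[leRHS]ger0_norm ?mulr_ge0 // -sqrtr_sqr; apply: ler_wsqrtr.
have : \sum_(w <- s) (f w - g w) ^+ 2 <= (size s)%:R * e ^+ 2.
  elim: s => [|w s IH]; first by rewrite big_nil mul0r.
  rewrite big_cons /= -natr1 mulrDl mul1r addrC lerD //.
  by rewrite -[leLHS]real_normK ?num_real // ler_sqr ?nnegrE.
move/le_trans; apply; rewrite exprMn ler_wpM2r ?sqr_ge0 //.
by rewrite -natrX ler_nat; case: (size s) => // n; rewrite expnS expn1 leq_pmulr.
Qed.

Lemma chain_ge0 C f g l : chain C f g l -> 0 <= l.
Proof. by elim=> // *; rewrite addr_ge0 ?seqlen_ge0. Qed.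

Lemma chain_sub C C' f g l : C `<=` C' -> chain C f g l -> chain C' f g l.
Proof.
move=> s; elim=> {f g l} [f /(pts_sub s)|f g h t l /(cocube_sub s) c u sp _]; first exact: chain_nil.
exact: chain_cons.
Qed.

Lemma chain_cat C f g h l l' : chain C f g l -> chain C g h l' -> chain C f h (l + l').
Proof.
move=> fg; elim: fg l' => {f g l} [f _ l'|f g k s l c u sp _ IH l' /IH]; first by rewrite add0r.
by rewrite -addrA; exact: chain_cons.
Qed.

Lemma chain_one C f g s : cocube C f g -> uniq s -> supported s f g -> chain C f g (seqlen s f g).
Proof.
move=> c u sp; rewrite -[seqlen _ _ _]addr0; apply: (chain_cons c u sp).
by apply: chain_nil; exact: cocube_r c.
Qed.

Lemma chain_rev C f g l : chain C f g l -> chain C g f l.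
Proof.
elim=> {f g l} [f Cf|f g h s l c u sp _ IH]; first exact: chain_nil.
rewrite addrC; apply: (chain_cat IH); rewrite seqlenC.
by apply: chain_one => //; [exact: cocubeC|move=> w /sp].
Qed.

Lemma coord_le_chain C f g l w : chain C f g l -> `|f w - g w| <= l.
Proof.
elim=> {f g l} [f _|f g h s l c u sp _ IH]; first by rewrite subrr normr0.
have -> : f w - h w = (f w - g w) + (g w - h w) by ring.
by apply: (le_trans (ler_normD _ _)); rewrite lerD // coord_le_seqlen.
Qed.

Definition convex_in (V : set (W -> bool)) C := [/\ C `<=` V, C !=set0 &
  forall a b z, C a -> C b -> V z -> (forall w, z w = a w \/ z w = b w) -> C z].

Definition const_on C w (e : bool) := forall c, C c -> c w = e.

(* The gate map onto a convex subcomplex replaces the coordinates of the walls disjoint from it. *)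
Definition gate_vtx C a : W -> bool := fun w =>
  if `[< const_on C w true >] then true else if `[< const_on C w false >] then false else a w.

Definition gate C f : W -> R := fun w =>
  if `[< const_on C w true >] then 1 else if `[< const_on C w false >] then 0 else f w.

Lemma gate_const C f w e : C !=set0 -> const_on C w e -> gate C f w = e%:R.
Proof.
move=> [c Cc] k; rewrite /gate; case: asboolP => [k1|k1].
  by have := k1 c Cc; rewrite (k c Cc) => ->.
by case: e k => [/k1//|k]; case: asboolP.
Qed.

Lemma gate_free C f w : ~ const_on C w true -> ~ const_on C w false -> gate C f w = f w.
Proof. by move=> k1 k0; rewrite /gate; case: asboolP => // _; case: asboolP. Qed.

Lemma gateP C f w : C !=set0 ->
  (exists2 e : bool, const_on C w e & gate C f w = e%:R) \/
  [/\ ~ const_on C w true, ~ const_on C w false & gate C f w = f w].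
Proof.
move=> C0; have [k1|k1] := pselect (const_on C w true).
  by left; exists true => //; exact: gate_const.
have [k0|k0] := pselect (const_on C w false).
  by left; exists false => //; exact: gate_const.
by right; split=> //; exact: gate_free.
Qed.

Lemma gate_vtx_free C a w : ~ const_on C w true -> ~ const_on C w false -> gate_vtx C a w = a w.
Proof. by move=> k1 k0; rewrite /gate_vtx; case: asboolP => // _; case: asboolP. Qed.

Lemma gate_vtx_const C a w e : C !=set0 -> const_on C w e -> gate_vtx C a w = e.
Proof.
move=> [c Cc] k; rewrite /gate_vtx; case: asboolP => [k1|k1].
  by have := k1 c Cc; rewrite (k c Cc) => ->.
by case: e k => [/k1//|k]; case: asboolP.
Qed.

Lemma gate_id C f : C !=set0 -> pts C f -> gate C f = f.
Proof.
move=> C0 [f01 H]; apply/funext => w.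
case: (gateP f w C0) => [[e k ->]|[_ _ ->//]].
case: e k => k.
  by have /eqP -> := k _ (H _ (floor01_rounding f)).
by have /negbFE/eqP -> := k _ (H _ (ceil01_rounding f)).
Qed.

Lemma gate_nexp C f g w : `|gate C f w - gate C g w| <= `|f w - g w|.
Proof.
by rewrite /gate; case: asboolP => _; [|case: asboolP => _ //]; rewrite subrr normr0.
Qed.

Section MedianStructure.
Variable V : set (W -> bool).
Hypothesis medV : forall a b c, V a -> V b -> V c -> V (fun w => majority (a w) (b w) (c w)).
Hypothesis finV : forall a b, V a -> V b -> exists s : seq W, forall w, w \notin s -> a w = b w.

(** Take [g] in [C] with the fewest differences from [a]. If some [c] in [C] disagreed with [g]
    where [g] disagrees with [a], the median of [a], [g], [c] would be closer to [a]; so those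
    coordinates are constant on [C]. *)
Lemma gate_vtx_in C a : convex_in V C -> V a -> C (gate_vtx C a).
Proof.
move=> [CV [c0 Cc0] conv] Va.
pose P n := `[< exists (g : W -> bool) (s : seq W), [/\ C g, forall w, g w != a w -> w \in s & size s = n] >].
have exP : exists n, P n.
  have [s Hs] := finV (CV _ Cc0) Va; exists (size s); apply/asboolP; exists c0, s; split=> // w.
  by apply: contraR => /Hs ->.
case: (ex_minnP exP) => n /asboolP[g [s [Cg Hs sn]]] nmin.
have key c w : C c -> g w <> a w -> c w = g w.
  move=> Cc ga; apply: contrapT => cg.
  have ws : w \in s by apply: Hs; apply/eqP.
  have : P (size (rem w s)).
    apply/asboolP; exists (fun w => majority (a w) (g w) (c w)), (rem w s); split=> //.
      apply: (conv g c) => //; first by apply: medV => //; exact: CV.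
      by move=> x; rewrite /majority; case: (a x) (g x) (c x) => -[] []; auto.
    move=> x mx.
    have gx : g x != a x by move: mx; rewrite /majority; case: (a x) (g x) (c x) => -[] [].
    have xw : x != w.
      apply: contraNneq mx => ->; apply/eqP.
      by move: ga cg; rewrite /majority; case: (a w) (g w) (c w) => -[] [].
    by have := Hs x gx; move/perm_mem: (perm_to_rem ws) => ->; rewrite inE (negbTE xw).
  move/nmin; rewrite size_rem // -sn.
  by case: (s) ws => // x s' _; rewrite /= ltnn.
suff -> : gate_vtx C a = g by [].
apply/funext => w; have [k1|k1] := pselect (const_on C w true).
  by rewrite (gate_vtx_const _ _ k1) ?(k1 g Cg) //; exists c0.
have [k0|k0] := pselect (const_on C w false).
  by rewrite (gate_vtx_const _ _ k0) ?(k0 g Cg) //; exists c0.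
rewrite gate_vtx_free //; apply: contrapT => ga.
have kk : const_on C w (g w) by move=> c Cc; apply: key => // e; apply: ga.
by case: (g w) kk.
Qed.

(** Changing [h] at the coordinates constant on [C] turns it into a joint vertex [h'] of [f] and
    [g], whose gate is [h]. *)
Lemma gate_pts_joint C f g h : convex_in V C -> cocube V f g ->
  joint (gate C f) (gate C g) h -> C h.
Proof.
move=> cC [f01 g01 H] J; have C0 : C !=set0 by case: cC.
pose h' w := if `[< const_on C w true \/ const_on C w false >] then f w == 1 else h w.
have Vh' : V h'.
  apply: H => w; rewrite /h'; case: asboolP => [_|k].
    by split=> ->; rewrite ?eqxx // eq_sym oner_eq0.
  have k1 : ~ const_on C w true by move=> ?; apply: k; left.
  have k0 : ~ const_on C w false by move=> ?; apply: k; right.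
  by case: (J w); rewrite !gate_free.
suff -> : h = gate_vtx C h' by exact: gate_vtx_in.
apply/funext => w; case: (J w).
case: (gateP f w C0) => [[e k]|[k1 k0 _] _ _]; last first.
  by rewrite gate_vtx_free // /h'; case: asboolP => // -[].
rewrite (gate_const f C0 k) (gate_const g C0 k) (gate_vtx_const _ C0 k).
by case: e {k} => _ => [_ ->|->].
Qed.

Lemma gate_cocube C f g : convex_in V C -> cocube V f g -> cocube C (gate C f) (gate C g).
Proof.
move=> cC c; have [f01 g01 _] := c; split=> [w|w|h]; last exact: gate_pts_joint.
- by rewrite /gate; case: ifP => _; [|case: ifP => // _]; rewrite ?lexx ?ler01.
- by rewrite /gate; case: ifP => _; [|case: ifP => // _]; rewrite ?lexx ?ler01.
Qed.

Lemma pts_cocube C f : pts C f <-> cocube C f f.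
Proof.
split=> [[f01 H]|/cocube_l//]; split=> // h J; apply: H => w.
by case: (J w) => j0 j1; split=> e; [exact: j0|exact: j1].
Qed.

Lemma gate_pts C f : convex_in V C -> pts V f -> pts C (gate C f).
Proof. by move=> cC /pts_cocube/(gate_cocube cC)/pts_cocube. Qed.

Lemma gate_chain C f g l : convex_in V C -> chain V f g l ->
  exists2 l', chain C (gate C f) (gate C g) l' & l' <= l.
Proof.
move=> cC; elim=> {f g l} [f /(gate_pts cC) Cf|f g h s l c u sp _ [l' ch le]].
  by exists 0 => //; exact: chain_nil.
exists (seqlen s (gate C f) (gate C g) + l').
  apply: chain_cons => //; first exact: gate_cocube.
  by move=> w /sp e; rewrite /gate e.
by apply: lerD => //; apply: seqlen_le => w; exact: gate_nexp.
Qed.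

(** Rounding down and rounding up give two vertices that differ exactly at the fractional
    coordinates. *)
Lemma fractional_finite f : pts V f -> exists s : seq W, forall w, w \notin s -> f w = 0 \/ f w = 1.
Proof.
move=> [f01 H]; have [s Hs] := finV (H _ (floor01_rounding f)) (H _ (ceil01_rounding f)).
exists s => w /Hs; rewrite /floor01 /ceil01.
by case: eqP => [->|]; [right|case: eqP; [left|]].
Qed.

Lemma support_exists f g : pts V f -> pts V g -> exists2 s : seq W, uniq s & supported s f g.
Proof.
move=> Vf Vg; have [s1 H1] := fractional_finite Vf; have [s2 H2] := fractional_finite Vg.
have [s3 H3] := finV (Vf.2 _ (floor01_rounding f)) (Vg.2 _ (floor01_rounding g)).
exists (undup (s1 ++ s2 ++ s3)); first exact: undup_uniq.
move=> w; rewrite mem_undup !mem_cat !negb_or => /and3P[/H1 w1 /H2 w2 /H3].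
rewrite /floor01; case: w1 w2 => -> [] -> //; rewrite eqxx eq_sym oner_eq0 //.
Qed.

Hypothesis stepV : forall a b, V a -> V b -> a <> b -> exists2 w, a w != b w & V (flip_at w a).

Lemma flip_cocube C a w : C a -> C (flip_at w a) -> cocube C (vtx a) (vtx (flip_at w a)).
Proof.
move=> Ca Cw; split; try exact: vtx_in_cube.
move=> h J; have [e|e] := eqVneq (h w) (a w).
  suff -> : h = a by [].
  apply/funext => w'; have [->//|n] := eqVneq w' w.
  by case: (J w'); rewrite /vtx flip_at_neq //; case: (a w') => [_ ->|->].
suff -> : h = flip_at w a by [].
apply/funext => w'; have [->|n] := eqVneq w' w.
  by rewrite flip_at_eq; case: (h w) (a w) e => -[].
by case: (J w'); rewrite /vtx flip_at_neq //; case: (a w') => [_ ->|->].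
Qed.

(* Vertices can be joined inside the interval they span. *)
Lemma flip_ind (P : (W -> bool) -> Prop) a b : V a -> V b ->
  (forall c w, V c -> (forall w, c w = a w \/ c w = b w) -> a w != b w -> c w = a w ->
     V (flip_at w c) -> P c -> P (flip_at w c)) -> P a -> P b.
Proof.
move=> Va Vb step Pa.
have [s Hs] := finV Va Vb.
have [n sn] : exists n, size s = n by exists (size s).
suff G c : V c -> (forall w, c w = a w \/ c w = b w) -> P c ->
    forall t, (forall w, w \notin t -> c w = b w) -> (size t <= n)%N -> P b.
  by apply: (G a) Hs _ => //; [left|rewrite sn].
move: n {sn}; move=> n; elim: n c => [|n IH] c Vc cab Pc t Ht tn.
  suff -> : b = c by [].
  by apply/funext => w; rewrite Ht //; case: t tn {Ht}.
have [->//|/eqP cb] := pselect (b = c).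
have [|w cw Vw] := stepV Vc Vb; first by move=> e; move/eqP: cb => /(_ (esym e)).
have ca : c w = a w by case: (cab w) cw => // ->; rewrite eqxx.
have wt : w \in t by apply: contraR cw => /Ht ->.
apply: (IH (flip_at w c) _ _ _ (rem w t)) => //.
- move=> w'; have [->|n'] := eqVneq w' w; last by rewrite flip_at_neq.
  by right; rewrite flip_at_eq; case: (c w) (b w) cw => -[].
- by apply: step => //; rewrite -ca.
- move=> w'; have [->|n'] := eqVneq w' w.
    by rewrite flip_at_eq; case: (c w) (b w) cw => -[].
  rewrite flip_at_neq // => w't; apply: Ht; apply: contra w't.
  by move/perm_mem: (perm_to_rem wt) => ->; rewrite inE (negbTE n').
- by rewrite size_rem //; case: (size t) tn.
Qed.

Lemma chain_exists f g : pts V f -> pts V g -> exists l, chain V f g l.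
Proof.
have near f' : pts V f' -> exists l, chain V f' (vtx (floor01 f')) l.
  move=> Vf; have Vr := Vf.2 _ (floor01_rounding f').
  have [s us ss] := support_exists Vf (proj2 (pts_vtx _ _) Vr).
  exists (seqlen s f' (vtx (floor01 f'))); apply: chain_one => //.
  split; [exact: Vf.1|exact: vtx_in_cube|move=> h J; apply: Vf.2 => w].
  case: (J w) => j0 j1; split=> e.
    by apply: j0 => //; rewrite /vtx /floor01 e eq_sym oner_eq0.
  by apply: j1 => //; rewrite /vtx /floor01 e eqxx.
move=> Vf Vg; have [l1 c1] := near f Vf; have [l2 c2] := near g Vg.
have [l3 c3] : exists l, chain V (vtx (floor01 f)) (vtx (floor01 g)) l.
  have Va := Vf.2 _ (floor01_rounding f); have Vb := Vg.2 _ (floor01_rounding g).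
  apply: (flip_ind (P := fun c => exists l, chain V (vtx (floor01 f)) (vtx c) l) Va Vb).
    move=> c w Vc _ _ _ Vw [l cl].
    have [s us ss] := support_exists (proj2 (pts_vtx _ _) Vc) (proj2 (pts_vtx _ _) Vw).
    exists (l + seqlen s (vtx c) (vtx (flip_at w c))); apply: (chain_cat cl).
    by apply: chain_one => //; exact: flip_cocube.
  by exists 0; apply: chain_nil; apply/pts_vtx.
by exists (l1 + (l3 + l2)); apply: (chain_cat c1); apply: (chain_cat c3); exact: chain_rev.
Qed.

End MedianStructure.
End Points.

Section Euclid.
Variable R : rcfType.
Implicit Types a b p q : R.

Lemma sqrt_sumsq_sqr a p : Num.sqrt (a ^+ 2 + p ^+ 2) ^+ 2 = a ^+ 2 + p ^+ 2.
Proof. by rewrite sqr_sqrtr // addr_ge0 ?sqr_ge0. Qed.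

Lemma minkowski2 a b p q :
  Num.sqrt ((a + b) ^+ 2 + (p + q) ^+ 2) <=
  Num.sqrt (a ^+ 2 + p ^+ 2) + Num.sqrt (b ^+ 2 + q ^+ 2).
Proof.
set x := Num.sqrt (a ^+ 2 + p ^+ 2); set y := Num.sqrt (b ^+ 2 + q ^+ 2).
have x0 : 0 <= x by exact: sqrtr_ge0.
have y0 : 0 <= y by exact: sqrtr_ge0.
have ex : x ^+ 2 = a ^+ 2 + p ^+ 2 by exact: sqrt_sumsq_sqr.
have ey : y ^+ 2 = b ^+ 2 + q ^+ 2 by exact: sqrt_sumsq_sqr.
rewrite -ler_sqr ?nnegrE ?sqrtr_ge0 ?addr_ge0 // sqrt_sumsq_sqr.
have cs : a * b + p * q <= x * y.
  apply: (le_trans (ler_norm _)).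
  rewrite -ler_sqr ?nnegrE ?mulr_ge0 // real_normK ?num_real // exprMn ex ey.
  by have := sqr_ge0 (a * q - b * p); lra.
have -> : (x + y) ^+ 2 = x ^+ 2 + 2 * (x * y) + y ^+ 2 by ring.
by rewrite ex ey; lra.
Qed.

End Euclid.

(** * The model is complete and CAT(0) *)

Section CatZeroModel.
Variables (R : realType) (W : choiceType) (V : set (W -> bool)) (N : nat).
Hypothesis medV : forall a b c, V a -> V b -> V c -> V (fun w => majority (a w) (b w) (c w)).
Hypothesis finV : forall a b, V a -> V b -> exists s : seq W, forall w, w \notin s -> a w = b w.
Hypothesis stepV : forall a b, V a -> V b -> a <> b -> exists2 w, a w != b w & V (flip_at w a).
Hypothesis dimV : forall a (s : seq W), uniq s ->
  (forall b, (forall w, w \notin s -> b w = a w) -> V b) -> (size s <= N)%N.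

Record Pt := PtOf { crd : W -> R ; crdP : pts V crd }.

Implicit Types (x y z : Pt) (C D : set (W -> bool)).

Lemma Pt_eq x y : crd x = crd y -> x = y.
Proof.
case: x y => [f Vf] [g Vg] /= e; subst g; congr PtOf; exact: Prop_irrelevance.
Qed.

Definition mdist x y : R := inf [set l | chain V (crd x) (crd y) l].

Lemma mdist_has_inf x y : has_inf [set l | chain V (crd x) (crd y) l].
Proof.
split; first by have [l] := chain_exists finV stepV (crdP x) (crdP y); exists l.
by exists 0 => l /chain_ge0.
Qed.

Lemma mdist_le x y l : chain V (crd x) (crd y) l -> mdist x y <= l.
Proof. by move=> c; apply: ge_inf => //; exact: (mdist_has_inf x y).2. Qed.

Lemma le_mdist x y t : (forall l, chain V (crd x) (crd y) l -> t <= l) -> t <= mdist x y.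
Proof. by move=> H; apply: lb_le_inf => //; exact: (mdist_has_inf x y).1. Qed.

Lemma mdist_chain x y e : 0 < e -> exists2 l, chain V (crd x) (crd y) l & l < mdist x y + e.
Proof. by move=> e0; have [l] := inf_adherent e0 (mdist_has_inf x y); exists l. Qed.

Lemma mdist_ge0 x y : 0 <= mdist x y.
Proof. by apply: le_mdist => l /chain_ge0. Qed.

Lemma mdistxx x : mdist x x = 0.
Proof.
by apply/eqP; rewrite eq_le mdist_ge0 andbT; apply: mdist_le; apply: chain_nil; exact: crdP.
Qed.

Lemma mdistC x y : mdist x y = mdist y x.
Proof.
suff H x' y' : mdist x' y' <= mdist y' x' by apply/eqP; rewrite eq_le !H.
by apply: le_mdist => l /chain_rev; exact: mdist_le.
Qed.

Lemma mdist_triangle x y z : mdist x z <= mdist x y + mdist y z.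
Proof.
apply/ler_addgt0Pr => e e0; have e2 : 0 < e / 2 by rewrite divr_gt0.
have [l1 c1 h1] := mdist_chain x y e2; have [l2 c2 h2] := mdist_chain y z e2.
by apply: (le_trans (mdist_le (chain_cat c1 c2))); lra.
Qed.

Lemma coord_le_mdist x y w : `|crd x w - crd y w| <= mdist x y.
Proof. by apply: le_mdist => l; exact: coord_le_chain. Qed.

Lemma mdist_eq0 x y : mdist x y = 0 -> x = y.
Proof.
move=> e; apply: Pt_eq; apply/funext => w; apply/eqP; rewrite -subr_eq0 -normr_le0 -e.
exact: coord_le_mdist.
Qed.

Definition inP C : set Pt := [set x | pts C (crd x)].

Lemma gate_Pt C x : convex_in V C -> pts V (gate C (crd x)).
Proof. by move=> cC; apply: (@pts_sub _ _ C); [case: cC|exact: (gate_pts medV finV cC (crdP x))]. Qed.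

Definition gatep C (cC : convex_in V C) x := PtOf (gate_Pt x cC).

Lemma gatep_in C (cC : convex_in V C) x : inP C (gatep cC x).
Proof. exact: (gate_pts medV finV cC (crdP x)). Qed.

Lemma gatep_id C (cC : convex_in V C) x : inP C x -> gatep cC x = x.
Proof. by move=> Cx; apply: Pt_eq; apply: gate_id => //; case: cC. Qed.

Lemma gatep_nexp C (cC : convex_in V C) x y : mdist (gatep cC x) (gatep cC y) <= mdist x y.
Proof.
apply: le_mdist => l /(gate_chain medV finV cC)[l' c le]; apply: le_trans le.
by apply: mdist_le; apply: chain_sub c; case: cC.
Qed.

Lemma mdist_chain_in C x y e : convex_in V C -> inP C x -> inP C y -> 0 < e ->
  exists2 l, chain C (crd x) (crd y) l & l < mdist x y + e.
Proof.
move=> cC Cx Cy e0; have [l c lt] := mdist_chain x y e0.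
have [l' c' le] := gate_chain medV finV cC c; exists l'; last exact: le_lt_trans lt.
by move: c'; rewrite !gate_id //; case: cC.
Qed.

Lemma maximal_seq (P : W -> Prop) n : (forall s : seq W, uniq s -> (forall w, w \in s -> P w) ->
  (size s <= n)%N) -> exists s : seq W, [/\ uniq s, (size s <= n)%N & forall w, w \in s <-> P w].
Proof.
elim: n => [|n IH] H.
  exists [::]; split=> // w; split=> // Pw.
  by have := H [:: w] isT; apply=> w'; rewrite inE => /eqP ->.
have [H'|] := pselect (forall s : seq W, uniq s -> (forall w, w \in s -> P w) -> (size s <= n)%N).
  by have [s [us sn sP]] := IH H'; exists s; split=> //; exact: leqW.
move=> /existsNP[s /not_implyP[us /not_implyP[sP /negP]]]; rewrite -ltnNge => sn.
exists s; split=> //; first exact: H.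
move=> w; split=> [/sP//|Pw]; apply: contrapT => /negP ws.
have : (size (w :: s) <= n.+1)%N.
  by apply: H => [|w']; rewrite /= ?ws // inE => /orP[/eqP ->//|/sP].
by rewrite /=; lia.
Qed.

Lemma fractional_seq x : exists s : seq W, [/\ uniq s, (size s <= N)%N &
  forall w, w \in s <-> 0 < crd x w < 1].
Proof.
apply: maximal_seq => s us Hs.
apply: (dimV (a := floor01 (crd x)) us) => b Hb; apply: (crdP x).2 => w.
have [/Hs/andP[w0 w1]|/Hb ->] := boolP (w \in s); last exact: floor01_rounding.
by split=> e; move: w0 w1; rewrite e ltxx.
Qed.

Lemma coord_cases x w : [\/ crd x w = 0, crd x w = 1 | 0 < crd x w < 1].
Proof.
have /andP[w0 w1] := (crdP x).1 w.
have [->|n0] := eqVneq (crd x w) 0; first by constructor 1.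
have [->|n1] := eqVneq (crd x w) 1; first by constructor 2.
by constructor 3; rewrite !lt_def n0 w0 w1 eq_sym n1.
Qed.

(** Coordinates converge uniformly, and the limit has finitely many fractional ones. From some index
    on, [u m] lies in a common cube with the limit, where at most [N] coordinates differ; so the
    distance is at most [N] times the uniform distance. *)
Lemma model_complete C : C `<=` V -> complete_on mdist (inP C).
Proof.
move=> CV u uC cu.
have cw w e : 0 < e -> exists n, forall m, (n <= m)%N -> `|crd (u m) w - crd (u n) w| <= e.
  move=> /cu[n Hn]; exists n => m nm; apply: (le_trans (coord_le_mdist _ _ _)); exact: Hn.
have [f Hf] := choice (fun w => cauchy_limit (cw w)).
have near e : 0 < e -> exists n, forall m, (n <= m)%N -> forall w, `|crd (u m) w - f w| <= e.
  move=> /cu[n Hn]; exists n => m nm w; apply: Hf => k mk.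
  apply: (le_trans (coord_le_mdist _ _ _)); apply: Hn => //; exact: leq_trans mk.
have f01 : in_cube f.
  move=> w; apply/andP; split; apply/ler_addgt0Pr => e /near[n /(_ n (leqnn _) w)];
    by have /andP[] := (crdP (u n)).1 w; rewrite ler_norml => ? ? /andP[]; lra.
have fracn (s : seq W) : (forall w, w \in s -> 0 < f w < 1) ->
    exists n, forall m, (n <= m)%N -> forall w, w \in s -> 0 < crd (u m) w < 1.
  elim: s => [|w s IH] Hs; first by exists 0%N.
  have [|n Hn] := IH; first by move=> w' ws; apply: Hs; rewrite inE ws orbT.
  have /andP[fw0 fw1] := Hs w (mem_head _ _).
  have e0 : 0 < Num.min (f w / 2) ((1 - f w) / 2) by rewrite lt_min !divr_gt0 ?subr_gt0.
  have [k Hk] := near _ e0.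
  exists (maxn n k) => m; rewrite geq_max => /andP[nm km] w'.
  rewrite inE => /orP[/eqP ->|]; last exact: Hn.
  have h1 : Num.min (f w / 2) ((1 - f w) / 2) <= f w / 2 by rewrite ge_min lexx.
  have h2 : Num.min (f w / 2) ((1 - f w) / 2) <= (1 - f w) / 2 by rewrite ge_min lexx orbT.
  by have := Hk m km w; rewrite ler_norml => /andP[]; lra.
have [F [uF _ FP]] : exists s : seq W, [/\ uniq s, (size s <= N)%N & forall w, w \in s <-> 0 < f w < 1].
  apply: maximal_seq => s us Hs; have [n Hn] := fracn s Hs.
  have [t [ut tN tP]] := fractional_seq (u n).
  by apply: leq_trans tN; apply: uniq_leq_size => // w /(Hn n (leqnn _) w)/tP.
have [n0 Hn0] := fracn F (fun w => (FP w).1).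
have [n1 Hn1] := near (1 / 2) ltac:(lra).
pose n2 := maxn n0 n1.
(* A coordinate fractional for the limit is fractional for [u m]; the others of the limit are 0 or
   1, and closeness 1/2 decides which. *)
have same m w : (n2 <= m)%N -> (crd (u m) w = 0 -> f w = 0) /\ (crd (u m) w = 1 -> f w = 1).
  rewrite geq_max => /andP[m0 m1]; have := Hn1 m m1 w; have /andP[fw0 fw1] := f01 w.
  have : ~ (0 < f w < 1) \/ 0 < crd (u m) w < 1.
    by have [/FP/(Hn0 m m0)|] := pselect (0 < f w < 1); [right|left].
  move=> Fr nr; split=> e; move: Fr nr; rewrite e ?ltxx ?andbF => -[|//] Fr; rewrite ler_norml => nr.
    apply/eqP; rewrite eq_le fw0 andbT leNgt; apply/negP => lt; apply: Fr; rewrite lt /=; lra.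
  apply/eqP; rewrite eq_le fw1 /= leNgt; apply/negP => lt; apply: Fr; rewrite lt andbT; lra.
have rnd m h : (n2 <= m)%N -> rounding f h -> rounding (crd (u m)) h.
  by move=> /same S H w; case: (S w) (H w) => s0 s1 [h0 h1]; split=> [/s0/h0|/s1/h1].
have Cf : pts C f.
  by split=> // h H; apply: (uC n2).2; exact: rnd.
exists (PtOf (pts_sub CV Cf)) => // e e0.
have e1 : 0 < e / N.+1%:R by rewrite divr_gt0.
have [n3 Hn3] := near _ e1.
exists (maxn n2 n3) => m; rewrite geq_max => /andP[m2 m3].
have [s [us sN sP]] := fractional_seq (u m).
have sup : supported s (crd (u m)) f.
  move=> w ws; case: (coord_cases (u m) w) => [e'|e'|/sP]; last by rewrite (negbTE ws).
    by rewrite e' ((same m w m2).1 e').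
  by rewrite e' ((same m w m2).2 e').
have co : cocube V (crd (u m)) f.
  split=> //; first exact: (crdP (u m)).1.
  move=> h J; apply: (crdP (u m)).2 => w; case: (J w) (same m w m2) => j0 j1 [s0 s1].
  by split=> e'; [apply: j0 => //; exact: s0|apply: j1 => //; exact: s1].
apply: (le_trans (@mdist_le (u m) (PtOf (pts_sub CV Cf)) _ (chain_one co us sup))).
apply: (le_trans (seqlen_bound s (ltW e1) (Hn3 m m3))).
rewrite mulrCA -[leRHS]mulr1 ler_wpM2l ?(ltW e0) // ler_pdivrMr // mul1r ler_nat.
exact: leqW.
Qed.

Definition upd (f : W -> R) w t : W -> R := fun w' => if w' == w then t else f w'.

Lemma upd_eq f w t : upd f w t w = t.
Proof. by rewrite /upd eqxx. Qed.

Lemma upd_neq f w t w' : w' != w -> upd f w t w' = f w'.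
Proof. by rewrite /upd => /negbTE ->. Qed.

Lemma upd_upd f w t t' : upd (upd f w t) w t' = upd f w t'.
Proof. by apply/funext => w'; rewrite /upd; case: eqP. Qed.

Lemma upd_id f w t : f w = t -> upd f w t = f.
Proof. by move=> e; apply/funext => w'; rewrite /upd; case: eqP => // ->. Qed.

Definition doubled D w := forall c, D c -> D (flip_at w c).

Definition face_of D w (e : bool) : set (W -> bool) := [set c | D c /\ c w = e].

Lemma doubled_flip D w c h : doubled D w -> D c -> (forall w', w' != w -> h w' = c w') -> D h.
Proof.
move=> dD Dc H; have [e|e] := eqVneq (h w) (c w).
  suff -> : h = c by [].
  by apply/funext => w'; have [->|/H] := eqVneq w' w.
suff -> : h = flip_at w c by exact: dD.
apply/funext => w'; have [->|n] := eqVneq w' w; last by rewrite flip_at_neq // H.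
by rewrite flip_at_eq; case: (h w) (c w) e => -[].
Qed.

Lemma cocube_upd D w f g t u : doubled D w -> 0 <= t <= 1 -> 0 <= u <= 1 ->
  cocube D f g -> cocube D (upd f w t) (upd g w u).
Proof.
move=> dD t01 u01 [f01 g01 H]; split=> [w'|w'|h J].
- by rewrite /upd; case: eqP.
- by rewrite /upd; case: eqP.
pose h' w' := if w' == w then f w == 1 else h w'.
apply: (@doubled_flip D w h') => //; last by move=> w' /negbTE n; rewrite /h' n.
apply: H => w'; rewrite /h'; have [->|n] := eqVneq w' w.
  by split=> ->; rewrite ?eqxx // eq_sym oner_eq0.
by case: (J w'); rewrite !upd_neq.
Qed.

Lemma cocube_face D w f g (e : bool) : doubled D w ->
  cocube D f g -> cocube (face_of D w e) (upd f w e%:R) (upd g w e%:R).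
Proof.
move=> dD c.
have e01 : 0 <= (e%:R : R) <= 1 by case: e; rewrite ?lexx ?ler01.
have [f01 g01 H] := cocube_upd dD e01 e01 c; split=> // h J; split; first exact: H.
by case: (J w); rewrite !upd_eq; case: e {e01 f01 g01 H J} => [_ ->|->].
Qed.

Lemma sumsq_upd (s : seq W) f g w t : uniq s -> supported s f g ->
  \sum_(v <- s) (f v - g v) ^+ 2 =
  \sum_(v <- s) (upd f w t v - upd g w t v) ^+ 2 + (f w - g w) ^+ 2.
Proof.
move=> us sp; have [ws|ws] := boolP (w \in s).
  rewrite !(bigD1_seq w) //= !upd_eq subrr expr0n /= add0r addrC; congr (_ + _).
  by apply: eq_bigr => v vw; rewrite !upd_neq.
rewrite (sp _ ws) subrr expr0n addr0; apply: eq_big_seq => v vs.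
by rewrite !upd_neq //; apply: contraNneq ws => <-.
Qed.

Lemma seqlen_upd (s : seq W) f g w t : uniq s -> supported s f g ->
  seqlen s f g = Num.sqrt (seqlen s (upd f w t) (upd g w t) ^+ 2 + (f w - g w) ^+ 2).
Proof. by move=> us sp; rewrite {2}/seqlen sqr_sqrtr ?sumsq_ge0 // -sumsq_upd. Qed.

Lemma chain_face D w e f h l : doubled D w -> chain D f h l ->
  exists2 l', chain (face_of D w e) (upd f w e%:R) (upd h w e%:R) l' &
    Num.sqrt (l' ^+ 2 + (f w - h w) ^+ 2) <= l.
Proof.
move=> dD; elim=> {f h l} [f /pts_cocube/(cocube_face e dD)/pts_cocube Cf|f g h s l c us sp _ [l' ch le]].
  by exists 0; [exact: chain_nil|rewrite subrr expr0n addr0 sqrtr0].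
exists (seqlen s (upd f w e%:R) (upd g w e%:R) + l').
  apply: chain_cons => //; first exact: cocube_face.
  by move=> v /sp vv; rewrite /upd vv.
rewrite (seqlen_upd w e%:R us sp).
have -> : f w - h w = (f w - g w) + (g w - h w) by ring.
by apply: (le_trans (minkowski2 _ _ _ _)); rewrite lerD2l.
Qed.

(** The coordinate [w] goes from [t] to [u] in proportion to the length covered, so all steps have
    the same slope and their lengths add up to the hypotenuse. *)
Lemma chain_lift D w (e : bool) f g l : doubled D w -> chain (face_of D w e) f g l ->
  forall t u, 0 <= t <= 1 -> 0 <= u <= 1 ->
  exists2 l', chain D (upd f w t) (upd g w u) l' & l' <= Num.sqrt (l ^+ 2 + (t - u) ^+ 2).
Proof.
move=> dD; have fD : face_of D w e `<=` D by move=> c [].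
have one f' g' s t u : cocube D f' g' -> uniq s -> supported s f' g' -> f' w = g' w ->
    0 <= t <= 1 -> 0 <= u <= 1 ->
    chain D (upd f' w t) (upd g' w u) (Num.sqrt (seqlen s f' g' ^+ 2 + (t - u) ^+ 2)).
  move=> c us sp fg t01 u01.
  pose s' := if w \in s then s else w :: s.
  have us' : uniq s' by rewrite /s'; case: ifP => //= ->.
  have sp' : supported s' (upd f' w t) (upd g' w u).
    move=> v vs; have nvw : v != w.
      by apply: contraNneq vs => ->; rewrite /s'; case: ifP => // _; rewrite mem_head.
    rewrite !upd_neq //; apply: sp; apply: contra vs => vs; rewrite /s'.
    by case: ifP => // _; rewrite inE vs orbT.
  have := chain_one (cocube_upd dD t01 u01 c) us' sp'.
  have ef : upd f' w (f' w) = f' by exact: upd_id.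
  have eg : upd g' w (f' w) = g' by rewrite fg; exact: upd_id.
  rewrite (seqlen_upd w (f' w) us' sp') !upd_upd !upd_eq ef eg.
  congr (chain _ _ _ (Num.sqrt (_ + _))).
  congr (_ ^+ 2); rewrite /seqlen /s'; case: ifP => // _.
  by rewrite big_cons fg subrr expr0n add0r.
elim=> {f g l} [f /pts_cocube c t u t01 u01|f g h s l c us sp ch IH t u t01 u01].
  have := one f f [::] t u (cocube_sub fD c) isT (fun _ _ => erefl) erefl t01 u01.
  rewrite {1}/seqlen big_nil sqrtr0; exists (Num.sqrt (0 ^+ 2 + (t - u) ^+ 2)) => //.
have [a0 l0] := (seqlen_ge0 s f g, chain_ge0 ch).
set a := seqlen s f g in a0 *.
have [la [la0 la1 ea]] : exists la, [/\ 0 <= la, la <= 1 & a = la * (a + l)].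
  have [z|z] := eqVneq (a + l) 0; first by exists 1; rewrite z mulr0; split=> //; lra.
  have p : 0 < a + l by rewrite lt_def z addr_ge0.
  exists (a / (a + l)); split; first by rewrite divr_ge0 // ltW.
    by rewrite ler_pdivrMr // mul1r lerDl.
  by rewrite divfK.
have el : l = (1 - la) * (a + l) by lra.
pose v := t + la * (u - t).
have v01 : 0 <= v <= 1.
  by move/andP: t01 => [t0 t1]; move/andP: u01 => [u0 u1]; rewrite /v; apply/andP; split; nra.
have wf : f w = e%:R /\ g w = e%:R.
  have vface (f' g' : W -> R) : cocube (face_of D w e) f' g' -> f' w = e%:R.
    move=> /cocube_l[f01 H]; have [_ h1] := H _ (floor01_rounding f').
    have [_ h2] := H _ (ceil01_rounding f').
    by move: h1 h2; rewrite /floor01 /ceil01; case: e {c ch IH H fD} => [/eqP //|_ /negbFE/eqP].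
  by split; [exact: (vface _ _ c)|exact: (vface _ _ (cocubeC c))].
have [l' ch' le'] := IH v u v01 u01.
have c1 := one f g s t v (cocube_sub fD c) us sp (etrans wf.1 (esym wf.2)) t01 v01.
exists (Num.sqrt (seqlen s f g ^+ 2 + (t - v) ^+ 2) + l'); first exact: chain_cat c1 ch'.
rewrite -/a.
have -> : Num.sqrt (a ^+ 2 + (t - v) ^+ 2) = la * Num.sqrt ((a + l) ^+ 2 + (t - u) ^+ 2).
  rewrite -[in RHS](ger0_norm la0) -sqrtr_sqr -sqrtrM ?sqr_ge0 //; congr Num.sqrt.
  by rewrite {1}ea /v; ring.
have e2 : Num.sqrt (l ^+ 2 + (v - u) ^+ 2) = (1 - la) * Num.sqrt ((a + l) ^+ 2 + (t - u) ^+ 2).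
  have la1' : 0 <= 1 - la by lra.
  rewrite -[in RHS](ger0_norm la1') -sqrtr_sqr -sqrtrM ?sqr_ge0 //; congr Num.sqrt.
  by rewrite {1}el /v; ring.
by apply: (le_trans (lerD (lexx _) le')); rewrite e2; lra.
Qed.

Lemma face_convex D w e : convex_in V D -> doubled D w -> convex_in V (face_of D w e).
Proof.
move=> [DV [c Dc] conv] dD; split; first by move=> a [/DV].
  have [e1|e1] := eqVneq (c w) e; first by exists c.
  exists (flip_at w c); split; first exact: dD.
  by rewrite flip_at_eq; case: (c w) e e1 => -[].
move=> a b z [Da ea] [Db eb] Vz zab; split; first exact: conv Da Db Vz zab.
by case: (zab w) => ->.
Qed.

Lemma upd_pts D w f t : doubled D w -> 0 <= t <= 1 -> pts D f -> pts D (upd f w t).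
Proof. by move=> dD t01 /pts_cocube/(cocube_upd dD t01 t01)/pts_cocube. Qed.

Lemma upd_face_pts D w f (e : bool) : doubled D w -> pts D f ->
  pts (face_of D w e) (upd f w e%:R).
Proof. by move=> dD /pts_cocube/(cocube_face e dD)/pts_cocube. Qed.

Lemma face_coord D w (e : bool) (f : W -> R) : pts (face_of D w e) f -> f w = e%:R.
Proof.
move=> [f01 H]; have [_ h1] := H _ (floor01_rounding f).
have [_ h2] := H _ (ceil01_rounding f).
by move: h1 h2; rewrite /floor01 /ceil01; case: e {H} => [/eqP //|_ /negbFE/eqP].
Qed.

Lemma face_sub D w e : face_of D w e `<=` D.
Proof. by move=> c []. Qed.

(** [chain_lift] and [chain_face] give the two inequalities: the complex of [D] is the metric
    product of a face with [0, 1]. *)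
Lemma mdist_product D w (e : bool) x y px py : convex_in V D -> doubled D w ->
  inP D x -> inP D y -> crd px = upd (crd x) w e%:R -> crd py = upd (crd y) w e%:R ->
  mdist x y ^+ 2 = mdist px py ^+ 2 + (crd x w - crd y w) ^+ 2.
Proof.
move=> cD dD Dx Dy epx epy.
have Fx : inP (face_of D w e) px by rewrite /inP /= epx; exact: upd_face_pts.
have Fy : inP (face_of D w e) py by rewrite /inP /= epy; exact: upd_face_pts.
suff -> : mdist x y = Num.sqrt (mdist px py ^+ 2 + (crd x w - crd y w) ^+ 2).
  by rewrite sqrt_sumsq_sqr.
apply/eqP; rewrite eq_le; apply/andP; split; apply/ler_addgt0Pr => r r0.
  have [l c lt] := mdist_chain_in (face_convex e cD dD) Fx Fy r0.
  have [l' c' le'] := chain_lift dD c ((crdP x).1 w) ((crdP y).1 w).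
  move: c'; rewrite epx epy !upd_upd !upd_id // => c'.
  apply: (@le_trans _ _ l'); first by apply: mdist_le; apply: chain_sub c'; case: cD.
  apply: (le_trans le').
  apply: (@le_trans _ _ (Num.sqrt ((mdist px py + r) ^+ 2 + ((crd x w - crd y w) + 0) ^+ 2))).
    rewrite addr0; apply: ler_wsqrtr; rewrite lerD2r ler_sqr ?nnegrE ?(chain_ge0 c) ?addr_ge0 ?mdist_ge0 // ltW //.
  apply: (le_trans (minkowski2 _ _ _ _)).
  by rewrite lerD2l expr0n addr0 sqrtr_sqr ger0_norm // ltW.
have [l c lt] := mdist_chain_in cD Dx Dy r0.
have [l' c' le'] := chain_face e dD c.
apply: (@le_trans _ _ l); last exact: ltW.
apply: (le_trans _ le'); apply: ler_wsqrtr; rewrite lerD2r ler_sqr ?nnegrE ?mdist_ge0 ?(chain_ge0 c') //.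
rewrite -epx -epy in c'; apply: mdist_le; apply: chain_sub c'.
by move=> v /face_sub; case: cD => DV _ _ /DV.
Qed.

(** Squared distances add up over the two factors, and on an interval Stewart's relation is an
    equality. *)
Lemma cat0_product D w e : convex_in V D -> doubled D w ->
  cat0_on mdist (inP (face_of D w e)) -> cat0_on mdist (inP D).
Proof.
move=> cD dD gF x y Dx Dy r r01.
have [DV _ _] := cD.
have proj z : inP D z -> {pz : Pt | crd pz = upd (crd z) w e%:R /\ inP (face_of D w e) pz}.
  move=> Dz; have F := upd_face_pts e dD Dz.
  by exists (PtOf (pts_sub DV (pts_sub (@face_sub _ _ _) F))).
have [px [epx Fx]] := proj x Dx; have [py [epy Fy]] := proj y Dy.
have [m0 Fm0 Hm0] := gF px py Fx Fy r r01.
pose t := (1 - r) * crd x w + r * crd y w.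
have t01 : 0 <= t <= 1.
  have /andP[x0 x1] := (crdP x).1 w; have /andP[y0 y1] := (crdP y).1 w.
  by case/andP: r01 => r0 r1; rewrite /t; apply/andP; split; nra.
have Dm : pts D (upd (crd m0) w t) by apply: upd_pts => //; apply: (pts_sub _ Fm0); exact: face_sub.
exists (PtOf (pts_sub DV Dm)) => // z Dz.
have [pz [epz Fz]] := proj z Dz.
have := Hm0 pz Fz; rewrite /stewart.
rewrite (@mdist_product D w e z _ pz m0) //; last first.
  by rewrite /= upd_upd upd_id //; exact: (face_coord Fm0).
rewrite (mdist_product cD dD Dz Dx epz epx) (mdist_product cD dD Dz Dy epz epy).
rewrite (mdist_product cD dD Dx Dy epx epy) /= upd_eq /t.
lra.
Qed.

Definition box (P : seq W) (a : W -> bool) : set (W -> bool) :=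
  [set v | V v /\ forall w, w \notin P -> v w = a w].

Lemma box_convex P a : V a -> convex_in V (box P a).
Proof.
move=> Va; split; [by move=> v []|by exists a|].
move=> b c z [_ Hb] [_ Hc] Vz zbc; split=> // w wP.
by case: (zbc w) => ->; [exact: Hb|exact: Hc].
Qed.

Lemma inP_sub C D : C `<=` D -> inP C `<=` inP D.
Proof. by move=> s x; exact: pts_sub. Qed.

(** The vertices of the carrier of the wall [w] in [C]. *)
Definition doubling C w : set (W -> bool) := [set c | C c /\ C (flip_at w c)].

Lemma doubling_doubled C w : doubled (doubling C w) w.
Proof. by move=> c [Cc Cf]; split=> //; rewrite flip_atK. Qed.

(** For [z] between [a] and [b], replace these by [a'] and [b'] on the side of [z]; then
    [flip_at w z] is the median of [z] and of the flips of [a'] and [b']. *)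
Lemma doubling_convex C w : convex_in V C -> doubling C w !=set0 -> convex_in V (doubling C w).
Proof.
move=> [CV C0 conv] D0; split=> //; first by move=> c [/CV].
move=> a b z Da Db Vz zab.
have Cz : C z by apply: (conv a b) => //; [case: Da|case: Db].
have adj c : doubling C w c -> exists c', [/\ doubling C w c', c' w = z w &
    forall w', w' != w -> c' w' = c w'].
  move=> Dc; have [e|e] := eqVneq (c w) (z w); first by exists c.
  exists (flip_at w c); split; first exact: doubling_doubled.
    by rewrite flip_at_eq; case: (c w) (z w) e => -[].
  by move=> w' n; rewrite flip_at_neq.
have [a' [Da' ea' Ha']] := adj a Da; have [b' [Db' eb' Hb']] := adj b Db.
split=> //.
have -> : flip_at w z = fun v => majority (z v) (flip_at w a' v) (flip_at w b' v).
  apply/funext => v; have [->|n] := eqVneq v w.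
    by rewrite !flip_at_eq ea' eb' /majority; case: (z w).
  by rewrite !flip_at_neq // Ha' // Hb' //; case: (zab v) => ->; rewrite /majority;
    case: (a v) (b v) => -[].
apply: (conv (flip_at w a') (flip_at w b')); [by case: Da'|by case: Db'| |].
  by apply: medV => //; apply: CV; [case: Da'|case: Db'].
move=> v; have [->|n] := eqVneq v w.
  by rewrite !flip_at_eq ea' eb' /majority; left; case: (z w).
by rewrite !flip_at_neq // Ha' // Hb' //; case: (zab v) => ->; rewrite /majority;
  case: (a v) (b v) => -[]; auto.
Qed.

(** Cut the chain before the first step that leaves the value [e] at [w]: this step lies in a cube
    crossed by [w], so its first point belongs to the carrier. *)
Lemma chain_crossing C w (e : bool) (f g : W -> R) l : chain C f g l -> f w = e%:R -> g w <> e%:R ->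
  exists c l1 l2, [/\ chain C f c l1, chain C c g l2, l = l1 + l2 &
    pts (face_of (doubling C w) w e) c].
Proof.
elim=> {f g l} [//|f g h s l c us sp ch IH fe he].
have [ge|ge] := eqVneq (g w) e%:R.
  have [c' [l1 [l2 [c1 c2 -> Fc]]]] := IH ge he.
  by exists c', (seqlen s f g + l1), l2; split=> //; rewrite ?addrA //; exact: chain_cons.
exists f, 0, (seqlen s f g + l); split; [|exact: chain_cons|by rewrite add0r|].
  by apply: chain_nil; exact: cocube_l c.
have [f01 g01 H] := c; split=> // h' Rd.
have hw : h' w = e by case: (Rd w); rewrite fe; case: e {fe he ge IH} => [_ ->|->].
split=> //; split; first by apply: H; exact: joint_rounding_l.
apply: H => w'; have [->|n] := eqVneq w' w; last by rewrite flip_at_neq //; exact: joint_rounding_l.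
rewrite fe; split=> e1 e2; move: ge; rewrite e2; case: e e1 {fe he IH hw} => //=.
- by move/eqP; rewrite oner_eq0.
- by rewrite eqxx.
- by rewrite eqxx.
- by move/eqP; rewrite eq_sym oner_eq0.
Qed.

Lemma near_crossing C w (e : bool) x y r : convex_in V C -> inP C x -> inP C y ->
  crd x w = e%:R -> crd y w <> e%:R -> 0 < r ->
  exists2 c, inP (face_of (doubling C w) w e) c & mdist x c + mdist c y <= mdist x y + r.
Proof.
move=> cC Cx Cy xe ye r0; have [l ch lt] := mdist_chain_in cC Cx Cy r0.
have [c [l1 [l2 [c1 c2 el Fc]]]] := chain_crossing ch xe ye.
have CV : C `<=` V by case: cC.
have FV : face_of (doubling C w) w e `<=` V by move=> v [[/CV]].
exists (PtOf (pts_sub FV Fc)) => //.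
apply: (@le_trans _ _ l); last exact: ltW.
by rewrite el; apply: lerD; apply: mdist_le; [exact: (chain_sub CV c1)|exact: (chain_sub CV c2)].
Qed.

(** Induction on the number of coordinates. The box is the union of its two sides at [w] and of the
    carrier of [w], which is a smaller box times [0, 1]; these pieces are glued along the two faces
    of the carrier. *)
Lemma cat0_box n P a : (size P <= n)%N -> uniq P -> V a -> cat0_on mdist (inP (box P a)).
Proof.
elim: n P a => [|n IH] [|w P] a // Pn uP Va.
- move=> x y Bx By r r01.
  have eqa z : inP (box [::] a) z -> crd z = vtx R a.
    move=> [z01 H]; apply/funext => v; have [_ h1] := H _ (floor01_rounding (crd z)).
    have [_ h2] := H _ (ceil01_rounding (crd z)).
    have := h1 v isT; have := h2 v isT; rewrite /floor01 /ceil01 /vtx.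
    by case: (a v) => [_ /eqP|/negbFE/eqP].
  have eqz z z' : inP (box [::] a) z -> inP (box [::] a) z' -> z = z'.
    by move=> /eqa e1 /eqa e2; apply: Pt_eq; rewrite e1 e2.
  exists x => // z Bz; rewrite (eqz y x) // (eqz z x) // /stewart mdistxx; lra.
- exact: IH.
have /andP[wP uP'] : (w \notin P) && uniq P by [].
have [[a' Ba' aw]|no] := pselect (exists2 a', box (w :: P) a a' & a' w <> a w); last first.
  suff -> : box (w :: P) a = box P a by exact: IH.
  apply/seteqP; split=> v [Vv Hv]; split=> // w'; last first.
    by rewrite inE negb_or => /andP[_ /Hv].
  have [-> _|n' w'P] := eqVneq w' w; last by apply: Hv; rewrite inE negb_or n'.
  by apply: contrapT => vw; apply: no; exists v.
have [Va' Ha'] := Ba'.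
pose K := box (w :: P) a; pose D := doubling K w.
have cK : convex_in V K by exact: box_convex.
have Ka : K a by [].
have D0 : D !=set0.
  (* On the way from [a] to [a'] inside the box some edge crosses [w], so the carrier is
     nonempty. *)
  have [] // : a' w = a w \/ D !=set0.
  apply: (flip_ind finV stepV (P := fun c => c w = a w \/ D !=set0) Va Va'); last by left.
  move=> c v Vc cab av cv Vf [cw|]; last by right.
  have Kc : K c.
    by split=> // v' nP; case: (cab v') => -> //; exact: Ha'.
  have [ev|nv] := eqVneq v w; last by left; rewrite flip_at_neq // eq_sym.
  subst v; right; exists c; split=> //; split=> // v' nP.
  rewrite flip_at_neq; first by case: Kc => _; apply.
  by apply: contraNneq nP => ->; rewrite mem_head.
have cD : convex_in V D by exact: doubling_convex.
have dD : doubled D w by exact: doubling_doubled.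
have gF e : cat0_on mdist (inP (face_of D w e)).
  have cF := face_convex e cD dD; have [FV [c0 Fc0] _] := cF.
  (* The face is itself a box, over the coordinates of [P] that vary on it: a vertex agreeing with
     [c0] at all others is its own gate. *)
  pose P2 := [seq w' <- P | `[< exists2 c, face_of D w e c & c w' <> c0 w' >]].
  suff -> : face_of D w e = box P2 c0.
    apply: IH; last exact: FV.
      by rewrite size_filter; apply: leq_trans (count_size _ _) _.
    by rewrite filter_uniq.
  apply/seteqP; split=> [c Fc|v [Vv Hv]].
    split=> [|w']; first exact: FV.
    rewrite mem_filter negb_and => /orP[/asboolPn nex|w'P].
      by apply: contrapT => ne; apply: nex; exists c.
    have [->|n'] := eqVneq w' w; first by rewrite (proj2 Fc) (proj2 Fc0).
    have w'n : w' \notin w :: P by rewrite inE negb_or n'.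
    by rewrite (proj2 (proj1 (proj1 Fc)) w' w'n) (proj2 (proj1 (proj1 Fc0)) w' w'n).
  have F0 : face_of D w e !=set0 by exists c0.
  have nP2 w' e' : const_on (face_of D w e) w' e' -> v w' = e'.
    move=> k; rewrite Hv ?(k c0 Fc0) // mem_filter negb_and; apply/orP; left.
    by apply/asboolPn => -[c Fc]; rewrite (k c Fc) (k c0 Fc0).
  suff -> : v = gate_vtx (face_of D w e) v by exact: (gate_vtx_in medV finV).
  apply/funext => w'.
  have [k1|k1] := pselect (const_on (face_of D w e) w' true).
    by rewrite (gate_vtx_const _ F0 k1); exact: nP2.
  have [k0|k0] := pselect (const_on (face_of D w e) w' false).
    by rewrite (gate_vtx_const _ F0 k0); exact: nP2.
  by rewrite gate_vtx_free.
have gD : cat0_on mdist (inP D) by exact: cat0_product (gF true).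
have gA : cat0_on mdist (inP (box P a)) by exact: IH.
have gB : cat0_on mdist (inP (box P a')) by exact: IH.
have boxE b : K b -> forall v, box P b v <-> K v /\ v w = b w.
  move=> [Vb Hb] v; split=> [[Vv Hv]|[[Vv Hv] vw]].
    split; last exact: Hv.
    split=> // w' w'n; rewrite Hv ?Hb //; by move: w'n; rewrite inE negb_or => /andP[].
  split=> // w' w'P; have [->//|n'] := eqVneq w' w.
  by rewrite Hv ?Hb // inE negb_or n'.
have FA b : K b -> face_of D w (b w) `<=` box P b.
  by move=> Kb v [[Kv _] vw]; apply/(boxE b Kb).
have inPbox b z : K b -> inP K z -> crd z w = (b w)%:R -> inP (box P b) z.
  move=> Kb [z01 H] zw; split=> // h Rd; apply/(boxE b Kb); split; first exact: H.
  by case: (Rd w); rewrite zw; case: (b w) => [_ ->|->].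
have coord_box b z : K b -> inP (box P b) z -> crd z w = (b w)%:R.
  move=> Kb [z01 H]; have [_ h1] := H _ (floor01_rounding (crd z)).
  have [_ h2] := H _ (ceil01_rounding (crd z)).
  have := h1 w wP; have := h2 w wP; rewrite /floor01 /ceil01.
  by case: (b w) => [_ /eqP|/negbFE/eqP].
have boxK b : K b -> inP (box P b) `<=` inP K.
  by move=> Kb; apply: inP_sub => v /(boxE b Kb)[].
have DK : inP D `<=` inP K by apply: inP_sub => v [].
have dist_ax := (mdist_ge0, mdistxx).
(* [near_crossing] gives points of the face with arbitrarily small excess; completeness and
   convexity give an exact one. *)
have cross1 b E : K b -> inP (face_of D w (b w)) `<=` E -> E `<=` inP K ->
    (forall z, E z -> crd z w = (b w)%:R -> inP (face_of D w (b w)) z) ->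
    cat0_on mdist E -> cat0_on mdist (inP (box P b)) ->
    crosses_at mdist (inP (box P b)) E (inP (face_of D w (b w))).
  move=> Kb FE EK Ew gE gb x y Bx Ey.
  have [yw|yw] := eqVneq (crd y w) (b w)%:R.
    by exists y; [exact: Ew|rewrite mdistxx addr0].
  apply: (exact_crossing mdist_ge0 mdistC mdist_triangle).
  - by apply: model_complete => v [[[]]].
  - move=> p q Fp Fq.
    have r2 : 0 <= (2^-1 : R) <= 1 by rewrite invr_ge0 ler0n invf_le1 ?ler1n ?ltr0n.
    have [m Fm Hm] := cat0_on_common mdist_ge0 mdistxx mdistC mdist_triangle
      (inP_sub (FA b Kb)) FE gb gE (gF (b w)) Fp Fq r2.
    by exists m => //; split; apply: Hm; [left|right].
  - move=> r r0; apply: (near_crossing cK) => //; [exact: boxK Bx|exact: EK|exact: coord_box|].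
    exact/eqP.
have FD e : inP (face_of D w e) `<=` inP D by apply: inP_sub; exact: face_sub.
have Dw (e : bool) z : inP D z -> crd z w = e%:R -> inP (face_of D w e) z.
  move=> [z01 H] zw; split=> // h Rd; split; first exact: H.
  by case: (Rd w); rewrite zw; case: (e) => [_ ->|->].
have gE : cat0_on mdist (inP (box P a) `|` inP D).
  apply: (cat0_on_glue mdist_ge0 mdistxx mdistC mdist_triangle
    (inP_sub (FA a Ka)) (FD (a w)) gA gD (gF (a w))).
  by apply: cross1 => // z; exact: Dw.
(* A point with fractional coordinate at [w] lies in the carrier, any other point on one of the two
   sides. *)
have -> : inP K = (inP (box P a) `|` inP D) `|` inP (box P a').
  apply/seteqP; split=> [z Kz|z [[/(boxK a Ka)|/DK]|/(boxK a' Ba')]] //.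
  have aa' : a' w = ~~ a w by case: (a w) (a' w) aw => -[].
  have vert (b : bool) : crd z w = b%:R -> inP (box P a) z \/ inP (box P a') z.
    have [->|n'] := eqVneq b (a w); first by left; exact: inPbox.
    move=> zb; right; apply: inPbox => //; rewrite zb aa'; congr (_%:R).
    by case: (b) (a w) n' => -[].
  case: (coord_cases z w) => [z0|z1|/andP[z0 z1]].
  - by case: (vert false z0) => ?; [left; left|right].
  - by case: (vert true z1) => ?; [left; left|right].
  left; right; have [z01 H] := Kz; split=> // h Rd; split; first exact: H.
  apply: H => w'; have [->|n'] := eqVneq w' w; last by rewrite flip_at_neq //; exact: Rd.
  by split=> e; move: z0 z1; rewrite e ltxx.
apply: (cat0_on_glue mdist_ge0 mdistxx mdistC mdist_triangle (C := inP (face_of D w (a' w)))) => //.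
- by move=> z /FD; right.
- exact: inP_sub (FA a' Ba').
apply: crosses_atC; first exact: mdistC.
apply: cross1 => //.
- by move=> z /FD; right.
- by move=> z [/(boxK a Ka)|/DK].
- move=> z [/(coord_box a z Ka) ->|]; last exact: Dw.
  by move=> e; exfalso; apply: aw; move/eqP: e; rewrite eqr_nat; case: (a w) (a' w) => -[].
Qed.

(** Finitely many points lie in a common finite box, and by uniqueness the dividing point found in
    one box is the right one in every larger box. *)
Lemma cat0_model : cat0_on mdist setT.
Proof.
move=> x y _ _ r r01.
have Va := (crdP x).2 _ (floor01_rounding (crd x)).
set a := floor01 (crd x) in Va.
have cover z : exists s : seq W, forall s', (forall w, w \in s -> w \in s') -> inP (box s' a) z.
  have Vz := (crdP z).2 _ (floor01_rounding (crd z)).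
  have [s1 H1] := fractional_finite finV (crdP z); have [s2 H2] := finV Va Vz.
  exists (s1 ++ s2) => s' sub; split=> [|h Rd]; first exact: (crdP z).1.
  split; first exact: (crdP z).2.
  move=> w ws; have : w \notin s1 ++ s2 by apply: contra ws; exact: sub.
  rewrite mem_cat negb_or => /andP[/H1 zw /H2 ->]; rewrite /floor01.
  by case: (Rd w) => h0 h1; case: zw => zw; rewrite zw ?(h0 zw) ?(h1 zw) ?eqxx // eq_sym oner_eq0.
have [sx Hx] := cover x; have [sy Hy] := cover y.
have ubox s : cat0_on mdist (inP (box (undup s) a)) by apply: cat0_box => //; exact: undup_uniq.
pose s0 := sx ++ sy.
have [m _ Hm] : exists2 m, inP (box (undup s0) a) m &
    forall z, inP (box (undup s0) a) z -> stewart mdist z x y r m.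
  by apply: ubox => //; [apply: Hx|apply: Hy] => w; rewrite mem_undup mem_cat => ->; rewrite ?orbT.
have xin s : inP (box (undup (s0 ++ s)) a) x.
  by apply: Hx => w; rewrite mem_undup !mem_cat => ->.
have yin s : inP (box (undup (s0 ++ s)) a) y.
  by apply: Hy => w; rewrite mem_undup !mem_cat => ->; rewrite orbT.
have xin0 : inP (box (undup s0) a) x by have := xin [::]; rewrite cats0.
have yin0 : inP (box (undup s0) a) y by have := yin [::]; rewrite cats0.
exists m => // z _.
have [sz Hz] := cover z; have [sm Hsm] := cover m.
pose s := sz ++ sm.
have [m' _ Hm'] : exists2 m', inP (box (undup (s0 ++ s)) a) m' &
    forall z, inP (box (undup (s0 ++ s)) a) z -> stewart mdist z x y r m'.
  by apply: ubox.
have e : mdist m' m = 0.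
  apply: (stewart_unique mdist_ge0 mdistC r01).
  - by apply: Hm'; apply: Hsm => w; rewrite mem_undup !mem_cat => ->; rewrite !orbT.
  - by apply: (stewart_left mdist_ge0 mdistxx r01); exact: Hm.
  - by apply: (stewart_right mdist_ge0 mdistxx mdistC r01); exact: Hm.
have -> : m = m' by apply/esym; exact: mdist_eq0.
by apply: Hm'; apply: Hz => w; rewrite mem_undup !mem_cat => ->; rewrite !orbT.
Qed.

End CatZeroModel.

(** * Fixed rays *)

Lemma ratio01 (R : realFieldType) (s t : R) : 0 <= s -> s <= t -> 0 < t -> 0 <= s / t <= 1.
Proof. by move=> s0 st t0; rewrite divr_ge0 ?(ltW t0) //= ler_pdivrMr // mul1r. Qed.

Section SteepestRay.
Variables (R : realType) (T : Type) (d : T -> T -> R).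
Hypothesis d_ge0 : forall x y, 0 <= d x y.
Hypothesis dxx : forall x, d x x = 0.
Hypothesis d_eq0 : forall x y, d x y = 0 -> x = y.
Hypothesis dC : forall x y, d x y = d y x.
Hypothesis d_triangle : forall x y z, d x z <= d x y + d y z.
Hypothesis cat0 : cat0_on d setT.
Hypothesis complete : complete_on d setT.

Definition divides x y r m := forall z, stewart d z x y r m.

Lemma divides_exists x y r : 0 <= r <= 1 -> exists m, divides x y r m.
Proof. by move=> r01; have [m _ Hm] := cat0 (x := x) (y := y) I I r01; exists m => z; exact: Hm. Qed.

Lemma divides_left x y r m : 0 <= r <= 1 -> divides x y r m -> d x m = r * d x y.
Proof.
move=> r01 D; have h1 := stewart_left d_ge0 dxx r01 (D x).
have h2 := stewart_right d_ge0 dxx dC r01 (D y).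
by apply/eqP; rewrite eq_le h1 /=; have := d_triangle x m y; rewrite (dC m y); lra.
Qed.

Lemma divides_right x y r m : 0 <= r <= 1 -> divides x y r m -> d m y = (1 - r) * d x y.
Proof.
move=> r01 D; have h1 := stewart_left d_ge0 dxx r01 (D x).
have h2 := stewart_right d_ge0 dxx dC r01 (D y).
rewrite dC; apply/eqP; rewrite eq_le h2 /=; have := d_triangle x m y; rewrite (dC m y); lra.
Qed.

Lemma divides_unique x y r m m' : 0 <= r <= 1 -> divides x y r m ->
  d x m' <= r * d x y -> d m' y <= (1 - r) * d x y -> m' = m.
Proof.
move=> r01 D h1 h2; apply: d_eq0; rewrite dC.
by apply: (stewart_unique d_ge0 dC r01 (D m')) => //; rewrite dC.
Qed.

Lemma divides_sub x y r r' m m' : 0 < r -> r <= 1 -> 0 <= r' -> r' <= r ->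
  divides x y r m -> divides x y r' m' -> divides x m (r' / r) m'.
Proof.
move=> r0 r1 r'0 r'r D D'.
have r01 : 0 <= r <= 1 by rewrite ltW.
have r'01 : 0 <= r' <= 1 by rewrite r'0 (le_trans r'r).
have q01 : 0 <= r' / r <= 1 by rewrite divr_ge0 ?(ltW r0) //= ler_pdivrMr // mul1r.
have [q Dq] := divides_exists x m q01.
have <- // : q = m'.
have ql := divides_left q01 Dq; have qr := divides_right q01 Dq.
have ml := divides_left r01 D; have mr := divides_right r01 D.
apply: (divides_unique r'01 D').
  by rewrite ql ml mulrA divfK // gt_eqF.
apply: (le_trans (d_triangle q m y)); rewrite qr mr ml.
have -> : (1 - r' / r) * (r * d x y) = (r - r') * d x y by field; rewrite gt_eqF.
lra.
Qed.

Lemma divides_thin x y y' r m m' : 0 <= r <= 1 ->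
  divides x y r m -> divides x y' r m' -> d m m' <= r * d y y'.
Proof.
move=> r01 D D'; have /andP[r0 r1] := r01.
rewrite -ler_sqr ?nnegrE ?mulr_ge0 //.
have := D' m; have := D y'; rewrite /stewart (dC m x) (dC m y') (dC y' x) (dC y' y).
rewrite (divides_left r01 D) => h1 h2; nra.
Qed.

Lemma divides_sym x y r m : divides x y r m -> divides y x (1 - r) m.
Proof. by move=> D z; apply: (stewart_sym dC). Qed.

(** The quadrilateral is cut along the diagonal from [x] to [y'], and [divides_thin] is applied to
    both triangles. *)
Lemma divides_busemann x y x' y' r m m' : 0 <= r <= 1 ->
  divides x y r m -> divides x' y' r m' -> d m m' <= (1 - r) * d x x' + r * d y y'.
Proof.
move=> r01 D D'; have [q Dq] := divides_exists x y' r01.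
have r01' : 0 <= 1 - r <= 1 by case/andP: r01 => ? ?; apply/andP; split; lra.
have h1 := divides_thin r01 D Dq.
have h2 := divides_thin r01' (divides_sym Dq) (divides_sym D').
by apply: (le_trans (d_triangle m q m')); lra.
Qed.

Variables (o : T) (Q : T -> R -> Prop).
(* [Q x t] stands for [b x <= t], where [b] is a convex 1-Lipschitz function. *)
Hypothesis Q_mono : forall x s t, Q x s -> s <= t -> Q x t.
Hypothesis Q_lip : forall x y t, Q x t -> Q y (t + d x y).
Hypothesis Q_conv : forall x y s t r m, Q x s -> Q y t -> 0 <= r <= 1 -> divides x y r m ->
  Q m ((1 - r) * s + r * t).
Hypothesis Q_low : forall x t, Q x t -> - d o x <= t.
Variable K : R.
Hypothesis K_gt0 : 0 < K.
Hypothesis Q_far : forall n : nat, exists2 x, d o x <= K * n%:R & Q x (- n%:R).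

Definition drops t := [set s | exists2 x, d o x <= t & Q x (- s)].
Definition drop t : R := sup (drops t).

Lemma Q_o : Q o 0.
Proof.
have [x] := Q_far 0; rewrite mulr0 => h q; have := d_ge0 o x => h'.
have e : d o x = 0 by apply/eqP; rewrite eq_le h h'.
by rewrite (d_eq0 e); rewrite oppr0 in q.
Qed.

Lemma drops_ub t : ubound (drops t) t.
Proof. by move=> s [x xt /Q_low]; lra. Qed.

Lemma drops_sup t : 0 <= t -> has_sup (drops t).
Proof.
move=> t0; split; last by exists t; exact: drops_ub.
by exists 0; exists o; rewrite ?dxx // oppr0; exact: Q_o.
Qed.

Lemma le_drop x s t : d o x <= t -> Q x (- s) -> s <= drop t.
Proof.
move=> xt q; apply: (sup_upper_bound (drops_sup _)); last by exists x.
exact: le_trans xt.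
Qed.

Lemma drop_gt t s : 0 <= t -> s < drop t -> exists2 x, d o x <= t & Q x (- s).
Proof.
move=> t0 h; have e0 : 0 < drop t - s by rewrite subr_gt0.
have [s' [x xt q] lt] := sup_adherent e0 (drops_sup t0); exists x => //.
by apply: (Q_mono q); rewrite -/(drop t) in lt; lra.
Qed.

Lemma drop_star t t' : 0 < t' -> t' <= t -> t' / t * drop t <= drop t'.
Proof.
move=> t'0 t't; have t0 : 0 < t by exact: lt_le_trans t't.
have r01 : 0 <= t' / t <= 1 by apply: ratio01 => //; exact: ltW.
have p : 0 < t' / t by rewrite divr_gt0.
rewrite mulrC -ler_pdivlMr //; apply: ge_sup; first by case: (drops_sup (ltW t0)).
move=> s [x xt q]; rewrite ler_pdivlMr //.
have [m D] := divides_exists o x r01.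
apply: (@le_drop m).
  rewrite (divides_left r01 D); apply: (le_trans (ler_wpM2l (ltW p) xt)).
  by rewrite divfK // gt_eqF.
have := Q_conv Q_o q r01 D; rewrite mulr0 add0r mulrN.
by rewrite mulrC.
Qed.

(** By convexity [drop t / t] is nonincreasing ([drop_slope_mono]), so its infimum is its limit: the
    maximal rate of descent at infinity. *)
Definition slopes := [set drop t / t | t in [set t | 1 <= t]].
Definition slope : R := inf slopes.

Lemma drop_slope_mono t t' : 0 < t -> t <= t' -> drop t' / t' <= drop t / t.
Proof.
move=> t0 tt'; have t'0 : 0 < t' by exact: lt_le_trans tt'.
by rewrite ler_pdivlMr // mulrC mulrA [_ * drop t' / _]mulrAC; exact: drop_star.
Qed.

Lemma slope_bound t : 1 <= t -> (2 * K)^-1 <= drop t / t.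
Proof.
(* With [t' >= K] the integer part [n] of [t' / K] is at least 1, hence at least half of [t' / K];
   this is the origin of the factor 2. *)
move=> t1; pose t' := Num.max t K.
have tt' : t <= t' by rewrite le_max lexx.
have Kt' : K <= t' by rewrite le_max lexx orbT.
have t0 : 0 < t by lra.
have t'0 : 0 < t' by lra.
apply: le_trans (drop_slope_mono t0 tt').
pose n := Num.truncn (t' / K).
have h0 : 0 <= t' / K by rewrite divr_ge0 // ltW.
have /andP[n1 n2] := truncn_itv h0; rewrite -/n in n1 n2.
have n3 : 1 <= n%:R :> R.
  by rewrite ler1n /n truncn_gt0 ler_pdivlMr // mul1r.
rewrite ler_pdivlMr // -div1r -mulrA mul1r.
have [x xn q] := Q_far n.
have h : n%:R <= drop t'.
  apply: (@le_drop x) => //; apply: (le_trans xn).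
  by rewrite mulrC -ler_pdivlMr.
apply: le_trans h; rewrite mulrC ler_pdivrMr ?mulr_gt0 //.
move: n2; rewrite -natr1 ltr_pdivrMr // => n2; nra.
Qed.

Lemma slopes_has_inf : has_inf slopes.
Proof.
split; first by exists (drop 1 / 1); exists 1 => /=.
by exists (2 * K)^-1 => _ [t /= t1 <-]; exact: slope_bound.
Qed.

Lemma slope_gt0 : 0 < slope.
Proof.
apply: (@lt_le_trans _ _ (2 * K)^-1); first by rewrite invr_gt0 mulr_gt0.
by apply: lb_le_inf; [case: slopes_has_inf|move=> _ [t /= t1 <-]; exact: slope_bound].
Qed.

Lemma slope_le_drop t : 1 <= t -> slope * t <= drop t.
Proof.
move=> t1; rewrite -ler_pdivlMr; last lra.
by apply: ge_inf; [case: slopes_has_inf|exists t].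
Qed.

Lemma drop_le_slope e : 0 < e -> exists2 t0, 1 <= t0 & forall t, t0 <= t -> drop t <= (slope + e) * t.
Proof.
move=> e0; have [_ [t /= t1 <-] lt] := inf_adherent e0 slopes_has_inf; exists t => // t' tt'.
rewrite -ler_pdivrMr; last lra.
by apply: (le_trans (drop_slope_mono _ tt')); [lra|exact: ltW].
Qed.

(* Points far out along which the function decays almost at the maximal rate point in almost the same direction: otherwise their midpoint would decay too fast. *)
Lemma steepest_close e : 0 < e -> exists dl s0, [/\ 0 < dl, 1 <= s0 &
  forall t x y, s0 <= t -> d o x <= t -> d o y <= t ->
    Q x (- ((slope - dl) * t)) -> Q y (- ((slope - dl) * t)) -> d x y <= e * t].
Proof.
move=> e0; pose e' := Num.min e 1.
have e'0 : 0 < e' by rewrite lt_min e0 /=.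
have e'e : e' <= e by rewrite ge_min lexx.
have e'1 : e' <= 1 by rewrite ge_min lexx orbT.
have a0 := slope_gt0; set a := slope in a0 *.
(* The midpoint of two points more than [e * t] apart lies within [(1 - e' ^+ 2 / 8) * t] of [o]. A
   rate above [a - dl] is then impossible as soon as [2 * dl] is less than [a * (e' ^+ 2 / 8)]. *)
pose dl := a * (e' ^+ 2 / 32).
have dl0 : 0 < dl by rewrite mulr_gt0 // divr_gt0 // exprn_gt0.
have [t0 t01 Ht0] := drop_le_slope dl0.
exists dl, (2 * t0); split=> //; first lra.
move=> t x y t0t ox oy qx qy; rewrite leNgt; apply/negP => D.
have tp : 0 < t by lra.
have r01 : 0 <= (2^-1 : R) <= 1 by rewrite invr_ge0 ler0n invf_le1 ?ler1n ?ltr0n.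
have [m Dm] := divides_exists x y r01.
have qm := Q_conv qx qy r01 Dm.
have e2 : e' ^+ 2 <= 1 by rewrite expr_le1 // ltW.
have e20 : 0 < e' ^+ 2 by rewrite exprn_gt0.
pose c := 1 - e' ^+ 2 / 8.
have c0 : 0 <= c by rewrite /c; lra.
have om2 : d o m ^+ 2 <= (c * t) ^+ 2.
  have h0 := Dm o; rewrite /stewart in h0; apply: (le_trans h0).
  have h1 : d o x ^+ 2 <= t ^+ 2 by rewrite ler_sqr ?nnegrE //; exact: ltW.
  have h2 : d o y ^+ 2 <= t ^+ 2 by rewrite ler_sqr ?nnegrE //; exact: ltW.
  have h3 : (e' * t) ^+ 2 <= d x y ^+ 2.
    have et0 : 0 <= e' * t by apply: mulr_ge0; exact: ltW.
    rewrite ler_sqr ?nnegrE // ltW //; apply: le_lt_trans D.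
    by rewrite ler_wpM2r // ltW.
  have e3 : (c * t) ^+ 2 = t ^+ 2 - (e' * t) ^+ 2 / 4 + (e' ^+ 2 * t) ^+ 2 / 64.
    by rewrite /c; field.
  rewrite e3; have := sqr_ge0 (e' ^+ 2 * t); lra.
have om : d o m <= c * t.
  have ct0 : 0 <= c * t by rewrite mulr_ge0 // ltW.
  by move: om2; rewrite ler_sqr ?nnegrE.
have h := @le_drop m ((a - dl) * t) (c * t) om.
have q' : Q m (- ((a - dl) * t)) by apply: (Q_mono qm); lra.
have := h q'; have ct : t0 <= c * t by rewrite /c; nra.
have := Ht0 _ ct; rewrite -/a => h1 h2.
have h3 : (a - dl) * t <= ((a + dl) * c) * t by lra.
rewrite ler_pM2r // /c /dl in h3.
move: h3; have := mulr_gt0 a0 e20; set u := e' ^+ 2 in e2 e20 *; nra.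
Qed.

Definition seq_far n x := d o x <= n.+1%:R /\ Q x (- (slope * n.+1%:R - 1)).

Lemma seq_far_exists n : exists x, seq_far n x.
Proof.
have n1 : 1 <= n.+1%:R :> R by rewrite ler1n.
have [||x ox q] := @drop_gt n.+1%:R (slope * n.+1%:R - 1); [lra| |by exists x].
by have := slope_le_drop n1; lra.
Qed.

(** The points [Y n s] of the segments from [o] to nearly optimal points [x n] form Cauchy sequences
    by [steepest_close]. The limit has unit speed because a nearly optimal [x n] must be at distance
    about [n.+1] from [o]. The constant 2 is 1 from [seq_far] and 1 from the passage to the
    limit. *)
Lemma exists_steepest_ray : exists rho : R -> T,
  [/\ forall s t, 0 <= s -> 0 <= t -> d (rho s) (rho t) = `|s - t|,
      forall t, 0 <= t -> d o (rho t) <= t &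
      forall t, 0 <= t -> Q (rho t) (- (slope * t - 2))].
Proof.
have a0 := slope_gt0; set a := slope in a0 *.
have [x Hx] := choice seq_far_exists.
have n1 n : 1 <= n.+1%:R :> R by rewrite ler1n.
have np n : 0 < n.+1%:R :> R by rewrite ltr0n.
have exY (p : nat * R) : exists m, 0 <= p.2 -> p.2 <= p.1.+1%:R ->
    divides o (x p.1) (p.2 / p.1.+1%:R) m.
  have [/andP[h1 h2]|h] := boolP (0 <= p.2 <= p.1.+1%:R); last first.
    by exists o => h1 h2; rewrite h1 h2 in h.
  have [|m D] := @divides_exists o (x p.1) (p.2 / p.1.+1%:R); last by exists m.
  exact: ratio01.
have [Y0 HY0] := choice exY; pose Y n s := Y0 (n, s).
have HY n s : 0 <= s -> s <= n.+1%:R -> divides o (x n) (s / n.+1%:R) (Y n s).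
  exact: (HY0 (n, s)).
have r01 n (s : R) : 0 <= s -> s <= n.+1%:R -> 0 <= s / n.+1%:R <= 1.
  by move=> h1 h2; exact: ratio01.
have Yo n s : 0 <= s -> s <= n.+1%:R -> d o (Y n s) = s / n.+1%:R * d o (x n).
  by move=> h1 h2; exact: divides_left (r01 _ _ h1 h2) (HY _ _ h1 h2).
have Yle n s : 0 <= s -> s <= n.+1%:R -> d o (Y n s) <= s.
  move=> h1 h2; rewrite Yo //; have [ox _] := Hx n.
  apply: (@le_trans _ _ (s / n.+1%:R * n.+1%:R)).
    by rewrite ler_wpM2l // divr_ge0.
  by rewrite divfK // gt_eqF.
have YQ n s : 0 <= s -> s <= n.+1%:R -> Q (Y n s) (- (a * s - 1)).
  move=> h1 h2; have [_ q] := Hx n.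
  have := Q_conv Q_o q (r01 _ _ h1 h2) (HY _ _ h1 h2); rewrite mulr0 add0r => q'.
  apply: (Q_mono q').
  have -> : s / n.+1%:R * - (slope * n.+1%:R - 1) = - (a * s) + s / n.+1%:R.
    by rewrite -/a; move: (n.+1%:R) (np n) => tn tnp; field; rewrite gt_eqF.
  have /andP[_ h3] := r01 n s h1 h2; move: (s / n.+1%:R) h3 => sn h3; lra.
have Ysub n s t : 0 <= s -> s <= t -> 0 < t -> t <= n.+1%:R -> divides o (Y n t) (s / t) (Y n s).
  move=> h1 h2 h3 h4.
  have -> : s / t = (s / n.+1%:R) / (t / n.+1%:R).
    by move: (n.+1%:R) (np n) => tn tnp; field; rewrite !gt_eqF.
  apply: (@divides_sub o (x n)) (HY _ _ _ _) (HY _ _ _ _) => //.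
  - by rewrite divr_gt0.
  - by rewrite ler_pdivrMr // mul1r.
  - by rewrite divr_ge0.
  - by rewrite ler_pM2r // invr_gt0.
  - exact: ltW.
  - exact: le_trans h4.
have Yclose (e : R) : 0 < e -> exists2 s0, 1 <= s0 & forall s1 n k s, s0 <= s1 ->
    s1 <= n.+1%:R -> s1 <= k.+1%:R -> 0 <= s -> s <= s1 -> d (Y n s) (Y k s) <= e * s.
  move=> e0; have [dl [s0 [dl0 s01 H]]] := steepest_close e0.
  exists (Num.max s0 dl^-1); first by rewrite le_max s01.
  move=> s1 n k s; rewrite ge_max => /andP[h1 h2] h3 h4 s_ge0 ss1.
  have s1p : 0 < s1 by lra.
  have dls : 1 <= dl * s1 by rewrite mulrC -ler_pdivrMr // div1r.
  have big : d (Y n s1) (Y k s1) <= e * s1.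
    by apply: H => //; [exact: Yle (ltW s1p) _|exact: Yle (ltW s1p) _| |];
      apply: (Q_mono (YQ _ _ (ltW s1p) _)) => //; rewrite -/a; lra.
  have q01 : 0 <= s / s1 <= 1 by exact: ratio01.
  have := divides_thin q01 (Ysub n s s1 s_ge0 ss1 s1p h3) (Ysub k s s1 s_ge0 ss1 s1p h4).
  move/le_trans; apply; apply: (@le_trans _ _ (s / s1 * (e * s1))).
    by rewrite ler_wpM2l //; case/andP: q01.
  by have -> : s / s1 * (e * s1) = e * s by field; rewrite gt_eqF.
have bign (t : R) : exists n0, forall n, (n0 <= n)%N -> t <= n.+1%:R.
  exists (Num.truncn t) => n h; apply: (@le_trans _ _ (Num.truncn t).+1%:R).
    by apply: ltW; exact: truncnS_gt.
  by rewrite ler_nat.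
have exlim (s : R) : exists l, 0 <= s -> forall e, 0 < e -> exists n, forall m, (n <= m)%N -> d (Y m s) l <= e.
  have [s0|] := boolP (0 <= s); last by exists o.
  have [||l _ Hl] := @complete (fun n => Y n s); [by []| |by exists l].
  move=> e e0; have e1 : 0 < e / (s + 1) by rewrite divr_gt0 // ltr_wpDl.
  have [s1 s11 H] := Yclose _ e1.
  have [n0 Hn0] := bign (Num.max s1 s); exists n0 => m k mn kn.
  apply: (@le_trans _ _ (e / (s + 1) * s)).
    apply: (H (Num.max s1 s)) => //; try exact: Hn0.
      by rewrite le_max lexx.
    by rewrite le_max lexx orbT.
  have -> : e / (s + 1) * s = e * (s / (s + 1)) by field; rewrite gt_eqF // ltr_wpDl.
  by rewrite -[leRHS]mulr1 ler_wpM2l ?(ltW e0) // ler_pdivrMr ?ltr_wpDl // mul1r lerDl.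
have [rho Hrho] := choice exlim.
have speed (e : R) : 0 < e -> exists n0, forall n, (n0 <= n)%N -> (1 - e) * n.+1%:R <= d o (x n).
  move=> e0; have e1 : 0 < a * e / 2 by rewrite divr_gt0 // mulr_gt0.
  have [t0 t01 Ht0] := drop_le_slope e1.
  have [n0 Hn0] := bign (Num.max ((t0 + 1) / a) (2 / (a * e))); exists n0 => n /Hn0.
  rewrite ge_max !ler_pdivrMr ?mulr_gt0 // => /andP[h1 h2].
  have [_ q] := Hx n; have low := Q_low q; rewrite -/a in q low.
  have v0 : t0 <= d o (x n) by lra.
  have h3 := le_drop (lexx _) q; have h4 := Ht0 _ v0; rewrite -/a in h4.
  rewrite leNgt; apply/negP => lt.
  have : (a + a * e / 2) * d o (x n) < (a + a * e / 2) * ((1 - e) * n.+1%:R).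
    by rewrite ltr_pM2l // addr_gt0.
  have : (a + a * e / 2) * ((1 - e) * n.+1%:R) <= a * n.+1%:R - 1.
    have -> : (a + a * e / 2) * ((1 - e) * n.+1%:R) = a * n.+1%:R - (n.+1%:R * (a * e)) / 2
       - (n.+1%:R * (a * e)) * e / 2 by field.
    have : 0 <= (n.+1%:R * (a * e)) * e / 2 by rewrite divr_ge0 ?mulr_ge0 ?ltW.
    lra.
  lra.
have lim2 s t e : 0 <= s -> 0 <= t -> 0 < e -> exists n0, forall n, (n0 <= n)%N ->
    `|d (rho s) (rho t) - d (Y n s) (Y n t)| <= e.
  move=> s0 t0 e0; have e2 : 0 < e / 2 by rewrite divr_gt0.
  have [n1' H1] := Hrho s s0 _ e2; have [n2' H2] := Hrho t t0 _ e2.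
  exists (maxn n1' n2') => n; rewrite geq_max => /andP[/H1 h1 /H2 h2].
  have := d_triangle (rho s) (Y n s) (rho t); have := d_triangle (Y n s) (Y n t) (rho t).
  have := d_triangle (Y n s) (rho s) (Y n t); have := d_triangle (rho s) (rho t) (Y n t).
  rewrite (dC (rho s) (Y n s)) (dC (rho t) (Y n t)) ler_norml; lra.
have geo s t : 0 <= s -> s <= t -> d (rho s) (rho t) = t - s.
  move=> s0 st; have t0 : 0 <= t by exact: le_trans st.
  have [tz|tn] := eqVneq t 0.
    have -> : s = t by apply/eqP; rewrite eq_le st tz s0.
    by rewrite dxx subrr.
  have tp : 0 < t by rewrite lt_def tn.
  have Yst n : t <= n.+1%:R -> d (Y n s) (Y n t) = (t - s) * (d o (x n) / n.+1%:R).
    move=> tn'; have q01 : 0 <= s / t <= 1 by exact: ratio01.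
    rewrite (divides_right q01 (Ysub n s t s0 st tp tn')) Yo //.
    by move: (n.+1%:R) (np n) => tm tmp; field; rewrite !gt_eqF.
  apply/eqP; rewrite eq_le; apply/andP; split; apply/ler_addgt0Pr => e e0.
    have [n0 H] := lim2 s t e s0 t0 e0; have [n1' H1] := bign t.
    have := H (maxn n0 n1') (leq_maxl _ _); rewrite Yst; last by apply: H1; exact: leq_maxr.
    set n := maxn n0 n1'; have [ox _] := Hx n.
    have : (t - s) * (d o (x n) / n.+1%:R) <= (t - s) * 1.
      by rewrite ler_wpM2l ?subr_ge0 // ler_pdivrMr // mul1r.
    by rewrite ler_norml; move: ((t - s) * (d o (x n) / n.+1%:R)) => P h /andP[]; lra.
  have e2 : 0 < e / 2 by rewrite divr_gt0.
  have e3 : 0 < e / 2 / (t - s + 1) by rewrite divr_gt0 // ltr_wpDl // subr_ge0.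
  have [n0 H] := lim2 s t _ s0 t0 e2; have [n1' H1] := bign t; have [n2' H2] := speed _ e3.
  pose n := maxn n0 (maxn n1' n2').
  have nn0 : (n0 <= n)%N by exact: leq_maxl.
  have nn1 : (n1' <= n)%N by rewrite /n maxnCA leq_maxl.
  have nn2 : (n2' <= n)%N by rewrite /n maxnA leq_maxr.
  have := H n nn0; rewrite Yst ?H1 // => h.
  have h2 : 1 - e / 2 / (t - s + 1) <= d o (x n) / n.+1%:R by rewrite ler_pdivlMr // H2.
  have := ler_wpM2l (_ : 0 <= t - s) h2; rewrite subr_ge0 => /(_ st).
  have : (t - s) * (e / 2 / (t - s + 1)) <= e / 2.
    rewrite mulrA ler_pdivrMr ?ltr_wpDl ?subr_ge0 // mulrC ler_pM2l // lerDl //.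
  move: h; rewrite ler_norml mulrBr mulr1.
  move: ((t - s) * (d o (x n) / n.+1%:R)) ((t - s) * (e / 2 / (t - s + 1))) => P P' /andP[]; lra.
exists rho; split.
- move=> s t s0 t0; have [st|st] := leP s t.
    by rewrite geo // distrC ger0_norm // subr_ge0.
  by rewrite dC geo ?(ltW st) // ger0_norm // subr_ge0 ltW.
- move=> t t0; apply/ler_addgt0Pr => e e0; have [n0 H] := Hrho t t0 e e0.
  have [n1' H1] := bign t; pose n := maxn n0 n1'.
  apply: (le_trans (d_triangle o (Y n t) (rho t))); apply: lerD.
    by apply: Yle => //; apply: H1; exact: leq_maxr.
  by apply: H; exact: leq_maxl.
- move=> t t0; have [n0 H] := Hrho t t0 1 ltr01.
  have [n1' H1] := bign t; pose n := maxn n0 n1'.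
  have q := YQ n t t0 (H1 n (leq_maxr _ _)).
  apply: (Q_mono (Q_lip (rho t) q)).
  have := H n (leq_maxl _ _); rewrite -/a; lra.
Qed.

(** [g] raises the decreasing function by at most a constant, so [g \o rho] also descends at nearly
    the maximal rate and [steepest_close] makes its distance to [rho] sublinear. That distance is a
    convex function, so it is bounded by its value at 0. *)
Lemma steepest_ray_fixed : exists rho : R -> T,
  (forall s t, 0 <= s -> 0 <= t -> d (rho s) (rho t) = `|s - t|) /\
  forall g : T -> T, (forall x y, d (g x) (g y) = d x y) ->
    (exists c, forall x t, Q x t -> Q (g x) (t + c)) ->
    exists k, forall t, 0 <= t -> d (g (rho t)) (rho t) <= k.
Proof.
have [rho [geo rho_o rhoQ]] := exists_steepest_ray; exists rho; split=> // g giso [c gQ].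
have a0 := slope_gt0; set a := slope in a0 rhoQ.
pose f t := d (g (rho t)) (rho t).
have rdiv s t : 0 <= s -> s <= t -> 0 < t -> divides (rho 0) (rho t) (s / t) (rho s).
  move=> s0 st t0; have q01 : 0 <= s / t <= 1 by exact: ratio01.
  have [m D] := divides_exists (rho 0) (rho t) q01.
  suff -> : rho s = m by [].
  apply: (divides_unique q01 D); rewrite !geo ?(ltW t0) // ?sub0r ?normrN ?(ger0_norm s0) ?(gtr0_norm t0).
    by rewrite divfK // gt_eqF.
  rewrite distrC ger0_norm ?subr_ge0 //.
  by have -> : (1 - s / t) * t = t - s by field; rewrite gt_eqF.
have gdiv s t : 0 <= s -> s <= t -> 0 < t -> divides (g (rho 0)) (g (rho t)) (s / t) (g (rho s)).
  move=> s0 st t0; have q01 : 0 <= s / t <= 1 by exact: ratio01.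
  have [m D] := divides_exists (g (rho 0)) (g (rho t)) q01.
  have D' := rdiv s t s0 st t0.
  suff -> : g (rho s) = m by [].
  by apply: (divides_unique q01 D); rewrite !giso (divides_left q01 D', divides_right q01 D').
have conv s t : 0 <= s -> s <= t -> 0 < t -> f s <= (1 - s / t) * f 0 + s / t * f t.
  move=> s0 st t0; have q01 : 0 <= s / t <= 1 by exact: ratio01.
  exact: divides_busemann q01 (gdiv s t s0 st t0) (rdiv s t s0 st t0).
pose k := d o (g o) + `|c| + 2.
have k0 : 0 <= k by rewrite /k !addr_ge0.
have sublin e : 0 < e -> exists2 t0, 0 < t0 & forall t, t0 <= t -> f t <= e * (t + k).
  move=> e0; have [dl [s0 [dl0 s01 H]]] := steepest_close e0.
  exists (Num.max s0 (((a + 1) * k + 2) / dl)).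
    by rewrite lt_max; apply/orP; left; lra.
  move=> t; rewrite ge_max ler_pdivrMr // => /andP[h1 h2].
  have t0 : 0 <= t by lra.
  have dlk : 0 <= dl * k by rewrite mulr_ge0 // ltW.
  have cn := ler_norm c; have cn0 := normr_ge0 c; have ogo := d_ge0 o (g o).
  apply: H => //.
  - lra.
  - apply: (le_trans (d_triangle o (g o) (g (rho t)))); rewrite giso.
    by have := rho_o t t0; rewrite /k; lra.
  - by apply: (le_trans (rho_o t t0)); lra.
  - by apply: (Q_mono (gQ _ _ (rhoQ t t0))); rewrite -/a /k; rewrite /k in h2 dlk; lra.
  - by apply: (Q_mono (rhoQ t t0)); rewrite -/a; lra.
exists (f 0) => s s0; apply/ler_addgt0Pr => e e0.
have e1 : 0 < e / (2 * (s + 1)) by rewrite divr_gt0 // mulr_gt0 // ltr_wpDl.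
have [t0 t00 H] := sublin _ e1.
pose t := Num.max t0 (Num.max (s + 1) k).
have tt0 : t0 <= t by rewrite le_max lexx.
have ts : s + 1 <= t by rewrite !le_max lexx orbT.
have tk : k <= t by rewrite !le_max lexx !orbT.
have tp : 0 < t by lra.
have st : s <= t by lra.
apply: (le_trans (conv s t s0 st tp)).
have q0 : 0 <= s / t by rewrite divr_ge0 // ltW.
have h1 : (1 - s / t) * f 0 <= f 0.
  by have : 0 <= s / t * f 0 by [rewrite mulr_ge0 // d_ge0]; lra.
apply: lerD => //.
apply: (@le_trans _ _ (s / t * (e / (2 * (s + 1)) * (t + t)))).
  rewrite ler_wpM2l //; apply: (le_trans (H t tt0)).
  by rewrite ler_wpM2l ?(ltW e1) // lerD2l.
have -> : s / t * (e / (2 * (s + 1)) * (t + t)) = e * (s / (s + 1)).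
  by field; rewrite !gt_eqF // ltr_wpDl.
by rewrite -[leRHS]mulr1 ler_wpM2l ?(ltW e0) // ler_pdivrMr ?ltr_wpDl // mul1r lerDl.
Qed.

End SteepestRay.

(** * The ray determined by a filter of convex subcomplexes *)

Section FixedRay.
Variables (R : realType) (W : choiceType) (V : set (W -> bool)) (N : nat).
Hypothesis medV : forall a b c, V a -> V b -> V c -> V (fun w => majority (a w) (b w) (c w)).
Hypothesis finV : forall a b, V a -> V b -> exists s : seq W, forall w, w \notin s -> a w = b w.
Hypothesis stepV : forall a b, V a -> V b -> a <> b -> exists2 w, a w != b w & V (flip_at w a).
Hypothesis dimV : forall a (s : seq W), uniq s ->
  (forall b, (forall w, w \notin s -> b w = a w) -> V b) -> (size s <= N)%N.

Implicit Types (C : set (W -> bool)) (a b : W -> bool).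
Notation Pt := (Pt R V).
Notation d := (@mdist R W V).
Notation inP := (@inP R W V).
Let d_ge0 := mdist_ge0 (R := R) finV stepV.
Let dC := mdistC (R := R) finV stepV.
Let dxx := mdistxx (R := R) finV stepV.
Let d_triangle := mdist_triangle (R := R) finV stepV.
Let d_eq0 := mdist_eq0 (R := R) finV stepV.

(** Induction on the number of changed coordinates: [b] is the median of the two vectors obtained by
    resetting [w], resp. [w'], and of the fourth corner of the square at [w], [w']. *)
Lemma cube_from_squares a (S : seq W) : V a -> (forall w, w \in S -> V (flip_at w a)) ->
  (forall w w', w \in S -> w' \in S -> w != w' -> V (flip_at w (flip_at w' a))) ->
  forall b, (forall w, w \notin S -> b w = a w) -> V b.
Proof.
move=> Va V1 V2 b Hb.
have [D HD] : exists D : seq W, uniq D /\ forall w, w \in D <-> b w != a w.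
  exists (undup [seq w <- S | b w != a w]); split; first exact: undup_uniq.
  move=> w; rewrite mem_undup mem_filter; split=> [/andP[]//|bw]; rewrite bw /=.
  by apply: contraR bw => /Hb ->.
have [n Dn] : exists n, size D = n by exists (size D).
elim/ltn_ind: n => n IH in b D Hb HD Dn *.
have DS w : w \in D -> w \in S by move=> /HD.2; apply: contraR => /Hb ->.
case: D HD Dn DS => [|w [|w' D]] [uD HD] Dn DS.
- suff -> : b = a by [].
  by apply/funext => w; apply/eqP/negPn/negP => /HD.
- suff -> : b = flip_at w a by apply: V1; apply: DS; rewrite mem_head.
  apply/funext => v; have [->|n'] := eqVneq v w.
    have /HD : w \in [:: w] by rewrite mem_head.
    by rewrite flip_at_eq; case: (b w) (a w) => -[].
  rewrite flip_at_neq //; apply/eqP/negPn/negP => /HD.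
  by rewrite inE (negbTE n').
have ww' : w != w' by move: uD; rewrite /= inE negb_or => /andP[/andP[]].
have wD : w \in [:: w, w' & D] by rewrite mem_head.
have w'D : w' \in [:: w, w' & D] by rewrite inE mem_head orbT.
have reset v : v \in [:: w, w' & D] -> V (fun u => if u == v then a u else b u).
  move=> vD; apply: (IH (size (rem v [:: w, w' & D])) _ _ (rem v [:: w, w' & D])) => //.
  - by rewrite -Dn size_rem.
  - by move=> u /Hb ->; case: eqP.
  - split; first exact: rem_uniq.
    move=> u; rewrite mem_rem_uniq // inE; have [->|nu] := eqVneq u v; first by rewrite eqxx.
    exact: HD.
have bw : b w = ~~ a w by have /HD := wD; case: (b w) (a w) => -[].
have bw' : b w' = ~~ a w' by have /HD := w'D; case: (b w') (a w') => -[].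
have -> : b = fun u => majority (if u == w then a u else b u) (if u == w' then a u else b u)
    (flip_at w (flip_at w' a) u).
  apply/funext => u; rewrite /majority; have [->|nu] := eqVneq u w.
    by rewrite (negbTE ww') flip_at_eq flip_at_neq // bw; case: (a w).
  have [->|nu'] := eqVneq u w'.
    by rewrite flip_at_neq 1?eq_sym // flip_at_eq bw'; case: (a w').
  by case: (b u) (flip_at _ _ _) => -[].
apply: medV; [exact: reset|exact: reset|].
by apply: V2 => //; exact: DS.
Qed.

Definition between a b : set (W -> bool) := [set z | V z /\ forall w, z w = a w \/ z w = b w].

Lemma between_convex a b : V a -> V b -> convex_in V (between a b).
Proof.
move=> Va Vb; split; [by move=> z []|by exists a; split=> // w; left|].
by move=> x y z [_ Hx] [_ Hy] Vz H; split=> // w; case: (H w) => ->.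
Qed.

Definition ptv a (Va : V a) : Pt := PtOf (proj2 (pts_vtx R V a) Va).

Lemma gate_vtx_neq C a w : gate_vtx C a w <> a w -> const_on C w (gate_vtx C a w).
Proof. by rewrite /gate_vtx; case: asboolP => // _; case: asboolP. Qed.

(** Every wall separating [a] from its gate is constant on [C], so all of [C] has the same gate in
    the interval between them. As gates are nonexpanding, the gate of [a] is then a nearest point of
    [C]. *)
Lemma gate_between C a b (cC : convex_in V C) (Va : V a) (Vb : V b) c :
  b = gate_vtx C a -> inP C c ->
  gatep medV finV (between_convex Va Vb) c = ptv Vb.
Proof.
move=> eb Cc; apply: Pt_eq; apply/funext => w /=.
have I0 : between a b !=set0 by case: (between_convex Va Vb).
have [e|ne] := eqVneq (b w) (a w).
  by rewrite (gate_const (crd c) I0 (e := a w)) /vtx ?e // => z [_ /(_ w)]; rewrite e => -[].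
have k : const_on C w (b w) by rewrite eb; apply: gate_vtx_neq; rewrite -eb; exact/eqP.
case: (gateP (crd c) w I0) => [[e k' ->]|[_ _ ->]].
  by rewrite /vtx -(k' b) //; split=> // v; right.
have Cf : pts (face_of C w (b w)) (crd c).
  by have [c01 H] := Cc; split=> // h /H Ch; split=> //; exact: k.
exact: face_coord Cf.
Qed.

Lemma gate_nearest C a (cC : convex_in V C) (Va : V a) (Vb : V (gate_vtx C a)) c :
  inP C c -> d (ptv Va) (ptv Vb) <= d (ptv Va) c.
Proof.
move=> Cc; rewrite -[ptv Vb](gate_between cC Va Vb erefl Cc).
rewrite -{1}[ptv Va](gatep_id medV finV (between_convex Va Vb)).
  exact: (gatep_nexp medV finV stepV).
by apply/pts_vtx; split=> // w; left.
Qed.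

Lemma inP_divides C x y r m : convex_in V C -> inP C x -> inP C y -> 0 <= r <= 1 ->
  divides d x y r m -> inP C m.
Proof.
move=> cC Cx Cy r01 D.
rewrite -(divides_unique d_ge0 d_eq0 dC r01 D (m' := gatep medV finV cC m)); first exact: gatep_in.
  rewrite -{1}(gatep_id medV finV cC Cx); apply: (le_trans (gatep_nexp medV finV stepV cC _ _)).
  by rewrite (divides_left d_ge0 dxx dC d_triangle r01 D).
rewrite -{1}(gatep_id medV finV cC Cy); apply: (le_trans (gatep_nexp medV finV stepV cC _ _)).
by rewrite (divides_right d_ge0 dxx dC d_triangle r01 D).
Qed.

Variable F : set (set (W -> bool)).
Hypothesis F_convex : forall C, F C -> convex_in V C.
Hypothesis F_directed : forall C C', F C -> F C' -> exists C2, [/\ F C2, C2 `<=` C & C2 `<=` C'].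
Hypothesis F_empty : forall a, V a -> exists2 C, F C & ~ C a.
Hypothesis F_nonempty : F !=set0.

Definition forward a w := V (flip_at w a) /\ exists2 C, F C & const_on C w (~~ a w).

(** Two forward walls span a square at [a]: its fourth corner is the median of the two neighbours of
    [a] and of a vertex of a common smaller member of the filter. *)
Lemma forward_cube a (s : seq W) : V a -> (forall w, w \in s -> forward a w) ->
  forall b, (forall w, w \notin s -> b w = a w) -> V b.
Proof.
move=> Va Hs; apply: cube_from_squares => // [w /Hs[]//|w w' /Hs[Vw [C FC kC]] /Hs[Vw' [C' FC' kC']] ww'].
have [C2 [F2 s2 s2']] := F_directed FC FC'.
have [C2V [z Cz] _] := F_convex F2.
have -> : flip_at w (flip_at w' a) = fun u => majority (flip_at w a u) (flip_at w' a u) (z u).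
  apply/funext => u; rewrite /majority; have [->|nu] := eqVneq u w.
    by rewrite !flip_at_eq !flip_at_neq // (kC z (s2 z Cz)); case: (a w).
  have [->|nu'] := eqVneq u w'.
    by rewrite flip_at_neq 1?eq_sym // !flip_at_eq (flip_at_neq (w := w)) 1?eq_sym // (kC' z (s2' z Cz)); case: (a w').
  by rewrite !flip_at_neq //; case: (a u) (z u) => -[].
by apply: medV => //; exact: C2V.
Qed.

Lemma forward_seq a : V a -> exists s : seq W, [/\ uniq s, (size s <= N)%N &
  forall w, w \in s <-> forward a w].
Proof.
move=> Va; apply: maximal_seq => s us Hs.
exact: (dimV (a := a) us) (forward_cube Va Hs).
Qed.

Lemma F_finite (P : W -> set (W -> bool) -> Prop) (s : seq W) :
  (forall w C C', C' `<=` C -> P w C -> P w C') -> (forall w, w \in s -> exists2 C, F C & P w C) ->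
  exists2 C, F C & forall w, w \in s -> P w C.
Proof.
move=> Pmono; elim: s => [|w s IH] H; first by have [C FC] := F_nonempty; exists C.
have [|C FC HC] := IH; first by move=> v vs; apply: H; rewrite inE vs orbT.
have [C' FC' PC'] := H w (mem_head _ _).
have [C2 [F2 s1 s2]] := F_directed FC FC'; exists C2 => // v.
by rewrite inE => /orP[/eqP ->|/HC Pv]; [exact: Pmono PC'|exact: Pmono Pv].
Qed.

(* Crossing at once all the walls adjacent to [a] that separate it from the end of the filter brings every small enough member of the filter closer by 1. *)
Lemma forward_step a (Va : V a) : exists b (Vb : V b), d (ptv Va) (ptv Vb) <= N%:R /\
  exists2 C0, F C0 & forall C, F C -> C `<=` C0 -> ~ C a ->
    forall c, inP C c -> exists2 c', inP C c' & d (ptv Vb) c' <= d (ptv Va) c - 1.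
Proof.
have [s [us sN sP]] := forward_seq Va.
pose b w := if w \in s then ~~ a w else a w.
have cube := forward_cube Va (fun w => (sP w).1).
have Vb : V b by apply: cube => w /negbTE ws; rewrite /b ws.
exists b, Vb; split.
  have sup : supported s (vtx R a) (vtx R b).
    by move=> w /negbTE ws; rewrite /vtx /b ws.
  have co : cocube V (vtx R a) (vtx R b).
    split; [exact: vtx_in_cube|exact: vtx_in_cube|move=> h J; apply: cube => w /negbTE ws].
    by case: (J w); rewrite /vtx /b ws; case: (a w) => [_ ->|->].
  apply: (le_trans (mdist_le finV stepV (x := ptv Va) (y := ptv Vb) (chain_one co us sup))).
  apply: (@le_trans _ _ ((size s)%:R * 1)); last by rewrite mulr1 ler_nat.
  apply: seqlen_bound => // w; rewrite /vtx; case: (a w) (b w) => -[]; rewrite ?subrr ?normr0 //.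
    by rewrite subr0 normr1.
  by rewrite sub0r normrN1.
have [C0 FC0 H0] : exists2 C, F C & forall w, w \in s -> const_on C w (~~ a w).
  apply: (F_finite (P := fun w C => const_on C w (~~ a w))).
    by move=> w C C' ss k c /ss; exact: k.
  by move=> w /sP[].
exists C0 => // C FC CC0 Ca c Cc.
have cC := F_convex FC; have [CV C_0 _] := cC.
have Cg := gate_vtx_in medV finV cC Va; have Vg := CV _ Cg.
set g := gate_vtx C a in Cg Vg.
exists (ptv Vg); first exact/pts_vtx.
have near : d (ptv Va) (ptv Vg) <= d (ptv Va) c := gate_nearest cC Va Vg Cc.
suff step : d (ptv Vb) (ptv Vg) <= d (ptv Va) (ptv Vg) - 1 by lra.
set d0 := d (ptv Va) (ptv Vg).
have d01 : 1 <= d0.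
  have [w wg] : exists w, g w != a w.
    apply: contrapT => no; apply: Ca; suff <- : g = a by [].
    by apply/funext => w; apply/eqP/negPn/negP => wg; apply: no; exists w.
  apply: le_trans (coord_le_mdist finV stepV (ptv Va) (ptv Vg) w) => /=.
  by rewrite /vtx; case: (g w) (a w) wg => -[] // _; rewrite ?subr0 ?sub0r ?normrN1 ?normr1.
(* A point [p] of the interval at distance at most [t < 1] from [a] has each coordinate within less
   than 1 of that of [a], so it lies in the cube of the forward walls. The gate onto the far sides
   [KA] of these walls sends [p] to [b] and fixes the gate [g] of [a]; hence the distance from [b]
   to [g] is at most that from [p], which is at most [d0 - t]. *)
apply/ler_addgt0Pr => e e0.
pose t := Num.max 0 (1 - e).
have t0 : 0 <= t by rewrite le_max lexx.
have t1 : t < 1 by rewrite gt_max ltr01 /=; lra.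
have te : 1 - e <= t by rewrite le_max lexx orbT.
have r01 : 0 <= t / d0 <= 1 by apply: ratio01; lra.
have [m D] := divides_exists (cat0_model medV finV stepV dimV) (ptv Va) (ptv Vg) r01.
pose I := between_convex Va Vg.
pose p := gatep medV finV I m.
have Ia : inP (between a g) (ptv Va) by apply/pts_vtx; split=> // w; left.
have Ig : inP (between a g) (ptv Vg) by apply/pts_vtx; split=> // w; right.
have Ip : inP (between a g) p by exact: gatep_in.
have ap : d (ptv Va) p <= t.
  rewrite -{1}(gatep_id medV finV I Ia); apply: (le_trans (gatep_nexp medV finV stepV I _ _)).
  rewrite (divides_left d_ge0 dxx dC d_triangle r01 D) divfK //; last by rewrite gt_eqF //; lra.
have pg : d p (ptv Vg) <= d0 - t.
  rewrite -{1}(gatep_id medV finV I Ig); apply: (le_trans (gatep_nexp medV finV stepV I _ _)).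
  rewrite (divides_right d_ge0 dxx dC d_triangle r01 D) -/d0.
  have dn : d0 != 0 by rewrite gt_eqF //; lra.
  by have -> : (1 - t / d0) * d0 = d0 - t by field.
have coord w : `|(a w)%:R - crd p w| < 1.
  by apply: le_lt_trans t1; apply: le_trans ap; exact: (coord_le_mdist finV stepV (ptv Va) p w).
have pround : rounding (crd p) a.
  move=> w; have := coord w; case: (a w) => h; split=> // e'; move: h; rewrite e'.
    by rewrite subr0 normr1 ltxx.
  by rewrite sub0r normrN1 ltxx.
have psupp w : w \notin s -> crd p w = (a w)%:R.
  move=> ws; apply/eqP; apply: contraNT ws => pw; apply/sP.
  have If : between a g (flip_at w a).
    apply: Ip.2 => v; have [->|nv] := eqVneq v w; last by rewrite flip_at_neq //; exact: pround.
    rewrite flip_at_eq; move: pw (coord w); case: (a w) => pw h; split=> e' //.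
      by rewrite e' eqxx in pw.
    by rewrite e' eqxx in pw.
  split; first by case: If.
  exists C => //; have [_ /(_ w)] := If; rewrite flip_at_eq => -[|gw].
    by case: (a w).
  by rewrite gw; apply: gate_vtx_neq; rewrite -/g -gw; case: (a w).
pose KA := [set z | V z /\ forall w, w \in s -> z w = ~~ a w].
have KAb : KA b by split=> // w ws; rewrite /b ws.
have cKA : convex_in V KA.
  split; [by move=> z []|by exists b|].
  by move=> x y z [_ Hx] [_ Hy] Vz H; split=> // w ws; case: (H w) => ->; auto.
have gp : gatep medV finV cKA p = ptv Vb.
  apply: Pt_eq; apply/funext => w /=.
  have KA0 : KA !=set0 by exists b.
  case: (gateP (crd p) w KA0) => [[e' k ->]|[k1 k0 ->]]; first by rewrite /vtx (k b KAb).
  have ws : w \notin s.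
    by apply/negP => ws; case: (a w) k1 k0 (fun z (h : KA z) => h.2 w ws) => k1 k0 k; [exact: k0|exact: k1].
  by rewrite psupp // /vtx /b (negbTE ws).
have gg : gatep medV finV cKA (ptv Vg) = ptv Vg.
  apply: gatep_id; apply/pts_vtx; split=> // w ws; exact: (H0 w ws g (CC0 g Cg)).
apply: (@le_trans _ _ (d p (ptv Vg))); last lra.
rewrite -gp -{1}gg; exact: (gatep_nexp medV finV stepV).
Qed.

Variables (a0 : W -> bool) (Va0 : V a0).
Let o : Pt := ptv Va0.

(** Stands for [d(x, C) - d(o, C) <= t] for all small enough members [C], without distances to sets.
    Smallness is an inclusion between sets of points because automorphisms act on points. *)
Definition eventually_closer (x : Pt) (t : R) := exists2 C0, F C0 &
  forall C, F C -> inP C `<=` inP C0 ->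
    forall c, inP C c -> exists2 c', inP C c' & d x c' <= d o c + t.

Lemma inP_subset C C' : C `<=` V -> inP C `<=` inP C' -> C `<=` C'.
Proof.
move=> CV s a Ca; have Va := CV _ Ca.
have /s/pts_vtx // : inP C (ptv Va) by apply/pts_vtx.
Qed.

(** Each [forward_step] costs at most [N] and gains 1; the rate [N.+1] stays positive in dimension 0
    as well. *)
Lemma eventually_closer_far (n : nat) :
  exists2 x, d o x <= N.+1%:R * n%:R & eventually_closer x (- n%:R).
Proof.
suff [a [Va [da [C0 FC0 H]]]] : exists a (Va : V a), d o (ptv Va) <= N.+1%:R * n%:R /\
   exists2 C0, F C0 & forall C, F C -> C `<=` C0 ->
   forall c, inP C c -> exists2 c', inP C c' & d (ptv Va) c' <= d o c - n%:R.
  exists (ptv Va) => //; exists C0 => // C FC CC0; apply: H => //.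
  by apply: inP_subset => //; case: (F_convex FC).
elim: n => [|n [a [Va [da [C0 FC0 H]]]]].
  have [C FC] := F_nonempty; exists a0, Va0; rewrite dxx mulr0; split=> //.
  by exists C => // C' _ _ c Cc; exists c => //; rewrite subr0.
have [b [Vb [dab [C1 FC1 H1]]]] := forward_step Va.
have [C2 FC2 C2a] := F_empty Va.
have [C3 [FC3 s30 s31]] := F_directed FC0 FC1.
have [C4 [FC4 s43 s42]] := F_directed FC3 FC2.
exists b, Vb; split.
  apply: (le_trans (d_triangle _ (ptv Va) _)).
  have -> : n.+1%:R = n%:R + 1 :> R by rewrite natr1.
  by rewrite mulrDr mulr1 lerD // (le_trans dab) // ler_nat leqnSn.
exists C4 => // C FC s c Cc.
have [|c1 Cc1 h1] := H C FC _ c Cc; first by move=> v /s/s43/s30.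
have [| |c2 Cc2 h2] := H1 C FC _ _ c1 Cc1; [by move=> v /s/s43/s31|by move=> /s/s42|].
exists c2 => //; apply: (le_trans h2); rewrite -natr1; lra.
Qed.

Definition preserves_family (g : Pt -> Pt) := forall C, F C ->
  exists2 C1, F C1 & forall x, inP C1 x <-> inP C (g x).

Theorem model_fixed_ray : exists rho : R -> Pt,
  (forall s t, 0 <= s -> 0 <= t -> d (rho s) (rho t) = `|s - t|) /\
  forall g g' : Pt -> Pt, (forall x y, d (g x) (g y) = d x y) -> cancel g g' -> cancel g' g ->
    preserves_family g -> preserves_family g' ->
    exists k, forall t, 0 <= t -> d (g (rho t)) (rho t) <= k.
Proof.
have cat0 : cat0_on d setT by exact: (cat0_model medV finV stepV dimV).
have compl : complete_on d setT.
  have inT x : inP V x by exact: crdP.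
  move=> u _ cu; have [x _ Hx] := model_complete finV stepV dimV (@subset_refl _ V) (fun n => inT (u n)) cu.
  by exists x.
have Qmono x s t : eventually_closer x s -> s <= t -> eventually_closer x t.
  move=> [C0 F0 H] st; exists C0 => // C FC sC c Cc; have [c' Cc' h] := H C FC sC c Cc.
  by exists c' => //; lra.
have Qlip x y t : eventually_closer x t -> eventually_closer y (t + d x y).
  move=> [C0 F0 H]; exists C0 => // C FC sC c Cc; have [c' Cc' h] := H C FC sC c Cc.
  by exists c' => //; have := d_triangle y x c'; rewrite (dC y x); lra.
have Qconv x y s t r m : eventually_closer x s -> eventually_closer y t -> 0 <= r <= 1 ->
    divides d x y r m -> eventually_closer m ((1 - r) * s + r * t).
  move=> [C1 F1 H1] [C2 F2 H2] r01 D; have [C0 [F0 s1 s2]] := F_directed F1 F2.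
  exists C0 => // C FC sC c Cc.
  have [c1 Cc1 h1] := H1 C FC (subset_trans sC (inP_sub s1)) c Cc.
  have [c2 Cc2 h2] := H2 C FC (subset_trans sC (inP_sub s2)) c Cc.
  have [c' D'] := divides_exists cat0 c1 c2 r01.
  exists c'; first exact: inP_divides (F_convex FC) Cc1 Cc2 r01 D'.
  apply: (le_trans (divides_busemann d_ge0 dxx dC d_triangle cat0 r01 D D')).
  by case/andP: r01 => r0 r1; nra.
have Qlow x t : eventually_closer x t -> - d o x <= t.
  move=> [C0 F0 H]; have cC := F_convex F0; have [CV _ _] := cC.
  have Cg := gate_vtx_in medV finV cC Va0; have Vg := CV _ Cg.
  have [|c' Cc' h] := H C0 F0 (@subset_refl _ _) (ptv Vg); first exact/pts_vtx.
  have := gate_nearest cC Va0 Vg Cc'; have := d_triangle o x c'; rewrite -/o; lra.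
have K0 : 0 < N.+1%:R :> R by rewrite ltr0n.
have [rho [geo fixed]] := steepest_ray_fixed d_ge0 dxx d_eq0 dC d_triangle cat0 compl
  Qmono Qlip Qconv Qlow K0 eventually_closer_far.
exists rho; split=> // g g' giso gK g'K pg pg'; apply: fixed => //.
(* Pulling members back by [g] compares distances from [g o] with distances from [o], which differ
   by at most [d o (g o)]. *)
exists (d o (g o)) => x t [C0 F0 H].
have [C1 FC1 H1] := pg' C0 F0; exists C1 => // C FC sC c Cc.
have [C2 FC2 H2] := pg C FC.
have [|||c' Cc' h] := H C2 _ _ (g' c); [by []|move=> y /H2/sC/H1|apply/H2; rewrite g'K //|].
  by rewrite gK.
exists (g c'); first exact/H2.
rewrite giso; apply: (le_trans h).
have -> : d o (g' c) = d (g o) c by rewrite -giso g'K.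
have := d_triangle (g o) o c; rewrite (dC (g o) o); lra.
Qed.

End FixedRay.

(** * Cells, vertices and edges *)

Section Vectors.
Variable R : realType.

Definition bvec n (b : 'I_n -> bool) : 'rV[R]_n := \row_i (b i)%:R.

Definition rnd n (u : 'rV[R]_n) (b : 'I_n -> bool) :=
  forall i, (u ord0 i = 0 -> b i = false) /\ (u ord0 i = 1 -> b i = true).

Lemma bvecE n (b : 'I_n -> bool) i : bvec b ord0 i = (b i)%:R.
Proof. by rewrite mxE. Qed.

Lemma rV_ext n (u v : 'rV[R]_n) : (forall i, u ord0 i = v ord0 i) -> u = v.
Proof. by move=> H; apply/rowP => i; rewrite H. Qed.

Lemma bool_natr_inj (a b : bool) : a%:R = b%:R :> R -> a = b.
Proof. by case: a b => -[] // /eqP; rewrite ?oner_eq0 // eq_sym oner_eq0. Qed.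

Lemma bvec_inj n (b b' : 'I_n -> bool) : bvec b = bvec b' -> b = b'.
Proof.
move=> e; apply/funext => i; apply: bool_natr_inj.
by have := congr1 (fun u : 'rV[R]_n => u ord0 i) e; rewrite !bvecE.
Qed.

Lemma unit_bvec n (b : 'I_n -> bool) : unit_cube (bvec b).
Proof. by move=> i; rewrite bvecE; case: (b i); rewrite ?lexx ?ler01. Qed.

Lemma rnd_bvec n (b b' : 'I_n -> bool) : rnd (bvec b) b' <-> b' = b.
Proof.
split=> [H|-> i].
  by apply/funext => i; case: (H i); rewrite bvecE; case: (b i) => [_ ->|->].
by rewrite bvecE; case: (b i); split=> // /eqP; rewrite ?oner_eq0 // eq_sym oner_eq0.
Qed.

Lemma rnd_floor n (u : 'rV[R]_n) : rnd u (fun i => u ord0 i == 1).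
Proof. by move=> i; split=> ->; rewrite ?eqxx // eq_sym oner_eq0. Qed.

Lemma rnd_change n (u : 'rV[R]_n) b i e : 0 < u ord0 i < 1 -> rnd u b ->
  rnd u (fun j => if j == i then e else b j).
Proof.
move=> /andP[u0 u1] H j; have [->|n'] := eqVneq j i; last exact: H.
by split=> h; move: u0 u1; rewrite h ltxx.
Qed.

Lemma rnd_flip n (u : 'rV[R]_n) b i : 0 < u ord0 i < 1 -> rnd u b -> rnd u (flip_at i b).
Proof.
move=> ui H; have := @rnd_change n u b i (~~ b i) ui H.
by congr (rnd u _); apply/funext => j; rewrite /flip_at; case: eqP => [->|].
Qed.

Lemma unit_cases n (u : 'rV[R]_n) i : unit_cube u ->
  [\/ u ord0 i = 0, u ord0 i = 1 | 0 < u ord0 i < 1].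
Proof.
move=> /(_ i)/andP[u0 u1].
have [->|n0] := eqVneq (u ord0 i) 0; first by constructor 1.
have [->|n1] := eqVneq (u ord0 i) 1; first by constructor 2.
by constructor 3; rewrite !lt_def n0 u0 u1 eq_sym n1.
Qed.

Lemma face_unit n (s : 'I_n -> option bool) (u : 'rV[R]_n) : face s u -> unit_cube u.
Proof. by case. Qed.

Lemma face_rnd n (s : 'I_n -> option bool) (u : 'rV[R]_n) b : face s u -> rnd u b -> face s (bvec b).
Proof.
move=> [_ H] rb; split; first exact: unit_bvec.
move=> i e si; rewrite bvecE; have := H i e si; case: (rb i) => r0 r1.
by case: e {si} => [/r1 ->|/r0 ->].
Qed.

(** If a coordinate fixed by [s] were fractional at [u], two roundings differing there would both
    have to lie in the face. *)
Lemma face_all_rnd n (s : 'I_n -> option bool) (u : 'rV[R]_n) : unit_cube u ->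
  (forall b, rnd u b -> face s (bvec b)) -> face s u.
Proof.
move=> uu H; split=> // i e si.
have [_ /(_ i e si)] := H _ (rnd_floor u); rewrite bvecE => /bool_natr_inj h1.
case: (unit_cases i uu) => [u0|u1|u01]; first by rewrite u0 -h1 u0 eq_sym oner_eq0.
  by rewrite u1 -h1 u1 eqxx.
have [_ /(_ i e si)] := H _ (rnd_flip u01 (rnd_floor u)); rewrite bvecE flip_at_eq => /bool_natr_inj.
by rewrite h1; case: (e).
Qed.

Definition minface n (u : 'rV[R]_n) : 'I_n -> option bool := fun i =>
  if u ord0 i == 0 then Some false else if u ord0 i == 1 then Some true else None.

Lemma minface_in n (u : 'rV[R]_n) : unit_cube u -> face (minface u) u.
Proof.
move=> uu; split=> // i e; rewrite /minface; case: eqP => [-> [<-]//|_].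
by case: eqP => [-> [<-]//|].
Qed.

Lemma minface_rnd n (u : 'rV[R]_n) b : face (minface u) (bvec b) -> rnd u b.
Proof.
move=> [_ H] i; split=> h; apply: bool_natr_inj; rewrite -bvecE; apply: H; rewrite /minface h.
  by rewrite eqxx.
by rewrite oner_eq0 eqxx.
Qed.

Lemma edist_sqr n (u v : 'rV[R]_n) : edist u v ^+ 2 = \sum_(i < n) (u ord0 i - v ord0 i) ^+ 2.
Proof. by rewrite /edist sqr_sqrtr // sumr_ge0 // => i _; exact: sqr_ge0. Qed.

Lemma edist_eq0 n (u v : 'rV[R]_n) : edist u v = 0 -> u = v.
Proof.
move=> e; have := edist_sqr u v; rewrite e expr0n /= => /esym/eqP.
rewrite psumr_eq0 => [|i _]; last exact: sqr_ge0.
move=> /allP H; apply: rV_ext => i; apply/eqP; rewrite -subr_eq0 -sqrf_eq0.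
by apply: H; rewrite mem_index_enum.
Qed.

Lemma edist_xx n (u : 'rV[R]_n) : edist u u = 0.
Proof.
apply/eqP; rewrite -sqrf_eq0 edist_sqr big1 // => i _; by rewrite subrr expr0n.
Qed.

Lemma bool_diff_sqr (a b : bool) : (a%:R - b%:R) ^+ 2 = (a != b)%:R :> R.
Proof. by case: a b => -[]; rewrite ?subrr ?subr0 ?sub0r ?sqrrN ?expr0n ?expr1n. Qed.

Lemma edist_bvec n (b b' : 'I_n -> bool) :
  edist (bvec b) (bvec b') ^+ 2 = #|[pred i | b i != b' i]|%:R.
Proof.
rewrite edist_sqr -sum1_card natr_sum [RHS]big_mkcond /=.
by apply: eq_bigr => i _; rewrite !bvecE bool_diff_sqr inE; case: (b i != b' i).
Qed.

Lemma edist_flip n (b : 'I_n -> bool) i : edist (bvec b) (bvec (flip_at i b)) ^+ 2 = 1.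
Proof.
rewrite edist_bvec (eq_card (B := pred1 i)) ?card1 // => j; rewrite !inE /flip_at.
by case: (eqVneq j i) => _; case: (b j).
Qed.

Lemma edist1_flip n (b b' : 'I_n -> bool) : edist (bvec b) (bvec b') ^+ 2 = 1 ->
  exists i, b' = flip_at i b.
Proof.
rewrite edist_bvec => /eqP; rewrite pnatr_eq1 => /card1P[i Hi]; exists i.
apply/funext => j; have := Hi j; rewrite !inE /flip_at.
by case: (eqVneq j i) => _ /=; case: (b j) (b' j) => -[].
Qed.

(* Diameters recognize the dimension of a face. *)
Lemma edist_face_le n (s : 'I_n -> option bool) (u v : 'rV[R]_n) : face s u -> face s v ->
  edist u v ^+ 2 <= #|[pred i | s i == None]|%:R.
Proof.
move=> [uu Hu] [uv Hv]; rewrite edist_sqr -sum1_card natr_sum [leRHS]big_mkcond /=.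
apply: ler_sum => i _; rewrite inE; case si: (s i) => [e|] /=.
  by rewrite (Hu i e si) (Hv i e si) subrr expr0n.
have /andP[u0 u1] := uu i; have /andP[v0 v1] := uv i; nra.
Qed.

Lemma edist_face_diam n (s : 'I_n -> option bool) : exists u v : 'rV[R]_n,
  [/\ face s u, face s v & edist u v ^+ 2 = #|[pred i | s i == None]|%:R].
Proof.
pose p e := bvec (fun i => if s i is Some e' then e' else e).
have fp e : face s (p e) by split=> [|i e' si]; [exact: unit_bvec|rewrite bvecE si].
exists (p false), (p true); split=> //; rewrite edist_bvec; congr (_%:R); apply: eq_card => i.
by rewrite !inE; case: (s i) => //= e; rewrite eqxx.
Qed.

Lemma unit_cubeE n : @unit_cube R n = face (fun=> None).
Proof. by apply/seteqP; split=> u //= [uu]. Qed.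

Lemma face_sub_unit n (s : 'I_n -> option bool) : face s `<=` @unit_cube R n.
Proof. by move=> u []. Qed.

End Vectors.
Arguments bvec {R n}.

Section CellGeometry.
Variables (R : realType) (X : cubeComplex R).
Implicit Types (c : cube X).

Definition vx c (b : 'I_(dim c) -> bool) : X := chart c (bvec b).

Lemma vx_inj c : injective (@vx c).
Proof. by move=> b b' /(chart_inj (unit_bvec _ _) (unit_bvec _ _))/bvec_inj. Qed.

Lemma cell_vx c (b : 'I_(dim c) -> bool) : cell c (vx b).
Proof. by exists (bvec b) => //; exact: unit_bvec. Qed.

Lemma same_face c c' x : cell c x -> cell c' x ->
  exists (s : 'I_(dim c) -> option bool) (s' : 'I_(dim c') -> option bool)
     (h : 'rV[R]_(dim c) -> 'rV[R]_(dim c')),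
  [/\ forall u, face s u -> face s' (h u) /\ chart c u = chart c' (h u),
      forall u', face s' u' -> exists2 u, face s u & u' = h u,
      isometric_on (face s) h,
      forall u, unit_cube u -> cell c' (chart c u) -> face s u &
      forall u u', unit_cube u -> unit_cube u' -> chart c u = chart c' u' -> face s u /\ u' = h u].
Proof.
move=> cx c'x; have [|s [s' [h [hF hI hG]]]] := @chart_glue _ X c c'; first by exists x.
exists s, s', h; split=> //.
- move=> u su; have s'h : face s' (h u) by rewrite -hF; exists u.
  by split=> //; apply/(hG _ _ (face_unit su) (face_unit s'h)).
- by move=> u'; rewrite -hF => -[u su <-]; exists u.
- by move=> u uu [u' uu' e]; case/(hG _ _ uu uu'): (esym e).
- by move=> u u' uu uu' /(hG _ _ uu uu').
Qed.

Lemma edist_glue c c' (u v : 'rV_(dim c)) (u' v' : 'rV_(dim c')) : unit_cube u -> unit_cube v -> unit_cube u' -> unit_cube v' ->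
  chart c u = chart c' u' -> chart c v = chart c' v' -> edist u v = edist u' v'.
Proof.
move=> uu uv uu' uv' e1 e2.
have [||s [s' [h [_ _ hI _ hG]]]] := @same_face c c' (chart c u); first by exists u.
  by exists u' => //; rewrite -e1.
have [su ->] := hG _ _ uu uu' e1; have [sv ->] := hG _ _ uv uv' e2.
by rewrite hI.
Qed.

(** Both charts are isometric, so [dim c'] and the number of free coordinates are read off from the
    same diameter. *)
Lemma face_cell c (s : 'I_(dim c) -> option bool) : exists c',
  [/\ cell c' = chart c @` face s, dim c' = #|[pred i | s i == None]| &
   exists k : 'rV[R]_(dim c') -> 'rV[R]_(dim c),
     forall u, unit_cube u -> face s (k u) /\ chart c' u = chart c (k u)].
Proof.
have [c' ec] := chart_face s; exists c'; have kex u : unit_cube u ->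
    exists v, face s v /\ chart c' u = chart c v.
  by move=> uu; have : (chart c' @` unit_cube) (chart c' u) by [exists u]; rewrite ec => -[v sv <-]; exists v.
have [k Hk] : exists k : 'rV[R]_(dim c') -> 'rV[R]_(dim c),
     forall u, unit_cube u -> face s (k u) /\ chart c' u = chart c (k u).
  have [|k Hk] := @choice _ _ (fun u v => unit_cube u -> face s v /\ chart c' u = chart c v).
    by move=> u; have [/kex[v Hv]|nu] := pselect (unit_cube u); [exists v|exists 0].
  by exists k.
split=> //; last by exists k.
have ke u v : unit_cube u -> unit_cube v -> edist (k u) (k v) = edist u v.
  move=> uu uv; have [su eu] := Hk u uu; have [sv ev] := Hk v uv.
  by apply: edist_glue => //; [exact: face_unit su|exact: face_unit sv].
have lift w : face s w -> exists2 w', unit_cube w' & k w' = w.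
  move=> swap_step; have : (chart c @` face s) (chart c w) by exists w.
  rewrite -ec => -[w' uw' e']; exists w' => //; have [sk ek] := Hk w' uw'.
  by apply: (chart_inj (face_unit sk) (face_unit swap_step)); rewrite -ek.
have full : #|[pred i : 'I_(dim c') | (None : option bool) == None]| = dim c'.
  by rewrite -[RHS]card_ord; apply: eq_card.
apply/eqP; rewrite eqn_leq -!(ler_nat R); apply/andP; split.
  have [p [q [fp fq e]]] := edist_face_diam R ((fun=> None) : 'I_(dim c') -> option bool).
  rewrite -[X in X%:R <= _]full -e -(ke _ _ (face_unit fp) (face_unit fq)).
  by apply: edist_face_le; [case: (Hk p (face_unit fp))|case: (Hk q (face_unit fq))].
have [p2 [q2 [fp fq <-]]] := edist_face_diam R s.
have [p2' up' <-] := lift p2 fp; have [q2' uq' <-] := lift q2 fq.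
rewrite ke // -[X in _ <= X%:R]full.
by apply: (@edist_face_le _ _ (fun=> None)); rewrite -unit_cubeE.
Qed.

Lemma is_vertex_vx c b : is_vertex (@vx c b).
Proof.
have [c' [ec ed _]] := face_cell (fun i => Some (b i)); exists c'; split.
  by rewrite ed (eq_card0 (A := [pred i | Some (b i) == None])).
rewrite ec; exists (bvec b) => //; split; first exact: unit_bvec.
by move=> i e [<-]; rewrite bvecE.
Qed.

(** The face of [c] shared with a 0-dimensional cell is a single point, so [u] coincides with its
    rounding. *)
Lemma vertex_in_cell c u : unit_cube u -> is_vertex (chart c u) -> exists b, u = bvec b.
Proof.
move=> uu [c0 [d0 c0u]].
have cx : cell c (chart c u) by exists u.
have [s [s' [h [_ _ hI hS _]]]] := same_face cx c0u.
have su := hS u uu c0u.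
have one (w w' : 'rV[R]_(dim c)) : face s w -> face s w' -> w = w'.
  move=> swap_step sw'; apply: edist_eq0; rewrite -(hI _ _ swap_step sw'); move: (h w) (h w'); rewrite d0 => p q.
  by apply/eqP; rewrite -sqrf_eq0 edist_sqr big_ord0.
exists (fun i => u ord0 i == 1); apply: one => //; exact: face_rnd su (rnd_floor u).
Qed.

Lemma is_vertexP v : is_vertex v <-> exists c b, v = @vx c b.
Proof.
split=> [vv|[c [b ->]]]; last exact: is_vertex_vx.
have [c [u uu e]] := chart_cover v; rewrite -e in vv.
by have [b eb] := vertex_in_cell uu vv; exists c, b; rewrite -e eb.
Qed.

Lemma vertex_of_cell c v : is_vertex v -> cell c v -> exists b, v = @vx c b.
Proof. by move=> vv [u uu e]; rewrite -e in vv *; have [b ->] := vertex_in_cell uu vv; exists b. Qed.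

(* The vertices of the carrier of [x], the smallest cell containing [x]. *)
Definition car x v := exists c u b, [/\ unit_cube u, x = chart c u, rnd u b & v = @vx c b].

(** Every cell containing the point contains all its carrier vertices, in particular so does the
    cell of the minimal face of [u]; this makes the notion independent of the chart. *)
Lemma carE c u v : unit_cube u -> car (chart c u) v <-> exists2 b, rnd u b & v = @vx c b.
Proof.
move=> uu; split=> [[c0 [u0 [b0 [uu0 e rb0 ev]]]]|[b rb ->]]; last by exists c, u, b.
have c0x : cell c0 (chart c u) by exists u0.
have in_cell c1 : cell c1 (chart c u) -> cell c1 v.
  move=> c1x; have [s [s' [h [hF _ _ hS _]]]] := same_face c0x c1x.
  have su0 : face s u0 by apply: hS => //; rewrite -e.
  have sb := face_rnd su0 rb0; rewrite ev /vx; have [s'h ->] := hF _ sb.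
  by exists (h (bvec b0)) => //; exact: face_unit s'h.
have vv : is_vertex v by rewrite ev; exact: is_vertex_vx.
have [|b eb] := vertex_of_cell (c := c) vv; first by apply: in_cell; exists u.
exists b => //; apply: minface_rnd.
have [c2 [e2 _ _]] := face_cell (minface u).
have : cell c2 v by apply: in_cell; rewrite e2; exists u => //; exact: minface_in.
rewrite e2 eb => -[w swap_step ew].
by rewrite -(chart_inj (face_unit swap_step) (unit_bvec _ _) ew).
Qed.

Lemma car_vertex x v : car x v -> is_vertex v.
Proof. by move=> [c [u [b [_ _ _ ->]]]]; exact: is_vertex_vx. Qed.

Lemma car_cell c x v : cell c x -> car x v -> cell c v.
Proof. by move=> [u uu <-] /(carE _ uu)[b _ ->]; exact: cell_vx. Qed.

Lemma car_exists x : exists v, car x v.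
Proof.
have [c [u uu <-]] := chart_cover x; exists (vx (fun i => u ord0 i == 1)).
by apply/carE => //; exists (fun i => u ord0 i == 1) => //; exact: rnd_floor.
Qed.

Lemma car_of_vertex v w : is_vertex v -> car v w <-> w = v.
Proof.
move=> /is_vertexP[c [b ->]]; rewrite /vx (carE _ (unit_bvec R b)).
by split=> [[b' /rnd_bvec -> ->//]|->]; exists b => //; apply/rnd_bvec.
Qed.

(** The face shared with [c] contains all roundings of the point, hence the point. *)
Lemma cell_of_car c x : (forall v, car x v -> cell c v) -> cell c x.
Proof.
move=> H; have [c' [u uu e]] := chart_cover x; rewrite -e in H *.
have [v cv] := car_exists (chart c' u).
have c'v : cell c' v by apply: car_cell cv; exists u.
have [s [s' [h [hF _ _ hS _]]]] := same_face c'v (H v cv).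
have su : face s u.
  apply: face_all_rnd => // b rb; apply: hS; first exact: unit_bvec.
  by apply: H; apply/carE => //; exists b.
by have [s'h ->] := hF u su; exists (h u) => //; exact: face_unit s'h.
Qed.

Definition adj v w := exists c b i, v = @vx c b /\ w = vx (flip_at i b).

Definition sq v1 v2 v3 v4 := exists c b i j, [/\ i != j, v1 = @vx c b, v2 = vx (flip_at i b),
  v3 = vx (flip_at i (flip_at j b)) & v4 = vx (flip_at j b)].

Lemma flip_atC (I : choiceType) (i j : I) b : flip_at i (flip_at j b) = flip_at j (flip_at i b).
Proof. by apply/funext => k; rewrite /flip_at; case: eqP; case: eqP. Qed.

Lemma flip_at_inj (I : choiceType) (i j : I) b : flip_at i b = flip_at j b -> i = j.
Proof.
move=> e; apply/eqP; apply: contraT => ij; have := congr1 (fun f => f i) e.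
by rewrite flip_at_eq flip_at_neq //; case: (b i).
Qed.

Lemma flip_at_neqb (I : choiceType) (i : I) b : flip_at i b <> b.
Proof. by move=> /(congr1 (fun f => f i)); rewrite flip_at_eq; case: (b i). Qed.

Lemma adjC v w : adj v w -> adj w v.
Proof. by move=> [c [b [i [-> ->]]]]; exists c, (flip_at i b), i; rewrite flip_atK. Qed.

Lemma adj_neq v w : adj v w -> v <> w.
Proof. by move=> [c [b [i [-> ->]]]] /vx_inj/esym; exact: flip_at_neqb. Qed.

Lemma adj_vertex v w : adj v w -> is_vertex v.
Proof. by move=> [c [b [i [-> _]]]]; exact: is_vertex_vx. Qed.

Lemma sq_rot v1 v2 v3 v4 : sq v1 v2 v3 v4 -> sq v2 v3 v4 v1.
Proof.
move=> [c [b [i [j [ij -> -> -> ->]]]]]; exists c, (flip_at i b), j, i; split=> //.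
- by rewrite eq_sym.
- by rewrite flip_atC.
- by rewrite flip_atK.
- by rewrite flip_atK.
Qed.

Lemma sq_rev v1 v2 v3 v4 : sq v1 v2 v3 v4 -> sq v1 v4 v3 v2.
Proof.
move=> [c [b [i [j [ij -> -> -> ->]]]]]; exists c, b, j, i; split=> //; first by rewrite eq_sym.
by rewrite flip_atC.
Qed.

Lemma sq_adj v1 v2 v3 v4 : sq v1 v2 v3 v4 -> adj v1 v2.
Proof. by move=> [c [b [i [j [ij -> -> _ _]]]]]; exists c, b, i. Qed.

Lemma sq_diag v1 v2 v3 v4 : sq v1 v2 v3 v4 -> v1 <> v3.
Proof.
move=> [c [b [i [j [ij -> _ -> _]]]]] /vx_inj/(congr1 (fun f => f i)).
by rewrite flip_at_eq flip_at_neq //; case: (b i).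
Qed.

Lemma vx_adj c b i : adj (vx b) (@vx c (flip_at i b)).
Proof. by exists c, b, i. Qed.

Lemma vx_sq c b i j : i != j ->
  sq (vx b) (@vx c (flip_at i b)) (vx (flip_at i (flip_at j b))) (vx (flip_at j b)).
Proof. by move=> ij; exists c, b, i, j. Qed.

Lemma adj_in_cell c b b' : adj (@vx c b) (vx b') -> exists i, b' = flip_at i b.
Proof.
move=> [c' [b0 [i [e1 e2]]]]; apply: (@edist1_flip R).
by rewrite -(edist_flip R b0 i); congr (_ ^+ 2); apply: edist_glue e1 e2; exact: unit_bvec.
Qed.

Lemma adj_cell c b v : adj (@vx c b) v -> cell c v -> exists i, v = vx (flip_at i b).
Proof.
move=> av cv; have [|b' eb'] := vertex_of_cell (c := c) (v := v) _ cv.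
  exact: (adj_vertex (adjC av)).
by rewrite eb' in av *; have [i ->] := adj_in_cell av; exists i.
Qed.

(** The face shared with [c] contains [b] and its neighbours in the directions [i] and [j], so it is
    free in both. *)
Lemma sq_cell c v1 v2 v3 v4 : sq v1 v2 v3 v4 -> cell c v1 -> cell c v2 -> cell c v4 -> cell c v3.
Proof.
move=> [c0 [b [i [j [ij -> -> -> ->]]]]] h1 h2 h4.
have [s [s' [h [hF _ _ hS _]]]] := same_face (cell_vx b) h1.
have fs b' : cell c (@vx c0 b') -> face s (bvec b' : 'rV[R]_(dim c0)) by move=> cb; apply: hS => //; exact: unit_bvec.
have [_ f1] := fs _ h1; have [_ f2] := fs _ h2; have [_ f4] := fs _ h4.
have si : s i = None.
  case e : (s i) => [t|] //; have := f1 _ _ e; have := f2 _ _ e; rewrite !bvecE flip_at_eq => <-.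
  by move/bool_natr_inj; case: (b i).
have sj : s j = None.
  case e : (s j) => [t|] //; have := f1 _ _ e; have := f4 _ _ e; rewrite !bvecE flip_at_eq => <-.
  by move/bool_natr_inj; case: (b j).
have sb : face s (bvec (flip_at i (flip_at j b)) : 'rV[R]_(dim c0)).
  split; first exact: unit_bvec.
  move=> k t sk; rewrite -(f1 _ _ sk) !bvecE !flip_at_neq //; apply: contra_eqN sk => /eqP ->.
    by rewrite sj.
  by rewrite si.
by have [s'h e] := hF _ sb; exists (h (bvec (flip_at i (flip_at j b)))) => //; exact: face_unit s'h.
Qed.

Lemma sq_corner c b i j v : i != j ->
  sq (@vx c b) (vx (flip_at i b)) v (vx (flip_at j b)) -> v = vx (flip_at i (flip_at j b)).
Proof.
move=> ij Hs; have cv := sq_cell Hs (cell_vx _) (cell_vx _) (cell_vx _).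
have [m em] := adj_cell (sq_adj (sq_rot Hs)) cv.
have [n en] := adj_cell (sq_adj (sq_rot (sq_rev Hs))) cv.
have nd := sq_diag Hs.
have [mi|mi] := eqVneq m i; first by case: nd; rewrite em mi flip_atK.
have e := en; rewrite em in e; move/vx_inj: e => e.
have [ni|ni] := eqVneq n i; first by rewrite en ni.
have := congr1 (fun f => f i) e; rewrite flip_at_neq 1?eq_sym // flip_at_eq.
rewrite flip_at_neq 1?eq_sym // flip_at_neq //; by case: (b i).
Qed.

Lemma sq_uniq v1 v2 v3 v3' v4 : sq v1 v2 v3 v4 -> sq v1 v2 v3' v4 -> v3 = v3'.
Proof.
by move=> [c [b [i [j [ij -> -> -> ->]]]]] Hs; rewrite (sq_corner ij Hs).
Qed.

Lemma sq_neighbours v1 v2 v3 v4 : sq v1 v2 v3 v4 -> v2 <> v4.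
Proof. by move=> /sq_rot/sq_diag. Qed.

(** For adjacent [v] and [y], the edge joining them, described without charts. *)
Definition segment v y : set X := [set x | forall w, car x w -> w = v \/ w = y].

Lemma segmentC v y : segment v y = segment y v.
Proof. by apply/seteqP; split=> x H w /H[]; tauto. Qed.

Lemma segment_in v y : is_vertex v -> segment v y v.
Proof. by move=> vv w /(car_of_vertex _ vv) ->; left. Qed.

Lemma segment_sub v y c : cell c v -> cell c y -> segment v y `<=` cell c.
Proof. by move=> cv cy x H; apply: cell_of_car => w /H[] ->. Qed.

Lemma segment_face c b i : segment (@vx c b) (vx (flip_at i b)) =
  chart c @` face (fun j => if j == i then None else Some (b j)).
Proof.
apply/seteqP; split=> [x H|_ [u fu <-] w].
  have [u uu e] := segment_sub (cell_vx b) (cell_vx (flip_at i b)) H.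
  exists u => //; apply: face_all_rnd => // b' rb'; split; first exact: unit_bvec.
  move=> j t; case: eqVneq => // ji [<-]; rewrite bvecE.
  have [|/vx_inj ->//|/vx_inj ->] := H (vx b'); first by rewrite -e; apply/carE => //; exists b'.
  by rewrite flip_at_neq.
move=> /(carE _ (face_unit fu))[b' /(face_rnd fu)[_ H] ->].
have [e|e] := eqVneq (b' i) (b i); [left|right]; congr vx; apply/funext => j.
  have [->//|ji] := eqVneq j i; apply: (@bool_natr_inj R); rewrite -bvecE.
  by apply: H; rewrite (negbTE ji).
have [->|ji] := eqVneq j i; first by rewrite flip_at_eq; case: (b' i) (b i) e => -[].
rewrite flip_at_neq //; apply: (@bool_natr_inj R); rewrite -bvecE.
by apply: H; rewrite (negbTE ji).
Qed.

Lemma card_free1 n (b : 'I_n -> bool) i :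
  #|[pred j | (if j == i then None else Some (b j)) == None]| = 1%N.
Proof. by rewrite (eq_card (B := pred1 i)) ?card1 // => j; rewrite !inE; case: (j == i). Qed.

Lemma segment_edge v y : adj v y -> is_edge (segment v y).
Proof.
move=> [c [b [i [-> ->]]]]; rewrite segment_face.
have [c' [e d _]] := face_cell (fun j => if j == i then None else Some (b j)).
by exists c'; rewrite e d card_free1.
Qed.

Lemma is_edgeP e v : is_edge e -> e v -> is_vertex v -> exists2 y, adj v y & e = segment v y.
Proof.
move=> [c [d1 ->]] cv vv; have [b ->] := vertex_of_cell vv cv.
have i : 'I_(dim c) by rewrite d1; exact: ord0.
exists (vx (flip_at i b)); first exact: vx_adj.
rewrite segment_face /cell unit_cubeE; congr (chart c @` face _); apply/funext => j.
have one (k l : 'I_(dim c)) : k = l by move: k l; rewrite d1 => k l; rewrite !ord1.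
by rewrite (one j i) eqxx.
Qed.

Lemma is_edge_adj e : is_edge e -> exists v y, adj v y /\ e = segment v y.
Proof.
move=> He; have [c [d1 ec]] := He; have [y ay ey] := is_edgeP (v := @vx c (fun=> false)) He
  ltac:(rewrite ec; exact: cell_vx) (is_vertex_vx _).
by exists (@vx c (fun=> false)), y.
Qed.

Lemma segment_inj v y y' : adj v y -> adj v y' -> segment v y = segment v y' -> y = y'.
Proof.
move=> ay ay' e; have : segment v y' y by rewrite -e segmentC; apply: segment_in; exact: adj_vertex (adjC ay).
have vy := adj_vertex (adjC ay).
by move=> /(_ y)[|e1|//]; [exact/car_of_vertex|case: (adj_neq ay)].
Qed.

Lemma link_vertexP v e : is_vertex v -> link_vertex v e <-> exists2 y, adj v y & e = segment v y.
Proof.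
move=> vv; split=> [[He ev]|[y ay ->]]; first exact: is_edgeP.
by split; [exact: segment_edge|exact: segment_in].
Qed.

Lemma sq_face_cell c b i j : i != j -> exists c', [/\ dim c' = 2,
  forall b', cell c' (@vx c b') <-> b' \in [:: b; flip_at i b; flip_at j b; flip_at i (flip_at j b)]
  & cell c' `<=` cell c].
Proof.
move=> ij; pose s k := if (k == i) || (k == j) then None else Some (b k).
have [c' [e d _]] := face_cell s; exists c'; split; last by rewrite e => x [u fu <-]; exists u => //; exact: face_unit fu.
  rewrite d (eq_card (B := pred2 i j)) ?card2 ?ij // => k; rewrite !inE /s.
  by case: ifP.
move=> b'; rewrite e; split=> [[u fu /(chart_inj (face_unit fu) (unit_bvec _ _)) eu]|].
  move: fu; rewrite eu => -[_ H]; rewrite !inE.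
  have Hk k : k != i -> k != j -> b' k = b k.
    by move=> ki kj; apply: (@bool_natr_inj R); rewrite -bvecE; apply: H; rewrite /s (negbTE ki) (negbTE kj).
  have ext f : f i = b' i -> f j = b' j -> (forall k, k != i -> k != j -> f k = b k) -> b' == f.
    move=> fi fj fk; apply/eqP/funext => k; have [->//|ki] := eqVneq k i; have [->//|kj] := eqVneq k j.
    by rewrite Hk // fk.
  have ji : j != i by rewrite eq_sym.
  have [ei|ei] := eqVneq (b' i) (b i); have [ej|ej] := eqVneq (b' j) (b j).
  - by rewrite ext.
  - rewrite (_ : b' == flip_at j b) ?orbT //; apply: ext; last by move=> k _ kj; rewrite flip_at_neq.
      by rewrite flip_at_neq.
    by rewrite flip_at_eq; case: (b' j) (b j) ej => -[].
  - rewrite (_ : b' == flip_at i b) ?orbT //; apply: ext; last by move=> k ki _; rewrite flip_at_neq.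
      by rewrite flip_at_eq; case: (b' i) (b i) ei => -[].
    by rewrite flip_at_neq.
  - rewrite (_ : b' == flip_at i (flip_at j b)) ?orbT //; apply: ext.
    + by rewrite flip_at_eq flip_at_neq //; case: (b' i) (b i) ei => -[].
    + by rewrite flip_at_neq // flip_at_eq; case: (b' j) (b j) ej => -[].
    + by move=> k ki kj; rewrite !flip_at_neq.
move=> Hb; exists (bvec b') => //; split; first exact: unit_bvec.
move=> k t; rewrite /s; case: eqVneq => // ki; case: eqVneq => //= kj [<-].
rewrite bvecE; move: Hb; rewrite !inE => /or4P[] /eqP ->; by rewrite ?flip_at_neq.
Qed.

(** Flagness of the link applied to the edges from [v] to [L]. Two of them form a simplex because
    the 2-cell of a square contains no further edge at its corner. *)
Lemma flag_cell v (L : set X) : flag_complex (link_vertex v) (@link_simplex R X v) -> is_vertex v ->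
  L !=set0 -> finite_set L -> (forall y, L y -> adj v y) ->
  (forall y z, L y -> L z -> y <> z -> exists p, sq v y p z) ->
  exists c b, v = @vx c b /\ forall y, L y <-> exists i, y = vx (flip_at i b).
Proof.
move=> Hflag vv [y0 Ly0] Lf Ladj Lsq.
have [||||_ [c [cv ec]]] := Hflag (segment v @` L).
- by exists (segment v y0), y0.
- exact: finite_image.
- by move=> _ [y Ly <-]; apply/link_vertexP => //; exists y => //; exact: Ladj.
- move=> _ _ [y Ly <-] [z Lz <-] ne.
  have yz : y <> z by move=> yz; apply: ne; rewrite yz.
  have [p [c [b [i [j [ij ev ey ep ez]]]]]] := Lsq y z Ly Lz yz.
  have [c' [_ Hc' c'c]] := sq_face_cell b ij.
  have c'v : cell c' v by rewrite ev; apply/Hc'; rewrite !inE eqxx.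
  have c'y : cell c' y by rewrite ey; apply/Hc'; rewrite !inE eqxx !orbT.
  have c'z : cell c' z by rewrite ez; apply/Hc'; rewrite !inE eqxx !orbT.
  split; first by exists (segment v y); left.
  exists c'; split=> //; apply/seteqP; split=> [e [->|->]|e [] /(link_vertexP _ vv)[w aw ->] ew].
  + by split; [apply/link_vertexP => //; exists y => //; exact: Ladj|exact: segment_sub].
  + by split; [apply/link_vertexP => //; exists z => //; exact: Ladj|exact: segment_sub].
  have c'w : cell c' w by apply: ew; rewrite segmentC; apply: segment_in; exact: adj_vertex (adjC aw).
  have cw := c'c _ c'w; rewrite ev in aw; have [k ek] := adj_cell aw cw.
  have := c'w; rewrite ek Hc' !inE => /or4P[] /eqP e1.
  + by case: (flip_at_neqb e1).
  + by left; rewrite e1 ey.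
  + by right; rewrite e1 ez.
  have ji : j != i by rewrite eq_sym.
  have [ki|ki] := eqVneq k i.
    have := congr1 (fun f => f j) e1; rewrite ki flip_at_neq // flip_at_neq // flip_at_eq.
    by case: (b j).
  have := congr1 (fun f => f i) e1; rewrite flip_at_eq flip_at_neq 1?eq_sym // flip_at_neq //.
  by case: (b i).
have [b eb] := vertex_of_cell vv cv; exists c, b; split=> // y; split=> [Ly|[i ey]].
  have ay := Ladj y Ly; have : (segment v @` L) (segment v y) by exists y.
  rewrite ec => -[_ sub]; apply: adj_cell; first by rewrite -eb.
  by apply: sub; rewrite segmentC; apply: segment_in; exact: adj_vertex (adjC ay).
have ay : adj v y by rewrite eb ey; exact: vx_adj.
have : (segment v @` L) (segment v y).
  rewrite ec; split; first by apply/link_vertexP => //; exists y.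
  by apply: segment_sub => //; rewrite ey; exact: cell_vx.
by move=> [y' Ly' e]; rewrite -(segment_inj (Ladj _ Ly') ay e).
Qed.

(** The squares make the edges to [x], [y], [z] pairwise adjacent in the link of [w], so one cell
    contains them; there [sq_corner] determines [p], [q], [r]. *)
Lemma sq_cube w x y z p q r : (forall v, is_vertex v -> flag_complex (link_vertex v) (@link_simplex R X v)) ->
  sq w x p y -> sq w y q z -> sq w z r x -> exists s, [/\ sq x p s r, sq y p s q & sq z q s r].
Proof.
move=> Hflag Hp Hq Hr.
have vw := adj_vertex (sq_adj Hp).
have [] := @flag_cell w [set x; y; z] (Hflag w vw) vw.
- by exists x; left; left.
- by rewrite !finite_setU; split; [split|]; exact: finite_set1.
- by move=> _ [[]|] ->; [exact: sq_adj Hp|exact: sq_adj Hq|exact: sq_adj Hr].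
- move=> _ _ [[]|] -> [[]|] -> // _; [exists p|exists r|exists p|exists q|exists r|exists q] => //; exact: sq_rev.
move=> c [b [ew HL]].
have /HL[i ei] : [set x; y; z] x by left; left.
have /HL[j ej] : [set x; y; z] y by left; right.
have /HL[k ek] : [set x; y; z] z by right.
have ij : i != j by apply: contraPneq (sq_neighbours Hp) => e; rewrite ei ej e.
have jk : j != k by apply: contraPneq (sq_neighbours Hq) => e; rewrite ej ek e.
have ki : k != i by apply: contraPneq (sq_neighbours Hr) => e; rewrite ek ei e.
rewrite {}ew {}ei {}ej {}ek {HL vw} in Hp Hq Hr *.
rewrite (sq_corner ij Hp) (sq_corner jk Hq) (sq_corner ki Hr).
exists (vx (flip_at i (flip_at j (flip_at k b)))); split.
- have := @vx_sq c (flip_at i b) j k jk; congr sq; congr vx; first by rewrite flip_atC.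
    by rewrite [in RHS]flip_atC; congr flip_at; rewrite [RHS]flip_atC.
- have := @vx_sq c (flip_at j b) i k ltac:(by rewrite eq_sym).
  by rewrite (flip_atC k j).
- have := @vx_sq c (flip_at k b) j i ltac:(by rewrite eq_sym).
  by rewrite (flip_atC j i) (flip_atC i k).
Qed.

Lemma sq_opposite v1 v2 v3 v4 : sq v1 v2 v3 v4 -> opposite_edges (segment v1 v2) (segment v4 v3).
Proof.
move=> [c [b [i [j [ij -> -> -> ->]]]]].
have [c' [d Hc' _]] := sq_face_cell b ij.
have cin b' : b' \in [:: b; flip_at i b; flip_at j b; flip_at i (flip_at j b)] ->
  exists b0, vx b' = @vx c' b0.
  by move=> /Hc'; apply: vertex_of_cell; exact: is_vertex_vx.
have [|b1 e1] := cin b; first by rewrite !inE eqxx.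
have [|b2 e2] := cin (flip_at i b); first by rewrite !inE eqxx !orbT.
have [|b3 e3] := cin (flip_at i (flip_at j b)); first by rewrite !inE eqxx !orbT.
have [|b4 e4] := cin (flip_at j b); first by rewrite !inE eqxx !orbT.
have Hs := @vx_sq c b i j ij; rewrite e1 e2 e3 e4 in Hs *.
have [i' ei'] := adj_in_cell (sq_adj Hs); have [j' ej'] := adj_in_cell (sq_adj (sq_rev Hs)).
rewrite {}ei' {}ej' {e2 e4} in Hs *.
have ij' : i' != j' by apply: contraPneq (sq_neighbours Hs) => ->.
rewrite (sq_corner ij' Hs) !segment_face; exists c', i'; split=> //.
  by exists (fun j => if j == i' then None else Some (b1 j)); split=> // k; case: eqP.
by exists (fun k => if k == i' then None else Some (flip_at j' b1 k)); split=> // k; case: eqP.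
Qed.

Lemma dual_edge_vx c i (e : set X) : dual_edge i e ->
  exists b : 'I_(dim c) -> bool, e = segment (vx b) (vx (flip_at i b)).
Proof.
move=> [s [Hs ->]]; exists (fun j => if s j is Some t then t else false).
rewrite segment_face; congr (chart c @` face _); apply/funext => j.
by case: eqVneq => [/Hs //|ji]; case es : (s j) => [t|] //; move/Hs: es ji => ->; rewrite eqxx.
Qed.

Lemma dual_edge_segment c (b : 'I_(dim c) -> bool) i : dual_edge i (segment (vx b) (vx (flip_at i b))).
Proof.
rewrite segment_face; exists (fun j => if j == i then None else Some (b j)).
by split=> // j; case: eqP.
Qed.

Lemma opposite_edges_sq e f : opposite_edges e f -> exists v1 v2 v3 v4,
  [/\ e = segment v1 v2, f = segment v4 v3, adj v1 v2 &
   sq v1 v2 v3 v4 \/ (v3 = v2 /\ v4 = v1)].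
Proof.
move=> [c [i [d2 /dual_edge_vx[b ->] /dual_edge_vx[b' ->]]]].
wlog bi : b' / b' i = b i => [H|].
  have [eb|eb] := eqVneq (b' i) (b i); first exact: H.
  rewrite (segmentC (vx b')) -{2}(flip_atK i b'); apply: H.
  by rewrite flip_at_eq; case: (b' i) (b i) eb => -[].
exists (vx b), (vx (flip_at i b)), (vx (flip_at i b')), (vx b'); split=> //; first exact: vx_adj.
have [->|nb] := pselect (b' = b); [by right|left].
have /existsNP[j bj] : ~ forall j, b' j = b j by move=> H; apply: nb; apply/funext.
have ij : i != j by apply/eqP => ij; apply: bj; rewrite -ij.
have -> : b' = flip_at j b; last exact: vx_sq.
apply/funext => k; have [->|kj] := eqVneq k j.
  by rewrite flip_at_eq; case: (b' j) (b j) bj => -[].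
rewrite flip_at_neq //; have [->//|ki] := eqVneq k i.
have : (#|[:: i; j; k]| <= 2)%N by rewrite -[leqRHS]d2 -[leqRHS]card_ord; exact: max_card.
by rewrite (card_uniqP _) //= !inE negb_or ij (eq_sym i k) ki eq_sym kj.
Qed.

End CellGeometry.

(** * Simple connectivity of the graph of squares *)

Section Homotopies.
Variables (V : Type) (adj : V -> V -> Prop) (sq : V -> V -> V -> V -> Prop).
Notation joins := (joins adj).
Notation homotopic := (homotopic adj sq).

Lemma homotopic_refl l : homotopic l l. Proof. exact: rst_refl. Qed.
Lemma homotopic_sym l l' : homotopic l l' -> homotopic l' l. Proof. exact: rst_sym. Qed.
Lemma homotopic_trans l2 l1 l3 : homotopic l1 l2 -> homotopic l2 l3 -> homotopic l1 l3.
Proof. exact: rst_trans. Qed.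

Lemma hstep_catl p q r : hstep adj sq p q -> hstep adj sq (p ++ r) (q ++ r).
Proof. by elim=> *; constructor. Qed.

Lemma homotopic_catl r p q : homotopic p q -> homotopic (p ++ r) (q ++ r).
Proof.
elim=> [x y H|x|x y _ H|x y z _ H _]; first by apply: rst_step; exact: hstep_catl.
- exact: homotopic_refl.
- exact: homotopic_sym.
- exact: homotopic_trans.
Qed.

Lemma homotopic_cons a p q : homotopic p q -> homotopic (a :: p) (a :: q).
Proof.
elim=> [x y H|x|x y _ H|x y z _ H _]; first by apply: rst_step; exact: hstep_cons.
- exact: homotopic_refl.
- exact: homotopic_sym.
- exact: homotopic_trans.
Qed.

Lemma homotopic_catr l p q : homotopic p q -> homotopic (l ++ p) (l ++ q).
Proof. by move=> H; elim: l => [//|a l IH] /=; exact: homotopic_cons. Qed.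

Lemma joins_head l u v : joins l u v -> exists t, l = v :: t.
Proof. by move=> [_ [t [-> _]]]; exists t. Qed.

Lemma joins_last l u v : joins l u v -> exists l0, l = rcons l0 u.
Proof. by move=> [_ [t [-> <-]]]; exists (belast v t); exact: lastI. Qed.

Lemma joins_ind (P : seq V -> V -> Prop) u : P [:: u] u ->
  (forall l v w, joins l u v -> adj w v -> P l v -> P (w :: l) w) ->
  forall l v, joins l u v -> P l v.
Proof.
move=> P0 P1; elim=> [|a [|b t] IH] v [wl [t' [e lt]]] //.
  by case: e lt => av <- /= lt; subst.
case: e lt => av <- /= lt; subst a; have [ab wt] := wl.
have jb : joins (b :: t) u b by split=> //; exists t.
exact: P1 jb ab (IH _ jb).
Qed.

Lemma joins_comp l l' u v w : joins l u v -> joins l' v w -> joins (l' ++ behead l) u w.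
Proof.
move=> jl; move: l' w; apply: joins_ind.
  by have [t e] := joins_head jl; rewrite e /= -e.
by move=> l' v' w' _ a j /=; exact: joins_cons j a.
Qed.

Lemma homotopic_comp l1 l2 l1' l2' u v w : joins l1 u v -> joins l2 u v ->
  joins l1' v w -> homotopic l1 l2 -> homotopic l1' l2' ->
  homotopic (l1' ++ behead l1) (l2' ++ behead l2).
Proof.
move=> j1 j2 j1' h h'; apply: homotopic_trans (homotopic_catl _ h').
have [t1 e1] := joins_head j1; have [t2 e2] := joins_head j2; have [l0 e0] := joins_last j1'.
by rewrite e1 e2 e0 /= !cat_rcons in h *; exact: homotopic_catr.
Qed.

Hypothesis adjC : forall a b, adj a b -> adj b a.

Lemma joins_inverse l u v : joins l u v ->
  exists2 l', joins l' v u & homotopic (l ++ behead l') [:: v].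
Proof.
move: l v; apply: joins_ind; first by exists [:: u]; [exact: joins_nil|exact: homotopic_refl].
move=> l v w jl wv [l' jl' h].
have jwv : joins [:: v; w] w v by split; [split=> //; exact: adjC|exists [:: w]].
exists (l' ++ behead [:: v; w]); first exact: joins_comp jwv jl'.
have [t' e'] := joins_head jl'; rewrite e' /= in h *.
rewrite catA; apply: (homotopic_trans (l2 := [:: w; v; w])).
  by apply: homotopic_cons; apply: (homotopic_catl [:: w] h).
by apply: rst_step; apply: hstep_back.
Qed.

Lemma homotopic_of_loops : (forall u l, joins l u u -> homotopic l [:: u]) ->
  forall u v l l', joins l u v -> joins l' u v -> homotopic l l'.
Proof.
move=> H u v l l' jl jl'; have [k jk hk] := joins_inverse jl'.
have hl := H _ _ (joins_comp jl jk).
have [t e] := joins_head jl; have [t' e'] := joins_head jl'; have [s es] := joins_head jk.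
have [k0 ek] := joins_last jk; have [l0 el] := joins_last jl'.
apply: (homotopic_trans (l2 := l' ++ behead (k ++ behead l))).
  rewrite es /= catA; apply: homotopic_sym.
  have -> : l = [:: v] ++ behead l by rewrite e.
  by apply: homotopic_catl; rewrite es in hk.
have {2}-> : l' = l' ++ behead [:: u] by rewrite cats0.
by apply: (homotopic_comp (joins_comp jl jk) (joins_nil _ _) jl' hl (homotopic_refl _)).
Qed.

End Homotopies.

(** * Edge paths inside one cell *)

Section CellWalks.
Variables (R : realType) (X : cubeComplex R).
Implicit Types (c : cube X).

Definition vertexT := {v : X | is_vertex v}.
Definition cell_vertex c (b : 'I_(dim c) -> bool) : vertexT := exist _ (vx b) (is_vertex_vx b).
Definition vadj (v w : vertexT) := adj (proj1_sig v) (proj1_sig w).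
Definition vsq (a b c d : vertexT) := sq (proj1_sig a) (proj1_sig b) (proj1_sig c) (proj1_sig d).
Definition incell c (v : vertexT) := cell c (proj1_sig v).

Notation joins := (joins vadj).
Notation homotopic := (homotopic vadj vsq).

Lemma Vt_eq (v w : vertexT) : proj1_sig v = proj1_sig w -> v = w.
Proof. by case: v w => [v pv] [w pw] /= e; subst w; congr exist; exact: Prop_irrelevance. Qed.

Lemma incell_vt c v : incell c v -> exists b, v = @cell_vertex c b.
Proof.
by move=> cv; have [b e] := vertex_of_cell (proj2_sig v) cv; exists b; exact: Vt_eq.
Qed.

Definition flips c (b : 'I_(dim c) -> bool) w := foldr (fun i a => flip_at i a) b w.

(* The letters of [w] are flipped from the last one to the first one. *)
Fixpoint wpath c (b : 'I_(dim c) -> bool) (w : seq 'I_(dim c)) : seq vertexT :=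
  cell_vertex (flips b w) :: if w is _ :: w' then wpath b w' else [::].

Lemma wpath_joins c b w : joins (@wpath c b w) (cell_vertex b) (cell_vertex (flips b w)).
Proof.
elim: w => [|i w IH]; first exact: joins_nil.
by apply: joins_cons IH _; apply: adjC; exact: vx_adj.
Qed.

Lemma wpath_swap c b i j w : homotopic (@wpath c b [:: i, j & w]) (wpath b [:: j, i & w]).
Proof.
have [->|ij] := eqVneq i j; first exact: homotopic_refl.
rewrite /= !(flip_atC j i); have -> : wpath b w = cell_vertex (flips b w) :: behead (wpath b w) by case: (w).
apply: rst_step; apply: hstep_sq; apply: sq_rot; apply: sq_rot.
exact: (vx_sq (flips b w) ij).
Qed.

Lemma wpath_front c b i w1 w2 : homotopic (@wpath c b (w1 ++ i :: w2)) (wpath b (i :: w1 ++ w2)).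
Proof.
elim: w1 => [|j w1 IH]; first exact: homotopic_refl.
apply: homotopic_trans _ (wpath_swap b j i _).
have eq : flips b (w1 ++ i :: w2) = flips b (i :: w1 ++ w2).
  by elim: (w1) => //= k s ->; rewrite /= flip_atC.
by rewrite /= eq; apply: homotopic_cons.
Qed.

Lemma flips_count c b w i : @flips c b w i = b i (+) odd (count_mem i w).
Proof.
elim: w => [|j w IH] /=; first by rewrite addbF.
have [->|ji] := eqVneq j i; first by rewrite flip_at_eq IH /= addbN.
by rewrite flip_at_neq 1?eq_sym // IH.
Qed.

Lemma wpath_cancel c b i w1 w2 : homotopic (@wpath c b (i :: w1 ++ i :: w2)) (wpath b (w1 ++ w2)).
Proof.
apply: (homotopic_trans (l2 := wpath b [:: i, i & w1 ++ w2])).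
  have eq : flips b (w1 ++ i :: w2) = flips b (i :: w1 ++ w2).
    by elim: (w1) => //= k s ->; rewrite /= flip_atC.
  by rewrite /= eq; apply: homotopic_cons; exact: wpath_front.
rewrite /= flip_atK; have -> : wpath b (w1 ++ w2) = cell_vertex (flips b (w1 ++ w2)) :: behead (wpath b (w1 ++ w2)).
  by case: (w1 ++ w2).
by apply: rst_step; apply: hstep_back; exact: vx_adj.
Qed.

(** Squares commute letters and backtracks cancel equal ones, so only the parity of each direction
    matters, and the end point determines it. *)
Lemma wpath_homotopic c b w w' : @flips c b w = flips b w' -> homotopic (wpath b w) (wpath b w').
Proof.
have [n] := ubnP (size w + size w'); elim: n w w' => // n IH w w' Hn e.
wlog [i [w1 ew]] : w w' Hn e / exists i w1, w = i :: w1.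
  case: w Hn e => [|i w1] Hn e H; last by apply: H => //; exists i, w1.
  case: w' Hn e => [|i w1] Hn e; first exact: homotopic_refl.
  by apply: homotopic_sym; apply: (H (i :: w1) [::]); [rewrite addnC|exact: esym|exists i, w1].
subst w; have [/splitPr H|iw] := boolP (i \in w1).
  case: w1 / H Hn e => p q Hn e.
  apply: homotopic_trans (wpath_cancel b i p q) _; apply: IH.
    by move: Hn; rewrite /= !size_cat /=; lia.
  rewrite -e; apply/funext => j; rewrite !flips_count /= !count_cat /=.
  by case: (i == j) => //=; rewrite !oddD addbA; case: odd; case: odd; case: (b j).
have iw' : i \in w'.
  apply: contraT => niw; have := congr1 (fun f => f i) e.
  rewrite !flips_count /= eqxx (count_memPn iw) (count_memPn niw).
  by case: (b i).
move: iw' Hn e => /splitPr[p q] Hn e.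
apply: homotopic_trans _ (homotopic_sym (wpath_front b i p q)).
have e' : flips b w1 = flips b (p ++ q).
  apply/funext => j; have := congr1 (fun f => f j) e; rewrite !flips_count /= !count_cat /=.
  by case: (i == j) => //=; rewrite ?addnS ?oddS /= ?addbN => /(congr1 negb); rewrite ?negbK.
rewrite /= e'; apply: homotopic_cons; apply: IH => //.
by move: Hn; rewrite /= !size_cat /=; lia.
Qed.

Lemma incell_wpath c b l v : joins l (cell_vertex b) v -> (forall z, List.In z l -> incell c z) ->
  exists w, l = @wpath c b w.
Proof.
move: l v; apply: joins_ind; first by exists [::].
move=> l v w jl wv IH Hin; have [|s es] := IH; first by move=> z zl; apply: Hin; right.
have cw : incell c w by apply: Hin; left.
have [t et] := joins_head jl; have ev : v = cell_vertex (flips b s) by move: et; rewrite es; case: s {es} => [|? ?] [].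
rewrite ev in wv; have [i ei] := adj_cell (adjC wv) cw.
exists (i :: s); rewrite /= -es; congr (_ :: _); exact: Vt_eq.
Qed.

Lemma incell_homotopic c u v l l' : joins l u v -> joins l' u v ->
  (forall z, List.In z l -> incell c z) -> (forall z, List.In z l' -> incell c z) ->
  homotopic l l'.
Proof.
move=> jl jl' Hl Hl'.
have [t et] := joins_last jl; have cu : incell c u.
  by apply: Hl; rewrite et -cats1; apply/List.in_or_app; right; left.
have [b eb] := incell_vt cu; subst u.
have [w ew] := incell_wpath jl Hl; have [w' ew'] := incell_wpath jl' Hl'.
rewrite ew ew' in jl jl' *; apply: wpath_homotopic.
have [s es] := joins_head jl; have [s' es'] := joins_head jl'.
have : cell_vertex (flips b w) = cell_vertex (flips b w').
  by transitivity v; [move: es|move: es']; case: (w) => [|? ?] [] //; case: (w') => [|? ?] [].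
by move=> /(congr1 (@proj1_sig _ _)) /vx_inj.
Qed.

Lemma cell_between c c' (b b' d : 'I_(dim c) -> bool) : cell c' (vx b) -> cell c' (vx b') ->
  (forall i, d i = b i \/ d i = b' i) -> cell c' (vx d).
Proof.
move=> h1 h2 H; have [s [s' [h [hF _ _ hS _]]]] := same_face (cell_vx b) h1.
have [_ f1] := hS _ (unit_bvec R b) h1; have [_ f2] := hS _ (unit_bvec R b') h2.
have [|s'h e] := hF (bvec d); last by exists (h (bvec d)); [exact: face_unit s'h|rewrite -e].
split; first exact: unit_bvec.
by move=> i t si; have := f1 i t si; have := f2 i t si; rewrite !bvecE; case: (H i) => ->.
Qed.

(** Flipping once each direction in which the ends differ stays in the interval between them, which
    lies in every cell containing both. *)
Lemma exists_cell_walk u v : (exists c, incell c u /\ incell c v) ->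
  exists l, joins l u v /\ forall c, incell c u -> incell c v -> forall z, List.In z l -> incell c z.
Proof.
move=> [c [cu cv]]; have [b eb] := incell_vt cu; have [b' eb'] := incell_vt cv; subst u v.
pose w := [seq i <- enum 'I_(dim c) | b i != b' i].
have uw : uniq w by apply: filter_uniq; exact: enum_uniq.
have ew : flips b w = b'.
  apply/funext => i; rewrite flips_count (count_uniq_mem _ uw).
  by rewrite mem_filter mem_enum andbT; case: (b i) (b' i) => -[].
exists (wpath b w); split; first by have := wpath_joins b w; rewrite ew.
move=> c' c'u c'v z Hz.
have [s [ez swap_step]] : exists s, z = cell_vertex (flips b s) /\ {subset s <= w} /\ uniq s.
  elim: (w) Hz uw => [|i s IH] /= [<-|] //; first by exists [::].
    by move=> us; exists (i :: s); do 2?split=> //.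
  by move=> /IH H /andP[_ /H[s' [e [sub us']]]]; exists s'; split=> //; split=> // j /sub; rewrite inE orbC => ->.
rewrite ez; apply: (cell_between c'u c'v) => i; rewrite -ew !flips_count.
case: swap_step => sub us; rewrite (count_uniq_mem _ uw) (count_uniq_mem _ us).
by case: (boolP (i \in s)) => [/sub ->|_]; [right|left; rewrite addbF].
Qed.

End CellWalks.

Import numFieldNormedType.Exports.

Section Clamp.
Variable R : realType.

(* Precomposing with [clamp] turns maps continuous on [0, 1] into maps continuous everywhere. *)
Definition clamp (t : R) : R := Num.max 0 (Num.min 1 t).

Lemma clamp_itv t : 0 <= clamp t <= 1.
Proof. by rewrite /clamp le_max lexx /= ge_max ler01 ge_min lexx. Qed.

Lemma clamp_id t : 0 <= t <= 1 -> clamp t = t.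
Proof. by move=> /andP[t0 t1]; rewrite /clamp min_r // max_r. Qed.

Lemma clamp0 t : t <= 0 -> clamp t = 0.
Proof. by move=> t0; rewrite /clamp max_l // ge_min t0 orbT. Qed.

Lemma clamp1 t : 1 <= t -> clamp t = 1.
Proof. by move=> t0; rewrite /clamp min_l // max_r. Qed.

Lemma continuous_clamp : continuous clamp.
Proof.
move=> t; apply: continuous_max; first exact: cvg_cst.
by apply: continuous_min; [exact: cvg_cst|exact: cvg_id].
Qed.

Lemma continuous_clampl (T : topologicalType) (p : R -> T) :
  {within `[0, 1], continuous p} -> continuous (p \o clamp).
Proof.
move=> cp; apply/continuousP => A oA.
have /continuousP/(_ A oA)/open_subspaceP[B oB eB] := cp.
have -> : (p \o clamp) @^-1` A = clamp @^-1` B.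
  have H t : (`[0, 1]%classic : set R) (clamp t) by rewrite /= in_itv /=; exact: clamp_itv.
  apply/seteqP; split=> t /= h.
    by have : (p @^-1` A `&` `[0, 1]) (clamp t) by []; rewrite -eB => -[].
  by have : (B `&` `[0, 1]) (clamp t) by []; rewrite eB => -[].
by move/continuousP: continuous_clamp; apply.
Qed.

Lemma continuous_clamp2 : continuous (fun z : R * R => (clamp z.1, clamp z.2)).
Proof.
move=> z.
have c1 : (fun w : R * R => clamp w.1) @ z --> clamp z.1.
  by apply: (@cvg_comp _ _ _ (fun w : R * R => w.1) clamp); [exact: cvg_fst|exact: continuous_clamp].
have c2 : (fun w : R * R => clamp w.2) @ z --> clamp z.2.
  by apply: (@cvg_comp _ _ _ (fun w : R * R => w.2) clamp); [exact: cvg_snd|exact: continuous_clamp].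
exact: (cvg_pair c1 c2).
Qed.

Lemma continuous_clampl2 (T : topologicalType) (H : R * R -> T) :
  {within `[0, 1] `*` `[0, 1], continuous H} ->
  continuous (fun z => H (clamp z.1, clamp z.2)).
Proof.
move=> cp; apply/continuousP => A oA.
have /continuousP/(_ A oA)/open_subspaceP[B oB eB] := cp.
pose k (z : R * R) := (clamp z.1, clamp z.2).
have -> : (fun z => H (clamp z.1, clamp z.2)) @^-1` A = k @^-1` B.
  have Hk z : (`[0, 1] `*` `[0, 1] : set (R * R)) (k z).
    by split; rewrite /= in_itv /=; exact: clamp_itv.
  apply/seteqP; split=> z /= h.
    by have : (H @^-1` A `&` (`[0, 1] `*` `[0, 1])) (k z) by []; rewrite -eB => -[].
  by have : (B `&` (`[0, 1] `*` `[0, 1])) (k z) by []; rewrite eB => -[].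
have ck : continuous k by exact: continuous_clamp2.
by move/continuousP: ck; apply.
Qed.

End Clamp.

(** * Open stars and polygonal paths *)

Section Stars.
Variables (R : realType) (X : cubeComplex R).

Definition star (v : X) : set X := [set x | car x v].

(** In a chart, the star of the vertex [b] consists of the points that share no coordinate with the
    vertex opposite to [b]. *)
Lemma star_open v : open (star v : set (pt X)).
Proof.
move=> c; apply/open_subspaceP.
have [[b ev]|nv] := pselect (exists b, v = @vx _ X c b); last first.
  exists set0; first exact: open0.
  rewrite set0I; apply/seteqP; split=> // u [/= /[swap] uu /(carE _ uu)[b _ e]].
  by apply: nv; exists b.
exists [set u : 'rV[R]_(dim c) | forall i, u ord0 i != (~~ b i)%:R].
  rewrite openE => u Hu.
  suff : \forall v \near u, forall i, (v : 'rV[R]_(dim c)) ord0 i != (~~ b i)%:R by [].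
  apply: (@filter_forall _ _ (fun i (v : 'rV[R]_(dim c)) => v ord0 i != (~~ b i)%:R) (nbhs u) (nbhs_filter u)) => i.
  apply: (@coord_continuous R _ _ ord0 i u [set r | r != (~~ b i)%:R]).
  by apply: open_nbhs_nbhs; split; [exact: open_neq|exact: Hu].
apply/seteqP; split=> u [H uu]; split=> //.
  rewrite /= /star /= ev; apply/carE => //; exists b => // i; have := H i.
  by case: (b i) => /= /eqP h; split.
move=> i /=; move: H; rewrite /= /star /= ev => /(carE _ uu)[b' rb /vx_inj eb].
rewrite eb; have [h0 h1] := rb i; apply/eqP => e; rewrite e in h0 h1.
by case: (b' i) h0 h1 => /= h0 h1; [have := h0 erefl|have := h1 erefl].
Qed.

Definition edge_point (c : cube X) (u v : 'rV[R]_(dim c)) (t : R) : X :=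
  chart c ((1 - clamp t) *: u + clamp t *: v).

Lemma edge_point_in n (u v : 'rV[R]_n) t : unit_cube u -> unit_cube v ->
  unit_cube ((1 - clamp t) *: u + clamp t *: v).
Proof.
move=> uu uv i; rewrite !mxE; have := clamp_itv t; have := uu i; have := uv i.
by move: (clamp t) (u ord0 i) (v ord0 i) => s p q; nra.
Qed.

Lemma continuous_edge_point (c : cube X) (u v : 'rV[R]_(dim c)) : unit_cube u -> unit_cube v ->
  continuous (edge_point u v : R -> pt X).
Proof.
move=> uu uv; apply/continuousP => A oA.
have /open_subspaceP[B oB eB] := oA c.
pose k (t : R) := (1 - clamp t) *: u + clamp t *: v.
have -> : edge_point u v @^-1` A = k @^-1` B.
  apply/seteqP; split=> t /= h.
    have : (chart c @^-1` A `&` unit_cube) (k t) by split=> //; exact: edge_point_in.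
    by rewrite -eB => -[].
  have : (B `&` unit_cube) (k t) by split=> //; exact: edge_point_in.
  by rewrite eB => -[].
have ck : continuous k.
  move=> t B' [P HP sub]; apply: (filterS (fun s H => sub (k s) H)).
  suff : \forall s \near t, forall i j, P i j (k s i j) by [].
  apply: (@filter_forall _ _ (fun i s => forall j, P i j (k s i j)) (nbhs t) (nbhs_filter t)) => i.
  apply: (@filter_forall _ _ (fun j s => P i j (k s i j)) (nbhs t) (nbhs_filter t)) => j.
  have : (fun s => (1 - clamp s) * u i j + clamp s * v i j) @ t --> (1 - clamp t) * u i j + clamp t * v i j.
    apply: cvgD; apply: cvgMr_tmp; last exact: continuous_clamp.
    by apply: cvgB; [exact: cvg_cst|exact: continuous_clamp].
  move=> /(_ (P i j)) H; have := H; rewrite /k; have := HP i j; rewrite !mxE => h1 /(_ h1).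
  by apply: (@filterS _ _ (nbhs_filter t)) => s /=; rewrite !mxE.
by move/continuousP: ck; apply.
Qed.

Lemma exists_edge_path v w : adj v w -> exists g : R -> pt X,
  [/\ continuous g, forall t, t <= 0 -> g t = v, forall t, 1 <= t -> g t = w &
   forall t, segment v w (g t)].
Proof.
move=> [c [b [i [-> ->]]]].
exists (edge_point (bvec b) (bvec (flip_at i b))); split.
- by apply: continuous_edge_point; exact: unit_bvec.
- by move=> t t0; rewrite /edge_point clamp0 // subr0 scale1r scale0r addr0.
- by move=> t t1; rewrite /edge_point clamp1 // subrr scale1r scale0r add0r.
move=> t; rewrite segment_face; exists ((1 - clamp t) *: bvec b + clamp t *: bvec (flip_at i b)) => //.
split; first by apply: edge_point_in; exact: unit_bvec.
move=> j e; case: eqVneq => // ji [<-]; rewrite !mxE flip_at_neq //.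
by rewrite -mulrDl subrK mul1r.
Qed.

Lemma continuous_paste (T : topologicalType) (a : R) (f g : R -> T) : continuous f -> continuous g ->
  f a = g a -> continuous (fun t => if t <= a then f t else g t).
Proof.
move=> cf cg e; apply/continuous_closedP => A cA.
have -> : (fun t => if t <= a then f t else g t) @^-1` A =
  (f @^-1` A `&` [set t | t <= a]) `|` (g @^-1` A `&` [set t | a <= t]).
  apply/seteqP; split=> t /=.
    by case: (leP t a) => ta h; [left|right; split=> //; exact: ltW].
  move=> [[h ->]//|[h at_]]; case: (leP t a) => // ta.
  by have -> : t = a by [apply: le_anti; rewrite ta at_]; rewrite e -(le_anti (_ : t <= a <= t)) // ta at_.
move/continuous_closedP: cf => /(_ A cA) cf; move/continuous_closedP: cg => /(_ A cA) cg.
by apply: closedU; apply: closedI => //; (exact: closed_le || exact: closed_ge).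
Qed.

Lemma exists_polygon (x : nat -> X) n : (forall j, (j < n)%N -> adj (x j) (x j.+1)) ->
  exists q : R -> pt X, [/\ continuous q, forall t, t <= 0 -> q t = x 0, forall t, n%:R <= t -> q t = x n,
    forall j, (j <= n)%N -> q j%:R = x j &
    forall j t, (j < n)%N -> j%:R <= t <= j.+1%:R -> segment (x j) (x j.+1) (q t)].
Proof.
elim: n => [_|n IH Hadj].
  exists (fun=> x 0); split=> //; first by move=> t; exact: cvg_cst.
  by move=> j; rewrite leqn0 => /eqP ->.
have [j jn|q [cq q0 qn qj qs]] := IH; first by apply: Hadj; exact: ltnW.
have [g [cg g0 g1 gs]] := exists_edge_path (Hadj n (ltnSn n)).
exists (fun t => if t <= n%:R then q t else g (t - n%:R)); split.
- apply: (continuous_paste (g := fun t => g (t - n%:R))) => //; last by rewrite subrr qn // g0.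
  move=> t; apply: (@cvg_comp _ _ _ (fun t => t - n%:R) g); last exact: cg.
  by apply: cvgB; [exact: cvg_id|exact: cvg_cst].
- by move=> t t0; rewrite (le_trans t0) ?ler0n // q0.
- move=> t tn; have tn' : n%:R < t by apply: lt_le_trans tn; rewrite ltr_nat.
  by rewrite leNgt tn' /= g1 // lerBrDl natr1.
- move=> j; rewrite leq_eqVlt => /orP[/eqP ->|]; last by rewrite ltnS => jn; rewrite ler_nat jn qj.
  by rewrite ler_nat ltnn g1 // -natrB ?subSnn.
- move=> j t jn /andP[t1 t2]; case: (leP t n%:R) => tn; last first.
    have e : j = n; last by rewrite e; exact: gs.
    apply/eqP; rewrite eqn_leq -ltnS jn /= -ltnS.
    by rewrite -(ltr_nat R); apply: lt_le_trans tn t2.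
  move: jn; rewrite ltnS leq_eqVlt => /orP[/eqP e|jn]; last by apply: qs; rewrite ?t1.
  have -> : t = n%:R by apply: le_anti; rewrite tn -e t1.
  by rewrite qn // e; apply: segment_in; exact: adj_vertex (Hadj n (ltnSn n)).
Qed.

Lemma star_common_cell x : exists c, forall v, star v x -> cell c v.
Proof. by have [c cx] := chart_cover x; exists c => v; exact: car_cell. Qed.

Lemma common_star (x : X) : exists v, is_vertex v /\ star v x.
Proof. by have [v cv] := car_exists x; exists v; split=> //; exact: car_vertex cv. Qed.

(** A Lebesgue number for the covering by preimages of open stars, from compactness of the unit
    square. *)
Lemma lebesgue_grid (H : R * R -> pt X) : continuous H -> exists m0, forall m, (m0 <= m)%N ->
  forall z, (`[0, 1] `*` `[0, 1] : set (R * R)) z -> exists v : vertexT X,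
  forall z' : R * R, `|z.1 - z'.1| <= m.+1%:R^-1 -> `|z.2 - z'.2| <= m.+1%:R^-1 -> star (proj1_sig v) (H z').
Proof.
move=> cH; pose P (m : nat) (z : R * R) := exists v : vertexT X,
  forall z' : R * R, `|z.1 - z'.1| <= m.+1%:R^-1 -> `|z.2 - z'.2| <= m.+1%:R^-1 -> star (proj1_sig v) (H z').
have /compact_near_coveringP K : compact (`[0, 1] `*` `[0, 1] : set (R * R)).
  by apply: compact_setX; exact: segment_compact.
have [m0 _ Hm0] : \forall m \near \oo, (`[0, 1] `*` `[0, 1] : set (R * R)) `<=` P m.
  apply: (K nat \oo P) => z _.
  have [v [vv sv]] := common_star (H z).
  have : nbhs z (H @^-1` star v) by apply: cH; apply: open_nbhs_nbhs; split=> //; exact: star_open.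
  rewrite -nbhs_ballE => -[e /= e0 sub].
  exists (ball z (e / 2), [set m | m.+1%:R^-1 < e / 2]) => /=.
    split; first by apply: nbhsx_ballx; rewrite divr_gt0.
    have e2 : 0 < e / 2 by rewrite divr_gt0.
    exact: (near_infty_natSinv_lt (PosNum e2)).
  move=> [z1 m] /= [bz me]; exists (exist _ v vv) => z' h1 h2; apply: sub; case: bz => b1 b2.
  have tri (p q r : R) : ball p (e / 2) q -> `|q - r| <= m.+1%:R^-1 -> ball p e r.
    rewrite /ball /= => b h; have -> : p - r = (p - q) + (q - r) by rewrite addrA subrK.
    by apply: le_lt_trans (ler_normD _ _) _; rewrite (splitr e); apply: ltrD => //; exact: le_lt_trans h me.
  by split; [exact: tri b1 h1|exact: tri b2 h2].
by exists m0 => m mm z zK; exact: Hm0 mm z zK.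
Qed.

End Stars.

Section Loops.
Variables (R : realType) (X : cubeComplex R).
Hypothesis Xsc : simply_connected R (pt X).
Notation vertexT := (vertexT X).
Notation vadj := (@vadj R X).
Notation vsq := (@vsq R X).
Notation joins := (joins vadj).
Notation homotopic := (homotopic vadj vsq).

Lemma vadjC (a b : vertexT) : vadj a b -> vadj b a.
Proof. exact: adjC. Qed.

Lemma joins_trans (u v w : vertexT) : (exists l, joins l u v) -> (exists l, joins l v w) -> exists l, joins l u w.
Proof. by move=> [l jl] [l' jl']; exists (l' ++ behead l); exact: joins_comp jl jl'. Qed.

(** The times at which the path is in the star of a vertex reachable from [u] form an open set. So
    do the other times, because vertices whose stars share a point are joined inside a cell. *)
Lemma vertices_connected (u v : vertexT) : exists l, joins l u v.
Proof.
have [_ /(_ (proj1_sig u) (proj1_sig v))[p [cp p0 p1]] _] := Xsc.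
have cq := continuous_clampl cp; set q := p \o _ in cq.
have stars (D : vertexT -> Prop) : open [set t | exists2 v', D v' & star (proj1_sig v') (q t)].
  have -> : [set t | exists2 v', D v' & star (proj1_sig v') (q t)] =
    \bigcup_(v' in D) (q @^-1` star (proj1_sig v')).
    by apply/seteqP; split=> t [v' Dv' sv']; exists v'.
  by apply: bigcup_open => v' _; move/continuousP: cq; apply; exact: star_open.
pose A := [set t | exists2 v', (exists l, joins l u v') & star (proj1_sig v') (q t)].
have AT : A = setT.
  have cT : connected (setT : set R) by apply/connected_intervalP.
  apply: cT.
  - exists 0, u; first by exists [:: u]; exact: joins_nil.
    by rewrite /q /= clamp0 // p0; apply/car_of_vertex => //; exact: proj2_sig.
  - by exists A; [exact: stars|rewrite setTI].
  exists A; last by rewrite setTI.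
  rewrite -openC; have -> : ~` A = [set t | exists2 v', (~ exists l, joins l u v') & star (proj1_sig v') (q t)].
    apply/seteqP; split=> t.
      have [v' [vv' sv']] := common_star (q t) => nA.
      by exists (exist _ v' vv') => // ju; apply: nA; exists (exist _ v' vv').
    move=> [v1 nj s1] [v2 j2 s2]; apply: nj; apply: joins_trans j2 _.
    have [c Hc] := star_common_cell (q t).
    have [|l [jl _]] := @exists_cell_walk _ X v2 v1; last by exists l.
    by exists c; split; apply: Hc.
  exact: stars.
have : A 1 by rewrite AT.
move=> [v' ju]; rewrite /q /= clamp1 // p1 /star /= => /(car_of_vertex _ (proj2_sig v)) e.
by rewrite -(Vt_eq e).
Qed.

Fixpoint listing (x : nat -> vertexT) n := x n :: if n is n'.+1 then listing x n' else [::].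

Lemma joins_listing u l v : joins l u v -> exists x n,
  [/\ l = listing x n, x 0%N = u, x n = v & forall j, (j < n)%N -> vadj (x j) (x j.+1)].
Proof.
move: l v; apply: joins_ind; first by exists (fun=> u), 0%N.
move=> l v w _ wv [x [n [-> x0 xn Hx]]].
exists (fun j => if (j <= n)%N then x j else w), n.+1; split=> //=; last 2 first.
- by rewrite ltnn.
- move=> j jn; case: (ltngtP j n) => [jn'|nj|->]; first exact: Hx.
    by move: jn; rewrite ltnS leqNgt nj.
  by rewrite xn; exact: vadjC.
rewrite ltnn; congr (_ :: _).
have H k : (k <= n)%N -> listing x k = listing (fun j => if (j <= n)%N then x j else w) k.
  by elim: k => [|k IH] kn //=; rewrite kn -IH // ltnW.
exact: H.
Qed.

Lemma joins_listing_of (x : nat -> vertexT) n : (forall j, (j < n)%N -> vadj (x j) (x j.+1)) ->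
  joins (listing x n) (x 0%N) (x n).
Proof.
elim: n => [_|n IH H]; first exact: joins_nil.
apply: joins_cons (IH _) _; last by apply: vadjC; exact: H.
by move=> j jn; apply: H; exact: ltnW.
Qed.


(* The null-homotopy sends each small square of a fine grid into the open star of a vertex. Vertices chosen
   for neighbouring squares lie in a common cell, so consecutive rows of the grid give homotopic edge paths. *)
Lemma loop_homotopic o l : joins l o o -> homotopic l [:: o].
Proof.
move=> jl; have [x [n [-> x0 xn Hx]]] := joins_listing jl; have {jl} jl := joins_listing_of Hx.
case: (posnP n) => [n0|n_gt0].
  by rewrite n0 /= x0; exact: homotopic_refl.
have [q [cq _ _ qj qs]] := @exists_polygon R X (fun j => proj1_sig (x j)) n Hx.
have nR : (0 : R) < n%:R by rewrite ltr0n.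
pose p (t : R) := q (t * n%:R).
have cp : continuous p.
  by move=> t; apply: (@cvg_comp _ _ _ (fun t => t * n%:R) q); [apply: cvgMr_tmp; exact: cvg_id|exact: cq].
have p0 : p 0 = proj1_sig o by rewrite /p mul0r (qj 0%N) // x0.
have p1 : p 1 = proj1_sig o by rewrite /p mul1r (qj n) // xn.
have [_ _ Hp] := Xsc.
have [|H [cH Hb Ht Hs]] := Hp p (continuous_subspaceT cp); first by rewrite p0 p1.
have {cH Hp} cH := continuous_clampl2 cH; set H' := (fun z : R * R => _) in cH.
have [m0 Hm0] := lebesgue_grid cH.
(* A multiple of [n], so that the nodes [x j] of the polygon sit at the grid points [m0.+1 * j]. *)
pose M := (m0.+1 * n)%N.
have M_gt0 : (0 < M)%N by rewrite muln_gt0.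
have MR : (0 : R) < M%:R by rewrite ltr0n.
pose g (a : nat) : R := a%:R / M%:R.
have g01 a : (a <= M)%N -> 0 <= g a <= 1.
  by move=> aM; rewrite /g divr_ge0 ?ler0n // ler_pdivrMr // mul1r ler_nat aM.
have [f Hf] : exists f : nat -> nat -> vertexT, forall a b, (a <= M)%N -> (b <= M)%N ->
    forall z' : R * R, `|g a - z'.1| <= M%:R^-1 -> `|g b - z'.2| <= M%:R^-1 -> star (proj1_sig (f a b)) (H' z').
  pose Q (ab : nat * nat) (v : vertexT) := (ab.1 <= M)%N -> (ab.2 <= M)%N ->
    forall z' : R * R, `|g ab.1 - z'.1| <= M%:R^-1 -> `|g ab.2 - z'.2| <= M%:R^-1 -> star (proj1_sig v) (H' z').
  have [|F HF] := @choice _ _ Q.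
    move=> [a b]; rewrite /Q /=.
    have [[aM bM]|nM] := pselect ((a <= M)%N /\ (b <= M)%N); last by exists o => aM bM; case: nM.
    have [||v Hv] := Hm0 M.-1 _ (g a, g b).
    - by rewrite -ltnS prednK // /M; move: n_gt0; case: (n) => // k _; rewrite mulnS leq_addr.
    - by split; rewrite /= in_itv /=; exact: g01.
    by exists v => _ _ z' h1 h2; apply: Hv => /=; rewrite prednK.
  by exists (fun a b => F (a, b)) => a b; exact: (HF (a, b)).
have gS a : `|g a - g a| <= M%:R^-1 /\ `|g a.+1 - g a| <= M%:R^-1.
  rewrite subrr normr0 invr_ge0 ler0n; split=> //.
  by rewrite /g -mulrBl -natr1 [a%:R + 1]addrC addrK mul1r ger0_norm // invr_ge0 ler0n.
have gS1 a : `|g a - g a| <= M%:R^-1 by case: (gS a).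
have gS2 a : `|g a.+1 - g a| <= M%:R^-1 by case: (gS a).
have star_o v : star (proj1_sig v) (proj1_sig o : X) -> v = o.
  by move=> /(car_of_vertex _ (proj2_sig o))/Vt_eq.
have H'g a b : (a <= M)%N -> (b <= M)%N -> H' (g a, g b) = H (g a, g b).
  by move=> aM bM; rewrite /H' /= !clamp_id ?g01.
have g0 : g 0%N = 0 by rewrite /g mul0r.
have gM : g M = 1 by rewrite /g divff // gt_eqF.
have f_left b : (b <= M)%N -> f 0%N b = o.
  move=> bM; apply: star_o; have := Hf 0%N b isT bM (g 0%N, g b) (gS1 _) (gS1 _).
  by rewrite H'g // g0; case: (Hs (g b) (g01 b bM)) => -> _; rewrite p0.
have f_right b : (b <= M)%N -> f M b = o.
  move=> bM; apply: star_o; have := Hf M b (leqnn _) bM (g M, g b) (gS1 _) (gS1 _).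
  by rewrite H'g // gM; case: (Hs (g b) (g01 b bM)) => _ ->; rewrite p0.
have f_top a : (a <= M)%N -> f a M = o.
  move=> aM; apply: star_o; have := Hf a M aM (leqnn _) (g a, g M) (gS1 _) (gS1 _).
  by rewrite H'g // gM Ht ?g01 // p0.
have cc a b : (a < M)%N -> (b < M)%N -> exists c, [/\ incell c (f a b), incell c (f a.+1 b),
    incell c (f a b.+1) & incell c (f a.+1 b.+1)].
  move=> aM bM; have [c Hc] := star_common_cell (H' (g a, g b)).
  by exists c; split; apply: Hc; apply: Hf => //; exact: ltnW.
have ch a b : (a < M)%N -> (b <= M)%N -> exists c, incell c (f a b) /\ incell c (f a.+1 b).
  move=> aM bM; have [c Hc] := star_common_cell (H' (g a, g b)).
  by exists c; split; apply: Hc; apply: Hf => //; exact: ltnW.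
have cv a b : (a <= M)%N -> (b < M)%N -> exists c, incell c (f a b) /\ incell c (f a b.+1).
  move=> aM bM; have [c Hc] := star_common_cell (H' (g a, g b)).
  by exists c; split; apply: Hc; apply: Hf => //; exact: ltnW.
have [J HJ] : exists J : vertexT -> vertexT -> seq vertexT, forall u v, (exists c, incell c u /\ incell c v) ->
    joins (J u v) u v /\ forall c, incell c u -> incell c v -> forall z, List.In z (J u v) -> incell c z.
  pose Q (uv : vertexT * vertexT) (l : seq vertexT) := (exists c, incell c uv.1 /\ incell c uv.2) ->
      joins l uv.1 uv.2 /\ forall c, incell c uv.1 -> incell c uv.2 -> forall z, List.In z l -> incell c z.
  have [|F HF] := @choice _ _ Q.
    move=> [u v]; rewrite /Q /=.
    have [h|nh] := pselect (exists c, incell c u /\ incell c v); last by exists [::] => h; case: nh.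
    by have [k Hk] := exists_cell_walk h; exists k.
  by exists (fun u v => F (u, v)) => u v; exact: (HF (u, v)).
(* The edge path through the vertices chosen along row [b], from column 0 to column [a]. *)
pose row b := fix row a := if a is a'.+1 then J (f a' b) (f a b) ++ behead (row a') else [:: f 0%N b].
have row_joins a b : (a <= M)%N -> (b <= M)%N -> joins (row b a) (f 0%N b) (f a b).
  elim: a => [_ _|a IH aM bM]; first exact: joins_nil.
  by apply: joins_comp (IH (ltnW aM) bM) _; case: (HJ _ _ (ch a b aM bM)).
have behead_assoc (l1 l2 l3 : seq vertexT) u v : joins l2 u v ->
    l1 ++ behead (l2 ++ behead l3) = (l1 ++ behead l2) ++ behead l3.
  by move=> j2; have [t ->] := joins_head j2; rewrite /= catA.
(* The strip between two rows is filled one column at a time: the four vertices chosen around a grid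
   square lie in one cell, where paths with the same ends are homotopic. *)
have row_step a b : (a <= M)%N -> (b < M)%N ->
    homotopic (row b.+1 a ++ behead (J (f 0%N b) (f 0%N b.+1))) (J (f a b) (f a b.+1) ++ behead (row b a)).
  elim: a => [_ bM|a IH aM bM].
    have [j0 _] := HJ _ _ (cv 0%N b isT bM); have [t e] := joins_head j0.
    by rewrite /= cats0 e /=; exact: homotopic_refl.
  have [jc _] := HJ _ _ (cv 0%N b isT bM).
  have [j1 c1] := HJ _ _ (ch a b.+1 aM bM); have [j0 c0] := HJ _ _ (ch a b aM (ltnW bM)).
  have [k0 d0] := HJ _ _ (cv a b (ltnW aM) bM); have [k1 d1] := HJ _ _ (cv a.+1 b aM bM).
  have r1 := row_joins a b.+1 (ltnW aM) bM; have r0 := row_joins a b (ltnW aM) (ltnW bM).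
  rewrite /= -(behead_assoc _ _ _ _ _ r1) (behead_assoc _ _ _ _ _ j0).
  apply: homotopic_trans.
    apply: (homotopic_comp _ _ j1 (IH (ltnW aM) bM) (homotopic_refl _ _ _)).
      exact: joins_comp jc r1.
    exact: joins_comp r0 k0.
  rewrite (behead_assoc _ _ _ _ _ k0); apply: homotopic_catl.
  have [c [h1 h2 h3 h4]] := cc a b aM bM.
  apply: (@incell_homotopic _ _ c _ _ _ _ (joins_comp k0 j1) (joins_comp j0 k1)) => z Hz; case: (List.in_app_or _ _ _ Hz) => {Hz}.
  - exact: c1.
  - by have [t e] := joins_head k0; rewrite e /= => zt; apply: (d0 c h1 h3); rewrite e; right.
  - exact: d1.
  - by have [t e] := joins_head j0; rewrite e /= => zt; apply: (c0 c h1 h2); rewrite e; right.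
have Joo : homotopic (J o o) [:: o].
  have [c co] : exists c, incell c o by have [c cx] := chart_cover (proj1_sig o); exists c.
  have [|joo coo] := HJ o o; first by exists c.
  by apply: (@incell_homotopic _ _ c _ _ _ _ joo (joins_nil _ _)) => z; [exact: coo|move=> [<-|[]]].
have row_rows b : (b < M)%N -> homotopic (row b M) (row b.+1 M).
  move=> bM; have := row_step M b (leqnn _) bM.
  have rb := row_joins M b (leqnn _) (ltnW bM); have rb1 := row_joins M b.+1 (leqnn _) bM.
  rewrite !f_left ?f_right // 1?ltnW // in rb rb1 *; move=> h.
  have [|joo _] := HJ o o; first by have [c cx] := chart_cover (proj1_sig o); exists c.
  have h1 := homotopic_comp joo (joins_nil _ o) rb1 Joo (homotopic_refl _ _ _).
  have h2 := homotopic_comp rb rb joo (homotopic_refl _ _ _) Joo.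
  have [t e] := joins_head rb; rewrite /= cats0 in h1; rewrite {2}e /= -e in h2.
  by apply: homotopic_trans (homotopic_sym h2) _; apply: homotopic_trans (homotopic_sym h) _.
have row_top a : (a <= M)%N -> homotopic (row M a) [:: o].
  elim: a => [_|a IH aM]; first by rewrite /= f_top //; exact: homotopic_refl.
  have ra := row_joins a M (ltnW aM) (leqnn _); rewrite /= !f_top // 1?ltnW // in ra *.
  have [|joo _] := HJ o o; first by have [c cx] := chart_cover (proj1_sig o); exists c.
  exact: (homotopic_comp ra (joins_nil _ o) joo (IH (ltnW aM)) Joo).
have row_all b : (b <= M)%N -> homotopic (row 0%N M) (row b M).
  elim: b => [_|b IH bM]; first exact: homotopic_refl.
  by apply: homotopic_trans (IH (ltnW bM)) _; exact: row_rows.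
suff bottom : forall j, (j <= n)%N -> homotopic (row 0%N (m0.+1 * j)%N) (listing x j).
  apply: homotopic_trans (homotopic_sym (bottom n (leqnn _))) _.
  by apply: homotopic_trans (row_all M (leqnn _)) _; exact: row_top.
(* The bottom row is the polygon itself, so between nodes [j] and [j.+1] only the stars of [x j] and
   [x j.+1] can occur. *)
have f_bottom j r : (j < n)%N -> (r <= m0.+1)%N -> let a := (m0.+1 * j + r)%N in
    (a <= M)%N /\ (f a 0%N = x j \/ f a 0%N = x j.+1).
  move=> jn rm a; have aM : (a <= M)%N.
    apply: (@leq_trans (m0.+1 * j.+1)); first by rewrite mulnS [leqRHS]addnC leq_add2l.
    by rewrite leq_mul2l jn orbT.
  split=> //; have := Hf a 0%N aM isT (g a, g 0%N) (gS1 _) (gS1 _).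
  have mR : (0 : R) < m0.+1%:R by rewrite ltr0n.
  have eg : g a * n%:R = j%:R + r%:R / m0.+1%:R.
    rewrite /g /a /M natrD !natrM; field; by rewrite !gt_eqF.
  rewrite H'g // g0 Hb ?g01 // /p => Hst.
  have := qs j (g a * n%:R) jn; rewrite eg -[j.+1%:R]natr1 lerDl divr_ge0 ?ler0n // lerD2l ler_pdivrMr // mul1r.
  rewrite ler_nat rm => /(_ isT); rewrite -eg => /(_ _ Hst)[] /Vt_eq; tauto.
have f_node j : (j <= n)%N -> f (m0.+1 * j)%N 0%N = x j.
  move=> jn; set a := (m0.+1 * j)%N; have aM : (a <= M)%N by rewrite leq_mul2l jn orbT.
  have := Hf a 0%N aM isT (g a, g 0%N) (gS1 _) (gS1 _).
  have mR : (0 : R) < m0.+1%:R by rewrite ltr0n.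
  have eg : g a * n%:R = j%:R by rewrite /g /a /M !natrM; field; rewrite !gt_eqF.
  rewrite H'g // g0 Hb ?g01 // /p eg qj // /star /= => /(car_of_vertex _ (proj2_sig _)).
  exact: Vt_eq.
elim=> [_|j IH jn].
  by rewrite muln0 /= f_left // x0; exact: homotopic_refl.
have jL : joins (listing x j) (x 0%N) (x j) by apply: joins_listing_of => k kj; apply: Hx; exact: ltn_trans jn.
(* Between two consecutive nodes the bottom row stays in every cell containing both, hence is
   homotopic to the edge. *)
have block r : (r <= m0.+1)%N -> exists G, [/\ joins G (x j) (f (m0.+1 * j + r)%N 0%N),
    (forall c, incell c (x j) -> incell c (x j.+1) -> forall z, List.In z G -> incell c z) &
    homotopic (row 0%N (m0.+1 * j + r)%N) (G ++ behead (listing x j))].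
  elim: r => [_|r IHr rm].
    exists [:: x j]; rewrite addn0 f_node ?(ltnW jn) //; split; first exact: joins_nil.
      by move=> c cj _ z [<-|[]].
    have [t e] := joins_head jL; rewrite e /= -e; exact: IH (ltnW jn).
  have [G [jG cG hG]] := IHr (ltnW rm).
  have [a0M h0] := f_bottom j r jn (ltnW rm); have [a1M h1] := f_bottom j r.+1 jn rm.
  rewrite addnS in a1M h1 *.
  have [jJ cJ] := HJ _ _ (ch (m0.+1 * j + r)%N 0%N a1M isT).
  exists (J (f (m0.+1 * j + r)%N 0%N) (f (m0.+1 * j + r).+1 0%N) ++ behead G); split.
  - exact: joins_comp jG jJ.
  - move=> c c0 c1 z Hz; case: (List.in_app_or _ _ _ Hz) => {Hz}.
      by apply: cJ; [case: h0 => ->|case: h1 => ->].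
    have [t e] := joins_head jG; rewrite e /= => zt; apply: (cG c) => //; rewrite e; by right.
  rewrite /= -(behead_assoc _ _ _ _ _ jG).
  have rj := row_joins (m0.+1 * j + r)%N 0%N a0M isT; rewrite f_left // -x0 in rj.
  exact: (homotopic_comp rj (joins_comp jL jG) jJ hG (homotopic_refl _ _ _)).
have [G [jG cG hG]] := block _ (leqnn _).
have em : (m0.+1 * j + m0.+1)%N = (m0.+1 * j.+1)%N by rewrite mulnS addnC.
rewrite em f_node // in jG hG.
apply: homotopic_trans hG _.
have jE : joins [:: x j.+1; x j] (x j) (x j.+1) by apply: joins_cons (joins_nil _ _) _; apply: vadjC; exact: Hx.
have [c cx] : exists c, incell c (x j) /\ incell c (x j.+1).
  have := Hx j jn; move=> [c [b [i [e1 e2]]]]; exists c.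
  by split; rewrite /incell ?e1 ?e2; exact: cell_vx.
have hE : homotopic G [:: x j.+1; x j].
  case: cx => c0 c1; apply: (@incell_homotopic _ _ c _ _ _ _ jG jE); first exact: cG.
  by move=> z [<-|[<-|[]]].
have := homotopic_comp jL jL jG (homotopic_refl _ _ _) hE.
by have [t e] := joins_head jL; rewrite e /= -e.
Qed.

Lemma vertices_simply_connected (u v : vertexT) l l' : joins l u v -> joins l' u v -> homotopic l l'.
Proof. exact: (homotopic_of_loops vadjC loop_homotopic). Qed.

End Loops.

(** * Walls and coordinates *)

Lemma cube_ind n (P : ('I_n -> bool) -> Prop) b0 : P b0 ->
  (forall i b, P b -> P (flip_at i b)) -> forall b, P b.
Proof.
move=> P0 PS b; pose w := [seq i <- enum 'I_n | b0 i != b i].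
suff H s : P (foldr (fun i a => flip_at i a) b0 s).
  have uw : uniq w by apply: filter_uniq; exact: enum_uniq.
  have <- : foldr (fun i a => flip_at i a) b0 w = b; last exact: H.
  apply/funext => i; have E s : foldr (fun i a => flip_at i a) b0 s i = b0 i (+) odd (count_mem i s).
    elim: s => [|j s IH] /=; first by rewrite addbF.
    have [->|ji] := eqVneq j i; first by rewrite flip_at_eq IH /= addbN.
    by rewrite flip_at_neq 1?eq_sym // IH.
  by rewrite E (count_uniq_mem _ uw) mem_filter mem_enum andbT; case: (b0 i) (b i) => -[].
by elim: s => //= i s; exact: PS.
Qed.

Section Halfspaces.
Variables (R : realType) (X : cubeComplex R).
Hypothesis Xcat : cat0_cube_complex X.
Notation vertexT := (vertexT X).
Notation vadj := (@vadj R X).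
Notation vsq := (@vsq R X).

Let Xsc : simply_connected R (pt X). Proof. by case: Xcat. Qed.
Lemma vconn (u v : vertexT) : exists l, joins vadj l u v.
Proof. exact: vertices_connected. Qed.
Let sconn (u v : vertexT) l l' : joins vadj l u v -> joins vadj l' u v -> homotopic vadj vsq l l'.
Proof. exact: vertices_simply_connected. Qed.
Let adjC' (a b : vertexT) : vadj a b -> vadj b a. Proof. exact: vadjC. Qed.
Let rot' (a b c d : vertexT) : vsq a b c d -> vsq b c d a. Proof. exact: sq_rot. Qed.
Let rev' (a b c d : vertexT) : vsq a b c d -> vsq a d c b. Proof. exact: sq_rev. Qed.
Let sqadj' (a b c d : vertexT) : vsq a b c d -> vadj a b. Proof. exact: sq_adj. Qed.
Let diag' (a b c d : vertexT) : vsq a b c d -> a <> c.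
Proof. by move=> h e; apply: (sq_diag h); rewrite e. Qed.
Let uniq' (a b c c' d : vertexT) : vsq a b c d -> vsq a b c' d -> c = c'.
Proof. by move=> h h'; apply: Vt_eq; exact: sq_uniq h h'. Qed.
Let cube' (w x y z p q r : vertexT) : vsq w x p y -> vsq w y q z -> vsq w z r x ->
  exists s : vertexT, [/\ vsq x p s r, vsq y p s q & vsq z q s r].
Proof.
move=> h1 h2 h3; have [s [s1 s2 s3]] := sq_cube Xcat.2 h1 h2 h3.
have vs : is_vertex s by exact: adj_vertex (sq_adj (sq_rot (sq_rot s1))).
by exists (exist _ s vs).
Qed.

Definition vdist := @gdist vertexT vadj vconn.
Definition side := @nearer vertexT vadj vconn.
Definition halfspaces : set (set vertexT) := @halfspace vertexT vadj vconn.

Lemma halfspacesC h : halfspaces h -> halfspaces (~` h).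
Proof. exact: (halfspaceC adjC' sconn). Qed.

Lemma side_edge a b : vadj a b -> [/\ halfspaces (side a b), side a b a & ~ side a b b].
Proof.
by move=> ab; have [h1 h2] := half_edge adjC' vconn sconn ab; split=> //; exists a, b.
Qed.

Lemma hs_edge h p q : halfspaces h -> vadj p q -> h p -> ~ h q -> h = side p q.
Proof. exact: (halfspace_edge adjC' rot' rev' sqadj' diag' uniq' cube' sconn). Qed.

Lemma hs_step u v : u <> v -> exists w, vadj v w /\ side w v u.
Proof.
move=> uv; have [w [vw e]] := step_towards adjC' vconn sconn uv.
by exists w; split=> //; rewrite /side /nearer /= e.
Qed.

Lemma vdist_side u v w : vadj v w -> side w v u -> vdist u v = (vdist u w).+1.
Proof.
by move=> vw; rewrite /side /nearer /=; case: (gdist_adjP adjC' vconn sconn u vw); rewrite /vdist => ->; lia.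
Qed.

Lemma hs_median u v w : exists m, forall h, halfspaces h -> h u /\ h v \/ h u /\ h w \/ h v /\ h w -> h m.
Proof. exact: (exists_median adjC' rot' rev' sqadj' diag' uniq' cube' vconn sconn). Qed.

Lemma hs_finite u v : exists s : seq (set vertexT), forall h, halfspaces h -> h u -> ~ h v -> List.In h s.
Proof. exact: (halfspaces_separating_finite adjC' rot' rev' sqadj' diag' uniq' cube' vconn sconn). Qed.

Lemma vquadrangle u z v w : vadj z v -> vadj z w -> v <> w -> side v z u -> side w z u ->
  exists x, vsq z v x w.
Proof.
move=> zv zw vw sv swap_step.
have [x [s _]] := quadrangle adjC' rot' rev' sqadj' diag' uniq' cube' sconn zv zw vw (vdist_side zv sv) (vdist_side zw swap_step).
by exists x.
Qed.

Lemma crossing_edges a b p q : vadj a b -> vadj p q -> side a b p -> ~ side a b q ->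
  edge_parallel vsq (a, b) (p, q).
Proof. exact: (crossing_edge_parallel adjC' rot' rev' sqadj' diag' uniq' cube' sconn). Qed.

Lemma side_automorphism (g g' : vertexT -> vertexT) a b : cancel g g' -> cancel g' g ->
  (forall u v, vadj u v -> vadj (g u) (g v)) -> (forall u v, vadj u v -> vadj (g' u) (g' v)) ->
  g @` side a b = side (g a) (g b).
Proof.
have le (f : vertexT -> vertexT) u v : (forall u v, vadj u v -> vadj (f u) (f v)) -> (vdist (f u) (f v) <= vdist u v)%N.
  move=> fa; apply: gdist_le; have [l jl e] := gdistP vconn u v.
  have H : forall l v, joins vadj l u v -> exists2 l', joins vadj l' (f u) (f v) & size l' = size l.
    apply: joins_ind; first by exists [:: f u]; [exact: joins_nil|].
    move=> k x y _ xy [k' jk' ek]; exists (f y :: k'); last by rewrite /= ek.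
    by apply: joins_cons jk' _; exact: fa.
  by have [l' jl' el] := H l v jl; exists l'; rewrite ?el.
move=> gK g'K ga g'a.
have E u v : vdist (g u) (g v) = vdist u v.
  apply/eqP; rewrite eqn_leq le //=; have := le g' (g u) (g v) g'a; by rewrite !gK.
apply/seteqP; split=> [_ [v /= h <-]|v h].
  by move: h; rewrite /side /nearer /= -!/(vdist _ _) !E.
exists (g' v) => //; move: h; rewrite /side /nearer /= -!/(vdist _ _).
by rewrite -{1 2}(g'K v) !E.
Qed.

Variable o : vertexT.

(* A wall is recorded by its side that does not contain the base vertex [o]. *)
Definition wallT := {h : set vertexT | halfspaces h /\ ~ h o}.
HB.instance Definition _ := gen_eqMixin wallT.
HB.instance Definition _ := gen_choiceMixin wallT.

Definition code (v : vertexT) : wallT -> bool := fun w => `[< proj1_sig w v >].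

Lemma code_o w : code o w = false.
Proof. by apply/asboolPn; case: w => h []. Qed.

Lemma wall_eq (w w' : wallT) : (forall x, code x w = code x w') -> w = w'.
Proof.
move=> H; have e : proj1_sig w = proj1_sig w'.
  apply/seteqP; split=> x hx; have := H x; rewrite /code.
    by rewrite asboolT // => /esym/asboolP.
  by rewrite [in RHS]asboolT // => /asboolP.
by case: w w' e {H} => [h p] [h' p'] /= e; subst h'; congr exist; exact: Prop_irrelevance.
Qed.

Lemma hs_wall h : halfspaces h -> exists (w : wallT) (b : bool), h = [set v | code v w = b].
Proof.
move=> Hh; have [ho|no] := pselect (h o).
  have P : halfspaces (~` h) /\ ~ (~` h) o by split; [exact: halfspacesC|move=> /(_ ho)].
  exists (exist (fun h => halfspaces h /\ ~ h o) _ P), false; apply/seteqP; split=> v /=.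
    by move=> hv; apply/asboolPn => /(_ hv).
  by move=> /asboolPn /= /contrapT.
exists (exist (fun h => halfspaces h /\ ~ h o) h (conj Hh no)), true; apply/seteqP; split=> v /=; first by move=> hv; apply/asboolP.
by move/asboolP.
Qed.

Lemma wall_hs (w : wallT) b : halfspaces [set v | code v w = b].
Proof.
have e : [set v | code v w = true] = proj1_sig w.
  by apply/seteqP; split=> v; [move/asboolP|move=> ?; apply/asboolP].
case: b; first by rewrite e; case: w {e} => h [].
have -> : [set v | code v w = false] = ~` [set v | code v w = true].
  by apply/seteqP; split=> v /=; case: (code v w).
by apply: halfspacesC; rewrite e; case: w {e} => h [].
Qed.

Lemma code_inj : injective code.
Proof.
move=> u v e; apply: contrapT => /hs_step[w [vw s]].
have [Hs h1 h2] := side_edge (adjC' vw); have [x [b eb]] := hs_wall Hs.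
by apply: h2; move: s; rewrite eb /= e.
Qed.

Lemma wall_unique w w' b b' : [set v | code v w = b] = [set v | code v w' = b'] -> w = w' /\ b = b'.
Proof.
move=> e; have eb : b = b'.
  have := congr1 (fun A => A o) e; rewrite /= !code_o.
  by case: b b' {e} => -[] //= e0; have : false = true by [rewrite e0|rewrite -e0].
split=> //; apply: wall_eq => x; have := congr1 (fun A => A x) e; rewrite /= -eb propeqE => -[].
by case: (code x w) (code x w') b {e eb} => -[] [] // h1 h2; first [have := h1 erefl; done|have := h2 erefl; done].
Qed.

Lemma adj_code u v : vadj u v -> exists w, code v = flip_at w (code u).
Proof.
move=> uv; have [Hs h1 h2] := side_edge uv; have [w [b eb]] := hs_wall Hs; exists w.
have cu : code u w = b by move: h1; rewrite eb.
have cv : code v w = ~~ b by move: h2; rewrite eb /=; case: (code v w) (b) => -[].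
apply/funext => w'; have [->|nw] := eqVneq w' w; first by rewrite flip_at_eq cu cv.
rewrite flip_at_neq //; apply: contraNeq nw => ne; apply/eqP.
have := hs_edge (wall_hs w' (code u w')) uv erefl; rewrite /= eb => /(_ (elimN eqP ne)).
by move/wall_unique => -[].
Qed.

Lemma code_adj u v w : code v = flip_at w (code u) -> vadj u v.
Proof.
move=> e; have uv : v <> u by move=> vu; move: e; rewrite vu => /esym/flip_at_neqb.
have [t [ut s]] := hs_step uv; have [w' ew'] := adj_code ut.
have [Hs h1 h2] := side_edge (adjC' ut); have [x [b eb]] := hs_wall Hs.
rewrite eb /= in s h1 h2.
have xw : x = w by apply/eqP; apply: contraPT s => xw; rewrite e flip_at_neq.
have xw' : x = w' by apply/eqP; apply: contraPT h1 => xw'; rewrite ew' flip_at_neq.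
have -> // : v = t by apply: code_inj; rewrite e ew' -xw -xw'.
Qed.

Lemma sq_code a b c d h : vsq a b c d -> code b = flip_at h (code a) -> code c = flip_at h (code d).
Proof.
move=> s eb.
have [k ek] := adj_code (sqadj' (rev' s)); have [k' ek'] := adj_code (sqadj' (rot' s)).
have [h' eh'] := adj_code (sqadj' (rot' (rev' s))).
have hk : h != k.
  by apply: contra_notN (diag' (rot' s)) => /eqP hk; apply: code_inj; rewrite eb ek hk.
have k'h : k' != h.
  by apply: contra_notN (diag' s) => /eqP e; apply: code_inj; rewrite ek' eb e flip_atK.
have [e|nh] := eqVneq h' h; first by rewrite eh' e.
have := congr1 (fun f => f h) eh'; rewrite {1}ek' eb flip_at_neq 1?eq_sym // flip_at_eq.
by rewrite flip_at_neq 1?eq_sym // ek flip_at_neq //; case: (code a h).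
Qed.

Definition codes : set (wallT -> bool) := [set a | exists v, a = code v].

Lemma codes_code v : codes (code v).
Proof. by exists v. Qed.

Lemma codes_med a b c : codes a -> codes b -> codes c -> codes (fun w => majority (a w) (b w) (c w)).
Proof.
move=> [u ->] [v ->] [w ->]; have [m Hm] := hs_median u v w; exists m.
apply/funext => x; apply/esym; apply: (Hm [set y | code y x = _] (wall_hs x _)) => /=.
by rewrite /majority; case: (code u x) (code v x) (code w x) => -[] []; tauto.
Qed.

Lemma codes_fin a b : codes a -> codes b -> exists s : seq wallT, forall w, w \notin s -> a w = b w.
Proof.
move=> [u ->] [v ->].
have half x y : exists s : seq wallT, forall w, code x w = true -> code y w = false -> w \in s.
  have [s Hs] := hs_finite x y.
  pose F (h : set vertexT) : seq wallT := if pselect (halfspaces h /\ ~ h o) is left p then [:: exist (fun h => halfspaces h /\ ~ h o) h p] else [::].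
  exists (flatten (map F s)) => w /asboolP hx /asboolPn hy.
  have : List.In (proj1_sig w) s by apply: Hs => //; case: (w) => h [].
  elim: (s) => //= h t IH [e|/IH]; rewrite mem_cat; last by move=> ->; rewrite orbT.
  rewrite /F; case: pselect => [p|[]]; last by rewrite e; exact: (proj2_sig w).
  rewrite inE orbC; apply/orP; right; apply/eqP.
  by case: w e {hx hy IH} => k q /= e; subst k; congr exist; exact: Prop_irrelevance.
have [s1 H1] := half u v; have [s2 H2] := half v u.
exists (s1 ++ s2) => w; rewrite mem_cat negb_or => /andP[n1 n2].
case eu : (code u w); case ev : (code v w) => //.
  by rewrite H1 in n1.
by rewrite H2 in n2.
Qed.

Lemma codes_step a b : codes a -> codes b -> a <> b -> exists2 w, a w != b w & codes (flip_at w a).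
Proof.
move=> [u ->] [v ->] ne; have vu : v <> u by move=> e; apply: ne; rewrite e.
have [t [ut s]] := hs_step vu; have [w ew] := adj_code ut.
have [Hs h1 h2] := side_edge (adjC' ut); have [x [c ec]] := hs_wall Hs.
rewrite ec /= in s h1 h2.
have xw : x = w by apply/eqP; apply: contraPT h1 => xw'; rewrite ew flip_at_neq.
exists w; last by exists t.
by rewrite -xw; apply/eqP => e; apply: h2; rewrite e.
Qed.

(* The hypothesis says that the cube spanned by [s] at [v] lies in the set of codes. *)
Lemma cube_cell v (s : seq wallT) : uniq s ->
  (forall b, (forall w, w \notin s -> b w = code v w) -> codes b) ->
  exists (c : cube X) (b0 : 'I_(dim c) -> bool), v = cell_vertex b0 /\
    forall w, w \in s <-> exists i, code (cell_vertex (flip_at i b0)) = flip_at w (code v).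
Proof.
move=> us Hcube.
case: s us Hcube => [|w0 s0] us Hcube.
  have [c [d0 cv]] := proj2_sig v; have [b eb] := incell_vt cv; exists c, b; split=> // w; split=> //.
  by move=> [i _]; move: i; rewrite d0 => -[].
set s := w0 :: s0 in us Hcube *.
have [|F HF] := @choice wallT vertexT (fun w y => w \in s -> code y = flip_at w (code v)).
  move=> w; have [ws|nws] := boolP (w \in s); last by exists v.
  have [|y ey] := Hcube (flip_at w (code v)); last by exists y.
  by move=> w' nw'; rewrite flip_at_neq //; apply: contraNneq nw' => ->.
have Fadj w : w \in s -> vadj v (F w) by move=> /HF/code_adj.
have Fside w x : w \in s -> code x w = ~~ code v w -> side (F w) v x.
  move=> ws cx; have e1 : code (F w) w = code x w by rewrite (HF _ ws) flip_at_eq cx.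
  rewrite -(hs_edge (wall_hs w (code x w)) (adjC' (Fadj w ws)) e1) //= cx.
  by case: (code v w).
have [||||c [b [ev Hc]]] := @flag_cell R X (proj1_sig v) [set proj1_sig (F w) | w in [set` s]] (Xcat.2 _ (proj2_sig v)) (proj2_sig v).
- by exists (proj1_sig (F w0)), w0 => //=; rewrite inE eqxx.
- by apply: finite_image; exact: finite_seq.
- by move=> _ [w /= ws <-]; exact: Fadj.
- move=> _ _ [w /= ws <-] [w' /= ws' <-] ne.
  have ww' : w != w' by apply: contra_notN ne => /eqP ->.
  have [|p ep] := Hcube (flip_at w (flip_at w' (code v))).
    move=> x nx; rewrite !flip_at_neq //; apply: contraNneq nx => ->//.
  have [|||x sx] := @vquadrangle p v (F w) (F w') (Fadj _ ws) (Fadj _ ws'); last by exists (proj1_sig x).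
  + by move=> e; apply: ne; rewrite e.
  + by apply: Fside => //; rewrite -ep flip_at_eq flip_at_neq.
  + by apply: Fside => //; rewrite -ep flip_at_neq 1?eq_sym // flip_at_eq.
exists c, b; split; first exact: Vt_eq.
move=> w; split=> [ws|[i ei]].
  have : [set proj1_sig (F w) | w in [set` s]] (proj1_sig (F w)) by exists w.
  move=> /Hc[i ei]; exists i; rewrite -(HF _ ws); congr code; exact: Vt_eq.
have : [set proj1_sig (F w) | w in [set` s]] (vx (flip_at i b)) by apply/Hc; exists i.
move=> [w' /= ws' e]; have e2 : F w' = cell_vertex (flip_at i b) by exact: Vt_eq.
have := HF _ ws'; rewrite e2 ei => /esym e3.
by rewrite (flip_at_inj (esym e3)).
Qed.

(** Opposite edges of a square cross the same wall, so the wall of a direction does not depend on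
    [b]. *)
Lemma exists_cell_walls (c : cube X) : exists wl : 'I_(dim c) -> wallT,
  forall i b, code (cell_vertex (flip_at i b)) = flip_at (wl i) (code (cell_vertex b)).
Proof.
pose z (_ : 'I_(dim c)) := false.
have [|wl Hwl] := @choice 'I_(dim c) wallT (fun i w => code (cell_vertex (flip_at i z)) = flip_at w (code (cell_vertex z))).
  by move=> i; apply: adj_code; exact: vx_adj.
exists wl => i; apply: (cube_ind (b0 := z)) => [|j b IH]; first exact: Hwl.
have [<-|ij] := eqVneq i j; first by rewrite flip_atK IH flip_atK.
have S : vsq (cell_vertex b) (cell_vertex (flip_at i b)) (cell_vertex (flip_at i (flip_at j b))) (cell_vertex (flip_at j b)).
  exact: (vx_sq b ij).
exact: sq_code S IH.
Qed.

Definition cwall (c : cube X) := projT1 (cid (exists_cell_walls c)).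

Lemma code_flip (c : cube X) i b : code (cell_vertex (flip_at i b)) = flip_at (@cwall c i) (code (cell_vertex b)).
Proof. by rewrite /cwall; case: (cid _) => wl /= ->. Qed.

Lemma vt_inj (c : cube X) (b b' : 'I_(dim c) -> bool) : cell_vertex b = cell_vertex b' -> b = b'.
Proof. by move=> /(congr1 (@proj1_sig _ _)) /vx_inj. Qed.

Lemma cwall_inj (c : cube X) : injective (@cwall c).
Proof.
move=> i j e; pose b (_ : 'I_(dim c)) := false.
have : code (cell_vertex (flip_at i b)) = code (cell_vertex (flip_at j b)) by rewrite !code_flip e.
by move=> /code_inj /vt_inj /flip_at_inj.
Qed.

Definition base (c : cube X) : wallT -> bool := code (cell_vertex (fun _ : 'I_(dim c) => false)).

Lemma code_cwall (c : cube X) (b : 'I_(dim c) -> bool) i : code (cell_vertex b) (@cwall c i) = base c (cwall i) (+) b i.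
Proof.
rewrite /base; move: b; apply: (cube_ind (b0 := fun=> false)) => [|j b IH]; first by rewrite addbF.
rewrite code_flip; have [e|ij] := eqVneq i j; first by rewrite -e !flip_at_eq IH addbN.
by rewrite !flip_at_neq // (inj_eq (@cwall_inj c)).
Qed.

Lemma code_off (c : cube X) (b : 'I_(dim c) -> bool) w : (forall i, @cwall c i <> w) -> code (cell_vertex b) w = base c w.
Proof.
move=> nw; rewrite /base; move: b; apply: (cube_ind (b0 := fun=> false)) => // j b IH.
by rewrite code_flip flip_at_neq //; apply/eqP => e; apply: (nw j).
Qed.

Lemma code_of_cell (c : cube X) h : (forall w, (forall i, @cwall c i <> w) -> h w = base c w) ->
  h = code (cell_vertex (fun i => base c (@cwall c i) (+) h (cwall i))).
Proof.
move=> H; apply/funext => w; have [[i <-]|n] := pselect (exists i, @cwall c i = w).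
  by rewrite code_cwall addbA addbb.
by rewrite code_off ?H // => i e; apply: n; exists i.
Qed.

End Halfspaces.

(** * Coordinates of the points of the complex *)

Section Kappa.
Variables (R : realType) (X : cubeComplex R).
Variables (Xcat : cat0_cube_complex X) (o : vertexT X).
Notation vertexT := (vertexT X).
Notation wallT := (wallT Xcat o).
Notation code := (@code R X Xcat o).
Notation codes := (@codes R X Xcat o).
Notation cwall := (@cwall R X Xcat o).
Notation base := (@base R X Xcat o).

(* The coordinate at a wall is 0 on the side of [o] and 1 on the other side. *)
Definition local_coord (c : cube X) (u : 'rV[R]_(dim c)) : wallT -> R := fun w =>
  if [pick i | @cwall c i == w] is Some i then (if base c w then 1 - u ord0 i else u ord0 i)
  else (base c w)%:R.

Lemma local_cwall (c : cube X) u i :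
  local_coord u (@cwall c i) = if base c (@cwall c i) then 1 - u ord0 i else u ord0 i.
Proof.
rewrite /local_coord; case: pickP => [j /eqP/cwall_inj ->//|/(_ i)]; by rewrite eqxx.
Qed.

Lemma local_off (c : cube X) (u : 'rV[R]_(dim c)) w : (forall i, @cwall c i <> w) ->
  local_coord u w = (base c w)%:R.
Proof. by move=> H; rewrite /local_coord; case: pickP => // j /eqP/H. Qed.

Lemma local_inj (c : cube X) (u v : 'rV[R]_(dim c)) : local_coord u = local_coord v -> u = v.
Proof.
move=> e; apply: rV_ext => i; have := congr1 (fun f => f (@cwall c i)) e; rewrite !local_cwall.
by case: (base _ _) => // /(congr1 (fun t => 1 - t)); rewrite !subKr.
Qed.

Lemma local_cube (c : cube X) (u : 'rV[R]_(dim c)) : unit_cube u -> in_cube (local_coord u).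
Proof.
move=> uu w; have [[i <-]|n] := pselect (exists i, @cwall c i = w).
  by rewrite local_cwall; case: (base _ _) => //; have := uu i; lra.
by rewrite local_off => [|i e]; [case: (base c w); rewrite ?lexx ?ler01|apply: n; exists i].
Qed.

Lemma natr_false (t : bool) : t%:R = 0 :> R -> t = false.
Proof. by case: t => // /eqP; rewrite oner_eq0. Qed.
Lemma natr_true (t : bool) : t%:R = 1 :> R -> t = true.
Proof. by case: t => // /eqP; rewrite eq_sym oner_eq0. Qed.

Lemma local_joint (c : cube X) (u v : 'rV[R]_(dim c)) h : unit_cube u -> unit_cube v ->
  joint (local_coord u) (local_coord v) h -> exists b : 'I_(dim c) -> bool, h = code (cell_vertex b).
Proof.
move=> uu uv J; exists (fun i => base c (@cwall c i) (+) h (cwall i)).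
apply: code_of_cell => w n; have [j0 j1] := J w; rewrite !local_off // in j0 j1.
by case: (base c w) j0 j1 => [_ /(_ erefl erefl)|/(_ erefl erefl)].
Qed.

Lemma local_rounding (c : cube X) (u : 'rV[R]_(dim c)) h : unit_cube u ->
  rounding (local_coord u) h <-> exists2 b, rnd u b & h = code (cell_vertex b).
Proof.
move=> uu; split=> [H|[b rb ->] w].
  have [b eb] := local_joint uu uu (joint_rounding_l (local_coord u) H); exists b => // i.
  have := H (@cwall c i); rewrite local_cwall eb code_cwall.
  case: (base _ _) => -[h0 h1]; split=> e.
  - by move: (h1 ltac:(rewrite e subr0//)); rewrite addTb; case: (b i).
  - by move: (h0 ltac:(rewrite e subrr//)); rewrite addTb; case: (b i).
  - by move: (h0 e).
  - by move: (h1 e).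
have [[i <-]|n] := pselect (exists i, @cwall c i = w).
  rewrite local_cwall code_cwall; have [r0 r1] := rb i; case: (base _ _); rewrite ?addTb ?addFb; split.
  - by move/eqP; rewrite subr_eq0 eq_sym => /eqP/r1 ->.
  - by move/eqP; rewrite subr_eq -[X in X == _]addr0 eq_sym => /eqP/addrI/r0 ->.
  - exact: r0.
  - exact: r1.
have n' i : @cwall c i <> w by move=> e; apply: n; exists i.
by rewrite local_off // code_off //; split; [exact: natr_false|exact: natr_true].
Qed.

Lemma local_const (c : cube X) (u : 'rV[R]_(dim c)) w t : unit_cube u ->
  (forall b, rnd u b -> code (cell_vertex b) w = t) -> local_coord u w = t%:R.
Proof.
move=> uu H; have rf := rnd_floor u.
have [[i ew]|n] := pselect (exists i, @cwall c i = w); last first.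
  have n' i : @cwall c i <> w by move=> e; apply: n; exists i.
  by rewrite local_off // -(H _ rf) code_off.
have := H _ rf; rewrite -ew code_cwall local_cwall.
case: (unit_cases i uu) => [->|->|u01].
- by rewrite eq_sym oner_eq0 addbF => ->; case: (t); rewrite ?subr0.
- by rewrite eqxx addbT => /(congr1 negb); rewrite negbK => ->; case: (t); rewrite ?subrr.
have := H _ (rnd_flip u01 rf); rewrite -ew code_cwall flip_at_eq addbN => e1 e2.
by move: e1; rewrite e2; case: (t).
Qed.

(** The squared distances to two neighbouring vertices differ by an affine function of the single
    coordinate in which these vertices differ. *)
Lemma local_dist (c : cube X) (u : 'rV[R]_(dim c)) b i : code (cell_vertex b) (@cwall c i) = false ->
  local_coord u (@cwall c i) = (1 + edist u (bvec b) ^+ 2 - edist u (bvec (flip_at i b)) ^+ 2) / 2.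
Proof.
rewrite code_cwall local_cwall !edist_sqr (bigD1 i) //= [X in _ = (_ - X) / 2](bigD1 i) //=.
rewrite (eq_bigr (fun j => (u ord0 j - (flip_at i b j)%:R) ^+ 2)); last first.
  by move=> j ji; rewrite bvecE flip_at_neq.
rewrite [X in _ = (_ - (_ + X)) / 2](eq_bigr (fun j => (u ord0 j - (flip_at i b j)%:R) ^+ 2)); last first.
  by move=> j ji; rewrite bvecE.
rewrite !bvecE flip_at_eq; move: (\sum_(j < _ | _) _) => s.
by case: (base _ _) (b i) => -[] //= _; field.
Qed.

(* By [local_dist] the coordinates are functions of distances to vertices, which do not depend on the chart. *)
Lemma local_glue (c c' : cube X) (u : 'rV[R]_(dim c)) (u' : 'rV[R]_(dim c')) :
  unit_cube u -> unit_cube u' -> chart c u = chart c' u' -> local_coord u = local_coord u'.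
Proof.
move=> uu uu' e; apply/funext => w.
have carx v : car (chart c u) v <-> car (chart c' u') v by rewrite e.
have [[b0 [b1 [r0 r1 ne]]]|const] := pselect (exists b0 b1,
    [/\ rnd u b0, rnd u b1 & code (cell_vertex b0) w <> code (cell_vertex b1) w]); last first.
  have [t Ht] : exists t, forall b, rnd u b -> code (cell_vertex b) w = t.
    exists (code (cell_vertex (fun i => u ord0 i == 1)) w) => b rb; apply: contrapT => ne; apply: const.
    by exists b, (fun i => u ord0 i == 1); split=> //; exact: rnd_floor.
  rewrite (local_const uu Ht); apply/esym; apply: local_const => // b' rb'.
  have /carx/(carE _ uu)[b rb eb] : car (chart c' u') (vx b') by apply/carE => //; exists b'.
  by rewrite (_ : cell_vertex b' = cell_vertex b); [exact: Ht|exact: Vt_eq].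
have [b [b2 [rb rb2 cb cb2]]] : exists b b2, [/\ rnd u b, rnd u b2, code (cell_vertex b) w = false & code (cell_vertex b2) w = true].
  by case e0 : (code (cell_vertex b0) w) ne; case e1 : (code (cell_vertex b1) w) => // _; [exists b1, b0|exists b0, b1].
have [[i ew]|n] := pselect (exists i, @cwall c i = w); last first.
  have n' i : @cwall c i <> w by move=> ew; apply: n; exists i.
  by move: cb cb2; rewrite !code_off // => ->.
have bi : b i != b2 i by apply: contraPneq cb2 => bi; rewrite -ew code_cwall -bi -code_cwall ew cb.
have u01 : 0 < u ord0 i < 1.
  case: (unit_cases i uu) => // ui; have [x0 x1] := rb i; have [y0 y1] := rb2 i.
    by rewrite x0 // y0 in bi.
  by rewrite x1 // y1 in bi.
have inc' b' : rnd u b' -> exists b'', vx b' = @vx _ X c' b''.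
  move=> r'; have : car (chart c u) (vx b') by apply/carE => //; exists b'.
  by move=> /carx/(carE _ uu')[b'' _ ->]; exists b''.
have [d ed] := inc' _ rb; have [d2 ed2] := inc' _ (rnd_flip u01 rb).
have [j ej] : exists j, d2 = flip_at j d.
  by apply: (@adj_in_cell _ X c'); rewrite -ed -ed2; exact: vx_adj.
have Ed : cell_vertex b = cell_vertex d by exact: Vt_eq.
have Ed2 : cell_vertex (flip_at i b) = cell_vertex (flip_at j d) by apply: Vt_eq; rewrite -ej.
have ew' : @cwall c' j = w.
  have := code_flip Xcat o i b; rewrite Ed2 code_flip Ed ew => /flip_at_inj; exact.
rewrite -{1}ew -ew' (@local_dist c u b i) ?ew // (@local_dist c' u' d j) ?ew' -?Ed //.
have d1 : edist u (bvec b) = edist u' (bvec d) by apply: edist_glue e ed => //; exact: unit_bvec.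
have d2' : edist u (bvec (flip_at i b)) = edist u' (bvec (flip_at j d)).
  by apply: edist_glue e _ => //; [exact: unit_bvec|exact: unit_bvec|rewrite -ej].
by rewrite d1 d2'.
Qed.

Lemma chart_cover' (x : X) : exists cu : {c : cube X & 'rV[R]_(dim c)},
  unit_cube (projT2 cu) /\ x = chart (projT1 cu) (projT2 cu).
Proof. by have [c [u uu <-]] := chart_cover x; exists (existT _ c u). Qed.

Definition kappa (x : X) : wallT -> R := local_coord (projT2 (projT1 (cid (chart_cover' x)))).

Lemma kappaE (c : cube X) (u : 'rV[R]_(dim c)) : unit_cube u -> kappa (chart c u) = local_coord u.
Proof. by move=> uu; rewrite /kappa; case: cid => cu /= [uu' e]; apply: local_glue. Qed.

Lemma kappa_rounding x h : rounding (kappa x) h <-> exists2 v : vertexT, car x (proj1_sig v) & h = code v.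
Proof.
have [c [u uu <-]] := chart_cover x; rewrite kappaE // local_rounding //; split=> [[b rb ->]|[v]].
  by exists (cell_vertex b) => //; apply/carE => //; exists b.
by move=> /(carE _ uu)[b rb e] ->; exists b => //; congr code; exact: Vt_eq.
Qed.

Lemma kappa_pts x : pts codes (kappa x).
Proof.
split=> [|h /kappa_rounding[v _ ->]]; last by exists v.
by have [c [u uu <-]] := chart_cover x; rewrite kappaE //; exact: local_cube.
Qed.

Lemma kappa_vertex (v : vertexT) : kappa (proj1_sig v) = vtx R (code v).
Proof.
have H := kappa_rounding (proj1_sig v).
apply/funext => w; have [in01 _] := kappa_pts (proj1_sig v).
have only h : rounding (kappa (proj1_sig v)) h -> h = code v.
  by move=> /H[v' /(car_of_vertex _ (proj2_sig v))/Vt_eq -> ->].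
have ef := only _ (floor01_rounding _); have ec := only _ (ceil01_rounding _).
have := congr1 (fun h => h w) ef; have := congr1 (fun h => h w) ec.
rewrite /= /floor01 /ceil01 /vtx; case: (code v w) => [_ /eqP ->//|/negbT].
by rewrite negbK => /eqP ->.
Qed.

(** Equal coordinates have equal roundings, so by [kappa_rounding] both points have the same carrier
    vertices and lie in a common cell. *)
Lemma kappa_inj : injective kappa.
Proof.
move=> x y e; have [c [u uu ex]] := chart_cover x; subst x.
have [v uv ey] : cell c y.
  apply: cell_of_car => v cv; have vv := car_vertex cv.
  have : rounding (kappa y) (code (exist _ v vv)) by apply/kappa_rounding; exists (exist _ v vv).
  rewrite -e => /kappa_rounding[v' cv' /code_inj ev'].
  by have := car_cell (ex_intro2 _ _ u uu erefl) cv'; rewrite -ev'.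
by subst y; move: e; rewrite !kappaE // => /local_inj ->.
Qed.

Lemma cube_point (c : cube X) f : in_cube f -> (forall w, (forall i, @cwall c i <> w) -> f w = (base c w)%:R) ->
  exists2 u : 'rV[R]_(dim c), unit_cube u & local_coord u = f.
Proof.
move=> f01 H; pose u : 'rV[R]_(dim c) := \row_i (if base c (@cwall c i) then 1 - f (cwall i) else f (cwall i)).
exists u; first by move=> i; rewrite mxE; have := f01 (@cwall c i); case: (base _ _); lra.
apply/funext => w; have [[i <-]|n] := pselect (exists i, @cwall c i = w).
  by rewrite local_cwall mxE; case: (base _ _) => //; rewrite subKr.
have n' i : @cwall c i <> w by move=> e; apply: n; exists i.
by rewrite local_off // H.
Qed.

(** The joint vertices of [f] and [g] form a cube of codes, which [cube_cell] realizes by a cell. *)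
Lemma common_cubeP f g : cocube codes f g -> exists (c : cube X) (u v : 'rV[R]_(dim c)),
  [/\ unit_cube u, unit_cube v, f = local_coord u & g = local_coord v].
Proof.
move=> cc; have [f01 g01 H] := cc.
(* [h0] and, below, [h1] are the two extreme joint vertices; they differ exactly at the free walls,
   so these are finitely many. *)
pose h0 w := if (f w == g w) && (f w == 0) then false else if (f w == g w) && (f w == 1) then true else false.
have h0J : joint f g h0.
  by move=> w; split=> fw gw; rewrite /h0 fw gw !eqxx //= oner_eq0.
have [v ev] := H _ h0J.
have [s [us Hs]] : exists s : seq wallT, uniq s /\ forall w, w \in s <-> ~ (f w = g w /\ (f w = 0 \/ f w = 1)).
  pose h1 w := if (f w == g w) && (f w == 0) then false else true.
  have h1J : joint f g h1 by move=> w; split=> fw gw; rewrite /h1 fw gw !eqxx //= oner_eq0.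
  have [v1 ev1] := H _ h1J.
  have [s Hs] := codes_fin (codes_code Xcat o v) (codes_code Xcat o v1).
  exists (undup [seq w <- s | `[< ~ (f w = g w /\ (f w = 0 \/ f w = 1)) >]]); split; first exact: undup_uniq.
  move=> w; rewrite mem_undup mem_filter; split=> [/andP[/asboolP]//|nw]; rewrite asboolT //=.
  apply: contraT => /Hs; rewrite -ev -ev1 /h0 /h1.
  have [fg|_] := eqVneq (f w) (g w) => //=.
  have [f0|_] := eqVneq (f w) 0 => /=; first by case: nw; split=> //; left.
  have [f1|_] := eqVneq (f w) 1 => //=; by case: nw; split=> //; right.
have [|c [b [ebv Hc]]] := @cube_cell R X Xcat o v s us.
  move=> a Ha; apply: H => w; split=> fw gw; (rewrite Ha -?ev; [|apply/negP => /Hs; rewrite fw gw; tauto]).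
    by rewrite /h0 fw gw !eqxx.
  by rewrite /h0 fw gw !eqxx oner_eq0.
have Hcw w : w \in s <-> exists i, @cwall c i = w.
  rewrite Hc; split=> [[i]|[i <-]]; last by exists i; rewrite ebv code_flip.
  by rewrite ebv code_flip => /flip_at_inj e; exists i.
have off w : (forall i, @cwall c i <> w) -> f w = (base c w)%:R /\ g w = (base c w)%:R.
  move=> n; have : w \notin s by apply/negP => /Hcw[i /n].
  move=> /negP ws; have {ws} [fg f01w] : f w = g w /\ (f w = 0 \/ f w = 1).
    by apply: contrapT => h; apply: ws; apply/Hs.
  rewrite -fg -(code_off b n) -ebv -ev /h0 -fg eqxx /=.
  by case: f01w => ->; rewrite ?eqxx ?oner_eq0.
have [u uu eu] := cube_point f01 (fun w n => (off w n).1).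
have [u' uu' eu'] := cube_point g01 (fun w n => (off w n).2).
by exists c, u, u'.
Qed.

Lemma kappa_surj f : pts codes f -> exists x, kappa x = f.
Proof.
move=> [f01 Hf]; have cc : cocube codes f f.
  by split=> // h J; apply: Hf => w; have [j0 j1] := J w; split=> e; [exact: j0|exact: j1].
have [c [u [v [uu uv ef _]]]] := common_cubeP cc.
by exists (chart c u); rewrite kappaE.
Qed.

Lemma local_cocube (c : cube X) (u v : 'rV[R]_(dim c)) : unit_cube u -> unit_cube v ->
  cocube codes (local_coord u) (local_coord v).
Proof.
move=> uu uv; split; [exact: local_cube|exact: local_cube|].
by move=> h /(local_joint uu uv)[b ->]; exact: codes_code.
Qed.

Definition cell_walls (c : cube X) : seq wallT := [seq @cwall c i | i <- enum 'I_(dim c)].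

Lemma uniq_cell_walls c : uniq (cell_walls c).
Proof. by rewrite map_inj_uniq ?enum_uniq //; exact: cwall_inj. Qed.

Lemma cell_wallsP c w : w \in cell_walls c <-> exists i, @cwall c i = w.
Proof.
split=> [/mapP[i _ ->]|[i <-]]; first by exists i.
by apply: map_f; rewrite mem_enum.
Qed.

Lemma local_supported (c : cube X) (u v : 'rV[R]_(dim c)) :
  supported (cell_walls c) (local_coord u) (local_coord v).
Proof.
by move=> w /negP nw; rewrite !local_off // => i e; apply: nw; apply/cell_wallsP; exists i.
Qed.

Lemma seqlen_local (c : cube X) (u v : 'rV[R]_(dim c)) :
  seqlen (cell_walls c) (local_coord u) (local_coord v) = edist u v.
Proof.
rewrite /seqlen /edist /cell_walls big_map big_enum /=; congr Num.sqrt.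
apply: eq_bigr => i _; rewrite !local_cwall; case: (base _ _) => //.
by rewrite -sqrrN; congr (_ ^+ 2); ring.
Qed.

Lemma seqlen_supported (s s' : seq wallT) (f g : wallT -> R) : uniq s -> uniq s' ->
  supported s f g -> supported s' f g -> seqlen s f g = seqlen s' f g.
Proof.
move=> us us' Hs Hs'; congr Num.sqrt.
have red t : supported t f g -> \sum_(w <- t) (f w - g w) ^+ 2 = \sum_(w <- t | f w != g w) (f w - g w) ^+ 2.
  by move=> _; rewrite [RHS]big_mkcond; apply: eq_bigr => w _; case: eqP => //= ->; rewrite subrr expr0n.
rewrite (red s) // (red s') // -big_filter -[RHS]big_filter; apply: perm_big; apply: uniq_perm.
- exact: filter_uniq.
- exact: filter_uniq.
move=> w; rewrite !mem_filter; case: eqP => //= ne.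
have -> : w \in s by apply: contraT => /Hs.
by have -> : w \in s' by apply: contraT => /Hs'.
Qed.

(** [common_cubeP] turns steps of the model into steps inside a cell, and [seqlen_local] matches the
    lengths. *)
Lemma string_chain x y l : string_length x y l <-> chain codes (kappa x) (kappa y) l.
Proof.
split; first elim=> [x'|c u v y' l' uu uv _ IH]; first by apply: chain_nil; exact: kappa_pts.
  rewrite (kappaE uv) in IH; rewrite kappaE // -seqlen_local; apply: chain_cons IH.
  - exact: local_cocube.
  - exact: uniq_cell_walls.
  - exact: local_supported.
move=> H; move: {-2}(kappa x) {-2}(kappa y) H (erefl (kappa x)) (erefl (kappa y)) => f h H.
elim: H x => {f h l} [f _ x ef ey|f g h s l cc us sp _ IH x ef ey].
  have -> : y = x by apply: kappa_inj; rewrite ef ey.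
  exact: string_nil.
have [c [u [v [uu uv eu ev]]]] := common_cubeP cc.
have -> : x = chart c u by apply: kappa_inj; rewrite kappaE // -eu ef.
rewrite (seqlen_supported us (uniq_cell_walls c) sp) ?eu ?ev ?seqlen_local.
  by apply: string_cons => //; apply: IH => //; rewrite kappaE // ev.
exact: local_supported.
Qed.

Definition Phi (x : X) : Pt R codes := PtOf (kappa_pts x).

Lemma cdist_mdist x y : cdist x y = mdist (Phi x) (Phi y).
Proof.
by congr inf; apply/seteqP; split=> l; [move/string_chain|move=> H; apply/string_chain].
Qed.

Lemma Phi_inj : injective Phi.
Proof. by move=> x y /(congr1 (@crd _ _ _)); exact: kappa_inj. Qed.

Lemma Phi_surj z : exists x, Phi x = z.
Proof.
by have [x ex] := kappa_surj (crdP z); exists x; apply: Pt_eq.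
Qed.

Lemma codes_dim N : (forall c : cube X, (dim c <= N)%N) -> forall a (s : seq wallT), uniq s ->
  (forall b, (forall w, w \notin s -> b w = a w) -> codes b) -> (size s <= N)%N.
Proof.
move=> HN a s us H; have [v ev] := H a (fun w _ => erefl).
have [|c [b0 [eb Hc]]] := @cube_cell R X Xcat o v s us; first by rewrite -ev.
apply: leq_trans (HN c); rewrite -[leqRHS]card_ord cardE -(size_map (@cwall c)).
apply: uniq_leq_size => // w /Hc[i]; rewrite eb code_flip => /flip_at_inj <-.
by apply: map_f; rewrite mem_enum.
Qed.

End Kappa.

(** * Automorphisms and hyperplanes *)

(** An isometry preserves the diameter of the unit cube, whose square is the dimension. *)
Lemma cube_isometry_dim (R : realType) m n (h : 'rV[R]_m -> 'rV[R]_n) :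
  h @` unit_cube = unit_cube -> isometric_on unit_cube h -> m = n.
Proof.
move=> im iso; have full k : #|[pred i : 'I_k | (None : option bool) == None]| = k.
  by rewrite -[RHS]card_ord; apply: eq_card.
apply/eqP; rewrite eqn_leq -!(ler_nat R); apply/andP; split.
  have [p [q [fp fq e]]] := edist_face_diam R ((fun=> None) : 'I_m -> option bool).
  rewrite -[X in X%:R <= _]full -e -(iso _ _ (face_unit fp) (face_unit fq)) -[X in _ <= X%:R]full.
  have hu u : unit_cube u -> face (fun=> None) (h u).
    by move=> uu; rewrite -unit_cubeE -im; exists u.
  by apply: edist_face_le; apply: hu; [exact: face_unit fp|exact: face_unit fq].
have [p2 [q2 [fp fq e]]] := edist_face_diam R ((fun=> None) : 'I_n -> option bool).
have lift w : unit_cube w -> exists2 w', unit_cube w' & h w' = w by rewrite -im => -[w' ? ?]; exists w'.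
have [p' up' ep] := lift _ (face_unit fp); have [q' uq' eq] := lift _ (face_unit fq).
rewrite -[X in X%:R <= _]full -e -ep -eq iso // -[X in _ <= X%:R]full.
by apply: (@edist_face_le _ _ (fun=> None)); rewrite -unit_cubeE.
Qed.

(** Chart-free, so that isomorphisms and products transport adjacency; [carP] and [sqP] serve the
    same purpose. *)
Lemma adjP (R : realType) (X : cubeComplex R) (v w : X) : adj v w <->
  [/\ is_vertex v, is_vertex w, v <> w & exists c : cube X, [/\ dim c = 1%N, cell c v & cell c w]].
Proof.
split=> [a|[vv vw ne [c [d1 cv cw]]]].
  split; [exact: adj_vertex a|exact: adj_vertex (adjC a)|exact: adj_neq|].
  have [c [d1 e]] := segment_edge a; exists c; rewrite -e; split=> //.
    by apply: segment_in; exact: adj_vertex a.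
  by rewrite segmentC; apply: segment_in; exact: adj_vertex (adjC a).
have [b eb] := vertex_of_cell vv cv; have [b' eb'] := vertex_of_cell vw cw.
have one (k l : 'I_(dim c)) : k = l by move: k l; rewrite d1 => k l; rewrite !ord1.
have i : 'I_(dim c) by rewrite d1; exact: ord0.
exists c, b, i; split=> //; rewrite eb'; congr vx; apply/funext => j.
rewrite (one j i) flip_at_eq; have : b' i <> b i.
  by move=> e; apply: ne; rewrite eb eb'; congr vx; apply/funext => k; rewrite (one k i).
by case: (b' i) (b i) => -[].
Qed.

Lemma carP (R : realType) (X : cubeComplex R) (x v : X) : car x v <->
  is_vertex v /\ forall c : cube X, cell c x -> cell c v.
Proof.
split=> [cv|[vv H]]; first by split; [exact: car_vertex cv|move=> c cx; exact: car_cell cx cv].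
have [c [u uu e]] := chart_cover x; subst x.
have [b eb] := vertex_of_cell vv (H c (ex_intro2 _ _ u uu erefl)).
apply/carE => //; exists b => //; apply: minface_rnd.
have [c2 [e2 _ _]] := face_cell (minface u).
have : cell c2 v by apply: H; rewrite e2; exists u => //; exact: minface_in.
rewrite e2 eb => -[w swap_step ew].
by rewrite -(chart_inj (face_unit swap_step) (unit_bvec _ _) ew).
Qed.

Section Iso.
Variables (R : realType) (X Y : cubeComplex R) (f : X -> Y).
Hypothesis fiso : cube_iso f.

Lemma iso_inj : injective f.
Proof. by case: fiso => /bij_inj. Qed.

Lemma maps_cube_dim (c : cube X) (c' : cube Y) : maps_cube f c c' -> dim c = dim c'.
Proof. by move=> [h [im iso _]]; exact: cube_isometry_dim im iso. Qed.

Lemma maps_cube_cell (c : cube X) (c' : cube Y) x : maps_cube f c c' -> cell c' (f x) <-> cell c x.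
Proof.
move=> [h [im _ H]]; split=> [[u' uu' e]|[u uu <-]].
  move: uu' e; rewrite -im => -[u uu <-]; rewrite -H // => /iso_inj <-; by exists u.
by rewrite H //; exists (h u) => //; rewrite -im; exists u.
Qed.

Lemma iso_cube_l (c : cube X) : exists c', [/\ maps_cube f c c', dim c = dim c' & forall x, cell c' (f x) <-> cell c x].
Proof.
case: fiso => _ /(_ c)[c' m] _; exists c'; split=> //; [exact: maps_cube_dim|].
by move=> x; exact: maps_cube_cell.
Qed.

Lemma iso_cube_r (c' : cube Y) : exists c, [/\ maps_cube f c c', dim c = dim c' & forall x, cell c' (f x) <-> cell c x].
Proof.
case: fiso => _ _ /(_ c')[c m]; exists c; split=> //; [exact: maps_cube_dim|].
by move=> x; exact: maps_cube_cell.
Qed.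

Lemma iso_vertex v : is_vertex (f v) <-> is_vertex v.
Proof.
split=> -[c [d0 cv]].
  by have [c' [_ e H]] := iso_cube_r c; exists c'; rewrite e -H.
by have [c' [_ e H]] := iso_cube_l c; exists c'; rewrite -e H.
Qed.

Lemma iso_adj v w : adj (f v) (f w) <-> adj v w.
Proof.
rewrite !adjP; split=> -[vv vw ne [c [d1 cv cw]]]; split; try by apply/iso_vertex.
- by move=> e; apply: ne; rewrite e.
- by have [c' [_ e H]] := iso_cube_r c; exists c'; split; [rewrite e|exact/H|exact/H].
- by move/iso_inj.
- by have [c' [_ e H]] := iso_cube_l c; exists c'; split; [rewrite -e|exact/H|exact/H].
Qed.

Lemma iso_car x v : car (f x) (f v) <-> car x v.
Proof.
rewrite !carP iso_vertex; split=> -[vv H]; split=> // c.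
  by have [c' [_ _ Hc]] := iso_cube_l c; rewrite -!Hc; exact: H.
by have [c' [_ _ Hc]] := iso_cube_r c; rewrite !Hc; exact: H.
Qed.

Lemma iso_string x y l : string_length x y l -> string_length (f x) (f y) l.
Proof.
elim=> [z|c u v z k uu uv _ IH]; first exact: string_nil.
case: fiso => _ /(_ c)[c' [h [im iso H]]] _.
rewrite H // -iso //; rewrite H // in IH; apply: string_cons => //; rewrite -im; [by exists u|by exists v].
Qed.

Lemma iso_inverse g : cancel f g -> cancel g f -> cube_iso g.
Proof.
move=> fK gK; have inv (c : cube X) (c' : cube Y) : maps_cube f c c' -> maps_cube g c' c.
  move=> [h [im iso H]].
  have [|k Hk] := @choice _ _ (fun (u' : 'rV[R]_(dim c')) (u : 'rV[R]_(dim c)) => unit_cube u' -> unit_cube u /\ h u = u').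
    move=> u'; have [uu'|n] := pselect (unit_cube u'); last by exists 0.
    by move: (uu'); rewrite -im => -[u uu <-]; exists u.
  exists k; split.
  - apply/seteqP; split=> [_ [u' /Hk[uu _] <-]//|u uu].
    have uh : unit_cube (h u) by rewrite -im; exists u.
    have [uk ek] := Hk _ uh; exists (h u) => //.
    by apply: edist_eq0; rewrite -iso // ek edist_xx.
  - by move=> u v /Hk[uu eu] /Hk[uv ev]; rewrite -iso // eu ev.
  - by move=> u /Hk[uu eu]; rewrite -{1}eu -H // fK.
split; first by exists f.
- by move=> c'; have [c [m _ _]] := iso_cube_r c'; exists c; exact: inv.
- by move=> c; have [c' [m _ _]] := iso_cube_l c; exists c'; exact: inv.
Qed.

End Iso.

Section Automorphisms.
Variables (R : realType) (X : cubeComplex R).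

Lemma Aut_inverse (g : X -> X) : Aut X g -> exists g', [/\ Aut X g', cancel g g' & cancel g' g].
Proof.
move=> ag; have [[g' gK g'K] _ _] := ag; exists g'; split=> //; exact: iso_inverse gK g'K.
Qed.

Lemma Aut_comp (f g : X -> X) : Aut X f -> Aut X g -> Aut X (f \o g).
Proof.
have comp (c c1 c2 : cube X) : maps_cube g c c1 -> maps_cube f c1 c2 -> maps_cube (f \o g) c c2.
  move=> [h [im iso H]] [h2 [im2 iso2 H2]]; exists (h2 \o h); split.
  - by rewrite -image_comp im im2.
  - move=> u v uu uv /=; rewrite iso2 ?iso // -im; by [exists u|exists v].
  - by move=> u uu /=; rewrite H // H2 // -im; exists u.
move=> [bf lf rf] [bg lg rg]; split; first exact: bij_comp.
  by move=> c; have [c1 m1] := lg c; have [c2 m2] := lf c1; exists c2; exact: comp m1 m2.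
by move=> c2; have [c1 m1] := rf c2; have [c m] := rg c1; exists c; exact: comp m m1.
Qed.

Lemma Aut_cdist (g : X -> X) x y : Aut X g -> cdist (g x) (g y) = cdist x y.
Proof.
move=> ag; have [g' [ag' gK g'K]] := Aut_inverse ag.
congr inf; apply/seteqP; split=> l /= H; last exact: iso_string.
by have := iso_string ag' H; rewrite !gK.
Qed.

End Automorphisms.

Section Hyperplanes.
Variables (R : realType) (X : cubeComplex R).
Variables (Xcat : cat0_cube_complex X) (o : vertexT X).
Notation vertexT := (vertexT X).
Notation vadj := (@vadj R X).
Notation vsq := (@vsq R X).
Notation wallT := (wallT Xcat o).
Notation code := (@code R X Xcat o).
Notation codes := (@codes R X Xcat o).
Notation cwall := (@cwall R X Xcat o).
Notation kappa := (@kappa R X Xcat o).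
Notation halfspaces := (halfspaces Xcat).
Notation side := (side Xcat).
Notation Phi := (@Phi R X Xcat o).
Notation seg a b := (segment (proj1_sig a) (proj1_sig b)).

Definition wall_hyperplane (w : wallT) : set X := [set x | kappa x w = 2^-1].

Lemma wall_side a b w : vadj a b -> code b = flip_at w (code a) -> side a b = [set x | code x w = code a w].
Proof.
move=> ab e; apply/esym; apply: hs_edge => //; first exact: wall_hs.
by rewrite /= e flip_at_eq; case: (code a w).
Qed.

Lemma wall_edge (w : wallT) : exists a b, vadj a b /\ code b = flip_at w (code a).
Proof.
have [a [b [ab e]]] := wall_hs w true; exists a, b; split=> //.
have [w' ew'] := adj_code Xcat o ab; have [_ ha hb] := side_edge Xcat ab.
rewrite /side -e /= in ha hb; rewrite ew'; congr flip_at; apply/eqP; rewrite eq_sym.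
by apply: contraPT ha => ww' ha; apply: hb; rewrite ew' flip_at_neq.
Qed.

Lemma segment_ends (a b a' b' : vertexT) w : vadj a b -> vadj a' b' -> seg a b = seg a' b' ->
  code b = flip_at w (code a) -> code b' = flip_at w (code a').
Proof.
move=> ab ab' e eb; have in' v : seg a b (proj1_sig v) -> v = a' \/ v = b'.
  by rewrite e => /(_ (proj1_sig v))[|/Vt_eq|/Vt_eq]; [apply/car_of_vertex => //; exact: proj2_sig|left|right].
have va := proj2_sig a; have vb := proj2_sig b.
have na : a' <> b' by move=> ee; apply: (adj_neq ab'); rewrite ee.
have nb : a <> b by move=> ee; apply: (adj_neq ab); rewrite ee.
case: (in' a) => [|ea|ea]; first exact: segment_in.
  case: (in' b) => [|eb'|eb']; first by rewrite segmentC; exact: segment_in.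
    by case: nb; rewrite ea eb'.
  by rewrite -ea -eb'.
case: (in' b) => [|eb'|eb']; first by rewrite segmentC; exact: segment_in.
  by rewrite -ea -eb' eb flip_atK.
by case: nb; rewrite ea eb'.
Qed.

Lemma edge_parallel_parallel e f : edge_parallel vsq e f -> parallel (seg e.1 e.2) (seg f.1 f.2).
Proof.
elim=> [x y H|x|x y z _ H1 _ H2]; [|exact: rst_refl|exact: rst_trans H1 H2].
by apply: rst_step; exact: sq_opposite.
Qed.

Definition on_wall (w : wallT) (e : set X) := exists a b, [/\ vadj a b, e = seg a b & code b = flip_at w (code a)].

Lemma opposite_edgesC (e f : set X) : opposite_edges e f -> opposite_edges f e.
Proof. by move=> [c [i [d h1 h2]]]; exists c, i. Qed.

Lemma parallel_on_wall w e f : parallel e f -> on_wall w e <-> on_wall w f.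
Proof.
have step e' f' : opposite_edges e' f' -> on_wall w e' -> on_wall w f'.
  move=> /opposite_edges_sq[v1 [v2 [v3 [v4 [ee ff a12 S]]]]] [a [b [ab eab eb]]].
  have vv1 := adj_vertex a12; have vv2 := adj_vertex (adjC a12).
  have e12 : code (exist _ v2 vv2) = flip_at w (code (exist _ v1 vv1)).
    by apply: segment_ends ab _ _ eb => //; rewrite -eab.
  case: S => [S|[e3 e4]]; last by subst v3 v4; exists (exist _ v1 vv1), (exist _ v2 vv2).
  have vv3 := adj_vertex (sq_adj (sq_rot (sq_rot S))).
  have vv4 := adj_vertex (sq_adj (sq_rot (sq_rot (sq_rot S)))).
  have S' : vsq (exist _ v1 vv1) (exist _ v2 vv2) (exist _ v3 vv3) (exist _ v4 vv4) by [].
  exists (exist _ v4 vv4), (exist _ v3 vv3); split=> //; last exact: sq_code S' e12.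
  exact: adjC (sq_adj (sq_rot (sq_rot S))).
elim=> [x y H|x|x y _ [H1 H2]|x y z _ [H1 H2] _ [H3 H4]].
- by split; apply: step => //; exact: opposite_edgesC.
- by [].
- by split.
- by split=> H; auto.
Qed.

Lemma natr_half (t : bool) : t%:R <> 2^-1 :> R.
Proof. by case: t => e; move: e; rewrite /=; lra. Qed.

(** Parallel edges cross the same wall by [parallel_on_wall]; conversely, edges crossing the same
    wall are parallel by [crossing_edges], after reversing one of them if necessary. *)
Lemma hyperplane_ofE a b w : vadj a b -> code b = flip_at w (code a) -> hyperplane_of (seg a b) = wall_hyperplane w.
Proof.
move=> ab eb; apply/seteqP; split=> [x [c [i [f [df pf [u [uu ui] ex]]]]]|x].
  have [b0 ef] := dual_edge_vx df.
  have /(parallel_on_wall w pf)[a' [b' [ab' ef' eb']]] : on_wall w (seg a b) by exists a, b.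
  have ew : cwall i = w.
    have : code (cell_vertex (flip_at i b0)) = flip_at w (code (cell_vertex b0)).
      apply: (segment_ends ab' _ _ eb'); first exact: vx_adj.
      by rewrite -ef' ef.
    by rewrite code_flip => /flip_at_inj.
  by rewrite -ex /wall_hyperplane /= kappaE // -ew local_cwall ui; case: (base _ _); lra.
have [c [u uu <-]] := chart_cover x; rewrite /wall_hyperplane /= kappaE // => H.
have [[i ew]|n] := pselect (exists i, @cwall c i = w); last first.
  by move: H; rewrite local_off => [/natr_half //|i e]; apply: n; exists i.
have ui : u ord0 i = 2^-1 by move: H; rewrite -ew local_cwall; case: (base _ _) => //; lra.
pose b0 (_ : 'I_(dim c)) := false.
exists c, i, (segment (vx b0) (vx (flip_at i b0))); split; last by exists u.
  exact: dual_edge_segment.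
have E := code_flip Xcat o i b0; rewrite ew in E.
have A : vadj (cell_vertex b0) (cell_vertex (flip_at i b0)) by exact: vx_adj.
have [e|e] := eqVneq (code (cell_vertex b0) w) (code a w).
  apply: (@edge_parallel_parallel (a, b) (cell_vertex b0, cell_vertex (flip_at i b0))); apply: (crossing_edges ab A).
    by rewrite (wall_side ab eb).
  by rewrite (wall_side ab eb) /= E flip_at_eq e; case: (code a w).
rewrite (segmentC (vx b0)); apply: (@edge_parallel_parallel (a, b) (cell_vertex (flip_at i b0), cell_vertex b0)).
apply: (crossing_edges ab (adjC A)); rewrite (wall_side ab eb) /=.
  by rewrite E flip_at_eq; case: (code a w) (code (cell_vertex b0) w) e => -[].
exact/eqP.
Qed.

Lemma hyperplaneP H : hyperplane H <-> exists w, H = wall_hyperplane w.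
Proof.
split=> [[e /is_edge_adj[v [y [a ->]]] ->]|[w ->]].
  have vv := adj_vertex a; have vy := adj_vertex (adjC a).
  have a' : vadj (exist _ v vv) (exist _ y vy) by [].
  have [w ew] := adj_code Xcat o a'; exists w; exact: (hyperplane_ofE a' ew).
have [a [b [ab eb]]] := wall_edge w; exists (seg a b); first exact: segment_edge.
by rewrite (hyperplane_ofE ab eb).
Qed.

(** At a common point both coordinates are 1/2, so they may be rounded independently. *)
Lemma hyp_meet w w' : wall_hyperplane w `&` wall_hyperplane w' !=set0 -> w <> w' -> forall t t', exists v, code v w = t /\ code v w' = t'.
Proof.
move=> [x [/= e e']] ne t t'.
pose h y := if y == w then t else if y == w' then t' else floor01 (kappa x) y.
have hr : rounding (kappa x) h.
  move=> y; rewrite /h; case: eqVneq => [->|_].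
    by rewrite e; split=> H; [have : (0 : R) = 2^-1 by []|have : (1 : R) = 2^-1 by []]; lra.
  case: eqVneq => [->|_]; last exact: floor01_rounding.
  by rewrite e'; split=> H; [have : (0 : R) = 2^-1 by []|have : (1 : R) = 2^-1 by []]; lra.
have [_ /(_ _ hr)[v ev]] := kappa_pts Xcat o x.
exists v; rewrite -ev /h eqxx; split=> //; rewrite eqxx; case: eqVneq => // e1; by case: ne.
Qed.

Lemma hyp_vertex w (v : vertexT) : ~ wall_hyperplane w (proj1_sig v).
Proof. by rewrite /wall_hyperplane /= kappa_vertex; exact: natr_half. Qed.

Lemma segment_off_hyp a b w : vadj a b -> code a w = code b w -> seg a b `<=` ~` wall_hyperplane w.
Proof.
move=> ab e x sx; rewrite /wall_hyperplane /=.
have H h : rounding (kappa x) h -> h w = code a w.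
  move=> /kappa_rounding[v cv ->]; case: (sx _ cv) => /Vt_eq -> //.
have Hf := H _ (floor01_rounding _); have Hc := H _ (ceil01_rounding _).
have h1 : (2^-1 == 1 :> R) = false by apply/eqP; lra.
have h0 : (2^-1 == 0 :> R) = false by apply/eqP; lra.
by move=> ex; rewrite /floor01 ex h1 in Hf; rewrite /ceil01 ex h0 /= -Hf in Hc.
Qed.

(* An edge path that stays in [h] avoids the hyperplane. *)
Lemma half_space_side h : halfspaces h -> exists Z : set X, half_space Z /\ forall v, h v -> Z (proj1_sig v).
Proof.
move=> [a [b [ab ->]]]; rewrite -/(side a b).
have [w ew] := adj_code Xcat o ab; have es := wall_side ab ew; rewrite es.
have [_ ha _] := side_edge Xcat ab.
exists (closure (connected_component (~` wall_hyperplane w) (proj1_sig a))); split.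
  exists (wall_hyperplane w), (proj1_sig a); split=> //; last exact: hyp_vertex.
  by apply/hyperplaneP; exists w.
move=> v hv; apply: subset_closure.
suff [A [cA sA Aa Av]] : exists A : set (pt X), [/\ connected A, A `<=` ~` wall_hyperplane w, A (proj1_sig a) & A (proj1_sig v)].
  by exists A => //; split.
have [n] := ubnP (vdist Xcat a v); elim: n v hv => // n IH v hv Hn.
have [ev|ne] := pselect (a = v).
  exists [set proj1_sig a]; split; [exact: connected1|by move=> _ ->; exact: hyp_vertex|by []|by rewrite ev].
have [t [vt_ st]] := hs_step Xcat ne.
have [w' ew'] := adj_code Xcat o vt_.
have side' : code a w' = code t w'.
  have ev : code v = flip_at w' (code t) by rewrite ew' flip_atK.
  by move: st; rewrite (wall_side (adjC vt_) ev).
have ct : code t w = code v w.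
  have [e|n'] := eqVneq w w'; last by rewrite ew' flip_at_neq.
  by subst w'; move: hv; rewrite /= side' ew' flip_at_eq; case: (code v w).
have [||A [cA sA Aa At]] := IH t; first by rewrite /= ct.
  by rewrite -ltnS -(vdist_side vt_ st).
have [g [cg g0 g1 gs]] := exists_edge_path vt_.
exists (A `|` (g @` setT)); split.
- apply: connectedU => //; first by exists (proj1_sig t); split=> //; exists 1 => //; exact: g1.
  have cT : connected (setT : set R) by apply/connected_intervalP.
  exact: (connected_continuous_connected cT (continuous_subspaceT cg)).
- move=> x [/sA//|[s _ <-]]; exact: (segment_off_hyp vt_ (esym ct)).
- by left.
- by right; exists 0 => //; exact: g0.
Qed.

Definition vertex_action : set (vertexT -> vertexT) := [set F | exists2 g, Aut X g & forall v, proj1_sig (F v) = g (proj1_sig v)].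

Lemma acts_of g : Aut X g -> exists2 F, vertex_action F & forall v, proj1_sig (F v) = g (proj1_sig v).
Proof.
move=> ag; have vg v : is_vertex v -> is_vertex (g v) by move/(iso_vertex ag).
by exists (fun v => exist _ (g (proj1_sig v)) (vg _ (proj2_sig v))) => //; exists g.
Qed.

Lemma acts_comp F F' : vertex_action F -> vertex_action F' -> vertex_action (F \o F').
Proof.
move=> [g ag e] [g' ag' e']; exists (g \o g'); first exact: Aut_comp.
by move=> v /=; rewrite e e'.
Qed.

Lemma acts_inverse F : vertex_action F -> exists F', [/\ vertex_action F', cancel F F' & cancel F' F].
Proof.
move=> [g ag e]; have [g' [ag' gK g'K]] := Aut_inverse ag; have [F' aF' e'] := acts_of ag'.
by exists F'; split=> // v; apply: Vt_eq; rewrite ?e ?e' ?e ?gK ?g'K.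
Qed.

Lemma acts_hs F h : vertex_action F -> halfspaces h -> halfspaces (F @` h).
Proof.
move=> aF [a [b [ab ->]]]; have [F' [aF' FK F'K]] := acts_inverse aF.
have pres F0 : vertex_action F0 -> forall u v, vadj u v -> vadj (F0 u) (F0 v).
  by move=> [g ag e] u v uv; have := (iso_adj ag (proj1_sig u) (proj1_sig v)).2 uv; rewrite -!e.
rewrite -/(side a b) (side_automorphism Xcat a b FK F'K (pres _ aF) (pres _ aF')).
by have [] := side_edge Xcat (pres _ aF _ _ ab).
Qed.

Hypothesis Xess : acts_essentially (Aut X).

Lemma essential_orbit h v : halfspaces h -> exists2 F, vertex_action F & ~ h (F v).
Proof.
move=> Hh; have [Z [hZ sZ]] := half_space_side Hh; apply: contrapT => H.
(* Radius 0 suffices: an orbit of [v] that never leaves [h] lies in the half-space [Z]. *)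
apply: (Xess (x := proj1_sig v) hZ); exists 0 => g ag; have [F aF eF] := acts_of ag.
exists (g (proj1_sig v)); last by rewrite (cdist_mdist Xcat o) mdistxx //; [exact: codes_fin|exact: codes_step].
by rewrite -eF; apply: sZ; apply: contrapT => n; apply: H; exists F.
Qed.

Definition vconv (K : set vertexT) := forall u v m, K u -> K v ->
  (forall w, code m w = code u w \/ code m w = code v w) -> K m.

Lemma hs_vconv k : halfspaces k -> vconv k.
Proof. by move=> /(hs_wall o)[w [b ->]] u v m /= hu hv /(_ w)[] ->. Qed.

(** Induction replaces [K] by its intersection with [k]. The median of points of the three pairwise
    intersections of [K], [k], [k'] lies in all three sets. *)
Lemma helly (s : seq (set vertexT)) (K : set vertexT) : vconv K ->
  K !=set0 -> (forall k, List.In k s -> vconv k) -> (forall k, List.In k s -> exists v, K v /\ k v) ->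
  (forall k k', List.In k s -> List.In k' s -> exists v, k v /\ k' v) ->
  exists v, K v /\ forall k, List.In k s -> k v.
Proof.
elim: s K => [K _ [v Kv]|k s IH K Kc K0 Hs HK Hp]; first by exists v.
have Hk : vconv k by apply: Hs; left.
have [||k' k's|k' k's|k1 k2 h1 h2|v [[Kv kv] H]] := IH [set v | K v /\ k v].
- by move=> u v m [Ku ku] [Kv kv] H; split; [exact: Kc H|exact: Hk H].
- by apply: HK; left.
- by apply: Hs; right.
- have [x [Kx kx]] := HK k (or_introl erefl); have [y [Ky ky]] := HK k' (or_intror k's).
  have [z [kz k'z]] := Hp k k' (or_introl erefl) (or_intror k's).
  have [m em] := codes_med (codes_code Xcat o x) (codes_code Xcat o y) (codes_code Xcat o z).
  have E w := congr1 (fun f => f w) em.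
  exists m; split; [split|].
  + by apply: (Kc x y) => // w; rewrite -E /majority; case: (code x w) (code y w) (code z w) => -[] []; tauto.
  + by apply: (Hk x z) => // w; rewrite -E /majority; case: (code x w) (code y w) (code z w) => -[] []; tauto.
  + apply: (Hs k' _ y z) => //; first by right.
    by move=> w; rewrite -E /majority; case: (code x w) (code y w) (code z w) => -[] []; tauto.
- by apply: Hp; right.
by exists v; split=> // k' [<-|/H].
Qed.

Lemma inP_car (K : set vertexT) (x : X) : inP (code @` K) (Phi x) <-> forall v, car x (proj1_sig v) -> K v.
Proof.
split=> [[_ H] v cv|H].
  by have [|v' Kv' /code_inj <-//] := H (code v); apply/kappa_rounding; exists v.
split; first by case: (kappa_pts Xcat o x).
by move=> h /kappa_rounding[v cv ->]; exists v => //; exact: H.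
Qed.

Variable N : nat.
Hypothesis Xdim : forall c : cube X, (dim c <= N)%N.
Hypothesis Xnofix : ~ exists xi, fixed_point_at_infinity (Aut X) xi.

(* If no automorphism flips [h], any finitely many translates of the complement of [h] intersect (Helly), while
   the intersection of all of them is empty because the action is essential: they generate a filter of convex
   subcomplexes escaping to infinity, which determines a boundary point fixed by Aut(X). *)
Lemma flippable h : halfspaces h -> exists2 F, vertex_action F & F @` (~` h) `<=` h.
Proof.
move=> Hh; apply: contrapT => Hun; apply: Xnofix.
have meet F1 F2 : vertex_action F1 -> vertex_action F2 -> exists v, (F1 @` (~` h)) v /\ (F2 @` (~` h)) v.
  move=> a1 a2; have [F1' [a1' K1 K1']] := acts_inverse a1; apply: contrapT => nm; apply: Hun.
  exists (F1' \o F2); first exact: acts_comp.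
  move=> _ [v nv <-]; apply: contrapT => n1; apply: nm; exists (F2 v); split; last by exists v.
  by exists (F1' (F2 v)) => //; rewrite K1'.
pose Orb : set (set vertexT) := [set k | exists2 F, vertex_action F & k = F @` (~` h)].
pose inter (s : seq (set vertexT)) : set vertexT := [set v | forall k, List.In k s -> k v].
pose Fam : set (set (wallT -> bool)) := [set C | exists2 s, (forall k, List.In k s -> Orb k) & C = code @` inter s].
have orb_hs k : Orb k -> halfspaces k by move=> [F aF ->]; apply: acts_hs => //; exact: halfspacesC.
have Fconv C : Fam C -> convex_in codes C.
  move=> [s Hs ->]; split; first by move=> _ [v _ <-]; exact: codes_code.
    have [|||||v [_ Hv]] := @helly s setT; last by exists (code v), v.
    - by [].
    - by exists o.
    - by move=> k /Hs/orb_hs; exact: hs_vconv.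
    - move=> k /Hs[F aF ->]; have [v [h1 _]] := meet F F aF aF; by exists v.
    - by move=> k k' /Hs[F aF ->] /Hs[F' aF' ->]; exact: meet.
  move=> _ _ z [u iu <-] [v iv <-] [m ->] H; exists m => // k ks.
  have [w [b ek]] := hs_wall o (orb_hs _ (Hs _ ks)).
  by have := iu k ks; have := iv k ks; rewrite ek /= => e1 e2; case: (H w) => ->.
have Fdir C C' : Fam C -> Fam C' -> exists C2, [/\ Fam C2, C2 `<=` C & C2 `<=` C'].
  move=> [s Hs ->] [s' Hs' ->]; exists (code @` inter (s ++ s')); split.
  - by exists (s ++ s') => // k /(List.in_app_or _ _ _)[/Hs|/Hs'].
  - by move=> _ [v iv <-]; exists v => // k ks; apply: iv; apply/List.in_or_app; left.
  - by move=> _ [v iv <-]; exists v => // k ks; apply: iv; apply/List.in_or_app; right.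
have Fempty a : codes a -> exists2 C, Fam C & ~ C a.
  move=> [v ->]; have [F aF nF] := essential_orbit v (halfspacesC Hh).
  have [F' [aF' FK F'K]] := acts_inverse aF.
  exists (code @` inter [:: F' @` (~` h)]); first by exists [:: F' @` (~` h)] => // k [<-|[]]; exists F'.
  move=> [v' iv' /code_inj ev]; apply: nF; rewrite -ev.
  by have [y ny <-] := iv' _ (or_introl erefl); rewrite F'K.
have Fne : Fam !=set0 by exists (code @` inter [::]), [::].
have [rho [rgeo rfix]] := model_fixed_ray R (@codes_med R X Xcat o) (@codes_fin R X Xcat o)
  (@codes_step R X Xcat o) (@codes_dim R X Xcat o N Xdim) Fconv Fdir Fempty Fne (codes_code Xcat o o).
have [|Psi HPsi] := @choice (Pt R codes) X (fun z x => Phi x = z); first by move=> z; exact: Phi_surj.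
have PsiK x : Psi (Phi x) = x by apply: (@Phi_inj R X Xcat o); rewrite HPsi.
pose r t := Psi (rho t).
have cdr s t : cdist (r s) (r t) = mdist (rho s) (rho t) by rewrite (cdist_mdist Xcat o) !HPsi.
have gr : geodesic_ray r by move=> s t s0 t0; rewrite cdr rgeo.
have tri (x y z : X) : cdist x z <= cdist x y + cdist y z.
  rewrite (cdist_mdist Xcat o x z) (cdist_mdist Xcat o x y) (cdist_mdist Xcat o y z).
  by apply: mdist_triangle; [exact: codes_fin|exact: codes_step].
have pres g (F : vertexT -> vertexT) : Aut X g -> (forall v, proj1_sig (F v) = g (proj1_sig v)) ->
    preserves_family Fam (fun z => Phi (g (Psi z))).
  move=> ag eF C [s Hs ->].
  have aF : vertex_action F by exists g.
  have [F' [aF' FK F'K]] := acts_inverse aF.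
  exists (code @` inter (map (fun k => F' @` k) s)).
    exists (map (fun k => F' @` k) s) => // k /List.in_map_iff[k0 [<- /Hs[F0 aF0 ->]]].
    exists (F' \o F0); first exact: acts_comp.
    by rewrite image_comp.
  move=> z; rewrite -{1}(HPsi z) !inP_car; split=> H v cv.
    have [v' ev'] : exists v', v = F v' by exists (F' v); rewrite F'K.
    have cv' : car (Psi z) (proj1_sig v') by rewrite ev' eF in cv; move/(iso_car ag): cv.
    move=> k ks; have [|y ky ey] := H v' cv' (F' @` k); first by apply/List.in_map_iff; exists k.
    by rewrite ev' -ey F'K.
  move=> k /List.in_map_iff[k0 [<- k0s]]; exists (F v); last by rewrite FK.
  by apply: H => //; rewrite eF; apply/(iso_car ag).
exists [set r' | geodesic_ray r' /\ asymptotic r r']; split; first by exists r.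
(* [g] moves the ray [r] by a bounded amount, so it preserves the class of rays asymptotic to [r];
   with the inverse of [g] this gives equality of the classes. *)
have stab g : Aut X g -> forall r', geodesic_ray r' /\ asymptotic r r' ->
    geodesic_ray (g \o r') /\ asymptotic r (g \o r').
  move=> ag r' [gr' [K HK]]; split; first by move=> s t s0 t0 /=; rewrite Aut_cdist // gr'.
  have [g' [ag' gK g'K]] := Aut_inverse ag.
  have [F aF eF] := acts_of ag; have [F' aF' eF'] := acts_of ag'.
  have [|||k Hk] := rfix (fun z => Phi (g (Psi z))) (fun z => Phi (g' (Psi z))) _ _ _ (pres g F ag eF) (pres g' F' ag' eF').
  - by move=> x y /=; rewrite -(cdist_mdist Xcat o) (Aut_cdist _ _ ag) (cdist_mdist Xcat o) !HPsi.
  - by move=> z; rewrite PsiK gK HPsi.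
  - by move=> z; rewrite PsiK g'K HPsi.
  exists (k + K) => t t0 /=; apply: le_trans (tri _ (g (r t)) _) _; apply: lerD.
    rewrite (cdist_mdist Xcat o) mdistC; last 2 first.
    + exact: codes_fin.
    + exact: codes_step.
    by rewrite -[X in mdist _ X]/(Phi (Psi (rho t))) HPsi; exact: Hk.
  by rewrite Aut_cdist //; exact: HK.
move=> g ag; apply/seteqP; split=> [_ [r' Hr' <-]|r' Hr']; first exact: stab.
have [g' [ag' gK g'K]] := Aut_inverse ag; exists (g' \o r'); first exact: stab.
by apply/funext => t /=; rewrite g'K.
Qed.

End Hyperplanes.

(** * Products *)

Section Subcomplex.
Variables (R : realType) (X : cubeComplex R) (P : set X).
Hypothesis Pcells : forall x, P x -> exists c : cube X, cell c `<=` P /\ cell c x.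

(* Charts are total functions, but only the points of the unit cube are known to be sent into [P]. *)
Definition clampv n (u : 'rV[R]_n) : 'rV[R]_n := \row_i clamp (u ord0 i).

Lemma clampv_unit n (u : 'rV[R]_n) : unit_cube (clampv u).
Proof. by move=> i; rewrite mxE; exact: clamp_itv. Qed.

Lemma clampv_id n (u : 'rV[R]_n) : unit_cube u -> clampv u = u.
Proof. by move=> uu; apply: rV_ext => i; rewrite mxE clamp_id //; exact: uu. Qed.

Definition sub_cube := {c : cube X | cell c `<=` P}.
Definition sub_dim (c : sub_cube) := dim (proj1_sig c).

Lemma sub_chart_in (c : sub_cube) (u : 'rV[R]_(sub_dim c)) : P (chart (proj1_sig c) (clampv u)).
Proof. by apply: (proj2_sig c); exists (clampv u) => //; exact: clampv_unit. Qed.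

Definition sub_chart (c : sub_cube) (u : 'rV[R]_(sub_dim c)) : {x | P x} := exist P _ (sub_chart_in u).

Lemma sub_chartE (c : sub_cube) (u : 'rV[R]_(sub_dim c)) : unit_cube u ->
  proj1_sig (sub_chart u) = chart (proj1_sig c) u.
Proof. by move=> uu /=; rewrite clampv_id. Qed.

Lemma sub_eq (x y : {x | P x}) : proj1_sig x = proj1_sig y -> x = y.
Proof. by case: x y => [x px] [y py] /= e; subst y; congr exist; exact: Prop_irrelevance. Qed.

Lemma sub_chart_inj (c : sub_cube) u v : unit_cube u -> unit_cube v ->
  @sub_chart c u = sub_chart v -> u = v.
Proof.
move=> uu uv /(congr1 (@proj1_sig _ _)); rewrite !sub_chartE //; exact: chart_inj.
Qed.

Lemma sub_image (c : sub_cube) (A : set 'rV[R]_(sub_dim c)) (x : {x | P x}) : A `<=` unit_cube ->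
  (@sub_chart c @` A) x <-> (chart (proj1_sig c) @` A) (proj1_sig x).
Proof.
move=> Au; split=> [[u Ax <-]|[u Ax e]]; exists u => //; first by rewrite sub_chartE //; exact: Au.
by apply: sub_eq; rewrite sub_chartE //; exact: Au.
Qed.

Lemma sub_chart_cover (x : {x | P x}) : exists c, (@sub_chart c @` unit_cube) x.
Proof.
have [c [cP cx]] := Pcells (proj2_sig x).
by exists (exist _ c cP); apply/sub_image.
Qed.

Lemma sub_chart_face c (s : 'I_(sub_dim c) -> option bool) :
  exists c', @sub_chart c' @` unit_cube = @sub_chart c @` face s.
Proof.
have [c' e] := chart_face (c := proj1_sig c) s.
have c'P : cell c' `<=` P.
  by rewrite /cell e => x [u fu <-]; apply: (proj2_sig c); exists u => //; exact: face_unit fu.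
exists (exist _ c' c'P); apply/seteqP; split=> x /(sub_image _ _) H.
  by apply/sub_image; [exact: face_sub_unit|rewrite -e; exact: H].
by apply/sub_image => //; rewrite e; apply: H; exact: face_sub_unit.
Qed.

Lemma sub_chart_glue c c' :
  (@sub_chart c @` unit_cube) `&` (@sub_chart c' @` unit_cube) !=set0 ->
  exists (s : 'I_(sub_dim c) -> option bool) (s' : 'I_(sub_dim c') -> option bool)
         (h : 'rV[R]_(sub_dim c) -> 'rV[R]_(sub_dim c')),
    [/\ h @` face s = face s', isometric_on (face s) h &
        forall u u', unit_cube u -> unit_cube u' ->
          (@sub_chart c u = @sub_chart c' u' <-> face s u /\ u' = h u)].
Proof.
move=> [x [/(sub_image _ (fun _ => id)) cx /(sub_image _ (fun _ => id)) c'x]].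
have [|s [s' [h [h1 h2 h3]]]] := chart_glue (c := proj1_sig c) (c' := proj1_sig c').
  by exists (proj1_sig x).
exists s, s', h; split=> // u u' uu uu'; rewrite -(h3 u u' uu uu'); split.
  by move=> /(congr1 (@proj1_sig _ _)); rewrite !sub_chartE.
by move=> e; apply: sub_eq; rewrite !sub_chartE.
Qed.

Definition subcomplex : cubeComplex R :=
  CubeComplex sub_chart_inj sub_chart_cover sub_chart_face sub_chart_glue.

Lemma sub_cell (c : cube subcomplex) (x : subcomplex) :
  cell c x <-> cell (proj1_sig c : cube X) (proj1_sig x).
Proof. exact: sub_image. Qed.

End Subcomplex.

(** * Splitting along transverse classes of walls *)

Section Boxes.
Variables (R : realType) (X : cubeComplex R).
Variables (Xcat : cat0_cube_complex X) (o : vertexT X).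
Notation vertexT := (vertexT X).
Notation wallT := (wallT Xcat o).
Notation code := (@code R X Xcat o).
Notation codes := (@codes R X Xcat o).
Notation kappa := (@kappa R X Xcat o).

(* The smallest cell containing the point with coordinates [f]. *)
Definition agree (f : wallT -> R) : set X := [set x | forall w, f w = 0 \/ f w = 1 -> kappa x w = f w].

Lemma agree_face (c : cube X) (u : 'rV[R]_(dim c)) : unit_cube u ->
  chart c @` face (minface u) = agree (@local_coord R X Xcat o c u).
Proof.
move=> uu; apply/seteqP; split=> [_ [u' fu' <-] w|x H].
  rewrite kappaE ?(face_unit fu') //; last exact: face_unit fu'.
  have [[i <-]|n] := pselect (exists i, @cwall R X Xcat o c i = w); last first.
    by have n' i : @cwall R X Xcat o c i <> w by [move=> e; apply: n; exists i]; rewrite !local_off.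
  rewrite !local_cwall; have [_ /(_ i)] := fu'; rewrite /minface.
  case: (unit_cases i uu) => [->|->|/andP[u0 u1]].
  - by rewrite eqxx => /(_ _ erefl) ->.
  - by rewrite oner_eq0 eqxx => /(_ _ erefl) ->.
  - by move=> _; case: (base _ _) => -[]; lra.
have [c' [e _ _]] := face_cell (minface u); rewrite -e.
apply: cell_of_car => v cv.
have c'x : cell c' (chart c u) by rewrite e; exists u => //; exact: minface_in.
apply: car_cell c'x _; have vv := car_vertex cv.
have r : rounding (kappa x) (code (exist _ v vv)) by apply/kappa_rounding; exists (exist _ v vv).
have : rounding (kappa (chart c u)) (code (exist _ v vv)).
  rewrite kappaE // => w; have [r0 r1] := r w.
  by split=> ew; [apply: r0|apply: r1]; rewrite H //; [left|right].
by move=> /kappa_rounding[v' cv' /code_inj ev]; rewrite -ev in cv'.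
Qed.

Lemma agree_cell f : pts codes f -> exists c : cube X, cell c = agree f.
Proof.
move=> /kappa_surj[x ex]; have [c [u uu e]] := chart_cover x.
have [c' [e' _ _]] := face_cell (minface u); exists c'; rewrite e' agree_face //.
by rewrite -kappaE // e ex.
Qed.

Lemma cell_agree (c : cube X) : exists x : X, cell c x /\ cell c = agree (kappa x).
Proof.
pose u : 'rV[R]_(dim c) := \row_i 2^-1.
have uu : unit_cube u by move=> i; rewrite mxE; lra.
exists (chart c u); split; first by exists u.
rewrite kappaE // -agree_face // /cell unit_cubeE; congr (chart c @` face _).
apply/funext => i; rewrite /minface mxE.
by rewrite !ifF //; apply/eqP; lra.
Qed.

Variable W1 : set wallT.
Definition glue2 T (f g : wallT -> T) : wallT -> T := fun w => if `[< W1 w >] then f w else g w.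

Hypothesis transverse : forall w w', W1 w -> ~ W1 w' -> forall t t', exists v, code v w = t /\ code v w' = t'.

(** The halfspaces prescribed by the mixture meet pairwise, by [transverse] or at [u] or [v], so
    Helly applies. Its convex set prescribes the walls outside [s], where [u] and [v] agree. *)
Lemma mix_codes a b : codes a -> codes b -> codes (glue2 a b).
Proof.
move=> [u ->] [v ->]; have [s Hs] := codes_fin (codes_code Xcat o u) (codes_code Xcat o v).
pose mix := glue2 (code u) (code v).
have mixE w : code u w = code v w -> mix w = code u w by rewrite /mix /glue2; case: ifP => // _ ->.
have inside w w' : exists y, code y w = mix w /\ code y w' = mix w'.
  have [h|h] := pselect (W1 w); have [h'|h'] := pselect (W1 w').
  - by exists u; rewrite /mix /glue2 !asboolT.
  - exact: transverse.
  - by have [y [e e']] := transverse h' h (mix w') (mix w); exists y.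
  - by exists v; rewrite /mix /glue2 !asboolF.
have [|||||m [Km Hm]] := @helly R X Xcat o (map (fun w => [set y | code y w = mix w]) s)
   [set y | forall w, w \notin s -> code y w = mix w].
- by move=> x y z Kx Ky H w nw; case: (H w) => ->; [exact: Kx|exact: Ky].
- by exists u => w nw; rewrite mixE // Hs.
- by move=> k /List.in_map_iff[w [<- _]]; apply: hs_vconv; exact: wall_hs.
- move=> k /List.in_map_iff[w [<- _]].
  have [h|h] := pselect (W1 w).
    by exists u; split=> [w' nw|]; [rewrite mixE // Hs|rewrite /= /mix /glue2 asboolT].
  by exists v; split=> [w' nw|]; [rewrite mixE ?Hs //|rewrite /= /mix /glue2 asboolF].
- move=> k k' /List.in_map_iff[w [<- _]] /List.in_map_iff[w' [<- _]]; exact: inside.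
exists m; apply/funext => w; apply/esym; have [ws|] := boolP (w \in s); last exact: Km.
apply: (Hm [set y | code y w = mix w]); apply/List.in_map_iff; exists w; split=> //.
by elim: (s) ws => //= x t IH; rewrite inE => /orP[/eqP ->|/IH]; [left|right].
Qed.

Lemma mix_pts (f g : wallT -> R) : pts codes f -> pts codes g -> pts codes (glue2 f g).
Proof.
move=> [f01 Hf] [g01 Hg]; split=> [w|h H]; first by rewrite /glue2; case: ifP.
have -> : h = glue2 (glue2 h (floor01 f)) (glue2 (floor01 g) h).
  by apply/funext => w; rewrite /glue2; case: asboolP.
apply: mix_codes; [apply: Hf|apply: Hg] => w; have := H w; rewrite /glue2; case: ifP => // _ _;
  exact: floor01_rounding.
Qed.

(** All coordinates of [o] are 0; for [D] one of two transverse classes, this is the factor through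
    [o] carrying the walls of the other class. *)
Definition vanishing (D : set wallT) : set X := [set x | forall w, D w -> kappa x w = 0].

Lemma vanishing_cells D x : vanishing D x -> exists c : cube X, cell c `<=` vanishing D /\ cell c x.
Proof.
move=> Dx; have [c ec] := agree_cell (kappa_pts Xcat o x); exists c; rewrite ec; split=> // y H w Dw.
by rewrite H Dx //; left.
Qed.

Let Y := subcomplex (@vanishing_cells (~` W1)).
Let Z := subcomplex (@vanishing_cells W1).
Let zero : wallT -> R := vtx R (code o).

Lemma zero_pts : pts codes zero.
Proof. by apply/pts_vtx; exact: codes_code. Qed.

Lemma zeroE w : zero w = 0.
Proof. by rewrite /zero /vtx code_o. Qed.

Lemma exists_split : exists f : X -> prod_complex Y Z, forall x,
  kappa (proj1_sig (f x).1) = glue2 (kappa x) zero /\ kappa (proj1_sig (f x).2) = glue2 zero (kappa x).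
Proof.
have [x|f Hf] := @choice _ _ (fun x (y : prod_complex Y Z) => kappa (proj1_sig y.1) = glue2 (kappa x) zero /\
  kappa (proj1_sig y.2) = glue2 zero (kappa x)); last by exists f.
have [y ey] := kappa_surj (mix_pts (kappa_pts Xcat o x) zero_pts).
have [z ez] := kappa_surj (mix_pts zero_pts (kappa_pts Xcat o x)).
have yY : vanishing (~` W1) y by move=> w nw; rewrite ey /glue2 asboolF // zeroE.
have zZ : vanishing W1 z by move=> w Ww; rewrite ez /glue2 asboolT // zeroE.
by exists (exist _ y yY, exist _ z zZ).
Qed.

Lemma edist_kappa (c : cube X) (u v : 'rV[R]_(dim c)) (s : seq wallT) : unit_cube u -> unit_cube v ->
  uniq s -> supported s (kappa (chart c u)) (kappa (chart c v)) ->
  edist u v = seqlen s (kappa (chart c u)) (kappa (chart c v)).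
Proof.
move=> uu uv us sp; rewrite -(seqlen_local Xcat o) !kappaE // in sp *.
apply: seqlen_supported => //; first exact: uniq_cell_walls.
exact: local_supported.
Qed.

Lemma glue2_supported (s : seq wallT) (f g f' g' : wallT -> R) : supported s f g -> supported s f' g' ->
  supported s (glue2 f f') (glue2 g g').
Proof. by move=> H H' w ws; rewrite /glue2; case: ifP => _; [exact: H|exact: H']. Qed.

(** The map [f] records the coordinates of each class separately, and [mix_pts] reassembles a point
    from its two projections. Neither factor is a point because [w1], resp. [w2], has a nonconstant
    coordinate on it. *)
Lemma product_not_irreducible w1 w2 : W1 w1 -> ~ W1 w2 -> ~ irreducible X.
Proof.
move=> Ww1 Ww2; apply; have [f Hf] := exists_split; exists Y, Z, f.
have g1 x w : W1 w -> kappa (proj1_sig (f x).1) w = kappa x w.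
  by move=> Ww; rewrite (Hf x).1 /glue2 asboolT.
have g2 x w : ~ W1 w -> kappa (proj1_sig (f x).2) w = kappa x w.
  by move=> Ww; rewrite (Hf x).2 /glue2 asboolF.
have finj : injective f.
  move=> x y e; apply: (@kappa_inj R X Xcat o); apply/funext => w.
  by have [h|h] := pselect (W1 w); [rewrite -g1 // e g1|rewrite -g2 // e g2].
have fsurj (y : Y) (z : Z) : exists x, f x = (y, z).
  have [x ex] := kappa_surj (mix_pts (kappa_pts Xcat o (proj1_sig y)) (kappa_pts Xcat o (proj1_sig z))).
  exists x; rewrite [f x]surjective_pairing; congr pair; apply: sub_eq; apply: (@kappa_inj R X Xcat o).
    apply/funext => w; rewrite (Hf x).1 ex /glue2; case: asboolP => // nw.
    by rewrite zeroE; apply/esym; exact: (proj2_sig y).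
  apply/funext => w; rewrite (Hf x).2 ex /glue2; case: asboolP => // nw.
  by rewrite zeroE; apply/esym; exact: (proj2_sig z).
have single (w : wallT) : exists a b : vertexT, kappa (proj1_sig a) w <> kappa (proj1_sig b) w.
  have [a [b [ab eb]]] := wall_edge w; exists a, b; rewrite !kappa_vertex /vtx eb flip_at_eq.
  by case: (code a w) => /eqP; rewrite ?oner_eq0 // eq_sym oner_eq0.
(* A bijection of cells is an isometry in charts: squared lengths are sums over walls, and each wall
   contributes to only one factor. *)
have maps (c : cube X) (c' : cube Y * cube Z) :
    (forall x, cell c x <-> cell c'.1 (f x).1 /\ cell c'.2 (f x).2) -> @maps_cube R X (prod_complex Y Z) f c c'.
  move=> rel.
  have img u : unit_cube u -> exists u', unit_cube u' /\ @prod_chart R Y Z c' u' = f (chart c u).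
    move=> uu; have /rel[h1 h2] : cell c (chart c u) by exists u.
    have : (@prod_chart R Y Z c' @` unit_cube) (f (chart c u)) by rewrite prod_cell.
    by move=> [u' uu' e]; exists u'.
  have [|h Hh] := @choice _ _ (fun (u : 'rV[R]_(dim c)) (u' : 'rV[R]_(dim c'.1 + dim c'.2)) =>
      unit_cube u -> unit_cube u' /\ @prod_chart R Y Z c' u' = f (chart c u)).
    by move=> u; have [/img[u' H]|n] := pselect (unit_cube u); [exists u'|exists 0].
  exists h; split.
  - apply/seteqP; split=> [_ [u uu <-]|u' uu']; first by case: (Hh u uu).
    have [x ex] := fsurj (prod_chart u').1 (prod_chart u').2.
    have cx : (cell c'.1 `*` cell c'.2) (f x) by rewrite ex -prod_cell; exists u'; rewrite // -surjective_pairing.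
    have [u uu eu] : cell c x by apply/rel.
    exists u => //; have [uh eh] := Hh u uu; apply: prod_chart_inj uh uu' _.
    by rewrite eh eu ex -surjective_pairing.
  - move=> u v uu uv; have [uh eh] := Hh u uu; have [vh evh] := Hh v uv.
    have [ul ur] := (unit_cube_row (h u)).1 uh; have [vl vr] := (unit_cube_row (h v)).1 vh.
    set s := cell_walls Xcat o c; set x := chart c u; set y := chart c v.
    have us : uniq s by exact: uniq_cell_walls.
    have sp : supported s (kappa x) (kappa y) by rewrite /x /y !kappaE //; exact: local_supported.
    have spz : supported s zero zero by [].
    have e1 : chart (proj1_sig c'.1) (lsubmx (h u)) = proj1_sig (f x).1.
      by rewrite -eh /= clampv_id.
    have e2 : chart (proj1_sig c'.2) (rsubmx (h u)) = proj1_sig (f x).2.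
      by rewrite -eh /= clampv_id.
    have e3 : chart (proj1_sig c'.1) (lsubmx (h v)) = proj1_sig (f y).1.
      by rewrite -evh /= clampv_id.
    have e4 : chart (proj1_sig c'.2) (rsubmx (h v)) = proj1_sig (f y).2.
      by rewrite -evh /= clampv_id.
    rewrite edist_row (edist_kappa uu uv us sp) -/x -/y.
    have d1 : edist (lsubmx (h u)) (lsubmx (h v)) = seqlen s (glue2 (kappa x) zero) (glue2 (kappa y) zero).
      rewrite (@edist_kappa (proj1_sig c'.1) _ _ s) //; rewrite e1 e3 (Hf x).1 (Hf y).1 //.
      exact: glue2_supported.
    have d2 : edist (rsubmx (h u)) (rsubmx (h v)) = seqlen s (glue2 zero (kappa x)) (glue2 zero (kappa y)).
      rewrite (@edist_kappa (proj1_sig c'.2) _ _ s) //; rewrite e2 e4 (Hf x).2 (Hf y).2 //.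
      exact: glue2_supported.
    rewrite d1 d2 /seqlen !sqr_sqrtr ?sumsq_ge0 // -big_split /=; congr Num.sqrt.
    by apply: eq_bigr => w _; rewrite /glue2; case: ifP => _; rewrite subrr expr0n ?addr0 ?add0r.
  - by move=> u uu; have [_ <-] := Hh u uu.
split.
- split.
  + exists (fun yz => projT1 (cid (fsurj yz.1 yz.2))).
      by move=> x; case: (cid _) => x' /= e; apply: finj; rewrite e -surjective_pairing.
    by move=> yz; case: (cid _) => x' /= e; rewrite e -surjective_pairing.
  + move=> c; have [x0 [cx0 ec]] := cell_agree c.
    have [c1 ec1] := agree_cell (mix_pts (kappa_pts Xcat o x0) zero_pts).
    have [c2 ec2] := agree_cell (mix_pts zero_pts (kappa_pts Xcat o x0)).
    have c1Y : cell c1 `<=` vanishing (~` W1).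
      by rewrite ec1 => x Hx w nw; rewrite Hx /glue2 asboolF ?zeroE //; left.
    have c2Z : cell c2 `<=` vanishing W1.
      by rewrite ec2 => x Hx w nw; rewrite Hx /glue2 asboolT ?zeroE //; left.
    exists (exist _ c1 c1Y, exist _ c2 c2Z); apply: maps => x /=.
    rewrite !sub_cell /= ec ec1 ec2; split=> [H|[H1 H2] w].
      split=> w; rewrite ?(Hf x).1 ?(Hf x).2 /glue2; case: ifP => // _; exact: H.
    have [h|h] := pselect (W1 w).
      by have := H1 w; rewrite (Hf x).1 /glue2 asboolT.
    by have := H2 w; rewrite (Hf x).2 /glue2 asboolF.
  + move=> [c1 c2]; have [y0 [cy0 ec1]] := cell_agree (proj1_sig c1); have [z0 [cz0 ec2]] := cell_agree (proj1_sig c2).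
    have [c ec] := agree_cell (mix_pts (kappa_pts Xcat o y0) (kappa_pts Xcat o z0)).
    have y00 := proj2_sig c1 _ cy0; have z00 := proj2_sig c2 _ cz0.
    exists c; apply: maps => x /=; rewrite !sub_cell /= ec ec1 ec2; split=> [H|[H1 H2] w].
      split=> w; rewrite ?(Hf x).1 ?(Hf x).2 /glue2; case: asboolP => h e.
      * by have := H w; rewrite /glue2 asboolT //; apply.
      * by rewrite zeroE y00.
      * by rewrite zeroE z00.
      * by have := H w; rewrite /glue2 asboolF //; apply.
    rewrite /glue2; case: asboolP => h.
      by have := H1 w; rewrite (Hf x).1 /glue2 asboolT.
    by have := H2 w; rewrite (Hf x).2 /glue2 asboolF.
- move=> [v Hv]; have [a [b]] := single w1; apply.
  by rewrite -(g1 _ _ Ww1) -[RHS](g1 _ _ Ww1) (Hv (f (proj1_sig a)).1) (Hv (f (proj1_sig b)).1).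
- move=> [v Hv]; have [a [b]] := single w2; apply.
  by rewrite -(g2 _ _ Ww2) -[RHS](g2 _ _ Ww2) (Hv (f (proj1_sig a)).2) (Hv (f (proj1_sig b)).2).
Qed.

End Boxes.

(** * Families of crossing walls *)

Section CrossingWalls.
Variables (R : realType) (X : cubeComplex R).
Variables (Xcat : cat0_cube_complex X) (o : vertexT X).
Notation vertexT := (vertexT X).
Notation wallT := (wallT Xcat o).
Notation code := (@code R X Xcat o).
Notation codes := (@codes R X Xcat o).
Notation kappa := (@kappa R X Xcat o).
Notation halfspaces := (halfspaces Xcat).

Definition quadrants (w w' : wallT) := forall t t', exists v, code v w = t /\ code v w' = t'.

Lemma convex_codes : convex_in codes codes.
Proof. by split=> //; exists (code o); exact: codes_code. Qed.

(** A path from [p] to [q] inside their interval crosses [w] at some edge; it stays in [C] by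
    convexity. *)
Lemma crossing_step C p q w : convex_in codes C -> C p -> C q -> p w != q w ->
  exists a, [/\ C a, C (flip_at w a) & forall y, p y = q y -> a y = p y].
Proof.
move=> [CV _ conv] Cp Cq pq.
pose found := exists a, [/\ C a, C (flip_at w a) & forall y, p y = q y -> a y = p y].
suff : found \/ (C q /\ q w = p w) by case=> // -[_ e]; rewrite e eqxx in pq.
apply: (@flip_ind wallT codes (@codes_fin R X Xcat o) (@codes_step R X Xcat o)
  (fun c => found \/ (C c /\ c w = p w)) p q (CV _ Cp) (CV _ Cq)); last by right.
move=> c w' Vc cpq pqw' cw' Vf [h|[Cc cw]]; first by left.
have fpq y : flip_at w' c y = p y \/ flip_at w' c y = q y.
  have [->|n] := eqVneq y w'; last by rewrite flip_at_neq.
  by right; rewrite flip_at_eq cw'; case: (p w') (q w') pqw' => -[].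
have Cf : C (flip_at w' c) by exact: conv Cp Cq Vf fpq.
have [e|n] := eqVneq w' w; last by right; split=> //; rewrite flip_at_neq 1?eq_sym.
left; exists c; split=> //; first by rewrite -e.
by move=> y pqy; case: (cpq y) => ->.
Qed.

Lemma doubling_codes w : convex_in codes (doubling codes w).
Proof.
apply: doubling_convex; [exact: codes_med|exact: convex_codes|].
have [a [b [ab eb]]] := wall_edge w; exists (code a); split; first exact: codes_code.
by exists b.
Qed.

(** The carrier of [w] is convex and has vertices on both sides of [w'], so a path inside it crosses
    [w']. *)
Lemma crossing_doubling w w' : quadrants w w' -> exists a,
  [/\ codes a, codes (flip_at w a) & codes (flip_at w' a)].
Proof.
move=> Q; have base t : exists a, doubling codes w a /\ a w' = t.
  have [u [u1 u2]] := Q false t; have [v [v1 v2]] := Q true t.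
  have [|a [Ca Cf Ha]] := @crossing_step codes (code u) (code v) w convex_codes (codes_code _ _ _) (codes_code _ _ _).
    by rewrite u1 v1.
  by exists a; split=> //; rewrite Ha ?u2 ?v2.
have [a [Da ea]] := base false; have [b [Db eb]] := base true.
have [|c [[Cc Cf] [Cc' _] _]] := crossing_step (doubling_codes w) Da Db (w := w'); first by rewrite ea eb.
by exists c.
Qed.

(** The carriers of the walls meet pairwise by [crossing_doubling], so by Helly they share a vertex
    [v]; medians then produce all vertices of the cube at [v]. *)
Lemma crossing_cube (s : seq wallT) : uniq s -> (forall w w', w \in s -> w' \in s -> w <> w' -> quadrants w w') ->
  exists v, forall b, (forall w, w \notin s -> b w = code v w) -> codes b.
Proof.
move=> us Hs; have mem_In (w : wallT) t : List.In w t -> w \in t.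
  by elim: t => //= x t IH [->|/IH]; rewrite inE ?eqxx // => ->; rewrite orbT.
have In_mem (w : wallT) t : w \in t -> List.In w t.
  by elim: t => //= x t IH; rewrite inE => /orP[/eqP ->|/IH]; [left|right].
pose D w : set vertexT := [set v | codes (flip_at w (code v))].
have Dconv w : vconv Xcat o (D w).
  move=> u v m Du Dv H; have [_ _ conv] := doubling_codes w.
  have Dd x : D w x -> doubling codes w (code x) by move=> Dx; split=> //; exact: codes_code.
  by case: (conv _ _ _ (Dd u Du) (Dd v Dv) (codes_code Xcat o m) H).
have [|||||v [_ Hv]] := @helly R X Xcat o (map D s) setT.
- by [].
- by exists o.
- by move=> k /List.in_map_iff[w [<- _]].
- move=> k /List.in_map_iff[w [<- _]]; have [_ [a [Ca Cf]] _] := doubling_codes w.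
  by have [v ev] := Ca; exists v; split=> //; rewrite /D /= -ev.
- move=> k k' /List.in_map_iff[w [<- /mem_In ws]] /List.in_map_iff[w' [<- /mem_In ws']].
  have [e|n] := eqVneq w w'.
    rewrite -e; have [_ [a [Ca Cf]] _] := doubling_codes w.
    by have [v ev] := Ca; exists v; split; rewrite /D /= -ev.
  have [a [[v ev] Cf Cf']] := crossing_doubling (Hs w w' ws ws' (elimN eqP n)).
  by exists v; split; rewrite /D /= -ev.
have Dv w : w \in s -> codes (flip_at w (code v)).
  by move=> ws; apply: (Hv (D w)); apply/List.in_map_iff; exists w; split=> //; exact: In_mem.
exists v => b Hb.
(* With two walls [w], [w'] changed, take the median of the vertices omitting one or the other
   change and of a vertex [x] in the wanted quadrant of [w], [w']. *)
have claim n : forall t : seq wallT, (size t <= n)%N -> uniq t -> {subset t <= s} -> codes (fun y => code v y (+) (y \in t)).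
  elim: n => [|n IH] [|w [|w' t]] //= Hn ut st.
  - by rewrite (_ : (fun _ => _) = code v); [exact: codes_code|apply/funext => y; rewrite addbF].
  - by rewrite (_ : (fun _ => _) = code v); [exact: codes_code|apply/funext => y; rewrite addbF].
  - rewrite (_ : (fun _ => _) = flip_at w (code v)); first by apply: Dv; apply: st; rewrite inE.
    apply/funext => y; rewrite inE; have [->|n'] := eqVneq y w; first by rewrite flip_at_eq addbT.
    by rewrite flip_at_neq // addbF.
  move: ut; rewrite inE negb_or => /andP[/andP[ww' wt] /andP[w't ut]].
  have C1 : codes (fun y => code v y (+) (y \in w :: t)).
    apply: IH => //=; first by rewrite wt.
    by move=> y; rewrite inE => /orP[/eqP ->|yt]; apply: st; rewrite !inE ?eqxx // yt !orbT.
  have C2 : codes (fun y => code v y (+) (y \in w' :: t)).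
    apply: IH => //=; first by rewrite w't.
    by move=> y; rewrite inE => /orP[/eqP ->|yt]; apply: st; rewrite !inE ?eqxx ?orbT // yt !orbT.
  have [||x [xw xw']] := Hs w w' _ _ (elimN eqP ww') (~~ code v w) (~~ code v w').
  - by apply: st; rewrite inE eqxx.
  - by apply: st; rewrite !inE eqxx orbT.
  have := codes_med C1 C2 (codes_code Xcat o x); congr codes; apply/funext => y; rewrite !inE /majority.
  have [->|n1] := eqVneq y w.
    by rewrite (negbTE ww') (negbTE wt) xw /=; case: (code v w).
  have [->|n2] := eqVneq y w'; first by rewrite (negbTE w't) xw' /=; case: (code v w').
  by case: (y \in t); case: (code v y); case: (code x y).
have sub : {subset [seq w <- s | b w != code v w] <= s} by move=> y; rewrite mem_filter => /andP[].
have := claim _ _ (leqnn _) (filter_uniq _ us) sub; congr codes.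
apply/funext => y; rewrite mem_filter; have [ys|/Hb ->] := boolP (y \in s); last by rewrite eqxx addbF.
by rewrite andbT; case: (b y) (code v y) => -[].
Qed.

Lemma crossing_quadrants w w' b b' : crossing [set v | code v w = b] [set v | code v w' = b'] <-> quadrants w w'.
Proof.
split=> [[[v1 [a1 b1]] [v2 [a2 b2]] [v3 [a3 b3]] [v4 [a4 b4]]] t t'|Q].
  rewrite /= in a1 b1 a2 b2 a3 b3 a4 b4.
  have neg (x y : bool) : ~ (x = y) -> x = ~~ y by case: x y => -[].
  have [->|/eqP/neg ->] := eqVneq t b; have [->|/eqP/neg ->] := eqVneq t' b'.
  - by exists v1.
  - by exists v2; split=> //; exact: neg.
  - by exists v3; split=> //; exact: neg.
  - by exists v4; split; exact: neg.
have nb (x : bool) : ~~ x <> x by case: x.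
split.
- by have [v [e1 e2]] := Q b b'; exists v.
- by have [v [e1 e2]] := Q b (~~ b'); exists v; split=> //=; rewrite e2; exact: nb.
- by have [v [e1 e2]] := Q (~~ b) b'; exists v; split=> //=; rewrite e1; exact: nb.
- by have [v [e1 e2]] := Q (~~ b) (~~ b'); exists v; split=> /=; rewrite ?e1 ?e2; exact: nb.
Qed.

Lemma disjoint_of_noncrossing w w' : w <> w' -> ~ quadrants w w' -> exists h k, disjoint_walls halfspaces h k.
Proof.
move=> ne nq; have [t [t' H]] : exists t t', forall v, code v w = t -> code v w' <> t'.
  apply: contrapT => H; apply: nq => t t'; apply: contrapT => H'; apply: H; exists t, t' => v e e'.
  by apply: H'; exists v.
exists [set v | code v w = t], [set v | code v w' = t']; split.
- exact: wall_hs.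
- exact: wall_hs.
- by move=> v e; exact: H.
move=> e; apply: ne; have e' : [set v | code v w = t] = [set v | code v w' = ~~ t'].
  by rewrite e; apply/seteqP; split=> v /=; case: (code v w') t' {H e} => -[] // /(_ erefl).
by case: (wall_unique e').
Qed.

Variable N : nat.
Hypothesis Xdim : forall c : cube X, (dim c <= N)%N.

Lemma crossing_bound (s : seq wallT) : uniq s -> (forall w w', w \in s -> w' \in s -> w <> w' -> quadrants w w') ->
  (size s <= N)%N.
Proof.
move=> us Hs; have [v Hv] := crossing_cube us Hs; exact: (codes_dim Xdim us Hv).
Qed.

Lemma hs_fdim (f : nat -> set vertexT) : (forall i, (i <= N)%N -> halfspaces (f i)) ->
  ~ (forall i j, (i < j)%N -> (j <= N)%N -> crossing (f i) (f j)).
Proof.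
move=> Hf Hc; have [|F HF] := @choice nat (wallT * bool) (fun i p => (i <= N)%N -> f i = [set v | code v p.1 = p.2]).
  move=> i; have [/Hf/(hs_wall o)[w [b e]]|n] := boolP (i <= N)%N; first by exists (w, b).
  by have [w [_ _]] := hs_wall o (Hf 0%N isT); exists (w, true).
have Q i j : (i < j)%N -> (j <= N)%N -> quadrants (F i).1 (F j).1.
  move=> ij jN; have := Hc i j ij jN; rewrite (HF i) ?(HF j) ?(ltnW (leq_trans ij jN)) //.
  by move/crossing_quadrants.
have irr w : ~ quadrants w w by move=> H; have [v [e1 e2]] := H true false; rewrite e1 in e2.
have QC w w' : quadrants w w' -> quadrants w' w by move=> H t t'; have [v [? ?]] := H t' t; exists v.
have inj i j : (i <= N)%N -> (j <= N)%N -> (F i).1 = (F j).1 -> i = j.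
  move=> iN jN e; case: (ltngtP i j) => // ij.
    by have := Q i j ij jN; rewrite e => /irr.
  by have := Q j i ij iN; rewrite e => /irr.
have : (size [seq (F i).1 | i <- iota 0 N.+1] <= N)%N.
  apply: crossing_bound.
    rewrite map_inj_in_uniq ?iota_uniq // => i j; rewrite !mem_iota !add0n !ltnS /= => iN jN; exact: inj.
  move=> w w' /mapP[i + ->] /mapP[j + ->]; rewrite !mem_iota !add0n !ltnS /= => iN jN ne.
  case: (ltngtP i j) => ij; [exact: Q|by apply: QC; exact: Q|by case: ne; rewrite ij].
by rewrite size_map size_iota ltnn.
Qed.

(** All walls together then form one cube by [crossing_cube], so distances are at most the number of
    walls. *)
Lemma bounded_of_crossing : (forall w w' : wallT, w <> w' -> quadrants w w') -> ~ unbounded X.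
Proof.
move=> Q; apply; have [s [us ms]] : exists s : seq wallT, uniq s /\ forall w, w \in s.
  have [|s [us _ ms]] := @maximal_seq wallT (fun=> True) N.
    by move=> s us _; apply: crossing_bound => // w w' _ _; exact: Q.
  by exists s; split=> // w; exact/ms.
have [v Hv] := crossing_cube us (fun w w' _ _ => @Q w w').
have all b : codes b by apply: Hv => w; rewrite ms.
exists ((size s)%:R * 1) => x y; rewrite (cdist_mdist Xcat o).
have cc : cocube codes (kappa x) (kappa y).
  by split=> //; [case: (kappa_pts Xcat o x)|case: (kappa_pts Xcat o y)].
have H : chain codes (kappa x) (kappa y) (seqlen s (kappa x) (kappa y) + 0).
  apply: chain_cons cc us _ (chain_nil (kappa_pts Xcat o y)).
  by move=> w; rewrite ms.
apply: (@le_trans _ _ (seqlen s (kappa x) (kappa y) + 0)).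
  exact: (@mdist_le R wallT codes (@codes_fin R X Xcat o) (@codes_step R X Xcat o) (Phi Xcat o x) (Phi Xcat o y) _ H).
rewrite addr0; apply: seqlen_bound => // w.
have [/(_ w)/andP[a0 a1] _] := kappa_pts Xcat o x; have [/(_ w)/andP[b0 b1] _] := kappa_pts Xcat o y.
by rewrite ler_norml; apply/andP; split; lra.
Qed.

Hypothesis Xunb : unbounded X.
Hypothesis Xess : acts_essentially (Aut X).
Hypothesis Xnofix : ~ exists xi, fixed_point_at_infinity (Aut X) xi.

Theorem irreducible_strongly_separated : irreducible X -> exists H H' : set X, strongly_separated H H'.
Proof.
move=> Xirr.
have crossC h k : halfspaces h -> crossing h k -> halfspaces k -> exists w w' b b', [/\ h = [set v | code v w = b],
    k = [set v | code v w' = b'] & quadrants w w'].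
  move=> /(hs_wall o)[w [b ->]] C /(hs_wall o)[w' [b' e]]; rewrite e in C *.
  by exists w, w', b, b'; split=> //; move/crossing_quadrants: C.
(* A class transverse to its complement is closed under taking complements of halfspaces, because a
   halfspace does not cross its own complement. So it comes from a class [W1] of walls, along which
   X would split. *)
have irr (P : set (set vertexT)) : (forall h k, halfspaces h -> halfspaces k -> P h -> ~ P k -> crossing h k) ->
    forall h k, halfspaces h -> halfspaces k -> P h -> P k.
  move=> HP h k Hh Hk Ph; apply: contrapT => nPk.
  have PC h' : halfspaces h' -> P h' -> P (~` h').
    move=> Hh' Ph'; apply: contrapT => nP; have [[v [hv nv]] _ _ _] := HP _ _ Hh' (halfspacesC Hh') Ph' nP.
    by apply: nv.
  have Pt' w b b' : P [set v | code v w = b] -> P [set v | code v w = b'].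
    have [->//|n] := eqVneq b b' => /(PC _ (wall_hs w b)); congr P.
    by apply/seteqP; split=> v /=; case: (code v w) b b' n => -[] [] //.
  pose W1 : set wallT := [set w | P [set v | code v w = true]].
  have [w1 [b1 e1]] := hs_wall o Hh; have [w2 [b2 e2]] := hs_wall o Hk.
  apply: (@product_not_irreducible R X Xcat o W1 _ w1 w2 _ _ Xirr).
  - by move=> w w' Ww nWw'; apply/(crossing_quadrants w w' true true); apply: HP => //; exact: wall_hs.
  - by rewrite /W1 /=; apply: (Pt' _ b1); rewrite -e1.
  - by move=> Ww2; apply: nPk; rewrite e2; exact: Pt' Ww2.
have disj : exists h k, disjoint_walls halfspaces h k.
  apply: contrapT => nd; apply: bounded_of_crossing Xunb => w w' ne; apply: contrapT => nq.
  exact: nd (disjoint_of_noncrossing ne nq).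
have [h [k [[Hh Hk hk ne] nt]]] := exists_strongly_separated (@halfspacesC R X Xcat) (@acts_comp R X)
  (@acts_inverse R X) (fun g h ag => @acts_hs R X Xcat g h ag)
  (flippable o Xess Xdim Xnofix) (N := N) hs_fdim irr disj.
have [w [b eh]] := hs_wall o Hh; have [w' [b' ek]] := hs_wall o Hk.
have nq : ~ quadrants w w'.
  by move=> /(_ b b')[v [e1 e2]]; apply: (hk v); rewrite ?eh ?ek.
have nww' : w <> w'.
  move=> e; subst w'; have [eb|nb] := eqVneq b b'.
    have [v hv] : exists v, code v w = b.
      have [u [y [_ ey]]] := wall_edge w; have [e0|n] := eqVneq (code u w) b; first by exists u.
      by exists y; rewrite ey flip_at_eq; move: n; case: (code u w); case: (b).
    by apply: (hk v); rewrite ?eh ?ek /= -?eb.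
  apply: ne; rewrite eh ek; apply/seteqP; split=> v /=; move: nb; case: (code v w); case: (b); case: (b') => // _ /(_ erefl).
exists (wall_hyperplane w), (wall_hyperplane w'); split; [by apply/(hyperplaneP Xcat o); exists w|by apply/(hyperplaneP Xcat o); exists w'|].
move=> [K [/(hyperplaneP Xcat o)[t ->] m1 m2]].
(* The third hyperplane could be one of the two; these would then meet, and distinct walls whose
   hyperplanes meet have all four quadrants. *)
have [e|n1] := eqVneq t w.
  by rewrite e in m2; apply: nq => x y; exact: hyp_meet m2 nww' x y.
have [e|n2] := eqVneq t w'.
  rewrite e in m1; apply: nq => x y; have [v [? ?]] := hyp_meet m1 (fun e => nww' (esym e)) y x; by exists v.
apply: nt; exists [set v | code v t = true]; split; first exact: wall_hs.
  by rewrite eh; apply/crossing_quadrants => x y; exact: hyp_meet m1 (elimN eqP n1) x y.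
by rewrite ek; apply/crossing_quadrants => x y; exact: hyp_meet m2 (elimN eqP n2) x y.
Qed.

End CrossingWalls.

(** * Hyperplanes of a product *)

Lemma sqP (R : realType) (X : cubeComplex R) (v1 v2 v3 v4 : X) : sq v1 v2 v3 v4 <->
  [/\ [/\ adj v1 v2, adj v2 v3, adj v3 v4 & adj v4 v1], v1 <> v3, v2 <> v4 &
    exists c : cube X, [/\ cell c v1, cell c v2, cell c v3 & cell c v4]].
Proof.
split=> [S|[[a12 a23 a34 a41] n13 n24 [c [c1 c2 c3 c4]]]].
  split; [|exact: sq_diag S|exact: sq_neighbours S|].
    by split; [exact: sq_adj S|exact: sq_adj (sq_rot S)|exact: sq_adj (sq_rot (sq_rot S))|exact: sq_adj (sq_rot (sq_rot (sq_rot S)))].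
  by move: S => [c [b [i [j [_ -> -> -> ->]]]]]; exists c; split; exact: cell_vx.
have [b eb] := vertex_of_cell (adj_vertex a12) c1; rewrite eb in a12 a41 n13 *.
have [i ei] := adj_cell a12 c2; have [j ej] := adj_cell (adjC a41) c4.
have ij : i != j by apply: contra_notN n24 => /eqP e; rewrite ei ej e.
rewrite ei in a23; have [m em] := adj_cell a23 c3; rewrite ej in a34; have [n en] := adj_cell (adjC a34) c3.
have mi : m != i by apply: contra_notN n13 => /eqP e; rewrite em e flip_atK.
have e : flip_at m (flip_at i b) = flip_at n (flip_at j b) by apply: (@vx_inj R X c); rewrite -em -en.
have ni : n = i.
  apply/eqP; apply: contraT => ni; have := congr1 (fun f => f i) e.
  rewrite flip_at_neq 1?eq_sym // flip_at_eq flip_at_neq 1?eq_sym // flip_at_neq //.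
  by case: (b i).
rewrite ei ej en ni; exact: vx_sq.
Qed.

Section ProductGraph.
Variables (R : realType) (Y Z : cubeComplex R).
Notation YZ := (prod_complex Y Z).

Lemma dim0_cell (W : cubeComplex R) (c : cube W) x y : dim c = 0%N -> cell c x -> cell c y -> x = y.
Proof.
move=> d0 [u _ <-] [v _ <-]; congr chart; apply: rV_ext => i.
by move: (ltn_ord i); rewrite [X in (_ < X)%N]d0.
Qed.

Lemma prod_cellP (c : cube YZ) (x : YZ) : cell c x <-> cell c.1 x.1 /\ cell c.2 x.2.
Proof. by change ((@prod_chart R Y Z c @` unit_cube) x <-> cell c.1 x.1 /\ cell c.2 x.2); rewrite prod_cell. Qed.

Lemma prod_vertex (y : Y) (z : Z) : @is_vertex R YZ (y, z) <-> is_vertex y /\ is_vertex z.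
Proof.
split=> [[c [/eqP d0 /prod_cellP[cy cz]]]|[[c1 [d1 cy]] [c2 [d2 cz]]]].
  move: d0; rewrite /= addn_eq0 => /andP[/eqP d1 /eqP d2].
  by split; [exists c.1|exists c.2].
exists ((c1, c2) : cube YZ); split; first by rewrite /= d1 d2.
by apply/prod_cellP.
Qed.

Lemma prod_adj (p q : YZ) : adj p q <->
  [/\ adj p.1 q.1, is_vertex p.2 & p.2 = q.2] \/ [/\ adj p.2 q.2, is_vertex p.1 & p.1 = q.1].
Proof.
case: p q => [y z] [y' z'] /=; rewrite adjP; split.
  move=> [/prod_vertex[vy vz] /prod_vertex[vy' vz'] ne [c [d /prod_cellP[/= cy cz] /prod_cellP[/= cy' cz']]]].
  move: d; rewrite /= => d.
  have [d1|d1] := posnP (dim c.1).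
    right; have e := dim0_cell d1 cy cy'; split=> //; apply/adjP; split=> //.
      by move=> ez; apply: ne; rewrite e ez.
    by exists c.2; split=> //; rewrite d1 in d.
  have d2 : dim c.2 = 0%N by move: d d1; case: (dim c.1) => // n; lia.
  left; have e := dim0_cell d2 cz cz'; split=> //; apply/adjP; split=> //.
    by move=> ez; apply: ne; rewrite e ez.
  by exists c.1; split=> //; rewrite d2 addn0 in d.
move=> [[/adjP[vy vy' ne [c1 [d1 cy cy']]] vz <-]|[/adjP[vz vz' ne [c2 [d2 cz cz']]] vy <-]].
  split; [by apply/prod_vertex|by apply/prod_vertex|by move=> [e]; apply: ne|].
  have [c2 [d2 cz]] := vz; exists ((c1, c2) : cube YZ).
  by split; [rewrite /= d1 d2|apply/prod_cellP|apply/prod_cellP].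
split; [by apply/prod_vertex|by apply/prod_vertex|by move=> [e]; apply: ne|].
have [c1 [d1 cy]] := vy; exists ((c1, c2) : cube YZ).
by split; [rewrite /= d1 d2|apply/prod_cellP|apply/prod_cellP].
Qed.

Lemma prod_sq (y y' : Y) (z z' : Z) : adj y y' -> adj z z' ->
  @sq R YZ (y, z) (y', z) (y', z') (y, z').
Proof.
move=> ay az; have vy := adj_vertex ay; have vy' := adj_vertex (adjC ay).
have vz := adj_vertex az; have vz' := adj_vertex (adjC az).
apply/sqP; split.
- split; apply/prod_adj; [left|right|left|right]; split=> //; exact: adjC.
- by move=> [e _]; exact: adj_neq ay e.
- by move=> [e _]; exact: adj_neq (adjC ay) e.
have [_ _ _ [c1 [_ cy cy']]] := (adjP _ _).1 ay; have [_ _ _ [c2 [_ cz cz']]] := (adjP _ _).1 az.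
by exists ((c1, c2) : cube YZ); split; apply/prod_cellP.
Qed.

End ProductGraph.

Section Split.
Variables (R : realType) (X Y Z : cubeComplex R) (f : X -> prod_complex Y Z).
Hypotheses (Xsc : simply_connected R (pt X)) (fiso : cube_iso f).
Variable g : prod_complex Y Z -> X.
Hypotheses (fK : cancel f g) (gK : cancel g f).

Lemma back_adj p q : adj p q -> adj (g p) (g q).
Proof. by move=> a; apply/(iso_adj fiso); rewrite !gK. Qed.

Lemma back_sq p q r s : sq p q r s -> sq (g p) (g q) (g r) (g s).
Proof.
move=> /sqP[[a1 a2 a3 a4] n1 n2 [c [c1 c2 c3 c4]]].
have ginj : injective g := can_inj gK.
apply/sqP; split; [by split; exact: back_adj|by move/ginj|by move/ginj|].
by have [c' [_ _ H]] := iso_cube_r fiso c; exists c'; split; apply/H; rewrite gK.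
Qed.

(** A vertical step of the base vertex slides the horizontal edge across a product square; a
    horizontal step changes nothing. *)
Lemma horizontal_parallel y y' u v l : adj y y' -> joins (@vadj R X) l u v ->
  parallel (segment (g (y, (f (proj1_sig u)).2)) (g (y', (f (proj1_sig u)).2)))
           (segment (g (y, (f (proj1_sig v)).2)) (g (y', (f (proj1_sig v)).2))).
Proof.
move=> ay; move: l v; apply: joins_ind; first exact: rst_refl.
move=> l v w _ wv H; apply: rst_trans H _.
have /prod_adj[[_ _ ->]|[az _ _]] : adj (f (proj1_sig w)) (f (proj1_sig v)) by apply/(iso_adj fiso).
  exact: rst_refl.
apply: rst_step; exact: sq_opposite (back_sq (prod_sq ay (adjC az))).
Qed.

Lemma vertical_parallel z z' u v l : adj z z' -> joins (@vadj R X) l u v ->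
  parallel (segment (g ((f (proj1_sig u)).1, z)) (g ((f (proj1_sig u)).1, z')))
           (segment (g ((f (proj1_sig v)).1, z)) (g ((f (proj1_sig v)).1, z'))).
Proof.
move=> az; move: l v; apply: joins_ind; first exact: rst_refl.
move=> l v w _ wv H; apply: rst_trans H _.
have /prod_adj[[ay _ _]|[_ _ ->]] : adj (f (proj1_sig w)) (f (proj1_sig v)) by apply/(iso_adj fiso).
  by apply: rst_step; apply: sq_opposite; apply: sq_rev; exact: back_sq (prod_sq (adjC ay) az).
exact: rst_refl.
Qed.

Definition horizontal (a b : X) := adj a b /\ (f a).2 = (f b).2.
Definition vertical (a b : X) := adj a b /\ (f a).1 = (f b).1.

Lemma horizontal_or_vertical a b : adj a b -> horizontal a b \/ vertical a b.
Proof.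
by move=> ab; have /prod_adj[[_ _ e]|[_ _ e]] : adj (f a) (f b) by [apply/(iso_adj fiso)]; [left|right].
Qed.

Lemma horizontal_adj a b : horizontal a b -> adj (f a).1 (f b).1.
Proof.
move=> [ab e]; have /prod_adj[[]//|[az _ _]] : adj (f a) (f b) by apply/(iso_adj fiso).
by case: (adj_neq az).
Qed.

Lemma vertical_adj a b : vertical a b -> adj (f a).2 (f b).2.
Proof.
move=> [ab e]; have /prod_adj[[ay _ _]|[]//] : adj (f a) (f b) by apply/(iso_adj fiso).
by case: (adj_neq ay).
Qed.

(* The product of a horizontal and a vertical edge is a square, whose center lies on both hyperplanes. *)
Lemma horizontal_meets_vertical a b p q : horizontal a b -> vertical p q ->
  hyperplane_of (segment a b) `&` hyperplane_of (segment p q) !=set0.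
Proof.
move=> hab vpq; have ay := horizontal_adj hab; have az := vertical_adj vpq.
have va := adj_vertex hab.1; have vp := adj_vertex vpq.1.
have [l jl] := vertices_connected Xsc (exist _ a va) (exist _ p vp).
have [l' jl'] := vertices_connected Xsc (exist _ p vp) (exist _ a va).
have H1 := horizontal_parallel ay jl; have H2 := vertical_parallel az jl'.
rewrite /= in H1 H2.
have ea : g ((f a).1, (f a).2) = a by rewrite -surjective_pairing fK.
have eb : g ((f b).1, (f a).2) = b by rewrite hab.2 -surjective_pairing fK.
have ep : g ((f p).1, (f p).2) = p by rewrite -surjective_pairing fK.
have eq : g ((f p).1, (f q).2) = q by rewrite vpq.2 -surjective_pairing fK.
rewrite ea eb in H1; rewrite ep eq in H2.
have [c [b0 [i [j [ij E1 E2 E3 E4]]]]] := back_sq (prod_sq ay az).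
rewrite E1 E2 in H1; rewrite E1 E4 in H2.
pose u : 'rV[R]_(dim c) := \row_k (if (k == i) || (k == j) then 2^-1 else (b0 k)%:R).
have uu : unit_cube u.
  move=> k; rewrite mxE; case: ifP => _; first by lra.
  by case: (b0 k); rewrite ?lexx ?ler01.
exists (chart c u); split.
  exists c, i, (segment (vx b0) (vx (flip_at i b0))); split=> //; first exact: dual_edge_segment.
  by exists u => //; split=> //; rewrite mxE eqxx.
exists c, j, (segment (vx b0) (vx (flip_at j b0))); split=> //; first exact: dual_edge_segment.
by exists u => //; split=> //; rewrite mxE eqxx orbT.
Qed.

Lemma joins_const (T : Type) (F : vertexT X -> T) : (forall v w, vadj v w -> F v = F w) -> forall u v, F u = F v.
Proof.
move=> H u v; have [l jl] := vertices_connected Xsc u v; move: l v jl.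
by apply: (@joins_ind _ _ (fun _ v => F u = F v)) => // l v w _ wv ->; rewrite (H w v).
Qed.

(** Without horizontal edges the first coordinate is constant on the connected vertex set, so [Y]
    has a single vertex and no cell of positive dimension. *)
Lemma exists_horizontal (o : vertexT X) : ~ single_vertex Y -> exists a b, horizontal a b.
Proof.
move=> nY; apply: contrapT => nh; apply: nY; exists (f (proj1_sig o)).1 => y.
have vo : is_vertex (f (proj1_sig o)) by apply/(iso_vertex fiso); exact: proj2_sig.
have [vy0 vz0] : is_vertex (f (proj1_sig o)).1 /\ is_vertex (f (proj1_sig o)).2.
  by apply/prod_vertex; rewrite -surjective_pairing.
have const (u v : vertexT X) : (f (proj1_sig u)).1 = (f (proj1_sig v)).1.
  apply: (@joins_const _ (fun u => (f (proj1_sig u)).1)) => {}v w vw; case: (horizontal_or_vertical vw) => [h|[]//].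
  by case: nh; exists (proj1_sig v), (proj1_sig w).
have [c cy] := chart_cover y.
have [d0|d1] := posnP (dim c); last first.
  have b0 : 'I_(dim c) -> bool := fun=> false.
  have a := vx_adj b0 (Ordinal d1); case: nh.
  exists (g (vx b0, (f (proj1_sig o)).2)), (g (vx (flip_at (Ordinal d1) b0), (f (proj1_sig o)).2)).
  split; last by rewrite !gK.
  by apply: back_adj; apply/prod_adj; left.
have vy : is_vertex y by exists c.
have vg : is_vertex (g (y, (f (proj1_sig o)).2)).
  by apply/(iso_vertex fiso); rewrite gK; apply/prod_vertex.
by have := const (exist _ _ vg) o; rewrite /= gK.
Qed.

Lemma exists_vertical (o : vertexT X) : ~ single_vertex Z -> exists a b, vertical a b.
Proof.
move=> nZ; apply: contrapT => nh; apply: nZ; exists (f (proj1_sig o)).2 => z.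
have [vy0 vz0] : is_vertex (f (proj1_sig o)).1 /\ is_vertex (f (proj1_sig o)).2.
  by apply/prod_vertex; rewrite -surjective_pairing; apply/(iso_vertex fiso); exact: proj2_sig.
have const (u v : vertexT X) : (f (proj1_sig u)).2 = (f (proj1_sig v)).2.
  apply: (@joins_const _ (fun u => (f (proj1_sig u)).2)) => {}v w vw; case: (horizontal_or_vertical vw) => [[]//|h].
  by case: nh; exists (proj1_sig v), (proj1_sig w).
have [c cz] := chart_cover z.
have [d0|d1] := posnP (dim c); last first.
  have b0 : 'I_(dim c) -> bool := fun=> false.
  have a := vx_adj b0 (Ordinal d1); case: nh.
  exists (g ((f (proj1_sig o)).1, vx b0)), (g ((f (proj1_sig o)).1, vx (flip_at (Ordinal d1) b0))).
  split; last by rewrite !gK.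
  by apply: back_adj; apply/prod_adj; right.
have vz : is_vertex z by exists c.
have vg : is_vertex (g ((f (proj1_sig o)).1, z)).
  by apply/(iso_vertex fiso); rewrite gK; apply/prod_vertex.
by have := const (exist _ _ vg) o; rewrite /= gK.
Qed.

End Split.

(** The two hyperplanes come from horizontal or vertical edges. If the types differ, they cross, and
    one of them serves as the third hyperplane; otherwise a hyperplane of the other type crosses
    both. *)
Lemma strongly_separated_irreducible (R : realType) (X : cubeComplex R) (H H' : set X) :
  simply_connected R (pt X) -> strongly_separated H H' -> irreducible X.
Proof.
move=> Xsc [[e1 /is_edge_adj[a [b [ab ->]]] ->] [e2 /is_edge_adj[p [q [pq ->]]] ->] nK] [Y [Z [f [fiso nY nZ]]]].
have [[g fK gK] _ _] := fiso.
pose o : vertexT X := exist _ a (adj_vertex ab).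
have [h1 [h2 hh]] := exists_horizontal Xsc fiso gK o nY.
have [v1 [v2 vv]] := exists_vertical Xsc fiso gK o nZ.
have meet := horizontal_meets_vertical Xsc fiso fK gK.
have hyperplane_edge x y : adj x y -> hyperplane (hyperplane_of (segment x y)).
  by move=> xy; exists (segment x y) => //; exact: segment_edge.
have nonempty x y (s t : X) : hyperplane_of (segment x y) `&` hyperplane_of (segment s t) !=set0 ->
    hyperplane_of (segment x y) `&` hyperplane_of (segment x y) !=set0.
  by move=> [z [hz _]]; exists z.
apply: nK; case: (horizontal_or_vertical fiso ab) => tab; case: (horizontal_or_vertical fiso pq) => tpq.
- exists (hyperplane_of (segment v1 v2)); split; first by apply: hyperplane_edge; case: vv.
    by rewrite setIC; exact: meet.
  by rewrite setIC; exact: meet.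
- exists (hyperplane_of (segment a b)); split; [exact: hyperplane_edge| |exact: meet].
  exact: nonempty (meet _ _ _ _ tab tpq).
- exists (hyperplane_of (segment p q)); split; [exact: hyperplane_edge|exact: meet|].
  exact: nonempty (meet _ _ _ _ tpq tab).
- exists (hyperplane_of (segment h1 h2)); split; [by apply: hyperplane_edge; case: hh|exact: meet|exact: meet].
Qed.

Theorem mainTheorem12 (R : realType) (X : cubeComplex R)
    (Xcat0 : cat0_cube_complex X)
    (Xdim : finite_dimensional X)
    (Xunb : unbounded X)
    (Xess : acts_essentially (Aut X))
    (Xnofix : ~ exists xi, fixed_point_at_infinity (Aut X) xi) :
  irreducible X <-> exists H H' : set X, strongly_separated H H'.
Proof.
have [N HN] := Xdim.
have [[x0 _] _ _] := Xcat0.1.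
split=> [Xirr|[H [H' HH]]]; last exact: strongly_separated_irreducible Xcat0.1 HH.
have [v cv] := car_exists x0.
exact: (@irreducible_strongly_separated R X Xcat0 (exist _ v (car_vertex cv)) N HN Xunb Xess Xnofix Xirr).
Qed.
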